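(* Let $S$ be a compact surface without boundary and let $f\colon S\to S$ be a $\mathrm{cw}_{\mathrm F}$-expansive homeomorphism. Let $\mathcal F^s=\mathcal A^s$ and $\mathcal F^u=\mathcal A^u$ be its stable and unstable atlases, and for $x\in S$ let $\mathcal F^s(x),\mathcal F^u(x)$ be the corresponding leaves through $x$. Then: 1. $\mathcal F^s$ and $\mathcal F^u$ are $f$-invariant dendritations (i.e. each is an invariant atlas over a complete basis which is both a Peano atlas and a cw-atlas), and no leaf is a Peano continuum (with the topology induced by $S$); 2. there is a residual set $G\subset S$ such that for all $x\in G$ the leaves $\mathcal F^s(x)$ and $\mathcal F^u(x)$, with the plaque topology, are non-compact one-dimensional manifolds (possibly with boundary); 3. there is a subset $H\subset G$ that is dense in $S$ such that $\mathcal F^s(x)$ and $\mathcal F^u(x)$ are topologically transverse at $x$ for all $x\in H$.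
   Context: $S$ carries a metric $\operatorname{dist}$ compatible with its topology $\tau$. A continuum is a compact connected metric space; a Peano continuum is a locally connected continuum. A set is residual if it is a countable intersection of open dense subsets. $f$ is $\mathrm{cw}_{\mathrm F}$-expansive if there is $\delta>0$ such that whenever $A,B\subset S$ are continua with $\operatorname{diam}(f^n(A))\le\delta$ for all $n\ge0$ and $\operatorname{diam}(f^n(B))\le\delta$ for all $n\le0$, the set $A\cap B$ is finite. Atlases. Let $X$ be a compact metric space (here $X=S$) with topology $\tau$. For $Y\subset X$ and $x\in Y$, $\operatorname{Comp}_x(Y)$ is the connected component of $Y$ containing $x$; $\mathcal C(Y)$ is the set of non-empty subcontinua of $Y$. A decomposition of a compact set $Y\subset X$ is a map $Q\colon Y\to\mathcal C(Y)$ with $x\in Q(x)$ for all $x$, any two values equal or disjoint, and upper semicontinuous: for all $x\in Y$ and every open $V\supset Q(x)$ there is a neighborhood $W$ of $x$ with $Q(y)\subset V$ for all $y\in W\cap Y$. If $Z\subset Y$, the monotone restriction is $Q|^m_Z(x)=\operatorname{Comp}_x(Q(x)\cap Z)$, $x\in Z$. Decompositions $Q_i$ of $Y_i$ ($i=1,2$) are compatible if $Q_1|^m_{Y_1\cap Y_2}=Q_2|^m_{Y_1\cap Y_2}$. An atlas over an open cover $\mathcal U$ of $X$ is a collection $\mathcal A=\{Q_{\overline U}\}_{U\in\mathcal U}$ of pairwise compatible decompositions $Q_{\overline U}$ of the closures $\overline U$. A basis $\mathcal U$ of $\tau$ is complete if $V\in\mathcal U$ and $U\subset V$ open imply $U\in\mathcal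 U$. Put $Q_U=Q_{\overline U}|^m_U$. For an atlas over a complete basis, the open plaques are the sets $Q_U(x)$ with $x\in U\in\mathcal U$; they form a basis of a topology on $X$, the plaque topology. The leaf of $x$ is the set of $y$ for which there are open plaques $P_1,\dots,P_n$ with $x\in P_1$, $y\in P_n$ and $P_i\cap P_{i+1}\ne\emptyset$ for $1\le i<n$. The atlas is a Peano atlas if its open plaques are locally connected in the topology induced by $\tau$. It is a cw-atlas if (1) each leaf is a countable union of open plaques, (2) each leaf is a meagre subset of $(X,\tau)$, and (3) the diameters of the leaves are bounded away from zero. It is invariant under $f$ if for all $n\in\mathbb Z$ and $U\in\mathcal U$: $f^n(U)\in\mathcal U$ and $Q_{f^n(\overline U)}(f^n(x))=f^n(Q_{\overline U}(x))$ for all $x\in\overline U$. Stable and unstable atlases. A continuum $C$ is stable if $\operatorname{diam}(f^n(C))\to0$ as $n\to+\infty$, and unstable if $\operatorname{diam}(f^n(C))\to 0$ as $n\to-\infty$. For closed $Y\subset S$ and $x\in Y$, $Q^s_Y(x)$ (resp. $Q^u_Y(x)$) is the set of $y\in Y$ such that some stable (resp. unstable) continuum $C\subset Y$ contains $x$ and $y$. $\mathcal U^s$ is the set of open $U\subset S$ such that $Q^s_{\overline U}$ is a decomposition of $\overline U$ all of whose values are stable continua, and $\mathcal A^s=\{Q^s_{\overline U}:U\in\mathcal U^s\}$; $\mathcal U^u,\mathcal A^u$ are defined analogously with unstable continua. Topological transversality at $x$: $\mathcal F^s(x)$ and $\mathcal F^u(x)$ are topologically transverse at $x$ if they contain arcs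 $\alpha\subset \mathcal F^s(x)$, $\beta\subset\mathcal F^u(x)$ with $\alpha\cap\beta=\{x\}$, $x$ not an end point of $\alpha$, and there is a closed disc $D\subset S$ containing $\alpha$ and separated by $\beta$ (i.e. $D\setminus \beta$ is disconnected) such that the two components of $\alpha\setminus\beta$ lie in different components of $D\setminus\beta$. *)

(* Defs.v *)
From HB Require Import structures.
From mathcomp Require Import all_boot all_order all_algebra finmap.
From mathcomp Require Import all_classical all_reals all_analysis.

Set Implicit Arguments.
Unset Strict Implicit.
Unset Printing Implicit Defensive.

Import Order.TTheory GRing.Theory Num.Theory.
Import numFieldNormedType.Exports.

Local Open Scope classical_set_scope.
Local Open Scope ring_scope.

(* A subset [A : set X] used where a topological space is expected denotes
   [set_type A] with the topology induced by [X]. *)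

Record homeo (X Y : topologicalType) := Homeo {
  homeo_fun :> X -> Y;
  homeo_inv : Y -> X;
  homeo_funK : cancel homeo_fun homeo_inv;
  homeo_invK : cancel homeo_inv homeo_fun;
  homeo_fun_continuous : continuous homeo_fun;
  homeo_inv_continuous : continuous homeo_inv
}.

Definition homeomorphic (X Y : topologicalType) : Prop :=
  inhabited (homeo X Y).

Definition hiter (X : topologicalType) (f : homeo X X) (n : int) : X -> X :=
  match n with
  | Posz k => iter k f
  | Negz k => iter k.+1 (homeo_inv f)
  end.

Definition locally_connected (X : topologicalType) : Prop :=
  forall (x : X) (V : set X), nbhs x V ->
    exists W : set X, [/\ open W, W x, W `<=` V & connected W].

Definition continuum (X : topologicalType) (C : set X) : Prop :=
  compact C /\ connected C.

Definition peano_continuum (X : topologicalType) (C : set X) : Prop :=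
  continuum C /\ locally_connected (set_type C).

Definition nowhere_dense (X : topologicalType) (A : set X) : Prop :=
  interior (closure A) = set0.

Definition meagre (X : topologicalType) (A : set X) : Prop :=
  exists2 F : nat -> set X, forall n, nowhere_dense (F n) & A = \bigcup_n F n.

(* Only used inside a compact space, where the set of distances is bounded;
   [sup set0 = 0], so the empty set has diameter 0. *)
Definition diam (R : realType) (X : metricType R) (A : set X) : R :=
  sup [set mdist p.1 p.2 | p in A `*` A].

Definition is_component (X : topologicalType) (A C : set X) : Prop :=
  exists2 x, A x & C = connected_component A x.

Definition surface (R : realType) (X : topologicalType) : Prop :=
  [/\ hausdorff_space X, @second_countable X &
    forall x : X, exists2 U : set X, open_nbhs x U &
      homeomorphic (set_type U) (R * R)%type].

(* Charts take values in relatively open subsets of the half-line. *)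
Definition one_manifold_with_boundary (R : realType) (X : topologicalType) :
    Prop :=
  [/\ hausdorff_space X, @second_countable X &
    forall x : X, exists2 U : set X, open_nbhs x U &
      exists2 W : set R, open W &
        homeomorphic (set_type U) (set_type (W `&` [set t : R | 0 <= t]))].

Definition arc (R : realType) (X : topologicalType) (A : set X) : Prop :=
  homeomorphic (set_type A) (set_type [set t : R | 0 <= t <= 1]).

Definition arc_endpoint (R : realType) (X : topologicalType) (A : set X)
    (x : X) : Prop :=
  exists h : homeo (set_type A) (set_type [set t : R | 0 <= t <= 1]),
  exists2 a : set_type A, set_val a = x &
    set_val (h a) = 0 \/ set_val (h a) = 1.

Definition closed_disc (R : realType) (X : topologicalType) (D : set X) :
    Prop :=
  homeomorphic (set_type D)
    (set_type [set p : R * R | p.1 ^+ 2 + p.2 ^+ 2 <= 1]).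

Section Atlases.
Variable X : topologicalType.
Implicit Types (Y Z U V : set X) (Q : X -> set X) (x y : X).

(* A decomposition of [Y] is represented by a function on [X] of which only
   the values at points of [Y] matter. *)
Definition decomposition Y Q : Prop :=
  [/\ forall x, Y x -> [/\ Q x x, Q x `<=` Y & continuum (Q x)],
      forall x y, Y x -> Y y -> Q x = Q y \/ Q x `&` Q y = set0 &
      forall x V, Y x -> open V -> Q x `<=` V ->
        \forall y \near within Y (nbhs x), Q y `<=` V].

Definition mono_restr Q Z : X -> set X :=
  fun x => connected_component (Q x `&` Z) x.

Definition compatible Y1 (Q1 : X -> set X) Y2 (Q2 : X -> set X) : Prop :=
  forall x, (Y1 `&` Y2) x ->
    mono_restr Q1 (Y1 `&` Y2) x = mono_restr Q2 (Y1 `&` Y2) x.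

(* [adec A Y] is $Q_Y$; only the values at [Y = closure U] with [adom A U]
   matter. *)
Record preatlas := PreAtlas {
  adom : set (set X);
  adec : set X -> X -> set X
}.

Implicit Type A : preatlas.

Definition is_atlas A : Prop :=
  [/\ adom A `<=` open,
      \bigcup_(U in adom A) U = setT,
      forall U, adom A U -> decomposition (closure U) (adec A (closure U)) &
      forall U V, adom A U -> adom A V ->
        compatible (closure U) (adec A (closure U))
                   (closure V) (adec A (closure V))].

Definition complete_basis (B : set (set X)) : Prop :=
  basis B /\ forall U V, B V -> open U -> U `<=` V -> B U.

Definition open_plaque A : set (set X) :=
  [set P | exists U x,
    [/\ adom A U, U x & P = mono_restr (adec A (closure U)) U x]].

Definition leaf A x : set X :=
  [set y | exists (n : nat) (P : nat -> set X),
    [/\ forall i, (i <= n)%N -> open_plaque A (P i), P 0%N x, P n y &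
        forall i, (i < n)%N -> P i `&` P i.+1 !=set0]].

Definition plaque_space A : Type := X.

End Atlases.

(* The plaque topology is generated by the open plaques; for an atlas over a
   complete basis they are a basis of it, see [open_plaque_basis] below. *)
HB.instance Definition _ (X : topologicalType) (A : preatlas X) :=
  Choice.copy (plaque_space A) X.
HB.instance Definition _ (X : topologicalType) (A : preatlas X) :=
  isSubBaseTopological.Build (plaque_space A) (@open_plaque X A) id.

Definition leaf_space (X : topologicalType) (A : preatlas X) (x : X) :
    topologicalType :=
  set_type (leaf A x : set (plaque_space A)).

Definition peano_atlas (X : topologicalType) (A : preatlas X) : Prop :=
  is_atlas A /\
  forall P : set X, open_plaque A P -> locally_connected (set_type P).

Definition cw_atlas (R : realType) (X : metricType R) (A : preatlas X) :
    Prop :=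
  [/\ is_atlas A,
      forall x, exists2 F : set (set X),
        countable F /\ F `<=` open_plaque A & leaf A x = \bigcup_(P in F) P,
      forall x, meagre (leaf A x) &
      exists2 d : R, 0 < d & forall x, d <= diam (leaf A x)].

Definition invariant_atlas (X : topologicalType) (f : homeo X X)
    (A : preatlas X) : Prop :=
  forall (n : int) (U : set X), adom A U ->
    adom A (hiter f n @` U) /\
    forall x, closure U x ->
      adec A (hiter f n @` closure U) (hiter f n x) =
      hiter f n @` adec A (closure U) x.

Definition invariant_dendritation (R : realType) (X : metricType R)
    (f : homeo X X) (A : preatlas X) : Prop :=
  [/\ complete_basis (adom A), peano_atlas A, cw_atlas A &
      invariant_atlas f A].

Section Dynamics.
Variables (R : realType) (X : metricType R) (f : homeo X X).

Definition cwF_expansive : Prop :=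
  exists2 d : R, 0 < d & forall A B : set X,
    continuum A -> continuum B ->
    (forall n : int, 0 <= n -> diam (hiter f n @` A) <= d) ->
    (forall n : int, n <= 0 -> diam (hiter f n @` B) <= d) ->
    finite_set (A `&` B).

Definition stable_continuum (C : set X) : Prop :=
  continuum C /\ diam (hiter f n%:Z @` C) @[n --> \oo] --> (0 : R).

Definition unstable_continuum (C : set X) : Prop :=
  continuum C /\ diam (hiter f (- n%:Z) @` C) @[n --> \oo] --> (0 : R).

(* [K] is the class of stable, or of unstable, continua. *)
Definition continua_dec (K : set (set X)) (Y : set X) (x : X) : set X :=
  [set y | Y y /\ exists C, [/\ K C, C `<=` Y, C x & C y]].

Definition continua_atlas (K : set (set X)) : preatlas X :=
  PreAtlas
    [set U | [/\ open U,
                 decomposition (closure U) (continua_dec K (closure U)) &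
                 forall x, closure U x -> K (continua_dec K (closure U) x)]]
    (continua_dec K).

Definition stable_atlas := continua_atlas stable_continuum.
Definition unstable_atlas := continua_atlas unstable_continuum.

End Dynamics.

Definition top_transverse (R : realType) (X : topologicalType)
    (Fs Fu : set X) (x : X) : Prop :=
  exists a b D : set X,
    [/\ [/\ arc R a, arc R b, a `<=` Fs & b `<=` Fu],
        a `&` b = [set x],
        ~ arc_endpoint R a x,
        [/\ closed_disc R D, a `<=` D & ~ connected (D `\` b)] &
        exists a1 a2 D1 D2 : set X,
          [/\ is_component (a `\` b) = [set a1; a2], a1 <> a2,
              is_component (D `\` b) D1 /\ is_component (D `\` b) D2,
              D1 <> D2 & a1 `<=` D1 /\ a2 `<=` D2]].

Section PlaqueBasis.
Variables (X : topologicalType) (A : preatlas X).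
Hypotheses (atA : is_atlas A) (cbA : complete_basis (adom A)).

Let plaque_sub (U W : set X) z : adom A U -> adom A W -> W `<=` U -> W z ->
  mono_restr (adec A (closure W)) W z `<=`
  mono_restr (adec A (closure U)) U z.
Proof.
move=> AU AW WU Wz; case: atA => _ _ dA cA.
have cWU := closureS WU.
have cWz : closure W z := subset_closure Wz.
have [dW _ _] := dA _ AW; have [Qz QW [_ Qc]] := dW z cWz.
have := cA _ _ AW AU z; rewrite (setIidl cWU) => /(_ cWz).
rewrite /mono_restr (setIidl QW) (connected_component_id Qz Qc) => QE.
apply: connected_component_max.
- exact: connected_component_refl.
- apply: subset_trans (@connected_component_sub _ _ _) _ => y [].
  by rewrite QE => /connected_component_sub[Qy _] /WU.
- exact: component_connected.
Qed.

Let plaque_eq (U : set X) x z : adom A U -> U x ->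
  mono_restr (adec A (closure U)) U x z ->
  mono_restr (adec A (closure U)) U x = mono_restr (adec A (closure U)) U z.
Proof.
move=> AU Ux xz; case: atA => _ _ dA _; have [dU dis _] := dA _ AU.
have [Qz Uz] := connected_component_sub xz.
have cUx : closure U x := subset_closure Ux.
have cUz : closure U z := subset_closure Uz.
rewrite /mono_restr; have [QE|Q0] := dis _ _ cUx cUz.
  by rewrite -QE; exact: same_connected_component.
have [Qzz _ _] := dU _ cUz.
by have : set0 z; [rewrite -Q0; split|].
Qed.

Lemma open_plaque_basis :
  basis (open_plaque A : set (set (plaque_space A))).
Proof.
have [[Ao _] Ac] := cbA.
have Acov : \bigcup_(U in adom A) U = setT by case: atA.
split=> [P pP|x N].
  exists [set P]; last by rewrite bigcup_set1.
  move=> _ ->; exists [fset (P : set X)]%fset.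
    by move=> i; rewrite !inE => ->.
  rewrite predeqE => t; split=> [|Pt i /=]; first by apply; rewrite /= !inE.
  by rewrite !inE => ->.
have plaques_meet (s : seq (set X)) :
    (forall P, P \in s -> open_plaque A P /\ P x) ->
    exists2 U, adom A U /\ U x & forall P, P \in s ->
      mono_restr (adec A (closure U)) U x `<=` P.
  elim: s => [_|P s IH sP].
    by have [U AU Ux] : (\bigcup_(U in adom A) U) x by [rewrite Acov]; exists U.
  have [|U [AU Ux] UP] := IH.
    by move=> P' P's; apply: sP; rewrite inE P's orbT.
  have [[V [z [AV Vz PE]]] Px] := sP _ (mem_head _ _).
  have Vx : V x by move: Px; rewrite PE => /connected_component_sub[].
  have oUV : open (U `&` V) by apply: openI; exact: Ao.
  have AUV : adom A (U `&` V) by apply: Ac AU oUV _; exact: subIsetl.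
  exists (U `&` V) => // P'; rewrite inE => /orP[/eqP ->|P's].
    rewrite PE (@plaque_eq V z x)//; last by rewrite -PE.
    by apply: plaque_sub => //; exact: subIsetr.
  apply: subset_trans (UP _ P's).
  by apply: plaque_sub => //; exact: subIsetl.
rewrite nbhsE => -[W [[D Dfin DO] Ox] ON].
move: Ox; rewrite -DO => -[I DI Ix].
have [F FA FI] := Dfin _ DI.
have [|U [AU Ux] UF] := plaques_meet (enum_fset F).
  move=> P PF; split; first by have := FA _ PF; rewrite inE.
  by move: Ix; rewrite -FI; apply.
exists (mono_restr (adec A (closure U)) U x).
  split; first by exists U, x.
  apply: connected_component_refl; split=> //.
  have /(_ _ AU)[h _ _] : forall U, adom A U ->
      decomposition (closure U) (adec A (closure U)) by case: atA.
  by case: (h x (subset_closure Ux)).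
move=> y Py; apply: ON; rewrite -DO; exists I => //.
suff : I y by [].
by rewrite -FI => P PF; exact: UF Py.
Qed.

End PlaqueBasis.

(* Main.v *)
(* The leaf of [x] is the union of the stable continua containing [x].
   - Stable continua of a uniform size exist through every point: otherwise some
     point would repel a clopen neighbourhood. They have empty interior, since a
     nondegenerate continuum cannot be both stable and unstable, so leaves are
     meagre. The iterates of a leaf are leaves, of diameter bounded below, so no
     leaf lies in a stable continuum: leaves are noncompact and, by Baire, not
     Peano continua.
   - In a disc, two continua reaching the circle near the same three points meet.
     If a stable continuum were not locally connected, infinitely many of its
     components in a disc, completed by unstable plaques to such tripods, would
     meet one another, giving an unstable plaque with infinitely many points on
     the stable continuum, against cwF-expansivity.
   - The same lemma shows, as in Moore's theorem on triods in the plane, that only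
     countably many leaves have a plaque that reaches the boundary of a disc of a
     countable basis in three points. In any other leaf the plaques are arcs.
   - A short unstable arc cuts a rectangle in two. Plaques of points close to a
     generic point of the arc, on both sides of it, have a uniform size, so in the
     limit some plaque passes from one side to the other. It meets the arc in a
     finite set, hence crosses it there. *)

Require Import Defs.
From HB Require Import structures.
From mathcomp Require Import all_boot all_order all_algebra.
From mathcomp Require Import all_classical all_reals all_analysis.
From mathcomp Require Import borel_hierarchy.
From mathcomp Require Import ring lra zify.

Set Implicit Arguments.
Unset Strict Implicit.
Unset Printing Implicit Defensive.

Import Order.TTheory GRing.Theory Num.Theory.
Import numFieldNormedType.Exports.

Local Open Scope classical_set_scope.
Local Open Scope ring_scope.

(** * Continua in compact metric spaces *)

(** Limits of continua are taken along ultrafilters ([ulim]), so that neither a Hausdorff metric nor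
    subsequences are needed. Apart from local connectedness and the crossing of the arc, where
    finiteness itself counts, cwF-expansivity enters through the fact that a finite connected set is
    a point: continua that stay [c]-small over time windows growing in both directions cannot keep a
    definite size ([limit_expansive]), since their limit would be [c]-small at all times.
    Quantitative statements follow by cutting a continuum, with boundary bumping, at the time when
    it reaches a given size and by shifting that time to 0. Stability controls an orbit only
    eventually, while expansivity needs control at all times; hence the passage to an iterate of
    [f], or to sets so small that their stable subcontinua have [c]-bounded orbits. Unstable
    statements are stable ones for [hinv f]. Planar topology is reduced to one lemma on labelled
    grids, a discrete Poincare-Miranda theorem. It gives the crossing of continua and the two sides
    of an arc across a square, in place of the Jordan curve theorem. *)

Section NearApp.
Context {I : Type} {F : set_system I} {FF : Filter F}.
Implicit Types P Q : I -> Prop.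

Lemma nearS1 P Q : (\forall i \near F, P i) -> (forall i, P i -> Q i) ->
  \forall i \near F, Q i.
Proof. by move=> FP PQ; apply: filterS FP. Qed.

Lemma nearS2 P1 P2 Q : (\forall i \near F, P1 i) -> (\forall i \near F, P2 i) ->
  (forall i, P1 i -> P2 i -> Q i) -> \forall i \near F, Q i.
Proof.
by move=> F1 F2 PQ; apply: filterS (filterI F1 F2) => i []; exact: PQ.
Qed.

Lemma nearS3 P1 P2 P3 Q : (\forall i \near F, P1 i) -> (\forall i \near F, P2 i) ->
  (\forall i \near F, P3 i) -> (forall i, P1 i -> P2 i -> P3 i -> Q i) ->
  \forall i \near F, Q i.
Proof.
move=> F1 F2 F3 PQ; apply: filterS (filterI F1 (filterI F2 F3)) => i [h []].
exact: PQ.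
Qed.

End NearApp.

(** * Ultrafilters in place of subsequences *)

Section Ultrafilters.

Lemma ultra_not (I : Type) (G : set_system I) (UG : UltraFilter G)
    (P : I -> Prop) : ~ (\forall i \near G, P i) -> \forall i \near G, ~ P i.
Proof. by move=> nP; case: (in_ultra_setVsetC P UG). Qed.

Lemma near_ex1 (I : Type) (G : set_system I) (UG : UltraFilter G)
    (P : I -> Prop) : (\forall i \near G, P i) -> exists i, P i.
Proof. by move=> /filter_ex. Qed.

Lemma near_ex2 (I : Type) (G : set_system I) (UG : UltraFilter G)
    (P Q : I -> Prop) : (\forall i \near G, P i) -> (\forall i \near G, Q i) ->
  exists i, P i /\ Q i.
Proof. by move=> h1 h2; apply: (near_ex1 UG); apply: (nearS2 h1 h2). Qed.

Lemma near_ex3 (I : Type) (G : set_system I) (UG : UltraFilter G)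
    (P Q P' : I -> Prop) : (\forall i \near G, P i) -> (\forall i \near G, Q i) ->
  (\forall i \near G, P' i) -> exists i, [/\ P i, Q i & P' i].
Proof. by move=> h1 h2 h3; apply: (near_ex1 UG); apply: (nearS3 h1 h2 h3). Qed.

Lemma ultra_or (I : Type) (G : set_system I) (UG : UltraFilter G)
    (P Q : I -> Prop) : (\forall i \near G, P i \/ Q i) ->
  (\forall i \near G, P i) \/ (\forall i \near G, Q i).
Proof.
move=> PQ; case: (pselect (\forall i \near G, P i)) => nP; [by left|right].
have nP' := ultra_not UG nP.
by apply: (nearS2 PQ nP') => i [].
Qed.

(** Pigeonhole principle: an ultrafilter cannot contain the complements of all of finitely many sets
    whose union it contains. *)
Lemma ultra_finite (I J : Type) (G : set_system I) (UG : UltraFilter G)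
    (A : set J) (P : J -> I -> Prop) : finite_set A ->
  (\forall i \near G, exists2 j, A j & P j i) ->
  exists2 j, A j & \forall i \near G, P j i.
Proof.
move=> finA H; apply: contrapT => /forall2NP nH.
have nP j : A j -> \forall i \near G, ~ P j i.
  by move=> Aj; apply: ultra_not => Pj; case: (nH j).
suff : \forall i \near G, False.
  by move=> /filter_ex [].
have nPA : \forall i \near G, forall j, A j -> ~ P j i.
  elim/Pchoice: J A P finA {H nH} nP => J A P /finite_seqP[s ->] nP.
  elim: s nP => [|j s IH] nP; first by apply: nearW => i j.
  have h1 : \forall i \near G, ~ P j i by apply: nP => /=; rewrite inE eqxx.
  have h2 : \forall i \near G, forall j, [set` s] j -> ~ P j i.
    by apply: IH => k ks; apply: nP => /=; rewrite inE; apply/orP; right.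
  apply: (nearS2 h1 h2) => i g1 g2 k /=; rewrite inE => /orP[/eqP ->//|].
  exact: g2.
by apply: (nearS2 nPA H) => i h [j Aj]; exact: h.
Qed.

(** With [P] constantly true this is a free ultrafilter on [nat], and it plays the role of a
    convergent subsequence. *)
Lemma ultra_frequently (P : nat -> Prop) :
  (forall N, exists2 n, (N <= n)%N & P n) ->
  exists G : set_system nat, [/\ UltraFilter G, \forall n \near G, P n &
    forall N, \forall n \near G, (N <= n)%N].
Proof.
move=> H.
pose F : set_system nat := filter_from setT (fun N => [set n | (N <= n)%N /\ P n]).
have FF : ProperFilter F.
  apply: filter_from_proper; last by move=> N _; have [n] := H N; exists n.
  apply: filter_from_filter; first by exists 0%N.
  move=> i j _ _; exists (maxn i j) => // n [] /=.
  by rewrite geq_max => /andP[].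
have [G [UG FG]] := ultraFilterLemma FF.
exists G; split => //.
  by apply: FG; exists 0%N => // n [].
by move=> N; apply: FG; exists N => // n [].
Qed.

Lemma ultra_fmap (I T : Type) (u : I -> T) (G : set_system I) :
  UltraFilter G -> UltraFilter (u @ G).
Proof.
move=> UG; split; first exact: fmap_proper_filter.
move=> H PH uH; apply/seteqP; split => [A HA|]; last exact: uH.
have [//|nA] := in_ultra_setVsetC (u @^-1` A) UG.
have /(filterI HA) : H (~` A) by apply: uH.
by rewrite setICr => /filter_not_empty.
Qed.

End Ultrafilters.

Section CompactMetric.
Context {R : realType} {S : metricType R}.
Implicit Types (x y z : S) (A B C K : set S).

(** Bounding pairwise distances avoids the supremum in [diam]; [diam_small] compares the two. *)
Definition small (r : R) A := forall x y, A x -> A y -> mdist x y <= r.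

Lemma small_sub r A B : A `<=` B -> small r B -> small r A.
Proof. by move=> AB sB x y /AB Bx /AB By; exact: sB. Qed.

Lemma small_le r r' A : r <= r' -> small r A -> small r' A.
Proof. by move=> rr sA x y Ax Ay; rewrite (le_trans _ rr)// sA. Qed.

Lemma mdist_sym x y : mdist x y = mdist y x.
Proof. exact: metric_sym. Qed.

Lemma ball_mdist x (e : R) y : ball x e y <-> mdist x y < e.
Proof. by rewrite ballEmdist. Qed.

Lemma nbhs_mdist_ex x (V : set S) : nbhs x V ->
  exists2 e : R, 0 < e & forall y, mdist x y < e -> V y.
Proof.
move/nbhs_ballP => [e /= e0 eV]; exists e => // y xy.
by apply: eV; rewrite ballEmdist.
Qed.

Lemma nbhs_mdist_lt x (e : R) : 0 < e -> nbhs x [set y | mdist x y < e].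
Proof.
move=> e0; apply/nbhs_ballP; exists e => //= y.
by rewrite ballEmdist.
Qed.

Lemma open_mdist_lt x (e : R) : open [set y | mdist x y < e].
Proof.
rewrite openE => y /= xy; rewrite /interior.
have e0 : 0 < e - mdist x y by rewrite subr_gt0.
apply: (nearS1 (nbhs_mdist_lt y e0)) => z /= yz.
by rewrite (le_lt_trans (metric_triangle _ y _))// -ltrBrDl.
Qed.

Lemma open_setP (O : set S) : open O <->
  forall x, O x -> exists2 e : R, 0 < e & forall y, mdist x y < e -> O y.
Proof.
split=> [oO x Ox|H].
  by apply: nbhs_mdist_ex; apply: open_nbhs_nbhs.
rewrite openE => x /H [e e0 eO]; rewrite /interior.
by apply: (nearS1 (nbhs_mdist_lt x e0)) => y; exact: eO.
Qed.

Lemma closureP_mdist A x : closure A x <->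
  forall e : R, 0 < e -> exists2 y, A y & mdist x y < e.
Proof.
split=> [cA e e0|H B /nbhs_mdist_ex[e e0 eB]].
  by have [y [Ay xy]] := cA _ (nbhs_mdist_lt x e0); exists y.
by have [y Ay xy] := H e e0; exists y; split => //; exact: eB.
Qed.

Lemma mdist_closed_le x (e : R) : closed [set y | mdist x y <= e].
Proof.
rewrite -openC; apply/open_setP => y /= /negP; rewrite -ltNge => exy.
exists (mdist x y - e); first by rewrite subr_gt0.
move=> z yz; apply/negP; rewrite -ltNge.
have := metric_triangle x z y; rewrite (mdist_sym z y) => h.
by rewrite -(ltrD2r (mdist y z)) (lt_le_trans _ h)// -ltrBrDl.
Qed.

Lemma small_closure r A : small r A -> small r (closure A).
Proof.
move=> sA x y /closureP_mdist cx /closureP_mdist cy.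
apply/ler_addgt0Pl => e e0.
have e20 : 0 < e / 2 by rewrite divr_gt0.
have [x' Ax' xx'] := cx _ e20; have [y' Ay' yy'] := cy _ e20.
have h1 := metric_triangle x x' y; have h2 := metric_triangle x' y' y.
have h3 := sA _ _ Ax' Ay'; rewrite (mdist_sym y' y) in h2.
lra.
Qed.

Lemma cvg_mdist (I : Type) (G : set_system I) (u : I -> S) x : Filter G ->
  (forall e : R, 0 < e -> \forall i \near G, mdist x (u i) < e) -> u @ G --> x.
Proof.
move=> FG h V /nbhs_mdist_ex [e e0 eV].
by apply: (nearS1 (h e e0)) => i; exact: eV.
Qed.

Lemma near_dist_lt (I : Type) (G : set_system I)
    (u : I -> S) x e : u @ G --> x -> 0 < e ->
  \forall i \near G, mdist x (u i) < e.
Proof. by move=> ux e0; exact: (ux _ (nbhs_mdist_lt x e0)). Qed.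

Lemma ulim_dist_le (I : Type) (G : set_system I) (UG : UltraFilter G)
    (u v : I -> S) x y r : u @ G --> x -> v @ G --> y ->
  (\forall i \near G, mdist (u i) (v i) <= r) -> mdist x y <= r.
Proof.
move=> ux vy h; apply/ler_addgt0Pl => e e0.
have e20 : 0 < e / 2 by rewrite divr_gt0.
have [i [h1 h2 h3]] := near_ex3 UG (near_dist_lt ux e20) (near_dist_lt vy e20) h.
have := metric_triangle x (u i) y; have := metric_triangle (u i) (v i) y.
rewrite (mdist_sym (v i) y) => *; lra.
Qed.

Lemma ulim_dist_ge (I : Type) (G : set_system I) (UG : UltraFilter G)
    (u v : I -> S) x y r : u @ G --> x -> v @ G --> y ->
  (\forall i \near G, r <= mdist (u i) (v i)) -> r <= mdist x y.
Proof.
move=> ux vy h; apply/ler_addgt0Pl => e e0.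
have e20 : 0 < e / 2 by rewrite divr_gt0.
have [i [h1 h2 h3]] := near_ex3 UG (near_dist_lt ux e20) (near_dist_lt vy e20) h.
have := metric_triangle (u i) x (v i); have := metric_triangle x y (v i).
rewrite (mdist_sym (u i) x) => *; lra.
Qed.

Lemma ulim_closed_mem (I : Type) (G : set_system I) (UG : UltraFilter G)
    (u : I -> S) x A : closed A -> u @ G --> x ->
  (\forall i \near G, A (u i)) -> A x.
Proof.
move=> cA ux uA; apply: cA => B Bx.
have [i [h1 h2]] := near_ex2 UG uA (ux _ Bx).
by exists (u i).
Qed.

Hypothesis S_compact : compact [set: S].

Lemma ulim_ex (I : Type) (G : set_system I) (UG : UltraFilter G)
  (u : I -> S) : exists x, u @ G --> x.
Proof.
have := S_compact; rewrite compact_ultra => /(_ _ (ultra_fmap u UG)).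
by move=> [|x [_ h]]; [exact: filterT|exists x].
Qed.

Lemma closed_compactS A : closed A -> compact A.
Proof. by move=> cA; apply: subclosed_compact cA S_compact _. Qed.

Lemma compact_closedS A : compact A -> closed A.
Proof. by apply: compact_closed; exact: metric_hausdorff. Qed.

Lemma mdist_bounded : exists M : R, small M setT.
Proof.
have [x0|e] := pselect (exists x : S, True); last first.
  by exists 0 => x; exfalso; apply: e; exists x.
case: x0 => x0 _; apply: contrapT => /forallNP h.
have [|G [UG _ hG]] := @ultra_frequently (fun=> True).
  by move=> N; exists N.
have h' n : exists p : S * S, n%:R < mdist p.1 p.2.
  apply: contrapT => /forallNP h'; apply: (h n%:R) => x y _ _.
  by rewrite leNgt; apply/negP => ?; apply: (h' (x, y)).
have [p hp] := choice h'.
have [x px] := ulim_ex UG (fun n => (p n).1).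
have [y py] := ulim_ex UG (fun n => (p n).2).
have [k hk] : exists k : nat, mdist x y < k%:R.
  by exists (Num.trunc (mdist x y)).+1; exact: truncnS_gt.
have := hk; rewrite ltNge => /negP; apply.
apply: ulim_dist_ge px py _; apply: (nearS1 (hG k)) => n kn.
by apply: ltW; apply: le_lt_trans (hp n); rewrite ler_nat.
Qed.

Lemma diam_small (r : R) A : 0 <= r -> (diam A <= r <-> small r A).
Proof.
move=> r0; have [M hM] := mdist_bounded; split=> h.
  move=> x y Ax Ay; apply: le_trans h.
  apply: ub_le_sup; last by exists (x, y).
  by exists M => _ [[a b] _ <-]; exact: hM.
rewrite /diam; have [->|/set0P[x Ax]] := eqVneq A set0.
  by rewrite setX0 image_set0 sup0.
apply: ge_sup; first by exists (mdist x x), (x, x).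
by move=> _ [[a b] [/= Aa Ab] <-]; exact: h.
Qed.

Lemma diam_ge_mdist A x y : A x -> A y -> mdist x y <= diam A.
Proof.
move=> Ax Ay; have [M hM] := mdist_bounded.
apply: ub_le_sup; last by exists (x, y).
by exists M => _ [[a b] _ <-]; exact: hM.
Qed.

Lemma nearest A z : compact A -> A !=set0 ->
  exists2 y, A y & forall y', A y' -> mdist z y <= mdist z y'.
Proof.
move=> cA A0.
have [|y Ay h] := @compact_EVT_min _ _ (mdist z) A A0 cA.
  apply: continuous_subspaceT => x; apply/cvgrPdist_lt => e e0.
  apply: (nearS1 (nbhs_mdist_lt x e0)) => y /= xy.
  rewrite distrC ltr_norml; apply/andP; split.
    have := metric_triangle z y x; rewrite (mdist_sym y x) => ?; lra.
  by have := metric_triangle z x y => ?; lra.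
exists y => [|y' Ay']; first exact: set_mem.
by apply: h; exact: mem_set.
Qed.

Lemma compact_disjoint_dist A B : closed A -> closed B -> A `&` B = set0 ->
  exists2 e : R, 0 < e & forall x y, A x -> B y -> e <= mdist x y.
Proof.
move=> cA cB AB; apply: contrapT => /forall2NP h.
have h' (n : nat) : exists p : S * S,
    [/\ A p.1, B p.2 & mdist p.1 p.2 < n.+1%:R^-1].
  apply: contrapT => /forallNP h'; have [] := h n.+1%:R^-1.
    by apply; rewrite invr_gt0.
  apply => x y Ax By; rewrite leNgt; apply/negP => xy.
  by apply: (h' (x, y)).
have [p hp] := choice h'.
have [|G [UG _ hG]] := @ultra_frequently (fun=> True).
  by move=> N; exists N.
have [x px] := ulim_ex UG (fun n => (p n).1).
have [y py] := ulim_ex UG (fun n => (p n).2).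
have Ax : A x by apply: ulim_closed_mem cA px _; apply: nearW => n; case: (hp n).
have By : B y by apply: ulim_closed_mem cB py _; apply: nearW => n; case: (hp n).
suff xy : x = y by have : set0 x by rewrite -AB; split => //; rewrite xy.
apply: mdist_positivity; apply/eqP; rewrite eq_le mdist_ge0 andbT.
apply/ler_addgt0Pl => e e0; rewrite addr0.
apply: (ulim_dist_le _ px py).
have [k hk] : exists k : nat, k.+1%:R^-1 < e.
  by have := ltr_add_invr e0 => -[k]; rewrite add0r; exists k.
apply: (nearS1 (hG k)) => n kn; have [_ _ /ltW/le_trans] := hp n; apply.
apply: le_trans (ltW hk); rewrite lef_pV2 ?posrE//.
by rewrite ler_nat.
Qed.

(** The Kuratowski limit along [G]. For an ultrafilter the lower and the upper limit agree, so
    nothing has to be extracted for the limit to exist. *)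
Definition ulim (I : Type) (G : set_system I) (C : I -> set S) : set S :=
  [set z | forall e : R, 0 < e ->
    \forall i \near G, exists2 y, C i y & mdist z y < e].

(** Having no gap of width [e], expressed through partitions rather than chains of points; this form
    passes directly to limits of sets. *)
Definition well_chained (e : R) C := forall A, C `&` A !=set0 ->
  C `\` A !=set0 -> exists y z, [/\ (C `&` A) y, (C `\` A) z & mdist y z < e].

Lemma connected_open_split (C O1 O2 : set S) : connected C -> open O1 ->
  open O2 -> C `<=` O1 `|` O2 -> C `&` O1 `&` O2 = set0 -> C `&` O1 !=set0 ->
  C `<=` O1.
Proof.
move=> cC o1 o2 C12 C0 C1.
have E : C `&` O1 = C `&` ~` O2.
  apply/seteqP; split => x [Cx Ox]; split => //.
    by move=> O2x; have : set0 x by rewrite -C0.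
  by case: (C12 x Cx).
suff <- : C `&` O1 = C by exact: subIsetr.
apply: cC => //; first by exists O1.
by exists (~` O2) => //; exact: open_closedC.
Qed.

Lemma connected_well_chained (e : R) C : 0 < e -> connected C -> well_chained e C.
Proof.
move=> e0 cC A [y [Cy Ay]] [z [Cz nAz]]; apply: contrapT => H.
have e20 : 0 < e / 2 by rewrite divr_gt0.
pose O B := \bigcup_(z in C `&` B) [set y | mdist z y < e / 2].
have oO B : open (O B) by apply: bigcup_open => w _; exact: open_mdist_lt.
have : C `<=` O A.
  apply: (connected_open_split cC (oO _) (oO (~` A))).
  - move=> w Cw; case: (pselect (A w)) => Aw; [left|right];
      by exists w => //=; rewrite mdistxx.
  - rewrite -subset0 => w [[Cw [a [Ca Aa] /= aw]] [b [Cb Ab] /= bw]].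
    apply: H; exists a, b; split => //.
    have h := metric_triangle a w b; rewrite (mdist_sym w b) in h.
    by clear -S_compact h aw bw; lra.
  - by exists y; split => //; exists y => //=; rewrite mdistxx.
move=> /(_ z Cz) [a [Ca Aa] /= az]; apply: H; exists a, z; split => //.
by clear -S_compact az e0; lra.
Qed.

(** * Limits of continua along an ultrafilter *)

Section Ulim.
Context (I : Type) (G : set_system I) (UG : UltraFilter G).
Implicit Types Ci : I -> set S.

Lemma ulim_closed Ci : closed (ulim G Ci).
Proof.
move=> z /closureP_mdist cz e e0.
have e20 : 0 < e / 2 by rewrite divr_gt0.
have [y hy zy] := cz _ e20.
apply: (nearS1 (hy _ e20)) => i [w Cw yw]; exists w => //.
have := metric_triangle z y w; lra.
Qed.

Lemma ulim_mem Ci (u : I -> S) z : u @ G --> z ->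
  (\forall i \near G, Ci i (u i)) -> ulim G Ci z.
Proof.
move=> uz uC e e0; apply: (nearS2 uC (near_dist_lt uz e0)) => i.
by exists (u i).
Qed.

Lemma ulim_const Ci y : (\forall i \near G, Ci i y) -> ulim G Ci y.
Proof.
move=> h e e0; apply: (nearS1 h) => i Cy; exists y => //.
by rewrite mdistxx.
Qed.

Lemma ulim_sel Ci z : ulim G Ci z -> (\forall i \near G, compact (Ci i)) ->
  exists2 u : I -> S, (\forall i \near G, Ci i (u i)) & u @ G --> z.
Proof.
move=> Lz cC.
have H i : exists y, compact (Ci i) -> Ci i !=set0 ->
    Ci i y /\ forall y', Ci i y' -> mdist z y <= mdist z y'.
  have [c|] := pselect (compact (Ci i)); last by move=> ?; exists z.
  have [c0|] := pselect (Ci i !=set0); last by move=> ?; exists z.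
  by have [y Cy h] := nearest z c c0; exists y.
have [u hu] := choice H; exists u.
  apply: (nearS2 cC (Lz 1 ltr01)) => i ci [y Cy _].
  by have [] := hu i ci (ex_intro _ y Cy).
apply: cvg_mdist => e e0; apply: (nearS2 cC (Lz e e0)) => i ci [y Cy zy].
have [_ /(_ y Cy) h] := hu i ci (ex_intro _ y Cy).
exact: le_lt_trans zy.
Qed.

Lemma ulim_sub Ci A : closed A -> (\forall i \near G, Ci i `<=` A) ->
  ulim G Ci `<=` A.
Proof.
move=> cA CA z Lz; apply: cA; apply/closureP_mdist => e e0.
have [i [[y Cy zy] h]] := near_ex2 UG (Lz e e0) CA.
by exists y => //; exact: h.
Qed.

(** Points chosen in [Ci i] outside [O] would converge, by compactness, to a point of the limit
    outside [O]. *)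
Lemma ulim_near Ci (O : set S) : open O -> ulim G Ci `<=` O ->
  \forall i \near G, Ci i `<=` O.
Proof.
move=> oO LO; apply: contrapT => /(ultra_not UG) h.
have H i : exists y, ~ (Ci i `<=` O) -> Ci i y /\ ~ O y.
  have [i0 /existsNP [y0 _]] := near_ex1 UG h.
  have [?|/existsNP[y /not_implyP]] := pselect (Ci i `<=` O).
    by exists y0.
  by exists y.
have [u hu] := choice H; have [z uz] := ulim_ex UG u.
have Lz : ulim G Ci z.
  by apply: ulim_mem uz _; apply: (nearS1 h) => i /hu [].
have : (~` O) z.
  apply: (ulim_closed_mem _ _ uz); first exact: open_closedC.
  by apply: (nearS1 h) => i /hu [].
by apply; exact: LO.
Qed.

(** If the limit split into two closed pieces at distance [e], almost every [Ci i] would lie in the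
    union of their [e / 4]-neighbourhoods and meet both, which leaves a gap wider than [e / 2].
    Assuming chains of every mesh instead of connectedness makes room for the chain components in
    [quasi_component]. *)
Lemma ulim_well_chained Ci :
  (forall e, 0 < e -> \forall i \near G, well_chained e (Ci i)) ->
  connected (ulim G Ci).
Proof.
move=> cC; apply: contrapT => /connectedPn [E [E0 LE [sE1 sE2]]].
set L := ulim G Ci in LE.
have cL : closed L := ulim_closed (Ci:=Ci).
have cE b : closed (E b).
  move=> z cz.
  have Lz : L z.
    by apply: cL; apply: closureS cz => w; rewrite LE; case: b; [right|left].
  move: Lz; rewrite LE => -[]; case: b cz => // cz Ez.
  - by have : set0 z by rewrite -sE2.
  - by have : set0 z by rewrite -sE1.
have Edis : E false `&` E true = set0.
  rewrite -subset0 -sE1 => z [h1 h2]; split => //; exact: subset_closure.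
have [e e0 he] := compact_disjoint_dist (cE false) (cE true) Edis.
have e40 : 0 < e / 4 by rewrite divr_gt0.
pose O b := \bigcup_(z in E b) [set y | mdist z y < e / 4].
have oO b : open (O b) by apply: bigcup_open => z _; exact: open_mdist_lt.
have CO : \forall i \near G, Ci i `<=` O false `|` O true.
  apply: ulim_near; first exact: openU.
  by rewrite -/L LE => z [] Ez; [left|right]; exists z => //=; rewrite mdistxx.
have hit b : \forall i \near G, Ci i `&` O b !=set0.
  have [z Ez] := E0 b.
  have Lz : L z by rewrite LE; case: b Ez; [right|left].
  by apply: (nearS1 (Lz _ e40)) => i [y Cy zy]; exists y; split => //; exists z.
have far y z : O false y -> O true z -> e / 2 < mdist y z.
  move=> [u Eu /= uy] [v Ev /= vz].
  have h1 := he u v Eu Ev; have h2 := metric_triangle u y v.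
  have h3 := metric_triangle y z v; rewrite (mdist_sym z v) in h3.
  by clear -S_compact uy vz h1 h2 h3; lra.
have e20 : 0 < e / 2 by rewrite divr_gt0.
have CC : \forall i \near G, well_chained (e / 2) (Ci i) /\
    Ci i `<=` O false `|` O true.
  by apply: (nearS2 (cC _ e20) CO) => i.
have [i [[ci cO] h1 [y [Cy Oy]]]] := near_ex3 UG CC (hit false) (hit true).
have [||u [v [[Cu Ou] [Cv nOv]]]] := ci (O false) => //.
  exists y; split => // Ofy; have := far _ _ Ofy Oy.
  by rewrite mdistxx; clear -S_compact e0; lra.
by have [//|Ov] := cO v Cv; have := far _ _ Ou Ov; clear -S_compact; lra.
Qed.

Lemma ulim_connected Ci : (\forall i \near G, connected (Ci i)) ->
  connected (ulim G Ci).
Proof.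
move=> cC; apply: ulim_well_chained => e e0.
by apply: (nearS1 cC) => i; exact: connected_well_chained.
Qed.

Lemma ulim_continuum Ci : (\forall i \near G, continuum (Ci i)) ->
  continuum (ulim G Ci).
Proof.
move=> h; split; first by apply: closed_compactS; exact: ulim_closed.
by apply: ulim_connected; apply: (nearS1 h) => i [].
Qed.

End Ulim.

End CompactMetric.

(** * Chain components and boundary bumping *)

Section Bumping.
Context {R : realType} {S : metricType R}.
Implicit Types (x y z : S) (A B C K F O : set S).

Inductive chain (e : R) K x : S -> Prop :=
| chain_refl : K x -> chain e K x x
| chain_step y z : chain e K x y -> K z -> mdist y z < e -> chain e K x z.

Lemma chain_sub e K x : chain e K x `<=` K.
Proof. by move=> y []. Qed.

Lemma chain_start e K x y : chain e K x y -> K x.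
Proof. by elim. Qed.

Lemma chain_well_chained e K x : well_chained e (chain e K x).
Proof.
move=> A [a [Ca Aa]] [b [Cb nAb]]; apply: contrapT => H.
have Cx : chain e K x x by apply: chain_refl; exact: chain_start Ca.
have [Ax|nAx] := pselect (A x).
  suff AA : chain e K x `<=` A by exact/nAb/AA.
  move=> y; elim=> // {}y z Cy Ay Kz yz; apply: contrapT => nAz.
  apply: H; exists y, z; split => //; split => //.
  exact: chain_step Cy Kz yz.
suff AA : chain e K x `<=` ~` A by apply: (AA a).
move=> y; elim=> // {}y z Cy Ay Kz yz Az.
apply: H; exists z, y; split; [split=> //|by split|by rewrite mdist_sym].
exact: chain_step Cy Kz yz.
Qed.

Lemma well_chained_chain e K x y : well_chained e K -> K x -> K y ->
  chain e K x y.
Proof.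
move=> wK Kx Ky; apply: contrapT => nxy.
have [||a [b [[Ka xa] [Kb nxb] ab]]] := wK (chain e K x).
- by exists x; split => //; exact: chain_refl.
- by exists y.
by apply: nxb; exact: chain_step xa Kb ab.
Qed.

Lemma closed_chain e K x : 0 < e -> closed K -> closed (chain e K x).
Proof.
move=> e0 cK z cz.
have [y xy zy] := (closureP_mdist _ _).1 cz _ e0.
apply: chain_step xy _ _; last by rewrite mdist_sym.
by apply: cK; apply: closureS cz; exact: chain_sub.
Qed.

Hypothesis S_compact : compact [set: S].

(** The limit of the [e]-chain components of [x] as [e] tends to 0 is connected, hence contained in
    the component of [x]; being inside [O], it drags some chain component into [O]. *)
Lemma quasi_component K x O : closed K -> K x -> open O ->
  connected_component K x `<=` O -> exists2 e : R, 0 < e & chain e K x `<=` O.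
Proof.
move=> cK Kx oO KO; apply: contrapT => /forall2NP H.
have [|G [UG _ hG]] := @ultra_frequently (fun=> True).
  by move=> N; exists N.
pose C n := chain (n.+1%:R^-1 : R) K x.
have Lc : connected (ulim G C).
  apply: ulim_well_chained => // e e0.
  have [k hk] : exists k : nat, k.+1%:R^-1 < e.
    by have := ltr_add_invr e0 => -[k]; rewrite add0r; exists k.
  apply: (nearS1 (hG k)) => n kn A A0 A1.
  have [y [z [Ay Az yz]]] := chain_well_chained A0 A1.
  exists y, z; split => //; apply: lt_trans yz (le_lt_trans _ hk).
  by rewrite lef_pV2 ?posrE// ler_nat.
have LK : ulim G C `<=` K.
  by apply: ulim_sub => //; apply: nearW => n; exact: chain_sub.
have Lx : ulim G C x.
  move=> e e0; apply: nearW => n; exists x; last by rewrite mdistxx.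
  exact: chain_refl.
have : ulim G C `<=` O.
  by apply: subset_trans KO; exact: connected_component_max.
move=> /(ulim_near S_compact UG oO) /(near_ex1 UG)[n Cn].
by case: (H n.+1%:R^-1) => //; apply; rewrite invr_gt0.
Qed.

Lemma component_continuum K x : closed K -> continuum (connected_component K x).
Proof.
move=> cK; split; last exact: component_connected.
by apply: closed_compactS => //; exact: component_closed.
Qed.

(** Otherwise the component, and then by [quasi_component] some chain component, lies in the
    interior of [F]. A chain component there is both open and closed in [C], so it is all of [C]. *)
Lemma boundary_bumping C F x : continuum C -> closed F -> C x -> F x ->
  ~ (C `<=` F) -> exists2 y, connected_component (C `&` F) x y & ~ interior F y.
Proof.
move=> [cC conC] cF Cx Fx nCF; apply: contrapT => /forall2NP H; apply: nCF.
have clC : closed C by exact: compact_closedS.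
have EF : connected_component (C `&` F) x `<=` interior F.
  by move=> y xy; case: (H y) => // /contrapT.
have cCF : closed (C `&` F) by exact: closedI.
have [e e0 he] := quasi_component cCF (conj Cx Fx) (open_interior F) EF.
have oN : open (\bigcup_(y in chain e (C `&` F) x) [set z | mdist y z < e]).
  by apply: bigcup_open => y _; exact: open_mdist_lt.
suff <- : chain e (C `&` F) x = C by move=> y /chain_sub[].
apply: conC; first by exists x; exact: chain_refl.
  exists (interior F `&`
      \bigcup_(y in chain e (C `&` F) x) [set z | mdist y z < e]).
    by apply: openI => //; exact: open_interior.
  apply/seteqP; split => z.
    move=> xz; split; first by have [] := chain_sub xz.
    split; first exact: he.
    by exists z => //=; rewrite mdistxx.
  move=> [Cz [/interior_subset Fz [y xy /= yz]]].
  exact: chain_step xy (conj Cz Fz) yz.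
exists (chain e (C `&` F) x); first exact: closed_chain.
apply/seteqP; split => [z xz|z []//].
by split => //; have [] := chain_sub xz.
Qed.

End Bumping.

(** * Expansivity and the existence of stable continua *)

Section Iterates.
Context {X : topologicalType}.
Implicit Types f : homeo X X.

Definition hinv f : homeo X X :=
  Homeo (@homeo_invK _ _ f) (@homeo_funK _ _ f)
    (@homeo_inv_continuous _ _ f) (@homeo_fun_continuous _ _ f).

Lemma hiterS f n x : hiter f (n + 1) x = f (hiter f n x).
Proof.
case: n => [n|[|n]] /=.
- by rewrite addn1.
- by rewrite homeo_invK.
- by rewrite subn1 /= homeo_invK.
Qed.

Lemma hiterB1 f n x : hiter f (n - 1) x = homeo_inv f (hiter f n x).
Proof. by rewrite -{2}(subrK 1 n) hiterS homeo_funK. Qed.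

Lemma hiterD f m n x : hiter f (m + n) x = hiter f m (hiter f n x).
Proof.
elim/int_rect: m => [|m IH|m IH]; first by rewrite add0r.
- by rewrite -addn1 PoszD addrAC !hiterS IH.
- by rewrite -addn1 PoszD opprD addrAC !hiterB1 IH.
Qed.

Lemma hiterK f n : cancel (hiter f n) (hiter f (- n)).
Proof. by move=> x; rewrite -hiterD addNr. Qed.

Lemma hiterVK f n : cancel (hiter f (- n)) (hiter f n).
Proof. by move=> x; rewrite -hiterD addrN. Qed.

Lemma hiter_inv f n x : hiter (hinv f) n x = hiter f (- n) x.
Proof.
elim/int_rect: n => [//|n IH|n IH].
- by rewrite -addn1 PoszD hiterS IH opprD hiterB1.
- by rewrite -addn1 PoszD opprD hiterB1 IH opprB addrC opprK hiterS.
Qed.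

Lemma iter_continuous (h : X -> X) n : continuous h -> continuous (iter n h).
Proof.
move=> ch; elim: n => [|n IH] x /=; first exact: cvg_id.
by apply: continuous_comp; [exact: IH|exact: ch].
Qed.

Lemma hiter_continuous f n : continuous (hiter f n).
Proof.
by case: n => n; apply: iter_continuous; [exact: homeo_fun_continuous|
  exact: homeo_inv_continuous].
Qed.

Lemma continuous_continuum (h : X -> X) C : continuous h -> continuum C ->
  continuum (h @` C).
Proof.
move=> ch [cC conC]; split; first by apply: continuous_compact => //; exact: continuous_subspaceT.
by apply: connected_continuous_connected => //; exact: continuous_subspaceT.
Qed.

End Iterates.

Section Expansive.
Context {R : realType} {S : metricType R}.
Implicit Types (x y z : S) (A B C D K F O : set S) (f : homeo S S).

Definition fsmall (h : S -> S) (r : R) C :=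
  forall x y, C x -> C y -> mdist (h x) (h y) <= r.

Lemma fsmall_image h r C : small r (h @` C) <-> fsmall h r C.
Proof.
split=> [H x y Cx Cy|H _ _ [x Cx <-] [y Cy <-]]; last exact: H.
by apply: H; [exists x|exists y].
Qed.

Lemma fsmall_sub h r A B : A `<=` B -> fsmall h r B -> fsmall h r A.
Proof. by move=> AB sB x y /AB Bx /AB By; exact: sB. Qed.

Lemma fsmall_le h r r' A : r <= r' -> fsmall h r A -> fsmall h r' A.
Proof. by move=> rr sA x y Ax Ay; rewrite (le_trans _ rr)// sA. Qed.

Lemma fsmall_center h (r : R) A x : (forall y, A y -> mdist (h x) (h y) <= r / 2) ->
  fsmall h r A.
Proof.
move=> H y z Ay Az; have h1 := H y Ay; have h2 := H z Az.
have h3 := metric_triangle (h y) (h x) (h z).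
by rewrite (mdist_sym (h y) (h x)) in h3; lra.
Qed.

Lemma cvg_homeo (I : Type) (G : set_system I) (u : I -> S) x (h : S -> S) :
  continuous h -> u @ G --> x -> (fun i => h (u i)) @ G --> h x.
Proof. by move=> ch ux; apply: (cvg_comp u h ux); exact: ch. Qed.

Lemma fsmall_closure h r C : continuous h -> fsmall h r C ->
  fsmall h r (closure C).
Proof.
move=> ch sC x y cx cy; apply/ler_addgt0Pl => e e0.
have e20 : 0 < e / 2 by rewrite divr_gt0.
have [x' [Cx' /ball_mdist hx]] := cx _ (ch x _ (nbhsx_ballx _ _ e20)).
have [y' [Cy' /ball_mdist hy]] := cy _ (ch y _ (nbhsx_ballx _ _ e20)).
have h1 := metric_triangle (h x) (h x') (h y).
have h2 := metric_triangle (h x') (h y') (h y).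
have h3 := sC _ _ Cx' Cy'; rewrite (mdist_sym (h y')) in h2.
by clear -h1 h2 h3 hx hy; lra.
Qed.

Definition stab f C := continuum C /\ forall e : R, 0 < e ->
  exists N, forall n, (N <= n)%N -> fsmall (iter n f) e C.

Lemma closed_orbit_close (h : S -> S) x (N : nat) (r : R) : continuous h ->
  closed [set z | forall i, (i <= N)%N -> mdist (iter i h x) (iter i h z) <= r].
Proof.
move=> ch z cz i iN; apply/ler_addgt0Pl => e e0.
have [z' [Hz /ball_mdist hz]] := cz _ (@iter_continuous _ h i ch z _ (nbhsx_ballx _ _ e0)).
have h1 := metric_triangle (iter i h x) (iter i h z') (iter i h z).
rewrite (mdist_sym (iter i h z')) in h1; have h2 := Hz i iN.
by clear -h1 h2 hz; lra.
Qed.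

(** Combined with [boundary_bumping]: a continuum cut by this set retains a point at which the bound
    [r] is reached at some time up to [N]. *)
Lemma interior_orbit_close (h : S -> S) x z (N : nat) (r : R) : continuous h ->
  (forall i, (i <= N)%N -> mdist (iter i h x) (iter i h z) < r) ->
  interior [set z | forall i, (i <= N)%N -> mdist (iter i h x) (iter i h z) <= r] z.
Proof.
move=> ch; rewrite /interior; elim: N => [|N IH] H.
  have h0 := H 0%N (leqnn _).
  have := nbhs_mdist_lt z (_ : 0 < r - mdist x z); rewrite subr_gt0 => /(_ h0).
  apply: filterS => w /= zw [|//] _ /=.
  by have := metric_triangle x z w; clear -zw; lra.
have {}IH := IH (fun i iN => H i (leqW iN)).
have h0 := H N.+1 (leqnn _).
have e0 : 0 < r - mdist (iter N.+1 h x) (iter N.+1 h z) by rewrite subr_gt0.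
have h1 := @iter_continuous _ h N.+1 ch z _ (nbhs_mdist_lt (iter N.+1 h z) e0).
apply: filterS (filterI IH h1) => w [hw1 hw2] i.
rewrite leq_eqVlt => /orP[/eqP ->|]; last by rewrite ltnS; exact: hw1.
have := metric_triangle (iter N.+1 h x) (iter N.+1 h z) (iter N.+1 h w).
by move: hw2; rewrite /preimage /mkset; clear; lra.
Qed.

Lemma finite_connected A : finite_set A -> connected A ->
  forall x y, A x -> A y -> x = y.
Proof.
move=> fA cA x y Ax Ay.
suff : [set x] = A by move=> h; move: Ay; rewrite -h.
apply: cA; first by exists x.
- exists (~` (A `\ x)).
    apply: closed_openC; apply: accessible_finite_set_closed.1.
      exact/hausdorff_accessible/metric_hausdorff.
    exact: finite_setD.
  apply/seteqP; split => [z -> |z [Az nz]]; first by split => // -[_]; apply.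
  by apply: contrapT => zx; apply: nz.
- exists [set x]; last by apply/seteqP; split => [z ->|z []].
  apply: accessible_closed_set1; exact/hausdorff_accessible/metric_hausdorff.
Qed.

(** Forward and backward times are separated, so that [f] and its inverse can be exchanged with the
    same constant. *)
Definition cwF_const (f : homeo S S) (c : R) := 0 < c /\ forall A B,
  continuum A -> continuum B ->
  (forall n, fsmall (iter n f) c A) ->
  (forall n, fsmall (iter n (homeo_inv f)) c B) -> finite_set (A `&` B).

Lemma cwF_const_inv f c : cwF_const f c -> cwF_const (hinv f) c.
Proof.
by move=> [c0 H]; split => // A B cA cB sA sB; rewrite setIC; exact: H.
Qed.

Hypothesis S_compact : compact [set: S].

Lemma cwF_constP f : cwF_expansive f -> exists c, cwF_const f c.
Proof.
move=> [c c0 H]; exists c; split => // A B cA cB sA sB; apply: H => //.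
  by case=> // n _; apply/(diam_small S_compact _ (ltW c0))/fsmall_image/sA.
case=> [[|//] _|n _]; apply/(diam_small S_compact _ (ltW c0))/fsmall_image.
  exact: (sB 0%N).
exact: sB.
Qed.

Section CW.
Variables (f : homeo S S) (c : R).
Hypothesis Hc : cwF_const f c.

Let c0 : 0 < c. Proof. by case: Hc. Qed.

(** All iterates of the limit continuum are [c]-small, so expansivity applied to it twice makes it
    finite, hence a point; yet it contains limits of points at distance [e]. *)
Lemma limit_expansive (I : Type) (G : set_system I) (UG : UltraFilter G)
    (D : I -> set S) (e : R) : 0 < e -> (\forall i \near G, continuum (D i)) ->
  (forall m : int, \forall i \near G, fsmall (hiter f m) c (D i)) ->
  (\forall i \near G, exists x y, [/\ D i x, D i y & e <= mdist x y]) -> False.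
Proof.
move=> e0 cD sD eD; set L := ulim G D.
have cL : continuum L by exact: ulim_continuum.
have comD : \forall i \near G, compact (D i) by apply: (nearS1 cD) => i [].
have sL m : fsmall (hiter f m) c L.
  move=> x y Lx Ly.
  have [u uC ux] := ulim_sel UG Lx comD.
  have [v vC vy] := ulim_sel UG Ly comD.
  apply: (ulim_dist_le UG (cvg_homeo (@hiter_continuous _ f m) ux)
    (cvg_homeo (@hiter_continuous _ f m) vy)).
  by apply: (nearS3 uC vC (sD m)) => i h1 h2; apply.
have LL : finite_set L.
  rewrite -(setIid L); case: Hc => _; apply => // n.
    exact: (sL n).
  by case: n => [|n]; [exact: (sL 0)|exact: (sL (Negz n))].
have [i0 [x0 _]] := near_ex1 UG eD.
have H i : exists p : S * S, (exists x y, [/\ D i x, D i y & e <= mdist x y]) ->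
   [/\ D i p.1, D i p.2 & e <= mdist p.1 p.2].
  have [[x [y h]]|h] := pselect (exists x y, [/\ D i x, D i y & e <= mdist x y]).
    by exists (x, y).
  by exists (x0, x0).
have [p hp] := choice H.
have [x px] := ulim_ex S_compact UG (fun n => (p n).1).
have [y py] := ulim_ex S_compact UG (fun n => (p n).2).
have Lx : L x by apply: ulim_mem px _; apply: (nearS1 eD) => i /hp[].
have Ly : L y by apply: ulim_mem py _; apply: (nearS1 eD) => i /hp[].
have : e <= mdist x y.
  by apply: (ulim_dist_ge UG px py); apply: (nearS1 eD) => i /hp[].
by rewrite (finite_connected LL cL.2 Lx Ly) mdistxx leNgt e0.
Qed.

(** If the images do not shrink, those at the late times when their size exceeds [e] are [c]-small
    on windows that extend ever further into the past. *)
Lemma bounded_stab C : continuum C -> (forall n, fsmall (iter n f) c C) ->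
  stab f C.
Proof.
move=> cC sC; split => // e e0; apply: contrapT => /forallNP H.
have [|G [UG hP hG]] := @ultra_frequently (fun n => ~ fsmall (iter n f) e C).
  move=> N; have /existsNP [n /not_implyP[Nn hn]] := H N; by exists n.
apply: (@limit_expansive _ G UG (fun n => iter n f @` C) e) => //.
- apply: nearW => n; apply: continuous_continuum => //.
  exact: (@hiter_continuous _ f n).
- move=> m; apply: (nearS1 (hG `|m|%N)) => n mn _ _ [x Cx <-] [y Cy <-].
  have E z : hiter f m (iter n f z) = iter `|(m + n)%R|%N f z.
    rewrite -[iter n f z]/(hiter f n z) -hiterD.
    by rewrite -[RHS]/(hiter f `|(m + n)%R|%N z) gez0_abs//; lia.
  by rewrite !E; exact: sC.
- apply: (nearS1 hP) => n /existsNP[x /existsNP[y]] h.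
  exists (iter n f x), (iter n f y).
  move: h => /not_implyP[Cx /not_implyP[Cy /negP]]; rewrite -ltNge => h.
  by split; [exists x|exists y|exact: ltW].
Qed.

(** A bounded time would be constant along [G], and continuity of that single iterate keeps the
    points together. *)
Lemma escape (h : S -> S) (I : Type) (G : set_system I) (UG : UltraFilter G)
    (x z : I -> S) (n : I -> nat) (e : R) : continuous h -> 0 < e ->
  (forall r, 0 < r -> \forall i \near G, mdist (x i) (z i) <= r) ->
  (\forall i \near G, e <= mdist (iter (n i) h (x i)) (iter (n i) h (z i))) ->
  forall N, \forall i \near G, (N <= n i)%N.
Proof.
move=> ch e0 xz hn N; apply: contrapT => /(ultra_not UG) H.
have [|j _ hj] := ultra_finite UG (P := fun j i => n i = j) (finite_II N).
  by apply: (nearS1 H) => i /negP; rewrite -ltnNge => ?; exists (n i).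
have [x' xx] := ulim_ex S_compact UG x; have [z' zz] := ulim_ex S_compact UG z.
have xz' : x' = z'.
  apply: mdist_positivity; apply/eqP; rewrite eq_le mdist_ge0 andbT.
  apply/ler_addgt0Pl => r r0; rewrite addr0.
  exact: (ulim_dist_le UG xx zz (xz r r0)).
have : e <= mdist (iter j h x') (iter j h z').
  apply: (ulim_dist_ge UG (cvg_homeo (@iter_continuous _ h j ch) xx)
     (cvg_homeo (@iter_continuous _ h j ch) zz)).
  by apply: (nearS2 hj hn) => i ->.
by rewrite xz' mdistxx leNgt e0.
Qed.

Lemma ex_invS_lt (e : R) : 0 < e -> exists k : nat, k.+1%:R^-1 < e.
Proof. by move=> e0; have := ltr_add_invr e0 => -[k]; rewrite add0r; exists k. Qed.

Lemma invS_le (e : R) (k n : nat) : k.+1%:R^-1 < e -> (k <= n)%N ->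
  n.+1%:R^-1 <= e.
Proof.
move=> ke kn; apply: le_trans (ltW ke).
by rewrite lef_pV2 ?posrE// ler_nat.
Qed.

(** Otherwise ever smaller stable continua later grow beyond [e]. Cut down so that they reach
    [e / 2] but never exceed [c], and observed at the time of reaching it, they contradict
    [limit_expansive]. *)
Lemma stab_small_forward (e : R) : 0 < e -> exists2 d : R, 0 < d &
  forall C, stab f C -> small d C -> forall n, fsmall (iter n f) e C.
Proof.
(* The cut pieces are only known to be [e]-small, and this bound must not exceed [c]. *)
wlog ec : e / e <= c.
  move=> H e0; have [||d d0 hd] := H (Num.min e c).
  - by rewrite ge_min lexx orbT.
  - by rewrite lt_min e0 c0.
  exists d => // C sC dC n; apply: fsmall_le (hd C sC dC n).
  by rewrite ge_min lexx.
move=> e0; apply: contrapT => /forall2NP H.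
have cf : continuous f by exact: homeo_fun_continuous.
have H' (k : nat) : exists q : set S * (S * S) * nat,
  [/\ continuum q.1.1, q.1.1 q.1.2.1 /\ q.1.1 q.1.2.2,
      mdist q.1.2.1 q.1.2.2 <= k.+1%:R^-1,
      (forall n, fsmall (iter n f) c q.1.1) &
      e / 2 <= mdist (iter q.2 f q.1.2.1) (iter q.2 f q.1.2.2)].
  have [] := H k.+1%:R^-1; first by rewrite invr_gt0.
  move=> /existsNP[C /not_implyP[[cC sC] /not_implyP[dC /existsNP[n]]]].
  move=> /existsNP[x /existsNP[y /not_implyP[Cx /not_implyP[Cy]]]] /negP.
  rewrite -ltNge => exy.
  have [N hN] := sC (e / 4) (divr_gt0 e0 (ltr0n _ 4)).
  have nN : (n <= N)%N.
    rewrite leqNgt; apply/negP => /ltnW /hN /(_ x y Cx Cy) h.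
    by clear -h exy e0 S_compact; lra.
  (* The component of [C] in [F] through [x] is [e]-small up to time [N], and later by the choice of
     [N]; bumping gives a point of it that reaches distance [e / 2] at some time up to [N]. *)
  set F := [set z | forall i, (i <= N)%N -> mdist (iter i f x) (iter i f z) <= e / 2].
  have cF : closed F by exact: closed_orbit_close.
  have Fx : F x by move=> i _; rewrite mdistxx divr_ge0// ltW.
  have nCF : ~ (C `<=` F).
    by move=> /(_ y Cy n nN) h; clear -h exy e0 S_compact; lra.
  have [z Ez nFz] := boundary_bumping S_compact cC cF Cx Fx nCF.
  have [i [iN hi]] : exists i, (i <= N)%N /\ e / 2 <= mdist (iter i f x) (iter i f z).
    apply: contrapT => /forallNP h; apply: nFz; apply: interior_orbit_close => //.
    move=> i iN; rewrite ltNge; apply/negP => hi; exact: (h i).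
  exists (connected_component (C `&` F) x, (x, z), i); split => //=.
  - apply: component_continuum => //; apply: closedI => //.
    by apply: compact_closedS; case: cC.
  - by split => //; exact: connected_component_refl.
  - by apply: dC => //; have [] := connected_component_sub Ez.
  - move=> m; have [mN|/ltnW Nm] := leqP m N.
      apply: fsmall_le ec _; apply: (fsmall_center (x := x)) => w.
      by move=> /connected_component_sub[_]; apply.
    apply: fsmall_sub (fsmall_le _ (hN m Nm)).
      by move=> w /connected_component_sub[].
    by clear -ec e0 S_compact; lra.
have [q hq] := choice H'.
have [|G [UG _ hG]] := @ultra_frequently (fun=> True).
  by move=> N; exists N.
have e20 : 0 < e / 2 by rewrite divr_gt0.
have esc : forall N, \forall i \near G, (N <= (q i).2)%N.
  apply: (escape UG (x := fun i => (q i).1.2.1) (z := fun i => (q i).1.2.2) cf e20).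
    move=> r r0; have [k hk] := ex_invS_lt r0.
    apply: (nearS1 (hG k)) => i ki; have [_ _ h _ _] := hq i.
    exact: le_trans h (invS_le hk ki).
  by apply: nearW => i; case: (hq i).
apply: (@limit_expansive _ G UG (fun k => iter (q k).2 f @` (q k).1.1) (e / 2)) => //.
- apply: nearW => k; apply: continuous_continuum; last by case: (hq k).
  exact: (@hiter_continuous _ f (q k).2).
- move=> m; apply: (nearS1 (esc `|m|%N)) => k mn _ _ [x Cx <-] [y Cy <-].
  have E z : hiter f m (iter (q k).2 f z) = iter `|(m + (q k).2)%R|%N f z.
    rewrite -[iter _ f z]/(hiter f (q k).2 z) -hiterD.
    by rewrite -[RHS]/(hiter f `|(m + (q k).2)%R|%N z) gez0_abs//; lia.
  by by rewrite !E; case: (hq k) => _ _ _ h _; exact: h.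
- apply: nearW => k; case: (hq k) => _ [h1 h2] _ _ h3.
  by eexists; eexists; split; [exists (q k).1.2.1|exists (q k).1.2.2|].
Qed.

(** Shift counterexamples to the time [i] at which they have size [e]. By [escape], applied forwards
    from time 0 and backwards from time [n], both [i] and [n - i] tend to infinity, so the windows
    exhaust the integers. *)
Lemma two_ended (e : R) : 0 < e -> exists2 d : R, 0 < d &
  forall D n, continuum D -> (forall i, (i <= n)%N -> fsmall (iter i f) c D) ->
  (exists i x y, [/\ (i <= n)%N, D x, D y & e <= mdist (iter i f x) (iter i f y)]) ->
  small d D -> fsmall (iter n f) d D -> False.
Proof.
move=> e0; apply: contrapT => /forall2NP H.
have cf : continuous f by exact: homeo_fun_continuous.
have H' (k : nat) : exists q : set S * (S * S) * (nat * nat),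
  [/\ continuum q.1.1 /\ (q.2.1 <= q.2.2)%N, q.1.1 q.1.2.1 /\ q.1.1 q.1.2.2,
      mdist q.1.2.1 q.1.2.2 <= k.+1%:R^-1 /\
      mdist (iter q.2.2 f q.1.2.1) (iter q.2.2 f q.1.2.2) <= k.+1%:R^-1,
      (forall i, (i <= q.2.2)%N -> fsmall (iter i f) c q.1.1) &
      e <= mdist (iter q.2.1 f q.1.2.1) (iter q.2.1 f q.1.2.2)].
  apply: contrapT => /forallNP H'.
  case: (H k.+1%:R^-1); first by rewrite invr_gt0.
  apply=> D n cD sD [i [x [y [iN Dx Dy exy]]]] s1 s2.
  by apply: (H' (D, (x, y), (i, n))); split => //=; split; [exact: s1|exact: s2].
have [q hq] := choice H'.
have [|G [UG _ hG]] := @ultra_frequently (fun=> True).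
  by move=> N; exists N.
have esc1 : forall N, \forall i \near G, (N <= (q i).2.1)%N.
  apply: (escape UG (x := fun i => (q i).1.2.1) (z := fun i => (q i).1.2.2) cf e0).
    move=> r r0; have [k hk] := ex_invS_lt r0.
    apply: (nearS1 (hG k)) => i ki; have [_ _ [h _] _ _] := hq i.
    exact: le_trans h (invS_le hk ki).
  by apply: nearW => i; case: (hq i).
have cg : continuous (homeo_inv f) by exact: homeo_inv_continuous.
have back i j x : (i <= j)%N -> iter (j - i) (homeo_inv f) (iter j f x) = iter i f x.
  move=> ij; rewrite -{2}(subnK ij) iterD; elim: (j - i)%N => [//|m IH].
  by rewrite iterSr /= homeo_funK IH.
have esc2 : forall N, \forall i \near G, (N <= (q i).2.2 - (q i).2.1)%N.
  apply: (escape UG (x := fun i => iter (q i).2.2 f (q i).1.2.1)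
    (z := fun i => iter (q i).2.2 f (q i).1.2.2) cg e0).
    move=> r r0; have [k hk] := ex_invS_lt r0.
    apply: (nearS1 (hG k)) => i ki; have [_ _ [_ h] _ _] := hq i.
    exact: le_trans h (invS_le hk ki).
  by apply: nearW => i; have [[_ ij] _ _ _ h] := hq i; rewrite !back.
apply: (@limit_expansive _ G UG (fun k => iter (q k).2.1 f @` (q k).1.1) e) => //.
- apply: nearW => k; apply: continuous_continuum; last by case: (hq k) => -[].
  exact: (@hiter_continuous _ f (q k).2.1).
- move=> m; apply: (nearS2 (esc1 `|m|%N) (esc2 `|m|%N)) => k m1 m2.
  move=> _ _ [x Cx <-] [y Cy <-].
  have E z : hiter f m (iter (q k).2.1 f z) = iter `|(m + (q k).2.1)%R|%N f z.
    rewrite -[iter _ f z]/(hiter f (q k).2.1 z) -hiterD.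
    by rewrite -[RHS]/(hiter f `|(m + (q k).2.1)%R|%N z) gez0_abs//; lia.
  rewrite !E; case: (hq k) => [[_ ij] _ _ h _]; apply: h => //.
  by move: m1 m2 ij; clear; lia.
- apply: nearW => k; case: (hq k) => _ [h1 h2] _ _ h3.
  by eexists; eexists; split; [exists (q k).1.2.1|exists (q k).1.2.2|].
Qed.

End CW.
End Expansive.

Section LocallyConnected.
Context {X : topologicalType}.
Hypothesis X_lc : locally_connected X.

Lemma component_open (O : set X) x : open O -> open (connected_component O x).
Proof.
move=> oO; rewrite openE => y Oxy; rewrite /interior.
have Oy := connected_component_sub Oxy.
have [W [oW Wy WO cW]] := X_lc (open_nbhs_nbhs (conj oO Oy)).
apply: (filterS _ (open_nbhs_nbhs (conj oW Wy))) => z Wz.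
by apply: connected_component_trans Oxy _; exists W.
Qed.

End LocallyConnected.

(** * Stable continua of uniform size *)

Section Existence.
Context {R : realType} {S : metricType R}.
Implicit Types (x y z : S) (A B C D E K F O V W : set S) (f : homeo S S).
Hypothesis S_compact : compact [set: S].
Hypothesis S_lc : locally_connected S.
Hypothesis S_perfect : forall x : S, ~ open [set x].

Lemma connected_nbhs z (e : R) : 0 < e -> exists W, [/\ open W, W z, connected W &
  forall y, closure W y -> mdist z y <= e].
Proof.
move=> e0; have [W [oW Wz We cW]] := S_lc (nbhs_mdist_lt z e0).
exists W; split => // y cy; apply: (@mdist_closed_le _ _ z e).
by apply: closureS cy => w /We /ltW.
Qed.

Lemma closure_continuum W : connected W -> continuum (closure W).
Proof.
move=> cW; split; last exact: connected_closure.
by apply: closed_compactS => //; exact: closed_closure.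
Qed.

Lemma continuumU A B : A `&` B !=set0 -> continuum A -> continuum B ->
  continuum (A `|` B).
Proof.
by move=> AB [kA cA] [kB cB]; split; [exact: compactU|exact: connectedU].
Qed.

(** The points that continua in [J] join to [y] form a set that is relatively open and closed in
    [J]. *)
Lemma continuum_connected J y y' : open J -> connected J -> J y -> J y' ->
  exists A, [/\ continuum A, A `<=` J, A y & A y'].
Proof.
move=> oJ cJ Jy Jy'.
pose T y' := exists A, [/\ continuum A, A `<=` J, A y & A y'].
have nb w : J w -> exists W, [/\ open W, W w, continuum (closure W) &
    closure W `<=` J].
  move=> Jw; have [e e0 eJ] := (open_setP _).1 oJ w Jw.
  have e20 : 0 < e / 2 by rewrite divr_gt0.
  have [W [oW Ww cW sW]] := connected_nbhs w e20.
  exists W; split => //; first exact: closure_continuum.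
  by move=> v /sW h; apply: eJ; lra.
have TW w W v : continuum (closure W) -> closure W `<=` J -> T w ->
    closure W w -> closure W v -> T v.
  move=> cW WJ [A [cA AJ Ay Aw]] Ww Wv; exists (A `|` closure W); split.
  - by apply: continuumU => //; exists w.
  - by rewrite subUset.
  - by left.
  - by right.
suff : J `<=` [set v | T v] `&` J by move=> /(_ y' Jy')[].
apply: (connected_open_split cJ (O2 := J `\` [set v | T v])).
- rewrite openE => w [Tw Jw]; rewrite /interior.
  have [W [oW Ww cW WJ]] := nb w Jw.
  apply: (filterS _ (open_nbhs_nbhs (conj oW Ww))) => v Wv; split.
    by apply: (TW w W v) => //; exact: subset_closure.
  by apply: WJ; exact: subset_closure.
- rewrite openE => w [Jw nTw]; rewrite /interior.
  have [W [oW Ww cW WJ]] := nb w Jw.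
  apply: (filterS _ (open_nbhs_nbhs (conj oW Ww))) => v Wv; split.
    by apply: WJ; exact: subset_closure.
  by move=> Tv; apply: nTw; apply: (TW v W w) => //; exact: subset_closure.
- by move=> w Jw; have [?|?] := pselect (T w); [left|right].
- by rewrite -subset0 => w [[_ [Tw _]] [_]].
- exists y; split => //; split => //; have [W [oW Wy cW WJ]] := nb y Jy.
  by exists (closure W); split => //; exact: subset_closure.
Qed.

(** A Lebesgue number argument: bad centres would accumulate at a point, one connected neighbourhood
    of which serves all centres close to it. *)
Lemma uniform_continuum_nbhs (d : R) : 0 < d -> exists2 r : R, 0 < r &
  forall z, exists E, [/\ continuum E, small d E &
    forall y, mdist z y < r -> E y].
Proof.
move=> d0; apply: contrapT => /forall2NP H.
have H' (n : nat) : exists z, ~ exists E, [/\ continuum E, small d E &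
    forall y, mdist z y < n.+1%:R^-1 -> E y].
  by case: (H n.+1%:R^-1) => [|/existsNP//]; rewrite invr_gt0.
have [zn hz] := choice H'.
have [|G [UG _ hG]] := @ultra_frequently (fun=> True).
  by move=> N; exists N.
have [z zz] := ulim_ex S_compact UG zn.
have d20 : 0 < d / 2 by rewrite divr_gt0.
have [W [oW Wz cW sW]] := connected_nbhs z d20.
have [e e0 eW] := (open_setP _).1 oW z Wz.
have e20 : 0 < e / 2 by rewrite divr_gt0.
have [k hk] := ex_invS_lt e20.
have [n [kn hn]] := near_ex2 UG (hG k) (near_dist_lt zz e20).
apply: (hz n); exists (closure W); split; first exact: closure_continuum.
- by apply: (@fsmall_center _ _ id d _ z) => y; exact: sW.
- move=> y zy; apply: subset_closure; apply: eW.
  have h1 := metric_triangle z (zn n) y.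
  by have h2 := lt_le_trans zy (invS_le hk kn); move: hn h2 h1 => /=; lra.
Qed.

Section Dyn.
Variables (f : homeo S S) (c : R).
Hypothesis Hc : cwF_const f c.
Let g := homeo_inv f.
Let c0 : 0 < c. Proof. by case: Hc. Qed.
Let Hg : cwF_const (hinv f) c. Proof. exact: cwF_const_inv. Qed.
Let cg : continuous g. Proof. exact: homeo_inv_continuous. Qed.
Let cf : continuous f. Proof. exact: homeo_fun_continuous. Qed.

Lemma iter_fgK n x : iter n f (iter n g x) = x.
Proof. by elim: n => // n IH; rewrite iterSr /= homeo_invK IH. Qed.

Lemma iter_gfK n x : iter n g (iter n f x) = x.
Proof. by elim: n => // n IH; rewrite iterSr /= /g homeo_funK. Qed.

Lemma iter_fgB i n x : (i <= n)%N -> iter i f (iter n g x) = iter (n - i) g x.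
Proof. by move=> ni; rewrite -{1}(subnKC ni) iterD iter_fgK. Qed.

Lemma iter_gfB i n x : (i <= n)%N -> iter i g (iter n f x) = iter (n - i) f x.
Proof. by move=> ni; rewrite -{1}(subnKC ni) iterD iter_gfK. Qed.

Section Repeller.
Variables (E : set S) (z : S) (r : R) (k : nat).
Hypotheses (k0 : (0 < k)%N) (r0 : 0 < r) (sE : stab (hinv f) E)
  (rE : forall y, mdist z y < r -> E y)
  (kE : forall y, E y -> mdist z (iter k g y) < r / 2).

Let h := iter k g.
Let B := [set y | mdist z y < r].
Let W := [set y | exists j, B (iter j h y)].

Let ch : continuous h. Proof. exact: iter_continuous. Qed.

Let iterh j y : iter j h y = iter (j * k) g y.
Proof. by elim: j => // j IH; rewrite /= IH /h -iterD mulSn. Qed.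

Let hB y : B y -> mdist z (h y) < r / 2.
Proof. by move=> By; apply: kE; exact: rE. Qed.

Let hBB y : B y -> B (h y).
Proof.
move=> /hB zh; apply: lt_trans zh _.
by rewrite ltr_pdivrMr// ltr_pMr// ltr1n.
Qed.

Let hBj i j y : (i <= j)%N -> B (iter i h y) -> B (iter j h y).
Proof.
move=> /subnK <- By; elim: (j - i)%N => [//|m IH].
by rewrite addSn /=; exact: hBB.
Qed.

Let W_open : open W.
Proof.
rewrite (_ : W = \bigcup_j (iter j h @^-1` B)).
  apply: bigcup_open => j _; apply: open_comp; last exact: open_mdist_lt.
  by move=> y _; exact: iter_continuous.
by apply/seteqP; split => y [j]; [exists j|exists j].
Qed.

Let compact_absorbed A : closed A -> A `<=` W ->
  exists j, forall y, A y -> B (iter j h y).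
Proof.
move=> cA AW; apply: contrapT => /forallNP H.
have H' j : exists y, A y /\ ~ B (iter j h y).
  by have /existsNP[y /not_implyP] := H j; exists y.
have [y hy] := choice H'.
have [|G [UG _ hG]] := @ultra_frequently (fun=> True).
  by move=> N; exists N.
have [w yw] := ulim_ex S_compact UG y.
have Aw : A w by apply: (ulim_closed_mem UG cA yw); apply: nearW => j; case: (hy j).
have [i Bi] := AW w Aw.
have nb : nbhs (iter i h w) B by apply: open_nbhs_nbhs; split => //; exact: open_mdist_lt.
have [j [ij Bij]] := near_ex2 UG (hG i) (yw _ (@iter_continuous _ h i ch w _ nb)).
by have [_] := hy j; apply; exact: hBj Bij.
Qed.

Let stab_sub A : continuum A -> A `<=` W -> stab (hinv f) A.
Proof.
move=> cA AW; split => // e e0.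
have [j hj] := compact_absorbed (compact_closedS cA.1) AW.
have [N hN] := sE.2 e e0.
exists (N + j * k)%N => n nN x y Ax Ay.
have nk : (j * k <= n)%N by apply: leq_trans nN; exact: leq_addl.
rewrite -(subnK nk) !iterD -/g -!iterh.
by apply: hN; [rewrite leq_subRL// addnC|apply/rE/hj..].
Qed.

(** The orbits of [q] and [y] approach each other to within [r / 2], and one further step of [h]
    brings the orbit of [y] within [r / 2] of [z]. *)
Let near_W y q A : stab (hinv f) A -> A y -> A q -> W y -> W q.
Proof.
move=> [_ sA] Ay Aq [j Bj].
have r20 : 0 < r / 2 by rewrite divr_gt0.
have [N hN] := sA (r / 2) r20.
set J := maxn j N.
have JN : (N <= J * k)%N by rewrite (leq_trans (leq_maxr j N))// leq_pmulr.
have BJ : B (iter J h y) by apply: hBj Bj; exact: leq_maxl.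
have h1 := hN _ (leq_trans JN (leq_addl k _)) y q Ay Aq.
rewrite !iterD -/g -!iterh -/h in h1; exists J.+1.
apply: (le_lt_trans (metric_triangle _ (h (iter J h y)) _)).
by rewrite [r]splitr; apply: ltr_leD h1; exact: hB.
Qed.

Hypothesis zisol : ~ open [set z].

(* The basin [W] of [z] is open. It is also closed: its small subcontinua are
   unstable, and their limits are unstable continua meeting [W]. Being compact
   and invariant, it is both contracted to [z] and preserved. *)
Lemma no_repeller : False.
Proof.
have hW y : W y -> W (iter k f y).
  move=> [j Bj]; exists j.+1; rewrite iterSr /h iter_gfK; exact: Bj.
have hWi i y : W y -> W (iter (i * k) f y).
  by move=> Wy; elim: i => // i IH; rewrite mulSn iterD; exact: hW.
have EW : B `<=` W by move=> y By; exists 0%N.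
have [d' d0 hd'] := stab_small_forward S_compact Hg (divr_gt0 c0 (ltr0n _ 2)).
have W_closed : closed W.
  move=> q cWq.
  have d20 : 0 < d' / 2 by rewrite divr_gt0.
  have [V [oV Vq cV sV]] := connected_nbhs q d20.
  have [y [Wy Vy]] := cWq V (open_nbhs_nbhs (conj oV Vq)).
  have oVW : open (V `&` W) by exact: openI.
  set J := connected_component (V `&` W) y.
  have oJ : open J by exact: component_open.
  have Jy : J y by apply: connected_component_refl.
  have JVW : J `<=` V `&` W by exact: connected_component_sub.
  (* Continua in [J] from [y] to points close to [q'] are stable for the inverse by [stab_sub], and
     small, so their orbits are uniformly bounded and their limit is stable. By [near_W] the limit
     carries membership in [W] from [y] to [q']. *)
  have key q' : V q' -> closure J q' -> W q'.
    move=> Vq' /closureP_mdist cJ.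
    have H (n : nat) : exists p : S * set S, [/\ J p.1, mdist q' p.1 < n.+1%:R^-1,
        continuum p.2, p.2 `<=` J & p.2 y /\ p.2 p.1].
      have [|y' Jy' qy'] := cJ n.+1%:R^-1; first by rewrite invr_gt0.
      have [A [cA AJ Ay Ay']] :=
        continuum_connected oJ (@component_connected _ _ _) Jy Jy'.
      by exists (y', A).
    have [p hp] := choice H.
    have [|G [UG _ hG]] := @ultra_frequently (fun=> True).
      by move=> N; exists N.
    have pq : (fun n => (p n).1) @ G --> q'.
      apply: cvg_mdist => e e0; have [k' hk] := ex_invS_lt e0.
      apply: (nearS1 (hG k')) => n kn; have [_ h1 _ _ _] := hp n.
      exact: lt_le_trans h1 (invS_le hk kn).
    set L := ulim G (fun n => (p n).2).
    have cL : continuum L by apply: ulim_continuum => //; apply: nearW => n; case: (hp n).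
    have sL m : fsmall (iter m g) c L.
      move=> u v Lu Lv.
      have cp : \forall n \near G, compact (p n).2.
        by apply: nearW => n; case: (hp n) => _ _ [].
      have [u' u'L uu] := ulim_sel UG Lu cp; have [v' v'L vv] := ulim_sel UG Lv cp.
      apply: (ulim_dist_le UG (cvg_homeo (@iter_continuous _ g m cg) uu)
        (cvg_homeo (@iter_continuous _ g m cg) vv)).
      apply: (nearS2 u'L v'L) => n h1 h2; have [_ _ cA AJ _] := hp n.
      have sA : stab (hinv f) (p n).2.
        by apply: stab_sub => // w /AJ /JVW[].
      have dA : small d' (p n).2.
        by apply: (@fsmall_center _ _ id d' _ q) => w /AJ /JVW[Vw _]; exact/sV/subset_closure.
      apply: le_trans (hd' _ sA dA m _ _ h1 h2) _.
      by rewrite ler_pdivrMr// ler_pMr// ler1n.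
    have Ly : L y.
      apply: (ulim_const UG).
      by apply: nearW => n; case: (hp n) => _ _ _ _ [].
    have Lq : L q'.
      by apply: (ulim_mem UG pq); apply: nearW => n; case: (hp n) => _ _ _ _ [].
    exact: near_W (bounded_stab S_compact Hg cL sL) Ly Lq Wy.
  suff VJ : V `<=` J by have [] := JVW _ (VJ q Vq).
  apply: (connected_open_split cV oJ (O2 := ~` closure J)).
  - by apply: closed_openC; exact: closed_closure.
  - move=> q' Vq'; have [cJ|nJ] := pselect (closure J q'); [left|by right].
    have VWq : (V `&` W) q' by split => //; exact: key.
    have oq := component_open S_lc q' oVW.
    have [w [Jw qw]] := cJ _ (open_nbhs_nbhs (conj oq (connected_component_refl VWq))).
    apply: connected_component_trans Jw _; exact: connected_component_sym.
  - by rewrite -subset0 => w [[_ Jw]]; apply; exact: subset_closure.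
  - by exists y.
(* One power of [h] sends the compact set [W] into the ball, and [iter k f] maps [W] into itself. So
   each point of [W] is the image of a point of [E] under arbitrarily high iterates of the inverse,
   which contract [E]: [W] is a single point. *)
have [j hj] := compact_absorbed W_closed (@subset_refl _ W).
have Wz : W z by apply: EW; rewrite /B /= mdistxx.
apply: zisol; rewrite (_ : [set z] = W)//; apply/seteqP; split => [_ ->//|w Ww].
apply: mdist_positivity; apply/eqP; rewrite eq_le mdist_ge0 andbT.
apply/ler_addgt0Pl => e e0; rewrite addr0.
have [N hN] := sE.2 e e0.
have wN y : y = iter (N * k) g (iter j h (iter ((N + j) * k) f y)).
  by rewrite iterh -iterD -mulnDl iter_gfK.
rewrite (wN z) (wN w); apply: hN; first by rewrite leq_pmulr.
  by apply/rE/hj/hWi.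
by apply/rE/hj/hWi.
Qed.

End Repeller.

(* Pull back small continua around [f^n x]. Either they grow infinitely often,
   and cut at the right time they converge to a stable continuum at [x], or they
   remain small, and a limit point of the orbit produces a repeller. *)
Lemma uniform_stable : exists2 e : R, 0 < e & forall x, exists C,
  [/\ stab f C, forall n, fsmall (iter n f) c C, C x &
     exists2 y, C y & e <= mdist x y].
Proof.
have c40 : 0 < c / 4 by rewrite divr_gt0.
have [d d0 hd] := two_ended S_compact Hc c40.
have [r r0 hr] := uniform_continuum_nbhs d0.
have [E hE] := choice hr.
exists (d / 2); first by rewrite divr_gt0.
move=> x.
(* [P n] says that the small continuum about [iter n f x], pulled back along the orbit, exceeds
   [c / 2] at some time up to [n]. *)
pose P n := exists2 i, (i <= n)%N & ~ fsmall (iter i g) (c / 2) (E (iter n f x)).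
have [HP|] := pselect (forall N, exists2 n, (N <= n)%N & P n); last first.
  move=> /existsNP[N /forall2NP HN]; exfalso.
  have sE n i : (N <= n)%N -> (i <= n)%N -> fsmall (iter i g) (c / 2) (E (iter n f x)).
    move=> Nn ni; have [//|nP] := HN n; apply: contrapT => h; apply: nP.
    by exists i.
  have [|G [UG _ hG]] := @ultra_frequently (fun=> True).
    by move=> M; exists M.
  have [z xz] := ulim_ex S_compact UG (fun n => iter n f x).
  set L := ulim G (fun n => E (iter n f x)).
  have cEE : \forall n \near G, continuum (E (iter n f x)).
    by apply: nearW => n; case: (hE (iter n f x)).
  have cL : continuum L by exact: ulim_continuum.
  have sL i : fsmall (iter i g) c L.
    move=> u v Lu Lv.
    have cp : \forall n \near G, compact (E (iter n f x)).
      by apply: (nearS1 cEE) => n [].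
    have [u' u'L uu] := ulim_sel UG Lu cp; have [v' v'L vv] := ulim_sel UG Lv cp.
    apply: (ulim_dist_le UG (cvg_homeo (@iter_continuous _ g i cg) uu)
        (cvg_homeo (@iter_continuous _ g i cg) vv)).
    apply: (nearS3 u'L v'L (hG (maxn N i))) => n h1 h2.
    rewrite geq_max => /andP[Nn ni].
    apply: le_trans (sE n i Nn ni _ _ h1 h2) _.
    by rewrite ler_pdivrMr// ler_pMr// ler1n.
  have stL : stab (hinv f) L := bounded_stab S_compact Hg cL sL.
  have r20 : 0 < r / 2 by rewrite divr_gt0.
  have r80 : 0 < r / 8 by rewrite divr_gt0.
  have rL y : mdist z y < r / 2 -> L y.
    move=> zy; apply: (ulim_const UG).
    apply: (nearS1 (near_dist_lt xz r20)) => n zn.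
    have [_ _] := hE (iter n f x); apply.
    have := metric_triangle (iter n f x) z y; rewrite (mdist_sym _ z).
    by move: zn zy => /=; lra.
  have [K hK] := stL.2 _ r80.
  (* Two visits to the [r / 8]-ball of [z] at times [n < m] that are more than [K] apart. Going back
     by [m - n] sends the later visit to the earlier one and contracts [L] to size [r / 8], so [L]
     lands within [r / 4] of [z], half of the radius [r / 2] given to [no_repeller]. *)
  have [n [_ zn]] := near_ex2 UG (hG 0%N) (near_dist_lt xz r80).
  have [m [nm zm]] := near_ex2 UG (hG (n + K.+1)%N) (near_dist_lt xz r80).
  have nm' : (n <= m)%N by apply: leq_trans nm; exact: leq_addr.
  have Kk : (K.+1 <= m - n)%N by rewrite leq_subRL.
  apply: (@no_repeller L z (r / 2) (m - n)) => //.
  - exact: leq_trans Kk.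
  - move=> y Ly.
    have Lm : L (iter m f x).
      by apply: rL; apply: lt_trans zm _; move: r0; lra.
    have h1 := hK _ (ltnW Kk) _ _ Lm Ly.
    rewrite -[hinv f]/(hinv f) /= -/g iter_gfB ?leq_subr// subKn// in h1.
    have h2 := metric_triangle z (iter n f x) (iter (m - n) g y).
    by move: h1 h2 zn => /=; move: r0; lra.
have H n : exists D, P n -> [/\ continuum D, D x,
    forall i, (i <= n)%N -> fsmall (iter i f) c D & ~ small d D].
  have [[i iN]|nP] := pselect (P n); last by exists set0.
  set xn := iter n f x.
  have [cE dE bE] := hE xn.
  have Exn : E xn xn by apply: bE; rewrite mdistxx.
  move=> /existsNP[u /existsNP[v /not_implyP[Eu /not_implyP[Ev /negP]]]].
  rewrite -ltNge => uv.
  have [w Ew hw] : exists2 w, E xn w & c / 4 < mdist (iter i g xn) (iter i g w).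
    apply: contrapT => /forall2NP h.
    have h' w : E xn w -> mdist (iter i g xn) (iter i g w) <= c / 4.
      by move=> Ew; have [//|/negP] := h w; rewrite -leNgt.
    have := h' u Eu; have := h' v Ev.
    have := metric_triangle (iter i g u) (iter i g xn) (iter i g v).
    rewrite (mdist_sym _ (iter i g xn)); move: uv; lra.
  (* The cut at distance [c / 4] keeps the piece below [c] at all backward times up to [n], while
     one of its points attains [c / 4]. *)
  set F := [set w | forall j, (j <= n)%N -> mdist (iter j g xn) (iter j g w) <= c / 4].
  have cF : closed F by exact: closed_orbit_close.
  have Fx : F xn by move=> j _; rewrite mdistxx ltW.
  have nEF : ~ (E xn `<=` F) by move=> /(_ w Ew i iN); rewrite leNgt hw.
  have [y Ky nFy] := boundary_bumping S_compact cE cF Exn Fx nEF.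
  set K := connected_component (E xn `&` F) xn in Ky.
  have [j [jn hj]] : exists j, (j <= n)%N /\ c / 4 <= mdist (iter j g xn) (iter j g y).
    apply: contrapT => /forallNP h; apply: nFy; apply: interior_orbit_close => //.
    by move=> j jn; rewrite ltNge; apply/negP => hj; exact: (h j).
  have cK : continuum K.
    by apply: component_continuum => //; apply: closedI => //; apply: compact_closedS; case: cE.
  have Kxn : K xn by exact: connected_component_refl.
  have D1 : continuum (iter n g @` K).
    by apply: continuous_continuum cK; exact: iter_continuous.
  have D2 i' : (i' <= n)%N -> fsmall (iter i' f) c (iter n g @` K).
    move=> ni _ _ [u' Ku <-] [v' Kv <-]; rewrite !iter_fgB//.
    have hF w' : K w' -> mdist (iter (n - i') g xn) (iter (n - i') g w') <= c / 4.
      by move=> /connected_component_sub[_]; apply; exact: leq_subr.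
    have := hF u' Ku; have := hF v' Kv.
    have := metric_triangle (iter (n - i') g u') (iter (n - i') g xn) (iter (n - i') g v').
    rewrite (mdist_sym _ (iter (n - i') g xn)); move: c0; lra.
  exists (iter n g @` K) => _; split => //.
    by exists xn => //; rewrite iter_gfK.
  (* The pulled back piece has size at least [c / 4] at the intermediate time [n - j] and is
     [d]-small at time [n], so [two_ended] forbids it to be [d]-small at time 0. *)
  move=> sD; apply: (hd _ n D1 D2 _ sD).
    exists (n - j)%N, (iter n g xn), (iter n g y); split.
    - exact: leq_subr.
    - by exists xn.
    - by exists y.
    - by rewrite !iter_fgB ?leq_subr// subKn.
  move=> _ _ [u' Ku <-] [v' Kv <-]; rewrite !iter_fgK; apply: dE.
    by case: (connected_component_sub Ku).
  by case: (connected_component_sub Kv).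
have [D hD] := choice H.
have [G [UG PG hG]] := ultra_frequently HP.
set L := ulim G D.
have hDG : \forall n \near G, [/\ continuum (D n), D n x,
    forall i, (i <= n)%N -> fsmall (iter i f) c (D n) & ~ small d (D n)].
  by apply: (nearS1 PG) => n; exact: hD.
have cDD : \forall n \near G, continuum (D n) by apply: (nearS1 hDG) => n [].
have cp : \forall n \near G, compact (D n) by apply: (nearS1 cDD) => n [].
have cL : continuum L by exact: ulim_continuum.
have Lx : L x.
  apply: (ulim_const UG).
  by apply: (nearS1 hDG) => n [].
have sL i : fsmall (iter i f) c L.
  move=> u v Lu Lv.
  have [u' u'L uu] := ulim_sel UG Lu cp; have [v' v'L vv] := ulim_sel UG Lv cp.
  apply: (ulim_dist_le UG (cvg_homeo (@iter_continuous _ f i cf) uu)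
        (cvg_homeo (@iter_continuous _ f i cf) vv)).
  have h3 : \forall n \near G, fsmall (iter i f) c (D n).
    by apply: (nearS2 hDG (hG i)) => n [_ _ + _]; apply.
  by apply: (nearS3 u'L v'L h3) => n h1 h2; apply.
exists L; split => //; first exact: bounded_stab sL.
apply: contrapT => /forall2NP h.
have h' y : L y -> mdist x y < d / 2.
  by move=> Ly; have [//|/negP] := h y; rewrite -ltNge.
have oO : open [set y | mdist x y < d / 2] by exact: open_mdist_lt.
have [n [LO hDn]] := near_ex2 UG (ulim_near S_compact UG oO h') hDG.
have [_ _ _] := hDn; apply.
by apply: (@fsmall_center _ _ id d _ x) => y /LO /= /ltW.
Qed.

End Dyn.
End Existence.

(** * The stable atlas and its leaves *)

Section HomeoImages.
Context {X : topologicalType} (h k : X -> X).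
Hypotheses (hk : cancel h k) (kh : cancel k h).
Hypotheses (ch : continuous h) (ck : continuous k).

Lemma image_preim (A : set X) : h @` A = k @^-1` A.
Proof.
apply/seteqP; split => [_ [x Ax <-]|y Ay]; first by rewrite /preimage /= hk.
by exists (k y).
Qed.

Lemma open_image (A : set X) : open A -> open (h @` A).
Proof. by move=> oA; rewrite image_preim; apply: open_comp => // x _; exact: ck. Qed.

Lemma closed_image (A : set X) : closed A -> closed (h @` A).
Proof. by move=> oA; rewrite image_preim; apply: preimage_closed => // x _; exact: ck. Qed.

Lemma closure_image (A : set X) : closure (h @` A) = h @` closure A.
Proof.
apply/seteqP; split.
  rewrite [X in _ `<=` X](closure_id _).1; last exact/closed_image/closed_closure.
  by apply: closureS; apply: image_subset; exact: subset_closure.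
move=> _ [x cx <-] V hV.
by have [y [Ay Vy]] := cx _ (ch hV); exists (h y); split => //; exists y.
Qed.

End HomeoImages.

Section Stable.
Context {R : realType} {S : metricType R}.
Implicit Types (x y z : S) (A B C D E K F O U V W Y : set S) (f : homeo S S).
Hypothesis S_compact : compact [set: S].

Lemma diam_ge0 A : 0 <= diam A.
Proof.
have [->|/set0P[x Ax]] := eqVneq A set0.
  by rewrite /diam setX0 image_set0 sup0.
by apply: le_trans (diam_ge_mdist S_compact Ax Ax); rewrite mdistxx.
Qed.

Lemma diam_to0 (h : nat -> S -> S) C :
  diam (h n @` C) @[n --> \oo] --> (0 : R) <->
  forall e : R, 0 < e -> exists N, forall n, (N <= n)%N -> fsmall (h n) e C.
Proof.
split=> [/cvgrPdist_le H e e0|H].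
  have [N _ hN] := H e e0; exists N => n Nn; apply/fsmall_image.
  apply/(diam_small S_compact _ (ltW e0)).
  by have := hN n Nn; rewrite sub0r normrN ger0_norm// diam_ge0.
apply/cvgrPdist_le => e e0; have [N hN] := H e e0.
exists N => // n Nn; rewrite /= sub0r normrN ger0_norm ?diam_ge0//.
by apply/(diam_small S_compact _ (ltW e0))/fsmall_image/hN.
Qed.

Lemma stable_continuumE f : stable_continuum f = stab f.
Proof.
apply/funext => C; apply/propext; rewrite /stable_continuum /stab.
by split=> -[cC sC]; split => //; apply/(diam_to0 (fun n => iter n f)).
Qed.

Lemma unstable_continuumE f : unstable_continuum f = stab (hinv f).
Proof.
apply/funext => C; apply/propext; rewrite /unstable_continuum /stab.
have E (n : nat) : hiter f (- n%:Z) = iter n (homeo_inv f).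
  by apply/funext => x; rewrite -hiter_inv.
split=> -[cC sC]; split => //.
  apply/(diam_to0 (fun n => iter n (homeo_inv f))); move: sC.
  by under eq_fun do rewrite E.
by under eq_fun do rewrite E; apply/(diam_to0 (fun n => iter n (homeo_inv f))).
Qed.

Section Basics.
Variables (f : homeo S S).

Lemma stab_sub A C : continuum A -> A `<=` C -> stab f C -> stab f A.
Proof.
move=> cA AC [_ sC]; split => // e /sC[N hN]; exists N => n Nn.
exact: fsmall_sub (hN n Nn).
Qed.

Lemma fsmallU (h : S -> S) (e : R) A B : A `&` B !=set0 -> fsmall h (e / 2) A ->
  fsmall h (e / 2) B -> fsmall h e (A `|` B).
Proof.
move=> [x [Ax Bx]] sA sB; apply: (fsmall_center (x := x)) => y [] ?;
  [exact: sA|exact: sB].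
Qed.

Lemma stabU A B : A `&` B !=set0 -> stab f A -> stab f B -> stab f (A `|` B).
Proof.
move=> AB [cA sA] [cB sB]; split; first exact: continuumU.
move=> e e0; have e20 : 0 < e / 2 by rewrite divr_gt0.
have [N hN] := sA _ e20; have [M hM] := sB _ e20.
exists (maxn N M) => n; rewrite geq_max => /andP[Nn Mn].
by apply: fsmallU => //; [exact: hN|exact: hM].
Qed.

Lemma hiter_image_continuum n C : continuum C -> continuum (hiter f n @` C).
Proof. by apply: continuous_continuum; exact: hiter_continuous. Qed.

Lemma stab_hiter n C : stab f C -> stab f (hiter f n @` C).
Proof.
move=> [cC sC]; split; first exact: hiter_image_continuum.
move=> e e0; have [N hN] := sC e e0; exists (N + `|n|)%N => m Nm.
move=> _ _ [x Cx <-] [y Cy <-].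
have E z : iter m f (hiter f n z) = iter `|(m%:Z + n)%R|%N f z.
  rewrite -[iter m f _]/(hiter f m _) -hiterD.
  by rewrite -[RHS]/(hiter f `|(m%:Z + n)%R|%N z) gez0_abs//; lia.
by rewrite !E; apply: hN => //; lia.
Qed.

Lemma stab_hiterE n C : stab f (hiter f n @` C) -> stab f C.
Proof.
move=> /(stab_hiter (- n)); rewrite image_comp.
rewrite (_ : _ \o _ = id) ?image_id//.
by apply/funext => x /=; rewrite hiterK.
Qed.

Local Notation Q := (continua_dec (stab f)).

Lemma dec_sub Y x : Q Y x `<=` Y.
Proof. by move=> y []. Qed.

Lemma dec_max Y x C : stab f C -> C `<=` Y -> C x -> C `<=` Q Y x.
Proof. by move=> sC CY Cx y Cy; split; [exact: CY|exists C]. Qed.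

Lemma dec_refl Y x : Y x -> Q Y x x.
Proof.
move=> Yx; apply: (@dec_max Y x [set x]) => //; last by move=> _ ->.
split; first by split; [exact: compact_set1|exact: connected1].
by move=> e e0; exists 0%N => n _ _ _ -> ->; rewrite mdistxx ltW.
Qed.

Lemma dec_sym Y x y : Q Y x y -> Q Y y x.
Proof. by move=> [_ [C [sC CY Cx Cy]]]; split; [exact: CY|exists C]. Qed.

Lemma dec_trans Y x y z : Q Y x y -> Q Y y z -> Q Y x z.
Proof.
move=> [_ [C [sC CY Cx Cy]]] [_ [D [sD DY Dy Dz]]]; split; first exact: DY.
exists (C `|` D); split; [|by rewrite subUset|by left|by right].
by apply: stabU => //; exists y.
Qed.

Lemma dec_eq Y x y : Q Y x y -> Q Y x = Q Y y.
Proof.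
move=> xy; apply/seteqP; split => z; apply: dec_trans => //.
exact: dec_sym.
Qed.

Lemma dec_disjoint Y x y : Q Y x = Q Y y \/ Q Y x `&` Q Y y = set0.
Proof.
have [[z [xz yz]]|] := pselect (Q Y x `&` Q Y y !=set0); last first.
  by move=> /nonemptyPn ->; right.
by left; rewrite (dec_eq xz) (dec_eq yz).
Qed.

(** This is the source of compatibility: both monotone restrictions to an intersection equal the
    decomposition of that intersection. *)
Lemma dec_restr Y Y' x : closed Y' -> Y' `<=` Y -> Y' x -> stab f (Q Y x) ->
  Q Y' x = connected_component (Q Y x `&` Y') x.
Proof.
move=> cY' YY Y'x sQ; apply/seteqP; split.
  move=> y [Y'y [C [sC CY Cx Cy]]]; exists C => //; split => //; last exact: sC.1.2.
  by move=> z Cz; split; [apply: (dec_max sC) => //; apply: subset_trans CY _|exact: CY].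
have cQ : closed (Q Y x `&` Y').
  by apply: closedI => //; apply: compact_closedS; exact: sQ.1.1.
apply: dec_max.
- apply: (stab_sub _ _ sQ); first exact: component_continuum.
  by move=> y /connected_component_sub[].
- by move=> y /connected_component_sub[].
- by apply: connected_component_refl; split => //; apply: dec_refl; exact: YY.
Qed.

Lemma dec_restr_stab Y Y' x : closed Y' -> Y' `<=` Y -> Y' x -> stab f (Q Y x) ->
  stab f (Q Y' x).
Proof.
move=> cY' YY Y'x sQ; rewrite (dec_restr cY' YY)//.
apply: (stab_sub _ _ sQ); last by move=> y /connected_component_sub[].
apply: component_continuum => //; apply: closedI => //.
by apply: compact_closedS; exact: sQ.1.1.
Qed.

Lemma near_within_mdist Y x (P : S -> Prop) :
  (\forall y \near within Y (nbhs x), P y) <->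
  exists2 e : R, 0 < e & forall y, mdist x y < e -> Y y -> P y.
Proof.
rewrite near_withinE; split=> [/nbhs_mdist_ex//|[e e0 h]].
by apply: (filterS _ (nbhs_mdist_lt x e0)) => y; exact: h.
Qed.

(** Upper semicontinuity reduces to stability of limits of plaques: a stable limit through [x] lies
    in the plaque of [x], and [ulim_near] brings nearby plaques into its neighbourhoods. *)
Lemma dec_decomposition Y : closed Y -> (forall x, Y x -> stab f (Q Y x)) ->
  (forall (G : set_system S) x, UltraFilter G -> G --> x -> Y x ->
     (\forall y \near G, Y y) -> stab f (ulim G (Q Y))) ->
  decomposition Y (Q Y).
Proof.
move=> cY sQ uQ; split=> [x Yx|x y _ _|x V Yx oV QV].
- by split; [exact: dec_refl|exact: dec_sub|case: (sQ x Yx)].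
- exact: dec_disjoint.
- apply/near_within_mdist; apply: contrapT => /forall2NP H.
  pose F := filter_from [set e : R | 0 < e]
    (fun e => [set y | [/\ mdist x y < e, Y y & ~ (Q Y y `<=` V)]]).
  have PF : ProperFilter F.
    apply: filter_from_proper; last first.
      move=> e e0; have [//|/existsNP[y /not_implyP[xy /not_implyP[Yy nV]]]] := H e.
      by exists y.
    apply: filter_from_filter; first by exists 1 => /=.
    move=> e1 e2 h1 h2; exists (Num.min e1 e2); first by rewrite /= lt_min h1.
    by move=> y /= []; rewrite lt_min => /andP[].
  have [G [UG FG]] := ultraFilterLemma PF.
  have Gx : G --> x.
    move=> W /nbhs_mdist_ex[e e0 eW]; apply: FG; exists e => // y [xy _ _].
    exact: eW.
  have GY : \forall y \near G, Y y by apply: FG; exists 1 => //= y [].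
  have GV : \forall y \near G, ~ (Q Y y `<=` V) by apply: FG; exists 1 => //= y [].
  have sL := uQ G x UG Gx Yx GY.
  have LV : ulim G (Q Y) `<=` V.
    apply: subset_trans QV; apply: dec_max => //.
      by apply: ulim_sub => //; apply: nearW => y; exact: dec_sub.
    apply: (ulim_mem UG (u := id) Gx); apply: (nearS1 GY) => y; exact: dec_refl.
  by have [y [h1 h2]] := near_ex2 UG (ulim_near S_compact UG oV LV) GV.
Qed.

Lemma dec_hiter n Y x : Q (hiter f n @` Y) (hiter f n x) = hiter f n @` Q Y x.
Proof.
have sub m Z z : hiter f m @` Q Z z `<=` Q (hiter f m @` Z) (hiter f m z).
  move=> _ [y [Zy [C [sC CZ Cz Cy]]] <-]; split; first by exists y.
  exists (hiter f m @` C); split; [exact: stab_hiter|exact: image_subset| |];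
    by [exists z|exists y].
apply/seteqP; split; last exact: sub.
move=> y Qy; have := sub (- n) _ _ (hiter f (- n) y) (imageP _ Qy).
rewrite hiterK image_comp (_ : _ \o _ = id) ?image_id; last first.
  by apply/funext => w /=; rewrite hiterK.
by move=> h; exists (hiter f (- n) y) => //; rewrite hiterVK.
Qed.

Lemma decomposition_hiter n Y : closed Y -> (forall x, Y x -> stab f (Q Y x)) ->
  decomposition Y (Q Y) ->
  decomposition (hiter f n @` Y) (Q (hiter f n @` Y)).
Proof.
move=> cY sQ [_ _ usc].
have ch m : continuous (hiter f m) by exact: hiter_continuous.
split=> [x [x' Yx <-]|x y _ _|_ V [x Yx <-] oV].
- split; [by apply: dec_refl; exists x'|exact: dec_sub|].
  by rewrite dec_hiter; apply: hiter_image_continuum; case: (sQ x' Yx).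
- exact: dec_disjoint.
- rewrite dec_hiter => QV; apply/near_within_mdist.
  have oV' : open (hiter f n @^-1` V) by apply: open_comp => // y _; exact: ch.
  have QV' : Q Y x `<=` hiter f n @^-1` V by move=> y Qy; apply: QV; exists y.
  have /near_within_mdist[e e0 he] := usc x _ Yx oV' QV'.
  have : nbhs (hiter f n x) (hiter f (- n) @^-1` [set y | mdist x y < e]).
    by apply: ch; rewrite hiterK; exact: nbhs_mdist_lt.
  move=> /nbhs_mdist_ex[d d0 hd]; exists d => // w' h [y Yy yw]; move: h; rewrite -yw => h {w' yw}.
  rewrite dec_hiter => _ [w Qw <-]; apply: (he y) => //.
  by have := hd _ h; rewrite /preimage /mkset hiterK.
Qed.

Definition plaque U x := mono_restr (Q (closure U)) U x.

Lemma plaque_sub_dec U x : plaque U x `<=` Q (closure U) x.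
Proof. by move=> y /connected_component_sub[]. Qed.

Lemma plaque_refl U x : U x -> plaque U x x.
Proof.
move=> Ux; apply: connected_component_refl; split => //.
by apply: dec_refl; exact: subset_closure.
Qed.

Lemma plaque_max U x C : stab f C -> C `<=` U -> C x -> C `<=` plaque U x.
Proof.
move=> sC CU Cx; apply: connected_component_max => //; last exact: sC.1.2.
move=> y Cy; split; last exact: CU.
by apply: dec_max Cy => //; apply: subset_trans CU _; exact: subset_closure.
Qed.

Local Notation A := (continua_atlas (stab f)).

Lemma adom_stab U x : adom A U -> closure U x -> stab f (Q (closure U) x).
Proof. by move=> [_ _]; apply. Qed.

(** The set [U] may be large, so limits of its plaques are not known to have bounded orbits. Upper
    semicontinuity on [closure V] instead forces such a limit into the plaque of [x] there, which is
    stable. *)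
Lemma adom_sub U V : adom A V -> open U -> U `<=` V -> adom A U.
Proof.
move=> AV oU UV; have [oV [_ _ usc] sV] := AV.
have cUV := closureS UV.
have sQ x : closure U x -> stab f (Q (closure U) x).
  move=> Ux; apply: (dec_restr_stab (closed_closure (A:=_)) cUV) => //.
  exact/sV/cUV.
split=> //; apply: dec_decomposition => //; first exact: closed_closure.
move=> G x UG Gx Ux GU.
have cL : continuum (ulim G (Q (closure U))).
  by apply: ulim_continuum => //; apply: (nearS1 GU) => y /sQ[].
apply: (stab_sub cL _ (sV x (cUV x Ux))).
move=> y Ly; apply: contrapT => nQ.
have cQ : closed (Q (closure V) x) by apply: compact_closedS; case: (sV x (cUV x Ux)) => -[].
have [e e0 he] : exists2 e : R, 0 < e & forall w, Q (closure V) x w -> e <= mdist y w.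
  have c1 : closed [set y].
    by apply: accessible_closed_set1; exact/hausdorff_accessible/metric_hausdorff.
  have [|e e0 he] := compact_disjoint_dist S_compact c1 cQ.
    by rewrite -subset0 => w [->].
  by exists e => // w; exact: he.
have e20 : 0 < e / 2 by rewrite divr_gt0.
have oO : open (~` [set w | mdist y w <= e / 2]) by apply: closed_openC; exact: mdist_closed_le.
have QO : Q (closure V) x `<=` ~` [set w | mdist y w <= e / 2].
  by move=> w Qw /= h; have := he w Qw; lra.
have /near_within_mdist[d d0 hd] := usc x _ (cUV x Ux) oO QO.
have nx : \forall w \near G, mdist x w < d by apply: Gx; exact: nbhs_mdist_lt.
have GG : \forall w \near G, closure U w /\ mdist x w < d.
  by apply: (nearS2 GU nx).
have [w [[Uw xw] [u Qu yu]]] := near_ex2 UG GG (Ly _ e20).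
have := hd w xw (cUV _ Uw) u; rewrite /setC /mkset => h.
apply: h; last exact: ltW.
case: Qu => Uu [C [sC CU Cw Cu]]; split; first exact: cUV.
by exists C; split => //; apply: subset_trans CU cUV.
Qed.

Lemma adom_hiter n U : adom A U -> adom A (hiter f n @` U) /\
  closure (hiter f n @` U) = hiter f n @` closure U.
Proof.
move=> [oU dU sU].
have cE : closure (hiter f n @` U) = hiter f n @` closure U.
  apply: closure_image (@hiterK _ f n) (@hiterVK _ f n) _ _ _;
    exact: hiter_continuous.
split => //; split.
- apply: open_image (@hiterK _ f n) (@hiterVK _ f n) _ _ oU.
  exact: hiter_continuous.
- by rewrite cE; apply: decomposition_hiter => //; exact: closed_closure.
- move=> y; rewrite cE => -[x Ux <-] /=; rewrite dec_hiter.
  by apply: stab_hiter; exact: sU.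
Qed.

Lemma stab_invariant : invariant_atlas f A.
Proof.
move=> n U AU; have [AfU cE] := adom_hiter n AU; split => // x Ux.
exact: dec_hiter.
Qed.

Variable c : R.
Hypothesis Hc : cwF_const f c.
Let c0 : 0 < c. Proof. by case: Hc. Qed.

(** In a small set every stable continuum through [x] follows the orbit of [x] to within [c / 2], so
    the union of these continua and its closure are [c]-bounded. The closure is then stable by
    [bounded_stab], and maximality identifies it with the union. *)
Lemma small_stab_ex : exists2 r : R, 0 < r & forall Y, closed Y -> small r Y ->
  forall x, Y x -> stab f (Q Y x) /\ forall n, fsmall (iter n f) c (Q Y x).
Proof.
have c20 : 0 < c / 2 by rewrite divr_gt0.
have [r r0 hr] := stab_small_forward S_compact Hc c20.
exists r => // Y cY sY x Yx.
have sQ n : fsmall (iter n f) c (Q Y x).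
  apply: (fsmall_center (x := x)) => y [_ [C [sC CY Cx Cy]]].
  by apply: (hr C sC) => //; exact: small_sub sY.
have cQ : connected (Q Y x).
  have -> : Q Y x = \bigcup_(C in [set C | [/\ stab f C, C `<=` Y & C x]]) C.
    apply/seteqP; split => [y [_ [C [sC CY Cx Cy]]]|y [C [sC CY Cx] Cy]].
      by exists C.
    exact: (dec_max sC).
  apply: bigcup_connected; first by exists x => C [].
  by move=> C [[[]]].
have sC : stab f (closure (Q Y x)).
  apply: (bounded_stab S_compact Hc); first exact: closure_continuum.
  move=> n; apply: fsmall_closure (sQ n); apply: iter_continuous.
  exact: homeo_fun_continuous.
suff QE : Q Y x = closure (Q Y x) by split => //; rewrite QE.
apply/seteqP; split; first exact: subset_closure.
apply: dec_max => //; last by apply: subset_closure; exact: dec_refl.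
by move=> y cy; apply: cY; apply: closureS cy; exact: dec_sub.
Qed.

Lemma small_adom (r : R) (hr : forall Y, closed Y -> small r Y ->
    forall x, Y x -> stab f (Q Y x) /\ forall n, fsmall (iter n f) c (Q Y x)) U :
  open U -> small r U -> adom A U.
Proof.
move=> oU sU; have cU : closed (closure U) by exact: closed_closure.
have sQ x Ux := hr _ cU (small_closure sU) x Ux.
split => //; last by move=> x /sQ[].
apply: dec_decomposition => // [x /sQ[]//|G x UG Gx Ux GU].
have cL : continuum (ulim G (Q (closure U))).
  by apply: ulim_continuum => //; apply: (nearS1 GU) => y /sQ[[]].
apply: (bounded_stab S_compact Hc cL) => n u v Lu Lv.
have cp : \forall y \near G, compact (Q (closure U) y).
  by apply: (nearS1 GU) => y /sQ[[[]]].
have cn : continuous (iter n f) by apply: iter_continuous; exact: homeo_fun_continuous.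
have [u' u'L uu] := ulim_sel UG Lu cp; have [v' v'L vv] := ulim_sel UG Lv cp.
apply: (ulim_dist_le UG (cvg_homeo cn uu) (cvg_homeo cn vv)).
by apply: (nearS3 u'L v'L GU) => y h1 h2 /sQ[_ h3]; exact: h3.
Qed.

Lemma ball_small x (r : R) : small r [set y | mdist x y < r / 2].
Proof. by apply: (@fsmall_center _ _ id r _ x) => y /ltW. Qed.

Lemma small_sub_adom x (V : set S) : nbhs x V -> exists U, [/\ adom A U, U x,
  closure U `<=` V & forall y, closure U y ->
   stab f (Q (closure U) y) /\ forall n, fsmall (iter n f) c (Q (closure U) y)].
Proof.
move=> /nbhs_mdist_ex[e e0 eV]; have [r r0 hr] := small_stab_ex.
set d := Num.min e r.
have d0 : 0 < d by rewrite lt_min e0 r0.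
have sU : small r [set y | mdist x y < d / 2].
  by apply: small_le (@ball_small x d); rewrite /d ge_min lexx orbT.
exists [set y | mdist x y < d / 2]; split.
- by apply: (small_adom hr) => //; exact: open_mdist_lt.
- by rewrite /= mdistxx divr_gt0.
- move=> y cy; apply: eV.
  have : mdist x y <= d / 2.
    apply: (@mdist_closed_le _ _ x (d / 2)).
    by apply: closureS cy => w /ltW.
  move=> h; apply: le_lt_trans h _; apply: lt_le_trans (_ : d <= e).
    by rewrite ltr_pdivrMr// ltr_pMr// ltr1n.
  by rewrite /d ge_min lexx.
- move=> y cy; apply: hr => //; first exact: closed_closure.
  exact: small_closure.
Qed.

Lemma adom_cover x : exists2 U, adom A U & U x.
Proof. by have [U [AU Ux _ _]] := small_sub_adom (@filterT _ (nbhs x) _); exists U. Qed.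

Lemma adom_basis : complete_basis (adom A).
Proof.
split; last by move=> U V AV oU UV; exact: adom_sub UV.
split; first by move=> U [].
move=> x V xV; have [U [AU Ux cUV _]] := small_sub_adom xV.
by exists U => //; apply: subset_trans cUV; exact: subset_closure.
Qed.

Lemma stab_is_atlas : is_atlas A.
Proof.
split.
- by move=> U [].
- by apply/seteqP; split => // x _; have [U AU Ux] := adom_cover x; exists U.
- by move=> U [].
- move=> U V AU AV x [Ux Vx]; rewrite /mono_restr /=.
  rewrite -!dec_restr//; try exact: adom_stab;
    try exact: subIsetl; try exact: subIsetr; apply: closedI; exact: closed_closure.
Qed.

Lemma stab_in_plaque C x : stab f C -> C x -> exists N : nat,
  forall m : nat, (N <= m)%N -> exists2 U, adom A U & C `<=` hiter f (- m%:Z) @` U /\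
    U = [set y | mdist (iter m f x) y < projT1 (cid2 small_stab_ex) / 2].
Proof.
move=> [cC sC] Cx; case: (cid2 small_stab_ex) => r r0 hr /=.
have [N hN] := sC (r / 4) (divr_gt0 r0 (ltr0n _ 4)).
exists N => m Nm; exists [set y | mdist (iter m f x) y < r / 2].
  apply: (small_adom hr); [exact: open_mdist_lt|exact: ball_small].
split => // y Cy; exists (iter m f y); last by rewrite -[iter m f y]/(hiter f m y) hiterK.
by rewrite /=; apply: le_lt_trans (hN m Nm x y Cx Cy) _; lra.
Qed.

(** The plaque of [x] in the preimage under the [m]-th iterate of a ball about [iter m f x], with
    half the constant of [small_stab_ex] as radius. A stable continuum through [x] ends up in these
    balls, so it lies in [leaf_plaque m x] for all large [m]. *)
Definition leaf_plaque (m : nat) x := plaque (hiter f (- m%:Z) @`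
  [set y | mdist (iter m f x) y < projT1 (cid2 small_stab_ex) / 2]) x.

Lemma leaf_plaque_open m x : open_plaque A (leaf_plaque m x).
Proof.
rewrite /leaf_plaque; case: (cid2 small_stab_ex) => r r0 hr /=.
exists (hiter f (- m%:Z) @` [set y | mdist (iter m f x) y < r / 2]), x.
split=> //.
  apply: (adom_hiter _ _).1; apply: (small_adom hr).
    exact: open_mdist_lt.
  exact: ball_small.
exists (iter m f x); last by rewrite -[iter m f x]/(hiter f m x) hiterK.
by rewrite /= mdistxx divr_gt0.
Qed.

Lemma stab_sub_leaf_plaque C x : stab f C -> C x -> exists N : nat,
  forall m : nat, (N <= m)%N -> C `<=` leaf_plaque m x.
Proof.
move=> sC Cx; have [N hN] := stab_in_plaque sC Cx; exists N => m Nm.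
have [U AU [CU UE]] := hN m Nm; rewrite /leaf_plaque -UE.
exact: plaque_max.
Qed.

Lemma open_plaque_stab P x y : open_plaque A P -> P x -> P y ->
  exists C, [/\ stab f C, P `<=` C, C x & C y].
Proof.
move=> [U [z [AU Uz ->]]] Px Py; exists (Q (closure U) z); split.
- by apply: adom_stab => //; exact: subset_closure.
- exact: plaque_sub_dec.
- exact: plaque_sub_dec.
- exact: plaque_sub_dec.
Qed.

Lemma leafE x : leaf A x = [set y | exists C, [/\ stab f C, C x & C y]].
Proof.
apply/seteqP; split => [y [n [P [oP P0 Pn PP]]]|y [C [sC Cx Cy]]].
- suff H i : (i <= n)%N -> forall w, P i w -> exists C, [/\ stab f C, C x & C w].
    exact: (H n).
  elim: i => [_ w P0w|i IH lin w Pw].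
    by have [C [sC _ Cx Cw]] := open_plaque_stab (oP 0%N isT) P0 P0w; exists C.
  have [v [Piv PSv]] := PP i lin.
  have [C [sC Cx Cv]] := IH (ltnW lin) v Piv.
  have [D [sD _ Dv Dw]] := open_plaque_stab (oP _ lin) PSv Pw.
  exists (C `|` D); split; [|by left|by right].
  by apply: stabU => //; exists v.
- have [N hN] := stab_sub_leaf_plaque sC Cx.
  have CP := hN N (leqnn _).
  exists 0%N, (fun=> leaf_plaque N x); split => //; last exact: CP.
    by move=> _ _; exact: leaf_plaque_open.
  exact: CP.
Qed.

Lemma leaf_bigcup x : leaf A x = \bigcup_m leaf_plaque m x.
Proof.
rewrite leafE; apply/seteqP; split => y.
  move=> [C [sC Cx Cy]]; have [N hN] := stab_sub_leaf_plaque sC Cx.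
  by exists N => //; exact: (hN N).
move=> [m _ my].
have mx : leaf_plaque m x x.
  have [U [z [AU Uz UE]]] := leaf_plaque_open m x.
  have : [set x] `<=` leaf_plaque m x.
    have sx : stab f [set x].
      split; first by split; [exact: compact_set1|exact: connected1].
      by move=> e e0; exists 0%N => n _ _ _ -> ->; rewrite mdistxx ltW.
    apply: plaque_max => // _ ->; exists (iter m f x).
      by rewrite /= mdistxx; case: (cid2 small_stab_ex) => r r0 _ /=; rewrite divr_gt0.
    by rewrite -[iter m f x]/(hiter f m x) hiterK.
  by apply.
have [C [sC _ Cx Cy]] := open_plaque_stab (leaf_plaque_open m x) mx my.
by exists C.
Qed.

End Basics.
End Stable.

(** * Locally connected subsets of a space *)

Section LocallyConnectedSubsets.
Context {X : topologicalType}.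
Implicit Types (C D V W O : set X).

(** Local connectedness of the subspace [C] in terms of subsets of [X]; [W] is a relative
    neighbourhood of [x] and need not be relatively open. *)
Definition lc_subset C := forall x V, C x -> nbhs x V ->
  exists W O, [/\ W `<=` C `&` V, connected W, W x, open O & O x /\ C `&` O `<=` W].

Lemma set_val_continuous C : continuous (set_val : set_type C -> X).
Proof. exact: initial_continuous. Qed.

Lemma set_type_nbhs C (a : set_type C) (N : set (set_type C)) : nbhs a N ->
  exists O, [/\ open O, O (set_val a) & set_val @^-1` O `<=` N].
Proof. by case=> _ [[ O oO <-] /= Oa ON]; exists O. Qed.

Lemma set_type_open C (N : set (set_type C)) : open N ->
  exists2 O, open O & N = set_val @^-1` O.
Proof. by case=> O oO <-; exists O. Qed.

Lemma open_set_type C O : open O -> open (set_val @^-1` O : set (set_type C)).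
Proof. by move=> oO; exists O. Qed.

Definition mkset_type C x (Cx : C x) : set_type C := exist _ x (mem_set Cx).

Lemma set_typeP C (a : set_type C) : C (set_val a).
Proof. by case: a => x /= h; exact: set_mem. Qed.

Lemma connected_set_type C D : D `<=` C -> connected D ->
  connected (set_val @^-1` D : set (set_type C)).
Proof.
move=> DC cD B [b Bb] [N1 oN1 B1] [N2 cN2 B2].
have [ O1 oO1 E1] := set_type_open oN1.
have [ O2 oO2 E2] : exists2 O, open O & ~` N2 = set_val @^-1` O.
  by apply: set_type_open; exact: closed_openC.
have {}E2 : N2 = set_val @^-1` (~` O2).
  by apply: setC_inj; rewrite E2 -preimage_setC setCK.
have DE : D `&` O1 = D `&` ~` O2.
  apply/seteqP; split => x [Dx Ox]; split => //.
    have : B (mkset_type (DC x Dx)) by rewrite B1; split => //; rewrite E1.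
    by rewrite B2 E2 => -[].
  have : B (mkset_type (DC x Dx)) by rewrite B2; split => //; rewrite E2.
  by rewrite B1 E1 => -[].
have DO : D `&` O1 = D.
  apply: cD.
  - by exists (set_val b); move: Bb; rewrite B1 E1 => -[].
  - by exists O1.
  - by exists (~` O2) => //; exact: open_closedC.
apply/seteqP; split => a; first by rewrite B1 => -[].
by move=> Da; rewrite B1; split => //; rewrite E1 /preimage /= -DO in Da *; case: Da.
Qed.

Lemma connected_set_val C (N : set (set_type C)) : connected N ->
  connected (set_val @` N).
Proof.
move=> cN; apply: connected_continuous_connected => //.
by apply: continuous_subspaceT; exact: set_val_continuous.
Qed.

Lemma lc_subsetP C : locally_connected (set_type C) -> lc_subset C.
Proof.
move=> lc x V Cx xV.
have [W [oW Wx WV cW]] := lc (mkset_type Cx) (set_val @^-1` V)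
  (@set_val_continuous C (mkset_type Cx) _ xV).
have [ O oO WE] := set_type_open oW.
exists (set_val @` W), O; split => //.
- move=> _ [a Wa <-]; split; [exact: set_typeP|exact: WV].
- exact: connected_set_val.
- by exists (mkset_type Cx).
- split; first by move: Wx; rewrite WE.
  move=> y [Cy Oy]; exists (mkset_type Cy) => //; by rewrite WE.
Qed.

Lemma lc_component_open C V x : lc_subset C -> open V ->
  exists2 O, open O & connected_component (C `&` V) x = C `&` O.
Proof.
move=> lc oV; set E := connected_component (C `&` V) x.
exists (\bigcup_(O in [set O | open O /\ C `&` O `<=` E]) O).
  by apply: bigcup_open => O [].
apply/seteqP; split => y; last by move=> [Cy [ O [_ OE] Oy]]; exact: OE.
move=> Ey; have [Cy Vy] := connected_component_sub Ey; split => //.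
have [W [ O [WCV cW Wy oO [Oy CO]]]] := lc y V Cy (open_nbhs_nbhs (conj oV Vy)).
exists O => //; split => // z /CO Wz.
by apply: connected_component_trans Ey _; exists W.
Qed.

Lemma lc_subset_component C V x : lc_subset C -> open V ->
  lc_subset (connected_component (C `&` V) x).
Proof.
move=> lc oV y V' Ey yV'; set E := connected_component (C `&` V) x in Ey *.
have [ O oO EO] := lc_component_open x lc oV; rewrite -/E in EO.
have [Cy Vy] := connected_component_sub Ey.
have Oy : O y by move: Ey; rewrite EO => -[].
have [W [ O' [WCV cW Wy oO' [Oy' CO]]]] :=
  lc y (V' `&` O) Cy (filterI yV' (open_nbhs_nbhs (conj oO Oy))).
exists W, O'; split => //.
- by move=> z /WCV[Cz [V'z Oz]]; split => //; rewrite EO.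
- split => // z [Ez O'z]; apply: CO; split => //.
  by have [] := connected_component_sub Ez.
Qed.

Lemma lc_set_type C : lc_subset C -> locally_connected (set_type C).
Proof.
move=> lc a N /set_type_nbhs[V [oV Va VN]].
have [ O oO EO] := lc_component_open (set_val a) lc oV.
set E := connected_component _ _ in EO.
have EC : E `<=` C by move=> y /connected_component_sub[].
have Ea : E (set_val a).
  by apply: connected_component_refl; split => //; exact: set_typeP.
exists (set_val @^-1` E); split => //.
- rewrite (_ : _ @^-1` E = set_val @^-1` O); first exact: open_set_type.
  apply/seteqP; split => b; rewrite /preimage /= EO => //.
    by case.
  by split => //; exact: set_typeP.
- by move=> b Eb; apply: VN; have [] := connected_component_sub Eb.
- apply: connected_set_type => //; exact: component_connected.
Qed.

End LocallyConnectedSubsets.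

Section CompactMore.
Context {R : realType} {S : metricType R}.
Implicit Types (x y z : S) (A B C D E K F J L O U V W Y Z : set S).
Hypothesis S_compact : compact [set: S].

Lemma closed_set1 x : closed [set x].
Proof. by apply: accessible_closed_set1; exact/hausdorff_accessible/metric_hausdorff. Qed.

Lemma continuum_chainable J y y' : connected J ->
  (forall w, J w -> exists K O, [/\ continuum K, K `<=` J, open O, O w &
     J `&` O `<=` K]) ->
  J y -> J y' -> exists A, [/\ continuum A, A `<=` J, A y & A y'].
Proof.
move=> cJ nb Jy Jy'.
pose T y' := exists A, [/\ continuum A, A `<=` J, A y & A y'].
have TK w K v : continuum K -> K `<=` J -> T w -> K w -> K v -> T v.
  move=> cK KJ [A [cA AJ Ay Aw]] Kw Kv; exists (A `|` K); split.
  - by apply: continuumU => //; exists w.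
  - by rewrite subUset.
  - by left.
  - by right.
pose P (b : bool) O := open O /\ exists w K, [/\ J w, (if b then T w else ~ T w) &
  [/\ continuum K, K `<=` J, J `&` O `<=` K & O w]].
have oP b : open (\bigcup_(O in P b) O) by apply: bigcup_open => O [].
have PT b v : J v -> (\bigcup_(O in P b) O) v -> if b then T v else ~ T v.
  move=> Jv [ O [oO [w [K [Jw hw [cK KJ OK Ow]]]]] Ov].
  have Kv := OK v (conj Jv Ov); have Kw := OK w (conj Jw Ow).
  case: b hw => hw; first exact: (TK w K v).
  by move=> Tv; apply: hw; exact: (TK v K w).
have cov b v : J v -> (if b then T v else ~ T v) -> (\bigcup_(O in P b) O) v.
  move=> Jv hv; have [K [ O [cK KJ oO Ov JO]]] := nb v Jv.
  by exists O => //; split => //; exists v, K.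
have Ty : T y.
  have [K [ O [cK KJ oO Ov JO]]] := nb y Jy.
  by exists K; split => //; exact: JO.
suff /(_ y' Jy')/(PT true _ Jy') : J `<=` \bigcup_(O in P true) O by [].
apply: (connected_open_split cJ (oP true) (oP false)).
- by move=> v Jv; have [Tv|nTv] := pselect (T v); [left; exact: cov|right; exact: cov].
- rewrite -subset0 => v [[Jv h1] h2].
  by have := PT false v Jv h2; apply; exact: (PT true v Jv h1).
- by exists y; split => //; exact: cov.
Qed.

Lemma lc_continuum_chainable L J O y y' : closed L -> lc_subset L -> open O ->
  J = L `&` O -> connected J -> J y -> J y' ->
  exists A, [/\ continuum A, A `<=` J, A y & A y'].
Proof.
move=> cL lcL oO JE cJ Jy Jy'; apply: continuum_chainable Jy Jy' => // w.
rewrite JE => -[Lw Ow].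
have [e e0 eO] := (open_setP _).1 oO w Ow.
have e20 : 0 < e / 2 by rewrite divr_gt0.
have [W [ O' [WL cW Ww oO' [Ow' LO]]]] := lcL w _ Lw (nbhs_mdist_lt w e20).
exists (closure W), O'; split => //.
- exact: closure_continuum.
- move=> v cv; split; first by apply: cL; apply: closureS cv => u /WL[].
  apply: eO; have : mdist w v <= e / 2.
    by apply: (@mdist_closed_le _ _ w (e / 2)); apply: closureS cv => u /WL[_] /ltW.
  by move=> h; apply: le_lt_trans h _; rewrite ltr_pdivrMr// ltr_pMr// ltr1n.
- by move=> v [[Lv _] O'v]; apply: subset_closure; exact: LO.
Qed.

(** Baire category inside [Z]: otherwise nested closed balls centred in [Z], the one of index
    [n + 1] missing [C n], have a common point in [Z]. *)
Lemma baire_cover Z (C : nat -> set S) : closed Z -> Z !=set0 ->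
  (forall n, closed (C n)) -> Z `<=` \bigcup_n C n ->
  exists n O, [/\ open O, (Z `&` O) !=set0 & Z `&` O `<=` C n].
Proof.
move=> cZ [z0 Zz0] cC ZC; apply: contrapT => H.
have step (q : nat * (S * R)) : exists p : S * R, Z q.2.1 -> 0 < q.2.2 ->
   [/\ Z p.1, 0 < p.2 & forall w, mdist p.1 w <= p.2 -> mdist q.2.1 w <= q.2.2 /\ ~ C q.1 w].
  case: q => n [y e] /=.
  have [Zy|] := pselect (Z y); last by move=> ?; exists (y, e).
  have [e0|] := pselect (0 < e); last by move=> ?; exists (y, e).
  have [y' [Zy' yy' nC]] : exists y', [/\ Z y', mdist y y' < e & ~ C n y'].
    apply: contrapT => /forallNP h; apply: H; exists n, [set w | mdist y w < e].
    split; [exact: open_mdist_lt|by exists y; split => //=; rewrite mdistxx|].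
    by move=> w [Zw yw]; apply: contrapT => nCw; apply: (h w).
  have [d1 d10 hd1] := (open_setP _).1 (closed_openC (cC n)) y' nC.
  exists (y', Num.min (d1 / 2) (e - mdist y y')) => _ _ /=; split => //.
    by rewrite lt_min divr_gt0//= subr_gt0.
  move=> w; rewrite le_min => /andP[w1 w2]; split.
    by have := metric_triangle y y' w; lra.
  by apply: hd1; apply: le_lt_trans w1 _; rewrite ltr_pdivrMr// ltr_pMr// ltr1n.
have [nx hnx] := choice step.
pose u := fix u n : S * R := if n is m.+1 then nx (m, u m) else (z0, 1).
have hu n : Z (u n).1 /\ 0 < (u n).2.
  elim: n => [|n [IH1 IH2]] /=; first by [].
  by have [] := hnx (n, u n) IH1 IH2.
have hs n w : mdist (u n.+1).1 w <= (u n.+1).2 ->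
    mdist (u n).1 w <= (u n).2 /\ ~ C n w.
  by have [h1 h2] := hu n; have [_ _] := hnx (n, u n) h1 h2; apply.
have hk k m w : mdist (u (m + k)%N).1 w <= (u (m + k)%N).2 ->
    mdist (u m).1 w <= (u m).2.
  elim: k => [|k IH]; first by rewrite addn0.
  by rewrite addnS => /hs[/IH].
have hmn m n : (m <= n)%N -> mdist (u m).1 (u n).1 <= (u m).2.
  move=> mn; apply: (hk (n - m)%N); rewrite subnKC// mdistxx.
  by apply: ltW; case: (hu n).
have [|G [UG _ hG]] := @ultra_frequently (fun=> True).
  by move=> N; exists N.
have [z uz] := ulim_ex S_compact UG (fun n => (u n).1).
have Zz : Z z by apply: (ulim_closed_mem UG cZ uz); apply: nearW => n; case: (hu n).
have [n _ Cnz] := ZC z Zz.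
have [_] : mdist (u n).1 z <= (u n).2 /\ ~ C n z; last by apply.
apply: hs; apply: (ulim_closed_mem UG (@mdist_closed_le _ _ (u n.+1).1 (u n.+1).2) uz).
by apply: (nearS1 (hG n.+1)) => m; exact: hmn.
Qed.

End CompactMore.

(** * Leaves are meagre and are not Peano continua *)

Section LeafProps.
Context {R : realType} {S : metricType R}.
Implicit Types (x y z : S) (A B C D E F J L O U V W Y Z : set S).
Hypothesis S_compact : compact [set: S].
Hypothesis S_lc : locally_connected S.
Hypothesis S_perfect : forall x : S, ~ open [set x].

Lemma uniform_stable_in (f : homeo S S) (c : R) (Hc : cwF_const f c) z F :
  closed F -> interior F z -> exists B, [/\ stab f B,
    forall n, fsmall (iter n f) c B, B z, B `<=` F & exists2 y, B y & y != z].
Proof.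
move=> cF Fz; have [e e0 he] := uniform_stable S_compact S_lc S_perfect Hc.
have [B [sB cB Bz [y By zy]]] := he z.
have [BF|nBF] := pselect (B `<=` F).
  exists B; split => //; exists y => //; apply/eqP => yz.
  by move: zy; rewrite yz mdistxx leNgt e0.
have [w Ew nFw] := boundary_bumping S_compact sB.1 cF Bz (interior_subset Fz) nBF.
exists (connected_component (B `&` F) z); split.
- apply: (stab_sub _ _ sB); last by move=> v /connected_component_sub[].
  apply: component_continuum => //; apply: closedI => //.
  by apply: compact_closedS; case: sB => -[].
- by move=> n; apply: fsmall_sub (cB n) => v /connected_component_sub[].
- by apply: connected_component_refl; split => //; exact: interior_subset.
- by move=> v /connected_component_sub[].
- by exists w => //; apply/eqP => wz; apply: nFw; rewrite wz.
Qed.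

Variables (f : homeo S S) (c : R).
Hypothesis Hc : cwF_const f c.
Let c0 : 0 < c. Proof. by case: Hc. Qed.
Let g := homeo_inv f.
Let Hg : cwF_const (hinv f) c. Proof. exact: cwF_const_inv. Qed.
Let cf : continuous f. Proof. exact: homeo_fun_continuous. Qed.

Lemma stab_bounded_image C : stab f C -> exists N : nat,
  forall n, fsmall (iter n f) c (hiter f N @` C).
Proof.
move=> [cC sC]; have [N hN] := sC c c0; exists N => n _ _ [x Cx <-] [y Cy <-].
by rewrite -[hiter f N]/(iter N f) -!iterD; apply: hN => //; exact: leq_addl.
Qed.

(** Some iterate of the continuum is [c]-bounded at all forward times; an unstable continuum inside
    that iterate meets it in a finite set and is therefore a point. *)
Lemma stab_interior C : stab f C -> interior C = set0.
Proof.
move=> sC; rewrite -subset0 => z Cz.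
have [N hN] := stab_bounded_image sC.
set C' := hiter f N @` C in hN.
have sC' : stab f C' by exact: stab_hiter.
have C'z : interior C' (hiter f N z).
  have oi : open (hiter f N @` interior C).
    apply: open_image (@hiterK _ f N) (@hiterVK _ f N) _ _ (open_interior C).
    exact: hiter_continuous.
  rewrite /interior; apply: (filterS _ (open_nbhs_nbhs (conj oi (imageP _ Cz)))).
  by apply: image_subset; exact: interior_subset.
have cC' : closed C' by apply: compact_closedS; case: sC' => -[].
have [B [sB cB Bz BC [y By yz]]] := uniform_stable_in Hg cC' C'z.
have fB : finite_set B.
  rewrite -(setIidr BC); case: Hc => _; apply => //; [exact: sC'.1|exact: sB.1].
by move/eqP: yz; apply; exact: finite_connected fB sB.1.2 _ _ By Bz.
Qed.

Local Notation A := (continua_atlas (stab f)).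

Lemma open_plaque_nowhere P x : open_plaque A P -> P x -> nowhere_dense P.
Proof.
move=> oP Px; have [C [sC PC _ _]] := open_plaque_stab oP Px Px.
rewrite /nowhere_dense -subset0 -(stab_interior sC); apply: interiorS.
rewrite [X in _ `<=` X](closure_id C).1; first exact: closureS.
by apply: compact_closedS; case: sC => -[].
Qed.

Lemma leaf_plaque_refl m x : leaf_plaque S_compact Hc m x x.
Proof.
apply: plaque_refl; exists (iter m f x); last by rewrite -[iter m f x]/(hiter f m x) hiterK.
by rewrite /= mdistxx; case: (cid2 _) => r r0 _ /=; rewrite divr_gt0.
Qed.

Lemma stab_cw_atlas : cw_atlas A.
Proof.
split.
- exact: (stab_is_atlas S_compact Hc).
- move=> x; exists (range (fun m => leaf_plaque S_compact Hc m x)).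
    split; first by apply: card_image_le.
    by move=> _ [m _ <-]; exact: leaf_plaque_open.
  rewrite (leaf_bigcup S_compact Hc); apply/seteqP; split => y.
    by move=> [m _ my]; exists (leaf_plaque S_compact Hc m x) => //; exists m.
  by move=> [_ [m _ <-] my]; exists m.
- move=> x; exists (fun m => leaf_plaque S_compact Hc m x).
    move=> m; apply: open_plaque_nowhere (leaf_plaque_refl m x).
    exact: leaf_plaque_open.
  exact: leaf_bigcup.
- have [e e0 he] := uniform_stable S_compact S_lc S_perfect Hc.
  exists e => // x; have [C [sC _ Cx [y Cy exy]]] := he x.
  apply: le_trans exy _; apply: diam_ge_mdist => //; rewrite (leafE S_compact Hc);
    by exists C.
Qed.

Lemma leaf_hiter n x : leaf A (hiter f n x) = hiter f n @` leaf A x.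
Proof.
rewrite !(leafE S_compact Hc); apply/seteqP; split => [y [C [sC Cx Cy]]|].
  exists (hiter f (- n) y); last by rewrite hiterVK.
  exists (hiter f (- n) @` C); split; first exact: stab_hiter.
    by exists (hiter f n x) => //; rewrite hiterK.
  by exists y.
move=> _ [y [C [sC Cx Cy]] <-]; exists (hiter f n @` C); split;
  [exact: stab_hiter|by exists x|by exists y].
Qed.

Lemma stab_leaf_not_stab x : ~ exists2 C, stab f C & leaf A x `<=` C.
Proof.
move=> [C [cC sC] LC].
have [e e0 he] := uniform_stable S_compact S_lc S_perfect Hc.
have e20 : 0 < e / 2 by rewrite divr_gt0.
have [N hN] := sC _ e20.
have [D [sD _ Dx [y Dy exy]]] := he (hiter f N x).
have Ly : leaf A (hiter f N x) y by rewrite (leafE S_compact Hc); exists D.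
have Lx : leaf A x x.
  by rewrite (leafE S_compact Hc); have [D' [sD' _ D'x _]] := he x; exists D'.
move: Ly; rewrite leaf_hiter => -[w Lw wy].
have := hN N (leqnn _) x w (LC _ Lx) (LC _ Lw).
by rewrite -[iter N f]/(hiter f N) wy; move: exy e0; lra.
Qed.

(* Being forward asymptotic to a given point is relatively open and closed in [K]. *)
Lemma loc_stab K : continuum K -> (forall y, K y -> exists O C,
  [/\ open O, O y, stab f C & K `&` O `<=` C]) -> stab f K.
Proof.
move=> cK loc.
have [->|/set0P[w Kw]] := eqVneq K set0.
  split; first by split; [exact: compact0|exact: connected0].
  by move=> e _; exists 0%N => n _ u v [].
pose asym y := forall e : R, 0 < e -> exists N, forall n, (N <= n)%N ->
  mdist (iter n f w) (iter n f y) <= e.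
have asymC y v C : stab f C -> C y -> C v -> asym y -> asym v.
  move=> [_ sC] Cy Cv ay e e0; have e20 : 0 < e / 2 by rewrite divr_gt0.
  have [N hN] := sC _ e20; have [M hM] := ay _ e20.
  exists (maxn N M) => n; rewrite geq_max => /andP[/hN h1 /hM h2].
  have := h1 y v Cy Cv; have := metric_triangle (iter n f w) (iter n f y) (iter n f v).
  by move: h2; lra.
have Kasym y : K y -> asym y.
  move=> Ky.
  pose P (b : bool) O := open O /\ exists v C, [/\ K v, (if b then asym v else ~ asym v) &
    [/\ stab f C, K `&` O `<=` C & O v]].
  have oP b : open (\bigcup_(O in P b) O) by apply: bigcup_open => O' [].
  have PT b v : K v -> (\bigcup_(O in P b) O) v -> if b then asym v else ~ asym v.
    move=> Kv [ O' [oO [v' [C [Kv' hv [sC OC Ov']]]]] Ov].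
    have Cv := OC v (conj Kv Ov); have Cv' := OC v' (conj Kv' Ov').
    case: b hv => hv; first exact: (asymC v' v C).
    by move=> av; apply: hv; exact: (asymC v v' C).
  have cov b v : K v -> (if b then asym v else ~ asym v) -> (\bigcup_(O in P b) O) v.
    move=> Kv hv; have [ O' [C [oO Ov sC OC]]] := loc v Kv.
    by exists O' => //; split => //; exists v, C.
  have aw : asym w by move=> e e0; exists 0%N => n _; rewrite mdistxx ltW.
  suff /(_ y Ky)/(PT true _ Ky) : K `<=` \bigcup_(O in P true) O by [].
  apply: (connected_open_split cK.2 (oP true) (oP false)).
  - by move=> v Kv; have [av|nav] := pselect (asym v); [left|right]; exact: cov.
  - rewrite -subset0 => v [[Kv h1] h2].
    by have := PT false v Kv h2; apply; exact: (PT true v Kv h1).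
  - by exists w; split => //; exact: cov.
(* From pointwise to uniform convergence: near a limit point [u] of bad points, [K] lies in one
   stable continuum, and [u] itself is asymptotic to [w]. *)
split => // e e0; apply: contrapT => /forallNP H.
have H' N : exists p : nat * S, [/\ (N <= p.1)%N, K p.2 &
   e / 2 < mdist (iter p.1 f w) (iter p.1 f p.2)].
  apply: contrapT => /forallNP h; apply: (H N) => n Nn.
  apply: (@fsmall_center _ _ (iter n f) e K w) => y Ky.
  by rewrite leNgt; apply/negP => wy; apply: (h (n, y)).
have [p hp] := choice H'.
have [|G [UG _ hG]] := @ultra_frequently (fun=> True).
  by move=> N; exists N.
have [u pu] := ulim_ex S_compact UG (fun n => (p n).2).
have Ku : K u.
  apply: (ulim_closed_mem UG _ pu); first by apply: compact_closedS; case: cK.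
  by apply: nearW => n; case: (hp n).
have [ O' [C [oO Ou [_ sC] OC]]] := loc u Ku.
have e40 : 0 < e / 4 by rewrite divr_gt0.
have [N hN] := sC _ e40; have [M hM] := Kasym u Ku _ e40.
have nO : \forall n \near G, O' (p n).2 by apply: pu; exact: open_nbhs_nbhs.
have [n [Opn]] := near_ex2 UG nO (hG (maxn N M)).
rewrite geq_max => /andP[Nn Mn].
have [np Kp hpn] := hp n.
have h1 := hN _ (leq_trans Nn np) u (p n).2 (OC _ (conj Ku Ou)) (OC _ (conj Kp Opn)).
have h2 := hM _ (leq_trans Mn np).
have := metric_triangle (iter (p n).1 f w) (iter (p n).1 f u) (iter (p n).1 f (p n).2).
by move: h1 h2 hpn; lra.
Qed.

(** It suffices that the leaf is stable near each of its points. Let [Z] be the closed set where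
    this fails; by Baire a relatively open part of [Z] lies in one stable continuum [C m]. A good
    point near that part is joined, by small stable continua inside the good set, to points
    arbitrarily close to [Z], so its late iterates stay close to those of [C m]. Hence a
    neighbourhood of [q] in the leaf is stable, although [q] is in [Z]. *)
Lemma leaf_not_peano x : ~ peano_continuum (leaf A x).
Proof.
set L := leaf A x; move=> [cL /lc_subsetP lcL].
have clL : closed L by apply: compact_closedS; case: cL.
suff sL : stab f L by apply: (@stab_leaf_not_stab x); exists L.
apply: loc_stab => // y Ly; apply: contrapT => ny.
pose good y := exists O C, [/\ open O, O y, stab f C & L `&` O `<=` C].
pose Z := L `&` [set y | ~ good y].
have og : open [set y | good y].
  rewrite openE => v [ O' [C [oO Ov sC OC]]]; rewrite /interior.
  by apply: (filterS _ (open_nbhs_nbhs (conj oO Ov))) => u Ou; exists O', C.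
have cZ : closed Z.
  apply: closedI => //; rewrite (_ : [set y | ~ good y] = ~` [set y | good y])//.
  exact: open_closedC.
have HC m : exists C, stab f C /\ leaf_plaque S_compact Hc m x `<=` C.
  have [C [sC PC _ _]] := open_plaque_stab (leaf_plaque_open S_compact Hc m x)
    (leaf_plaque_refl m x) (leaf_plaque_refl m x).
  by exists C.
have [C hC] := choice HC.
have [|||m [ O' [oO [q [[Lq nq] Oq]] ZO]]] := @baire_cover _ _ S_compact Z C cZ.
- by exists y.
- by move=> m; apply: compact_closedS; case: (hC m) => -[[]].
- move=> v [Lv _]; move: Lv; rewrite /L (leaf_bigcup S_compact Hc) => -[k _ kv].
  by exists k => //; have [_] := hC k; apply.
have c40 : 0 < c / 4 by rewrite divr_gt0.
have [r r0 hr] := stab_small_forward S_compact Hc c40.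
pose V := O' `&` [set v | mdist q v < r / 2].
have oV : open V by apply: openI => //; exact: open_mdist_lt.
have Vq : V q by split => //=; rewrite mdistxx divr_gt0.
set W := connected_component (L `&` V) q.
have [ O1 oO1 WE] := lc_component_open q lcL oV; rewrite -/W in WE.
have Wq : W q by exact: connected_component_refl.
have WLV : W `<=` L `&` V by exact: connected_component_sub.
have cW : connected W by exact: component_connected.
have [M hM] := (hC m).1.2 _ c40.
apply: (nq); exists O1, (closure W); split => //.
- by move: Wq; rewrite WE => -[].
- have sW n : (M <= n)%N -> fsmall (iter n f) c W.
    move=> Mn; apply: (@fsmall_center _ _ _ _ _ q) => w Ww.
    have [p [Wp Zp hwp]] : exists p, [/\ W p, Z p &
        mdist (iter n f w) (iter n f p) <= c / 4].
      have [gw|ngw] := pselect (good w); last first.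
        by exists w; split => //; [split => //; case: (WLV w Ww)|rewrite mdistxx ltW].
      set J := connected_component (L `&` (O1 `&` [set y | good y])) w.
      have oO2 : open (O1 `&` [set y | good y]) by exact: openI.
      have [ O2 oO2' JE] := lc_component_open w lcL oO2; rewrite -/J in JE.
      have Jw : J w.
        by apply: connected_component_refl; move: Ww; rewrite WE => -[].
      have JW : J `<=` W.
        by move=> v /connected_component_sub[Lv [ O1v _]]; rewrite WE.
      (* The component [J] of the good part of [W] omits [q], so in the connected set [W] it has a
         boundary point, which cannot be good. *)
      have [p [Wp cJp ngp]] : exists p, [/\ W p, closure J p & ~ good p].
        apply: contrapT => H.
        have WJ : W `<=` O2.
          apply: (connected_open_split cW oO2' (O2 := ~` closure J)).
          - by apply: closed_openC; exact: closed_closure.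
          - move=> v Wv; have [cJv|?] := pselect (closure J v); [left|by right].
            have gv : good v by apply: contrapT => ?; apply: H; exists v.
            have Lv : (L `&` (O1 `&` [set y | good y])) v.
              by move: Wv; rewrite {1}WE => -[? ?].
            have [ O3 oO3 KE] := lc_component_open v lcL oO2.
            have K3 : O3 v by have := connected_component_refl Lv; rewrite KE => -[].
            have [u [Ju O3u]] := cJv _ (open_nbhs_nbhs (conj oO3 K3)).
            have : connected_component (L `&` (O1 `&` [set y | good y])) v u.
              by rewrite KE; split => //; have [] := connected_component_sub Ju.
            move=> /connected_component_sym uv.
            have := connected_component_trans Ju uv; rewrite -/J JE => -[].
            by [].
          - rewrite -subset0 => v [[Wv O2v]]; apply; apply: subset_closure.
            by rewrite JE; split => //; case: (WLV v Wv).
          - by exists w; split => //; move: Jw; rewrite JE => -[].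
        have Jq : J q by rewrite JE; split => //; exact: WJ.
        have [_ [_ gq]] := connected_component_sub Jq; apply: nq; exact: gq.
      exists p; split => //; first by split => //; case: (WLV p Wp).
      apply/ler_addgt0Pl => e e0.
      have := @iter_continuous _ f n cf p _ (nbhs_mdist_lt (iter n f p) e0).
      move=> /cJp[p' [Jp' /= pp']].
      have [A' [cA AJ Aw Ap']] := lc_continuum_chainable S_compact clL lcL oO2' JE
        (@component_connected _ _ _) Jw Jp'.
      have sA : stab f A'.
        apply: loc_stab => // v Av.
        have [_ [_ [ O3 [C3 [oO3 O3v sC3 OC3]]]]] := connected_component_sub (AJ v Av).
        exists O3, C3; split => // u [Au O3u]; apply: OC3; split => //.
        by have [] := connected_component_sub (AJ u Au).
      have dA : small r A'.
        apply: (@fsmall_center _ _ id r _ q) => v /AJ/JW/WLV[_ [_ /=]].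
        exact: ltW.
      have h1 := hr _ sA dA n w p' Aw Ap'.
      have := metric_triangle (iter n f w) (iter n f p') (iter n f p).
      by rewrite (mdist_sym (iter n f p') (iter n f p)); move: h1 pp'; rewrite /mkset; lra.
    have Zq : Z q by [].
    have h2 := hM n Mn p q (ZO _ (conj Zp (WLV p Wp).2.1)) (ZO _ (conj Zq Oq)).
    have := metric_triangle (iter n f q) (iter n f p) (iter n f w).
    rewrite (mdist_sym (iter n f q) (iter n f p)) (mdist_sym (iter n f p) (iter n f w)).
    by move: h2 hwp; lra.
  apply: (@stab_hiterE _ _ f M); apply: (bounded_stab S_compact Hc).
    by apply: hiter_image_continuum; exact: closure_continuum.
  move=> n _ _ [u Wu <-] [v Wv <-].
  rewrite -[hiter f M]/(iter M f) -!iterD.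
  apply: (fsmall_closure (iter_continuous cf) (sW _ _)) => //; exact: leq_addl.
- by move=> v [Lv O1v]; apply: subset_closure; rewrite WE.
Qed.

End LeafProps.

(** * Crossing continua in the plane *)

Section GridLemma.

(** A label is a coordinate axis together with a sign; two labels are compatible unless they are the
    two signs of one axis. *)
Let adj (u v : bool * bool) := (u.1 == v.1) ==> (u.2 == v.2).

Let w (u v : bool * bool) : int :=
  if (u == (true, false)) && (v == (false, false)) then 1
  else if (u == (false, false)) && (v == (true, false)) then - 1 else 0.

(* Summing [w] around each triangle of the grid gives 0, since three pairwise
   compatible labels take at most two values; around the boundary of the grid
   it gives 1. *)
Lemma grid_labelling (m n : nat) (lab : nat -> nat -> bool * bool) :
  (forall i j, adj (lab i j) (lab i.+1 j)) ->
  (forall i j, adj (lab i j) (lab i j.+1)) ->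
  (forall i j, adj (lab i j) (lab i.+1 j.+1)) ->
  (forall j, lab 0%N j != (true, true)) -> (forall j, lab m j != (true, false)) ->
  (forall i, lab i 0%N != (false, true)) -> (forall i, lab i n != (false, false)) ->
  False.
Proof.
move=> aH aV aD bL bR bB bT.
pose H i j := w (lab i j) (lab i.+1 j); pose V i j := w (lab i j) (lab i j.+1).
have tri (a b c : bool * bool) : adj a b -> adj b c -> adj a c -> w a b + w b c = w a c.
  by case: a b c => [[] []] [[] []] [[] []].
have cell i j : H i j + V i.+1 j = V i j + H i j.+1.
  by rewrite /H /V (tri _ _ (lab i.+1 j.+1))// (tri _ _ (lab i.+1 j.+1)).
have rowE i : \sum_(j < n) V i.+1 j - \sum_(j < n) V i j = H i n - H i 0%N.
  have : forall k, \sum_(j < k) V i.+1 j - \sum_(j < k) V i j = H i k - H i 0%N.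
    elim=> [|k IH]; first by rewrite !big_ord0 !subrr.
    have hc : H i k.+1 = H i k + V i.+1 k - V i k by rewrite cell; ring.
    by rewrite !big_ord_recr /= opprD addrACA IH hc; ring.
  exact.
have colE k : \sum_(j < n) V k j - \sum_(j < n) V 0%N j =
    \sum_(i < k) H i n - \sum_(i < k) H i 0%N.
  elim: k => [|k IH]; first by rewrite !big_ord0 !subrr.
  have hr : \sum_(j < n) V k.+1 j = \sum_(j < n) V k j + (H k n - H k 0%N).
    by rewrite -rowE; ring.
  by rewrite hr addrAC IH !big_ord_recr /=; ring.
have VR : \sum_(j < n) V m j = 0.
  apply: big1 => j _; rewrite /V /w; have := bR j; have := bR j.+1.
  by case: (lab m j) (lab m j.+1) => [[] []] [[] []].
have HT : \sum_(i < m) H i n = 0.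
  apply: big1 => j _; rewrite /H /w; have := bT j; have := bT j.+1.
  by case: (lab j n) (lab j.+1 n) => [[] []] [[] []].
(* On the left side [(true, true)] does not occur and [(false, true)] is incompatible with
   [(false, false)]. So [(false, false)] is entered and left only through [(true, false)], and the
   sum telescopes. *)
have VL : forall k, \sum_(j < k) V 0%N j =
    (lab 0%N k == (false, false))%:Z - (lab 0%N 0%N == (false, false))%:Z.
  elim=> [|k IH]; first by rewrite big_ord0 subrr.
  rewrite big_ord_recr /= IH /V /w; have := aV 0%N k; have := bL k; have := bL k.+1.
  by case: (lab 0%N k) (lab 0%N k.+1) (lab 0%N 0%N) => [[] []] [[] []] [[] []].
(* Similarly, the bottom labels leave [(true, false)] only towards [(false, false)]. *)
have HB : forall k, \sum_(i < k) H i 0%N =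
    (lab k 0%N != (true, false))%:Z - (lab 0%N 0%N != (true, false))%:Z.
  elim=> [|k IH]; first by rewrite big_ord0 subrr.
  rewrite big_ord_recr /= IH /H /w; have := aH k 0%N; have := bB k; have := bB k.+1.
  by case: (lab k 0%N) (lab k.+1 0%N) (lab 0%N 0%N) => [[] []] [[] []] [[] []].
have := colE m; rewrite VR HT VL HB; move: (bT 0%N) (bR 0%N) (bL 0%N) (bB 0%N).
by case: (lab 0%N 0%N) (lab 0%N n) (lab m 0%N) => [[] []] [[] []] [[] []].
Qed.

End GridLemma.

Section PlaneMetric.
Variable R : realType.

(** The maximum metric, because its balls are the ones that the product structure on [R * R] already
    has. *)
Definition plane_dist (p q : R * R) : R := Num.max `|p.1 - q.1| `|p.2 - q.2|.

Let plane_ge0 p q : 0 <= plane_dist p q.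
Proof. by rewrite le_max normr_ge0. Qed.

Let plane_pos p q : plane_dist p q = 0 -> p = q.
Proof.
move=> /eqP; rewrite eq_le ge_max !normr_le0 !subr_eq0.
by case: p q => [a b] [c d] /= /andP[/andP[/eqP -> /eqP ->]].
Qed.

Let plane_ball (p : R * R) d : ball p d = [set q | plane_dist p q < d].
Proof.
apply/seteqP; split => q.
  by move=> [h1 h2]; rewrite /= /plane_dist gt_max; apply/andP.
by rewrite /= /plane_dist gt_max => /andP[h1 h2].
Qed.

HB.instance Definition _ :=
  PseudoMetric_isMetric.Build R (R * R)%type plane_ge0 plane_pos plane_ball.

Lemma plane_distE (p q : R * R) : mdist p q = Num.max `|p.1 - q.1| `|p.2 - q.2|.
Proof. by []. Qed.

Lemma plane_dist1 (p q : R * R) : `|p.1 - q.1| <= mdist p q.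
Proof. by rewrite plane_distE le_max lexx. Qed.

Lemma plane_dist2 (p q : R * R) : `|p.2 - q.2| <= mdist p q.
Proof. by rewrite plane_distE le_max lexx orbT. Qed.

Lemma plane_dist_lt (p q : R * R) (e : R) :
  (mdist p q < e) = (`|p.1 - q.1| < e) && (`|p.2 - q.2| < e).
Proof. by rewrite plane_distE gt_max. Qed.

End PlaneMetric.

Section CompactSets.
Context {R : realType} {S : metricType R}.
Implicit Types (A B : set S).

Lemma ulim_in (I : Type) (G : set_system I) (UG : UltraFilter G) (u : I -> S) A :
  compact A -> (\forall i \near G, A (u i)) -> exists2 x, A x & u @ G --> x.
Proof.
rewrite compact_ultra => cA uA.
by have [x [Ax ux]] := cA _ (ultra_fmap u UG) uA; exists x.
Qed.

Lemma compact_dist A B : compact A -> compact B -> A `&` B = set0 ->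
  exists2 e : R, 0 < e & forall x y, A x -> B y -> e <= mdist x y.
Proof.
move=> cA cB AB; apply: contrapT => /forall2NP h.
have h' (n : nat) : exists p : S * S,
    [/\ A p.1, B p.2 & mdist p.1 p.2 < n.+1%:R^-1].
  apply: contrapT => /forallNP h'; have [] := h n.+1%:R^-1.
    by apply; rewrite invr_gt0.
  apply => x y Ax By; rewrite leNgt; apply/negP => xy.
  by apply: (h' (x, y)).
have [p hp] := choice h'.
have [|G [UG _ hG]] := @ultra_frequently (fun=> True).
  by move=> N; exists N.
have [|x Ax px] := ulim_in UG cA (u := fun n => (p n).1).
  by apply: nearW => n; case: (hp n).
have [|y By py] := ulim_in UG cB (u := fun n => (p n).2).
  by apply: nearW => n; case: (hp n).
suff xy : x = y by have : set0 x by rewrite -AB; split => //; rewrite xy.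
apply: mdist_positivity; apply/eqP; rewrite eq_le mdist_ge0 andbT.
apply/ler_addgt0Pl => e e0; rewrite addr0; have [k hk] := ex_invS_lt e0.
apply: (ulim_dist_le UG px py); apply: (nearS1 (hG k)) => n kn.
have [_ _ /ltW h1] := hp n; exact: le_trans h1 (invS_le hk kn).
Qed.

(** The sequence is constant from [n] on, so that the labels in [crossing] can be defined at all
    pairs of naturals. *)
Lemma chain_seq (e : R) A x y : 0 < e -> connected A -> A x -> A y ->
  exists n (u : nat -> S), [/\ u 0%N = x, u n = y, forall i, A (u i) &
    forall i, mdist (u i) (u i.+1) < e].
Proof.
move=> e0 cA Ax Ay.
have := well_chained_chain (connected_well_chained e0 cA) Ax Ay.
move=> C; elim: C {Ay} => [_|{}y z _ [n [u [u0 un Au hu]]] Az yz].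
  by exists 0%N, (fun=> x); split => // i; rewrite mdistxx.
exists n.+1, (fun i => if (i <= n)%N then u i else z); split => //.
- by rewrite ltnn.
- by move=> i; case: ifP.
- move=> i; case: (ltngtP i n) => [lin|nli|->] //.
  + by rewrite mdistxx.
  + by rewrite un.
Qed.

End CompactSets.

Section Crossing.
Context {R : realType}.
Implicit Types (a b c d p q x y z : (R * R)%type) (A B T : set (R * R)%type).

(** Otherwise the continua are at some distance [e]. Take [e]-chains [u] in [A] and [v] in [B], and
    label [(i, j)] by a coordinate of [u i - v j] of modulus at least [e], with a sign. Differences
    at neighbouring pairs vary by less than [2 * e], so no sign flips, and the position of the end
    points excludes one label on each side of the grid. *)
Lemma crossing A B a0 a1 b0 b1 : continuum A -> continuum B ->
  A a0 -> A a1 -> B b0 -> B b1 ->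
  (forall b, B b -> a0.1 <= b.1 <= a1.1) ->
  (forall a, A a -> b0.2 <= a.2 <= b1.2) -> A `&` B !=set0.
Proof.
move=> [kA cA] [kB cB] Aa0 Aa1 Bb0 Bb1 hB hA; apply: contrapT => /nonemptyPn AB.
have [e e0 he] := compact_dist kA kB AB.
have [m [u [u0 um Au hu]]] := chain_seq e0 cA Aa0 Aa1.
have [n [v [v0 vn Bv hv]]] := chain_seq e0 cB Bb0 Bb1.
pose F1 i j := (u i).1 - (v j).1; pose F2 i j := (u i).2 - (v j).2.
have F12 i j : ~~ (e <= `|F1 i j|) -> e <= `|F2 i j|.
  have := he _ _ (Au i) (Bv j); rewrite plane_distE le_max => /orP[->//|].
  by [].
have u1 i : `|(u i).1 - (u i.+1).1| < e := le_lt_trans (plane_dist1 _ _) (hu i).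
have u2 i : `|(u i).2 - (u i.+1).2| < e := le_lt_trans (plane_dist2 _ _) (hu i).
have v1 i : `|(v i).1 - (v i.+1).1| < e := le_lt_trans (plane_dist1 _ _) (hv i).
have v2 i : `|(v i).2 - (v i.+1).2| < e := le_lt_trans (plane_dist2 _ _) (hv i).
pose lab i j := if e <= `|F1 i j| then (true, 0 < F1 i j) else (false, F2 i j < 0).
have sgn (s t : R) : e <= `|s| -> e <= `|t| -> `|s - t| < e + e -> (0 < s) = (0 < t).
  rewrite !ler_normr ltr_norml => /orP[]h1 /orP[]h2 /andP[h3 h4];
    apply/idP/idP => h5; lra.
have sgn' (s t : R) : e <= `|s| -> e <= `|t| -> `|s - t| < e + e -> (s < 0) = (t < 0).
  rewrite !ler_normr ltr_norml => /orP[]h1 /orP[]h2 /andP[h3 h4];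
    apply/idP/idP => h5; lra.
have close i j i' j' : `|F1 i j - F1 i' j'| < e + e -> `|F2 i j - F2 i' j'| < e + e ->
    ((lab i j).1 == (lab i' j').1) ==> ((lab i j).2 == (lab i' j').2).
  rewrite /lab => c1 c2; case: ifPn => h1; case: ifPn => h2 //=.
    by rewrite (sgn _ _ h1 h2 c1).
  by rewrite (sgn' _ _ (F12 _ _ h1) (F12 _ _ h2) c2).
apply: (@grid_labelling m n lab).
- move=> i j; apply: close; rewrite /F1 /F2.
    by move: (u1 i); rewrite !ltr_norml => /andP[]; lra.
  by move: (u2 i); rewrite !ltr_norml => /andP[]; lra.
- move=> i j; apply: close; rewrite /F1 /F2.
    by move: (v1 j); rewrite !ltr_norml => /andP[]; lra.
  by move: (v2 j); rewrite !ltr_norml => /andP[]; lra.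
- move=> i j; apply: close; rewrite /F1 /F2.
    by move: (u1 i) (v1 j); rewrite !ltr_norml => /andP[? ?] /andP[? ?]; lra.
  by move: (u2 i) (v2 j); rewrite !ltr_norml => /andP[? ?] /andP[? ?]; lra.
- move=> j; rewrite /lab /F1 u0; case: ifP => // _.
  have /andP[h _] := hB _ (Bv j).
  by apply/eqP => -[]; rewrite subr_gt0 ltNge h.
- move=> j; rewrite /lab /F1 um; case: ifPn => // h1.
  have /andP[_ h] := hB _ (Bv j).
  apply/eqP => -[h2]; move: h1; rewrite leNgt ger0_norm ?subr_ge0//.
  by move/negP; apply; apply: le_lt_trans e0; rewrite leNgt h2.
- move=> i; rewrite /lab /F2 v0; case: ifP => // _.
  have /andP[h _] := hA _ (Au i).
  by apply/eqP => -[]; rewrite subr_lt0 ltNge h.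
- move=> i; rewrite /lab; case: ifPn => // h1.
  have /andP[_ h] := hA _ (Au i).
  apply/eqP => -[h2]; have := F12 _ _ h1; rewrite /F2 vn ler0_norm ?subr_le0// => h3.
  by move: h2; rewrite /F2 vn => /negbT; rewrite -leNgt; move: h3 e0; lra.
Qed.

Lemma square_labelling (lab : R * R -> bool * bool) (e : R) : 0 < e ->
  (forall p q, 0 <= p.1 <= 1 -> 0 <= p.2 <= 1 -> 0 <= q.1 <= 1 -> 0 <= q.2 <= 1 ->
     mdist p q < e -> ((lab p).1 == (lab q).1) ==> ((lab p).2 == (lab q).2)) ->
  (forall t, 0 <= t <= 1 -> lab (0, t) != (true, true)) ->
  (forall t, 0 <= t <= 1 -> lab (1, t) != (true, false)) ->
  (forall t, 0 <= t <= 1 -> lab (t, 0) != (false, true)) ->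
  (forall t, 0 <= t <= 1 -> lab (t, 1) != (false, false)) -> False.
Proof.
move=> e0 ha hL hR hB hT.
have [N hN] := ex_invS_lt e0.
(* [minn] repeats the last grid point, since [grid_labelling] takes labels at all indices. *)
pose g (i : nat) : R := (minn i N.+1)%:R / N.+1%:R.
have g01 i : 0 <= g i <= 1.
  rewrite /g divr_ge0//= ler_pdivrMr// mul1r ler_nat; exact: geq_minr.
have gS i : `|g i - g i.+1| < e.
  apply: le_lt_trans hN; rewrite /g -mulrBl normrM (ger0_norm (_ : 0 <= N.+1%:R^-1))//.
  rewrite ler_piMl// distrC -natrB; last by lia.
  by rewrite ger0_norm// (_ : 1 = 1%:R)// ler_nat; lia.
have g0 : g 0%N = 0 by rewrite /g min0n mul0r.
have gN : g N.+1 = 1 by rewrite /g minnn divff// pnatr_eq0.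
have gd i : `|g i - g i| < e by rewrite subrr normr0.
apply: (@grid_labelling N.+1 N.+1 (fun i j => lab (g i, g j))).
- by move=> i j; apply: ha => //=; rewrite plane_dist_lt /= gS gd.
- by move=> i j; apply: ha => //=; rewrite plane_dist_lt /= gS gd.
- by move=> i j; apply: ha => //=; rewrite plane_dist_lt /= !gS.
- by move=> j; rewrite g0; exact: hL.
- by move=> j; rewrite gN; exact: hR.
- by move=> j; rewrite g0; exact: hB.
- by move=> j; rewrite gN; exact: hT.
Qed.

End Crossing.

(** * Chords and tripods in the unit disc *)

Section Circle.
Context {R : realType}.
Implicit Types (a b c d p q x y z : (R * R)%type) (A B T : set (R * R)%type).

Definition normsq p : R := p.1 ^+ 2 + p.2 ^+ 2.
Definition unit_disc : set (R * R) := [set p | normsq p <= 1].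
(** Twice the signed area of the triangle [p], [q], [x]. *)
Definition turn p q x : R :=
  (q.1 - p.1) * (x.2 - p.2) - (q.2 - p.2) * (x.1 - p.1).

Lemma turn_swap p q x : turn p x q = - turn p q x.
Proof. by rewrite /turn; ring. Qed.

Lemma continuous_continuum2 (X Y : topologicalType) (h : X -> Y) C :
  continuous h -> continuum C -> continuum (h @` C).
Proof.
move=> ch [cC conC]; split.
  by apply: continuous_compact => //; exact: continuous_subspaceT.
by apply: connected_continuous_connected => //; exact: continuous_subspaceT.
Qed.

Lemma normsq_comb p q (t : R) : normsq p = 1 -> normsq q = 1 ->
  normsq (p.1 + t * (q.1 - p.1), p.2 + t * (q.2 - p.2)) =
  1 - t * (1 - t) * ((q.1 - p.1) ^+ 2 + (q.2 - p.2) ^+ 2).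
Proof.
rewrite /normsq /= => h1 h2.
transitivity ((1 - t) * (p.1 ^+ 2 + p.2 ^+ 2) + t * (q.1 ^+ 2 + q.2 ^+ 2) -
  t * (1 - t) * ((q.1 - p.1) ^+ 2 + (q.2 - p.2) ^+ 2)); first by ring.
by rewrite h1 h2; ring.
Qed.

Lemma coord_continuous (f : R * R -> R) : continuous f ->
  forall A, compact A -> exists2 L : R, 0 < L & forall x, A x -> `|f x| <= L.
Proof.
move=> cf A cA.
have : compact (f @` A) by apply: continuous_compact => //; exact: continuous_subspaceT.
move=> /compact_bounded[M [_ hM]]; exists (`|M| + 1).
  by rewrite ltr_pwDr.
move=> x Ax; apply: (hM (`|M| + 1)); last by exists x.
by rewrite ltr_pwDr// ler_norm.
Qed.

Lemma affine_continuous (k1 k2 k3 : R) :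
  continuous (fun p : R * R => k1 * p.1 + k2 * p.2 + k3).
Proof.
move=> p; apply: cvgD; last exact: cvg_cst.
by apply: cvgD; (apply: cvgM; [exact: cvg_cst|]); [exact: cvg_fst|exact: cvg_snd].
Qed.

Lemma pair_continuous (T : topologicalType) (f g : T -> R) : continuous f ->
  continuous g -> continuous (fun t => (f t, g t)).
Proof.
move=> cf cg t; apply: cvg_mdist => e e0.
have h1 : \forall s \near t, `|f t - f s| < e := cf t _ (nbhsx_ballx (f t) e e0).
have h2 : \forall s \near t, `|g t - g s| < e := cg t _ (nbhsx_ballx (g t) e e0).
apply: (nearS2 h1 h2) => s b1 b2.
by rewrite plane_dist_lt; apply/andP.
Qed.

Lemma hsegment_continuum (s t k : R) : continuum [set p : R * R | s <= p.1 <= t /\ p.2 = k].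
Proof.
have -> : [set p : R * R | s <= p.1 <= t /\ p.2 = k] = (fun u => (u, k)) @` `[s, t].
  apply/seteqP; split => [[u v] /= [h ->]|_ [u h <-]] /=.
    by exists u => //; rewrite /= in_itv.
  by move: h; rewrite /= in_itv.
have cf : continuous (fun u : R => (u, k)).
  by apply: pair_continuous => u; [exact: cvg_id|exact: cvg_cst].
split.
  by apply: continuous_compact; [exact: continuous_subspaceT|exact: segment_compact].
apply: connected_continuous_connected; first exact: segment_connected.
exact: continuous_subspaceT.
Qed.

Lemma vsegment_continuum (s t k : R) : continuum [set p : R * R | s <= p.2 <= t /\ p.1 = k].
Proof.
have -> : [set p : R * R | s <= p.2 <= t /\ p.1 = k] = (fun u => (k, u)) @` `[s, t].
  apply/seteqP; split => [[u v] /= [h ->]|_ [u h <-]] /=.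
    by exists v => //; rewrite /= in_itv.
  by move: h; rewrite /= in_itv.
have cf : continuous (fun u : R => (k, u)).
  by apply: pair_continuous => u; [exact: cvg_cst|exact: cvg_id].
split.
  by apply: continuous_compact; [exact: continuous_subspaceT|exact: segment_compact].
apply: connected_continuous_connected; first exact: segment_connected.
exact: continuous_subspaceT.
Qed.

(* The continua are prolonged by rays along the axes so that [crossing] applies. *)
Lemma axis_crossing A B (s s' t t' : R) : 0 < s -> 0 < s' -> 0 < t -> 0 < t' ->
  continuum A -> continuum B ->
  A (- s, 0) -> A (s', 0) -> B (0, - t) -> B (0, t') ->
  (forall p, B p -> p.2 = 0 -> p.1 <= - s \/ s' <= p.1 -> A p) ->
  (forall p, A p -> p.1 = 0 -> p.2 <= - t \/ t' <= p.2 -> B p) ->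
  A `&` B !=set0.
Proof.
move=> s0 s0' t0 t0' kA kB As As' Bt Bt' inA inB.
have c1 : continuous (fun p : R * R => p.1) by move=> p; exact: cvg_fst.
have c2 : continuous (fun p : R * R => p.2) by move=> p; exact: cvg_snd.
have [L1 L10 hL1] := coord_continuous c1 (compactU kA.1 kB.1).
have [L2 L20 hL2] := coord_continuous c2 (compactU kA.1 kB.1).
pose L := L1 + L2.
have bAB p : (A `|` B) p -> (- L <= p.1 <= L) /\ (- L <= p.2 <= L).
  move=> Ap; have := hL1 p Ap; have := hL2 p Ap.
  by rewrite !ler_norml /L => /andP[? ?] /andP[? ?]; split; apply/andP; split; lra.
have [/andP[sL _] _] := bAB _ (or_introl As); have [/andP[_ sL'] _] := bAB _ (or_introl As').
have [_ /andP[tL _]] := bAB _ (or_intror Bt); have [_ /andP[_ tL']] := bAB _ (or_intror Bt').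
rewrite /= in sL sL' tL tL'.
have L0 : 0 < L by rewrite /L; apply: addr_gt0.
have NL : - L <= 0 <= L by rewrite oppr_le0 (ltW L0).
pose A' := [set p : R * R | - L <= p.1 <= - s /\ p.2 = 0] `|` (A `|`
   [set p : R * R | s' <= p.1 <= L /\ p.2 = 0]).
pose B' := [set p : R * R | - L <= p.2 <= - t /\ p.1 = 0] `|` (B `|`
   [set p : R * R | t' <= p.2 <= L /\ p.1 = 0]).
have cA' : continuum A'.
  apply: continuumU.
  - by exists (- s, 0); split; [rewrite /= sL lexx|left].
  - exact: hsegment_continuum.
  apply: continuumU => //; last exact: hsegment_continuum.
  by exists (s', 0); split => //; rewrite /= sL' lexx.
have cB' : continuum B'.
  apply: continuumU.
  - by exists (0, - t); split; [rewrite /= tL lexx|left].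
  - exact: vsegment_continuum.
  apply: continuumU => //; last exact: vsegment_continuum.
  by exists (0, t'); split => //; rewrite /= tL' lexx.
have [p [H1 H2]] : A' `&` B' !=set0.
  apply: (@crossing _ A' B' (- L, 0) (L, 0) (0, - L) (0, L)) => //.
  - by left; rewrite /= sL lexx.
  - by right; right; rewrite /= sL' lexx.
  - by left; rewrite /= tL lexx.
  - by right; right; rewrite /= tL' lexx.
  - by move=> p [[_ /= ->]|[Bp|[_ /= ->]]] //=; case: (bAB p (or_intror Bp)).
  - by move=> p [[_ /= ->]|[Bp|[_ /= ->]]] //=; case: (bAB p (or_introl Bp)).
have nN (x y : R) : 0 < y -> x = 0 -> x <= - y -> False.
  by move=> y0 -> h; move: y0; rewrite ltNge -oppr_ge0 h.
have nP (x y : R) : 0 < y -> x = 0 -> y <= x -> False.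
  by move=> y0 -> h; move: (lt_le_trans y0 h); rewrite ltxx.
case: H1 => [[/= /andP[_ hA] yE]|[Ap|[/= /andP[hA _] yE]]];
  case: H2 => [[/= /andP[_ hB] xE]|[Bp|[/= /andP[hB _] xE]]].
- by case: (nN _ _ t0 yE hB).
- by exists p; split => //; apply: inA => //; left.
- by case: (nP _ _ t0' yE hB).
- by exists p; split => //; apply: inB => //; left.
- by exists p.
- by exists p; split => //; apply: inB => //; right.
- by case: (nN _ _ t0 yE hB).
- by exists p; split => //; apply: inA => //; right.
- by case: (nP _ _ t0' yE hB).
Qed.

Lemma chord_param a c p (w : R) : normsq a = 1 -> normsq c = 1 -> a != c ->
  unit_disc p -> p.1 = a.1 + w * (c.1 - a.1) -> p.2 = a.2 + w * (c.2 - a.2) ->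
  w <= 0 \/ 1 <= w -> p = a \/ p = c.
Proof.
move=> na nc neq Dp e1 e2 hw.
have ac : 0 < (c.1 - a.1) ^+ 2 + (c.2 - a.2) ^+ 2.
  rewrite lt_neqAle addr_ge0 ?sqr_ge0// andbT eq_sym; apply: contra_neq neq.
  move=> /eqP; rewrite paddr_eq0 ?sqr_ge0// !sqrf_eq0 !subr_eq0 => /andP[/eqP h1 /eqP h2].
  by rewrite [a]surjective_pairing [c]surjective_pairing h1 h2.
have E : normsq p = 1 - w * (1 - w) * ((c.1 - a.1) ^+ 2 + (c.2 - a.2) ^+ 2).
  by rewrite -normsq_comb// /normsq /= -e1 -e2.
have h1 : 0 <= w * (1 - w).
  rewrite -(pmulr_lge0 _ ac) -subr_le0 -[X in X <= _]subr0.
  by move: Dp; rewrite /unit_disc /= E; clear; lra.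
clear Dp E ac; case: hw => hw; [left|right].
  have w0 : w = 0 by clear -h1 hw; nra.
  by rewrite [p]surjective_pairing e1 e2 w0 !mul0r !addr0 -surjective_pairing.
have w1 : w = 1 by clear -h1 hw; nra.
by rewrite [p]surjective_pairing e1 e2 w1 !mul1r !subrKC -surjective_pairing.
Qed.

Lemma opposite_ratio (x y : R) : x * y < 0 -> 0 < x / (x - y) < 1.
Proof.
move=> h.
have [a0|a0] := ltP 0 x.
  have b0 : y < 0 by rewrite -(pmulr_rlt0 _ a0).
  have ab : 0 < x - y by lra.
  by rewrite divr_gt0//= ltr_pdivrMr// mul1r; lra.
have a0' : x < 0.
  by rewrite lt_neqAle a0 andbT; apply: contraTN h => /eqP ->; rewrite mul0r ltxx.
have b0 : 0 < y by rewrite -(nmulr_rlt0 _ a0').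
have ab : 0 < y - x by lra.
have -> : x / (x - y) = - x / (y - x) by rewrite -[x - y]opprB invrN mulrN mulNr.
by rewrite divr_gt0 ?oppr_gt0//= ltr_pdivrMr// mul1r; lra.
Qed.

Lemma chord_point a c b d : normsq a = 1 -> normsq c = 1 -> normsq b = 1 ->
  normsq d = 1 -> turn a c b * turn a c d < 0 -> exists s t : R,
  [/\ 0 < s < 1, 0 < t < 1, b.1 + t * (d.1 - b.1) = a.1 + s * (c.1 - a.1) &
      b.2 + t * (d.2 - b.2) = a.2 + s * (c.2 - a.2)].
Proof.
move=> na nc nb nd hneg.
set al := turn a c b in hneg; set be := turn a c d in hneg.
(* [turn a c] is affine along the chord from [b] to [d], and [t] is the place where it vanishes. *)
pose t := al / (al - be).
have t01 : 0 < t < 1 by exact: opposite_ratio.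
have ab0 : al - be != 0.
  by apply/eqP => h; move: t01; rewrite /t h invr0 mulr0 ltxx.
pose m : R * R := (b.1 + t * (d.1 - b.1), b.2 + t * (d.2 - b.2)).
have bd : 0 < (d.1 - b.1) ^+ 2 + (d.2 - b.2) ^+ 2.
  rewrite lt_neqAle addr_ge0 ?sqr_ge0// andbT eq_sym; apply: contra_neq ab0.
  move=> /eqP; rewrite paddr_eq0 ?sqr_ge0// !sqrf_eq0 !subr_eq0 => /andP[/eqP e1 /eqP e2].
  by rewrite /al /be /turn e1 e2 subrr.
have nm : normsq m < 1.
  rewrite normsq_comb// -subr_gt0 opprB addrC subrK pmulr_lgt0//.
  by case/andP: t01 => h1 h2; rewrite mulr_gt0// subr_gt0.
have ac : 0 < (c.1 - a.1) ^+ 2 + (c.2 - a.2) ^+ 2.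
  rewrite lt_neqAle addr_ge0 ?sqr_ge0// andbT eq_sym; apply: contra_neq ab0.
  move=> /eqP; rewrite paddr_eq0 ?sqr_ge0// !sqrf_eq0 => /andP[/eqP e1 /eqP e2].
  by rewrite /al /be /turn e1 e2 !mul0r !subrr.
have tm : turn a c m = 0.
  have -> : turn a c m = al + t * (be - al) by rewrite /al /be /m /turn /=; ring.
  by rewrite -[be - al]opprB mulrN /t divfK// subrr.
have ac0 := lt0r_neq0 ac.
(* The coefficient of the orthogonal projection of [m - a] on [c - a]; as [m] lies on the line
   through [a] and [c], the projection is [m - a] itself. *)
pose s := ((m.1 - a.1) * (c.1 - a.1) + (m.2 - a.2) * (c.2 - a.2)) /
  ((c.1 - a.1) ^+ 2 + (c.2 - a.2) ^+ 2).
have hs1 : s * (c.1 - a.1) = m.1 - a.1.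
  rewrite /s mulrAC; apply: (mulIf ac0); rewrite divfK//; apply/eqP.
  by rewrite -subr_eq0; apply/eqP; rewrite -[RHS](mulr0 (c.2 - a.2)) -tm /turn; ring.
have hs2 : s * (c.2 - a.2) = m.2 - a.2.
  rewrite /s mulrAC; apply: (mulIf ac0); rewrite divfK//; apply/eqP.
  by rewrite -subr_eq0; apply/eqP; rewrite -[RHS](mulr0 (- (c.1 - a.1))) -tm /turn; ring.
have ms1 : m.1 = a.1 + s * (c.1 - a.1) by rewrite hs1 subrKC.
have ms2 : m.2 = a.2 + s * (c.2 - a.2) by rewrite hs2 subrKC.
exists s, t; split => //.
have E : normsq m = 1 - s * (1 - s) * ((c.1 - a.1) ^+ 2 + (c.2 - a.2) ^+ 2).
  by rewrite -normsq_comb// /normsq /= -ms1 -ms2.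
have h : 0 < s * (1 - s).
  by rewrite -(pmulr_lgt0 _ ac); move: nm; rewrite E; clear; lra.
by clear -h; apply/andP; split; nra.
Qed.

(** In affine coordinates whose axes are the two chords this is [axis_crossing]. By [chord_param]
    the disc meets the line of a chord, outside its open chord, only at the end points, so the rays
    prolonging one continuum touch the other only where both meet. *)
Lemma chord_crossing A B a c b d : continuum A -> continuum B ->
  A `<=` unit_disc -> B `<=` unit_disc -> A a -> A c -> B b -> B d ->
  normsq a = 1 -> normsq c = 1 -> normsq b = 1 -> normsq d = 1 ->
  turn a c b * turn a c d < 0 -> A `&` B !=set0.
Proof.
move=> kA kB AD BD Aa Ac Bb Bd na nc nb nd hneg.
have [s [t [s01 t01 M1 M2]]] := chord_point na nc nb nd hneg.
have dt0 : (c.1 - a.1) * (d.2 - b.2) - (c.2 - a.2) * (d.1 - b.1) != 0.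
  apply/eqP => h; have E : turn a c b = turn a c d.
    by apply/eqP; rewrite -subr_eq0; apply/eqP; rewrite -[RHS]oppr0 -h /turn; ring.
  by move: hneg; rewrite E ltNge -expr2 sqr_ge0.
have neq_ac : a != c by apply: contraTN hneg => /eqP ->; rewrite /turn !subrr !mul0r subrr mul0r ltxx.
have neq_bd : b != d by apply: contraTN hneg => /eqP ->; rewrite -expr2 ltNge sqr_ge0.
pose m : R * R := (a.1 + s * (c.1 - a.1), a.2 + s * (c.2 - a.2)).
(* Up to sign, the entries of the inverse of the matrix with columns [c - a] and [d - b]. *)
pose k1 := (d.2 - b.2) / ((c.1 - a.1) * (d.2 - b.2) - (c.2 - a.2) * (d.1 - b.1)).
pose k2 := (d.1 - b.1) / ((c.1 - a.1) * (d.2 - b.2) - (c.2 - a.2) * (d.1 - b.1)).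
pose l1 := (c.2 - a.2) / ((c.1 - a.1) * (d.2 - b.2) - (c.2 - a.2) * (d.1 - b.1)).
pose l2 := (c.1 - a.1) / ((c.1 - a.1) * (d.2 - b.2) - (c.2 - a.2) * (d.1 - b.1)).
have i1 : k1 * (c.1 - a.1) - k2 * (c.2 - a.2) = 1 by rewrite /k1 /k2; field.
have i2 : k1 * (d.1 - b.1) - k2 * (d.2 - b.2) = 0 by rewrite /k1 /k2; field.
have i3 : l2 * (c.2 - a.2) - l1 * (c.1 - a.1) = 0 by rewrite /l1 /l2; field.
have i4 : l2 * (d.2 - b.2) - l1 * (d.1 - b.1) = 1 by rewrite /l1 /l2; field.
have j1 : k1 * (c.1 - a.1) - l1 * (d.1 - b.1) = 1 by rewrite /k1 /l1; field.
have j2 : l2 * (d.1 - b.1) = k2 * (c.1 - a.1) by rewrite /l2 /k2; field.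
have j3 : k1 * (c.2 - a.2) = l1 * (d.2 - b.2) by rewrite /k1 /l1; field.
have j4 : l2 * (d.2 - b.2) - k2 * (c.2 - a.2) = 1 by rewrite /l2 /k2; field.
clearbody k1 k2 l1 l2.
pose u (p : R * R) := k1 * (p.1 - m.1) - k2 * (p.2 - m.2).
pose v (p : R * R) := l2 * (p.2 - m.2) - l1 * (p.1 - m.1).
have uv1 p : p.1 = m.1 + u p * (c.1 - a.1) + v p * (d.1 - b.1).
  transitivity (m.1 + (k1 * (c.1 - a.1) - l1 * (d.1 - b.1)) * (p.1 - m.1) +
    (l2 * (d.1 - b.1) - k2 * (c.1 - a.1)) * (p.2 - m.2)); last by rewrite /u /v; ring.
  by rewrite j1 j2 subrr; ring.
have uv2 p : p.2 = m.2 + u p * (c.2 - a.2) + v p * (d.2 - b.2).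
  transitivity (m.2 + (k1 * (c.2 - a.2) - l1 * (d.2 - b.2)) * (p.1 - m.1) +
    (l2 * (d.2 - b.2) - k2 * (c.2 - a.2)) * (p.2 - m.2)); last by rewrite /u /v; ring.
  by rewrite j3 j4 subrr; ring.
have uvP p (x y : R) : p.1 = m.1 + x * (c.1 - a.1) + y * (d.1 - b.1) ->
    p.2 = m.2 + x * (c.2 - a.2) + y * (d.2 - b.2) -> u p = x /\ v p = y.
  move=> h1 h2; rewrite /u /v h1 h2; split.
    transitivity (x * (k1 * (c.1 - a.1) - k2 * (c.2 - a.2)) +
      y * (k1 * (d.1 - b.1) - k2 * (d.2 - b.2))); first by ring.
    by rewrite i1 i2; ring.
  transitivity (x * (l2 * (c.2 - a.2) - l1 * (c.1 - a.1)) +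
      y * (l2 * (d.2 - b.2) - l1 * (d.1 - b.1))); first by ring.
  by rewrite i3 i4; ring.
have [ua va] : u a = - s /\ v a = 0 by apply: uvP; rewrite /m /=; ring.
have [uc vc] : u c = 1 - s /\ v c = 0 by apply: uvP; rewrite /m /=; ring.
have [ub vb] : u b = 0 /\ v b = - t by apply: uvP; rewrite /m /= -?M1 -?M2; ring.
have [ud vd] : u d = 0 /\ v d = 1 - t by apply: uvP; rewrite /m /= -?M1 -?M2; ring.
pose F p : R * R := (u p, v p).
have cu : continuous u.
  rewrite (_ : u = fun p => k1 * p.1 + (- k2) * p.2 + (k2 * m.2 - k1 * m.1)).
    exact: affine_continuous.
  by apply/funext => p; rewrite /u; ring.
have cv : continuous v.
  rewrite (_ : v = fun p => (- l1) * p.1 + l2 * p.2 + (l1 * m.1 - l2 * m.2)).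
    exact: affine_continuous.
  by apply/funext => p; rewrite /v; ring.
have cF : continuous F by exact: pair_continuous.
have Finj p q : F p = F q -> p = q.
  by move=> -[h1 h2]; rewrite [p]surjective_pairing [q]surjective_pairing
    (uv1 p) (uv2 p) (uv1 q) (uv2 q) h1 h2.
case/andP: s01 => s0 s1; case/andP: t01 => t0 t1.
suff [_ [[p Ap <-] [q Bq /Finj qp]]] : F @` A `&` F @` B !=set0.
  by exists p; split => //; rewrite -qp.
apply: (@axis_crossing _ _ s (1 - s) t (1 - t)) => //.
- by rewrite subr_gt0.
- by rewrite subr_gt0.
- exact: continuous_continuum2.
- exact: continuous_continuum2.
- by exists a => //; rewrite /F ua va.
- by exists c => //; rewrite /F uc vc.
- by exists b => //; rewrite /F ub vb.
- by exists d => //; rewrite /F ud vd.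
- move=> _ [p Bp <-] /= v0 hu; exists p => //.
  have [] := @chord_param a c p (s + u p) na nc neq_ac (BD p Bp).
  + by rewrite {1}(uv1 p) v0 /m /=; ring.
  + by rewrite {1}(uv2 p) v0 /m /=; ring.
  + by case: hu => hu; [left|right]; [rewrite -lerBrDl sub0r|rewrite -lerBlDl].
  + by move=> ->.
  + by move=> ->.
- move=> _ [p Ap <-] /= u0 hv; exists p => //.
  have [] := @chord_param b d p (t + v p) nb nd neq_bd (AD p Ap).
  + by rewrite {1}(uv1 p) u0 /m /= -M1; ring.
  + by rewrite {1}(uv2 p) u0 /m /= -M2; ring.
  + by case: hv => hv; [left|right]; [rewrite -lerBrDl sub0r|rewrite -lerBlDl].
  + by move=> ->.
  + by move=> ->.
Qed.

(** Each factor has modulus at most 2 and moves by at most [2 * e], so each of the two products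
    moves by at most [8 * e]. *)
Lemma turn_close p q x p' q' x' (e : R) : 0 < e ->
  normsq p <= 1 -> normsq q <= 1 -> normsq x <= 1 ->
  normsq p' <= 1 -> normsq q' <= 1 -> normsq x' <= 1 ->
  mdist p p' < e -> mdist q q' < e -> mdist x x' < e ->
  `|turn p q x - turn p' q' x'| <= 16 * e.
Proof.
move=> e0.
have B z : normsq z <= 1 -> (-1 <= z.1 <= 1) /\ (-1 <= z.2 <= 1).
  rewrite /normsq => h; rewrite -!ler_norml -[1](@sqrtr1 R) -!sqrtr_sqr.
  by split; apply: ler_wsqrtr; apply: le_trans h; rewrite (lerDl, lerDr) sqr_ge0.
move=> /B[p1 p2] /B[q1 q2] /B[x1 x2] /B[p1' p2'] /B[q1' q2'] /B[x1' x2'].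
rewrite !plane_dist_lt !ltr_norml => /andP[dp1 dp2] /andP[dq1 dq2] /andP[dx1 dx2].
have P (s t s' t' : R) : -2 <= s <= 2 -> -2 <= t' <= 2 -> - (2 * e) <= s - s' <= 2 * e ->
    - (2 * e) <= t - t' <= 2 * e -> -(8 * e) <= s * t - s' * t' <= 8 * e.
  rewrite -!ler_norml => hs ht' h1 h2.
  have -> : s * t - s' * t' = s * (t - t') + (s - s') * t' by ring.
  apply: le_trans (ler_normD _ _) _; rewrite !normrM.
  have -> : 8 * e = 2 * (2 * e) + (2 * e) * 2 by ring.
  by apply: lerD; apply: ler_pM.
rewrite ler_norml /turn.
have h1 : -(8 * e) <= (q.1 - p.1) * (x.2 - p.2) - (q'.1 - p'.1) * (x'.2 - p'.2) <= 8 * e.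
  by apply: P; [clear -p1 q1|clear -p2' x2'|clear -dp1 dp2 dq1 dq2|clear -dp1 dp2 dx1 dx2]; lra.
have h2 : -(8 * e) <= (q.2 - p.2) * (x.1 - p.1) - (q'.2 - p'.2) * (x'.1 - p'.1) <= 8 * e.
  by apply: P; [clear -p2 q2|clear -p1' x1'|clear -dp1 dp2 dq1 dq2|clear -dp1 dp2 dx1 dx2]; lra.
by clear -h1 h2; lra.
Qed.

Lemma turn_circle_eq0 p q x : normsq p = 1 -> normsq q = 1 -> normsq x = 1 ->
  p != q -> x != p -> x != q -> turn p q x != 0.
Proof.
move=> np nq nx pq xp xq; apply/eqP => t0.
have pq0 : 0 < (q.1 - p.1) ^+ 2 + (q.2 - p.2) ^+ 2.
  rewrite lt_neqAle addr_ge0 ?sqr_ge0// andbT eq_sym; apply: contra_neq pq.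
  move=> /eqP; rewrite paddr_eq0 ?sqr_ge0// !sqrf_eq0 !subr_eq0 => /andP[/eqP e1 /eqP e2].
  by rewrite [p]surjective_pairing [q]surjective_pairing e1 e2.
have pq0' := lt0r_neq0 pq0.
pose s := ((x.1 - p.1) * (q.1 - p.1) + (x.2 - p.2) * (q.2 - p.2)) /
  ((q.1 - p.1) ^+ 2 + (q.2 - p.2) ^+ 2).
have hs1 : s * (q.1 - p.1) = x.1 - p.1.
  rewrite /s mulrAC; apply: (mulIf pq0'); rewrite divfK//; apply/eqP.
  by rewrite -subr_eq0; apply/eqP; rewrite -[RHS](mulr0 (q.2 - p.2)) -t0 /turn; ring.
have hs2 : s * (q.2 - p.2) = x.2 - p.2.
  rewrite /s mulrAC; apply: (mulIf pq0'); rewrite divfK//; apply/eqP.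
  by rewrite -subr_eq0; apply/eqP; rewrite -[RHS](mulr0 (- (q.1 - p.1))) -t0 /turn; ring.
have E1 : x.1 = p.1 + s * (q.1 - p.1) by rewrite hs1 subrKC.
have E2 : x.2 = p.2 + s * (q.2 - p.2) by rewrite hs2 subrKC.
have : normsq x = 1 - s * (1 - s) * ((q.1 - p.1) ^+ 2 + (q.2 - p.2) ^+ 2).
  by rewrite -normsq_comb// /normsq /= -E1 -E2.
rewrite nx => /eqP; rewrite -subr_eq0 opprB addrC subrK mulf_eq0 (negbTE pq0') orbF.
rewrite mulf_eq0 subr_eq0 => /orP[/eqP s0|/eqP s1].
  by case/eqP: xp; rewrite [x]surjective_pairing E1 E2 s0 !mul0r !addr0 -surjective_pairing.
by case/eqP: xq; rewrite [x]surjective_pairing E1 E2 -s1 !mul1r !subrKC -surjective_pairing.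
Qed.

(** The turns, divided by that of the triangle, are barycentric coordinates of [z]: nonnegative, and
    positive at [p]. By strict convexity a point of the circle in an inscribed triangle is a
    vertex. *)
Lemma circle_triangle p q x z : normsq p = 1 -> normsq q = 1 -> normsq x = 1 ->
  normsq z = 1 -> 0 < turn p q x -> 0 <= turn p q z -> turn p x z <= 0 ->
  0 < turn z q x -> z = p.
Proof.
move=> np nq nx nz D0 h1 h2 h3.
set D := turn p q x in D0.
have D1 := lt0r_neq0 D0.
pose w1 := turn z q x / D; pose w2 := - turn p x z / D; pose w3 := turn p q z / D.
have w1p : 0 < w1 by rewrite divr_gt0.
have w2p : 0 <= w2 by rewrite divr_ge0 ?oppr_ge0// ltW.
have w3p : 0 <= w3 by rewrite divr_ge0// ltW.
have sum1 : w1 + w2 + w3 = 1.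
  by rewrite /w1 /w2 /w3 -!mulrDl -[RHS](divff D1); congr (_ / _); rewrite /D /turn; ring.
have z1 : z.1 = w1 * p.1 + w2 * q.1 + w3 * x.1.
  rewrite /w1 /w2 /w3 -[LHS](mulfK D1) ![_ / D * _]mulrAC -!mulrDl; congr (_ / _).
  by rewrite /D /turn; ring.
have z2 : z.2 = w1 * p.2 + w2 * q.2 + w3 * x.2.
  rewrite /w1 /w2 /w3 -[LHS](mulfK D1) ![_ / D * _]mulrAC -!mulrDl; congr (_ / _).
  by rewrite /D /turn; ring.
clearbody w1 w2 w3.
pose dd (a b : R * R) := (a.1 - b.1) ^+ 2 + (a.2 - b.2) ^+ 2.
have dd0 a b : 0 <= dd a b by rewrite addr_ge0 ?sqr_ge0.
have E : w1 * w2 * dd p q + w1 * w3 * dd p x + w2 * w3 * dd q x = 0.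
  have : normsq z = w1 * (w1 + w2 + w3) * normsq p + w2 * (w1 + w2 + w3) * normsq q +
      w3 * (w1 + w2 + w3) * normsq x -
      (w1 * w2 * dd p q + w1 * w3 * dd p x + w2 * w3 * dd q x).
    by rewrite /normsq /dd z1 z2; ring.
  rewrite nz np nq nx !sum1 !mulr1 sum1 => /eqP.
  by rewrite -subr_eq0 opprB addrC subrK => /eqP.
have ddeq a b : dd a b = 0 -> a = b.
  move=> /eqP; rewrite paddr_eq0 ?sqr_ge0// !sqrf_eq0 !subr_eq0 => /andP[/eqP e1 /eqP e2].
  by rewrite [a]surjective_pairing [b]surjective_pairing e1 e2.
have ndeg (a b : R * R) : (a = p /\ b = q) \/ (a = p /\ b = x) -> dd a b <> 0.
  by move=> [[-> ->]|[-> ->]] /ddeq h; move: D0; rewrite /D /turn -h; lra.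
have w1p' := ltW w1p.
have n1 : 0 <= w1 * w2 * dd p q by apply: mulr_ge0 => //; apply: mulr_ge0.
have n2 : 0 <= w1 * w3 * dd p x by apply: mulr_ge0 => //; apply: mulr_ge0.
have n3 : 0 <= w2 * w3 * dd q x by apply: mulr_ge0 => //; apply: mulr_ge0.
have w20 : w2 = 0.
  have : w1 * w2 * dd p q = 0 by lra.
  move=> /eqP; rewrite !mulf_eq0 (negbTE (lt0r_neq0 w1p)) /= => /orP[/eqP//|/eqP h].
  by exfalso; apply: (ndeg p q) h; left.
have w30 : w3 = 0.
  have : w1 * w3 * dd p x = 0 by lra.
  move=> /eqP; rewrite !mulf_eq0 (negbTE (lt0r_neq0 w1p)) /= => /orP[/eqP//|/eqP h].
  by exfalso; apply: (ndeg p x) h; right.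
have w11 : w1 = 1 by lra.
by rewrite [z]surjective_pairing z1 z2 w11 w20 w30 !mul1r !mul0r !addr0 -surjective_pairing.
Qed.

(* Two continua reaching the circle near the same three points must meet: the
   first point of one of them is cut off from one of its other two points by a
   chord joining two points of the other. *)
Lemma tripod_meet a1 a2 a3 : normsq a1 = 1 -> normsq a2 = 1 -> normsq a3 = 1 ->
  a1 != a2 -> a1 != a3 -> a2 != a3 -> exists2 e : R, 0 < e &
  forall T T' b1 b2 b3 b1' b2' b3', continuum T -> continuum T' ->
    T `<=` unit_disc -> T' `<=` unit_disc ->
    [/\ T b1, T b2 & T b3] -> [/\ T' b1', T' b2' & T' b3'] ->
    [/\ normsq b1 = 1, normsq b2 = 1 & normsq b3 = 1] ->
    [/\ normsq b1' = 1, normsq b2' = 1 & normsq b3' = 1] ->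
    [/\ mdist a1 b1 < e, mdist a2 b2 < e & mdist a3 b3 < e] ->
    [/\ mdist a1 b1' < e, mdist a2 b2' < e & mdist a3 b3' < e] ->
    T `&` T' !=set0.
Proof.
(* Exchanging [a2] and [a3] reverses the orientation and leaves the claim unchanged. *)
wlog D0 : a2 a3 / 0 < turn a1 a2 a3.
  move=> H n1 n2 n3 d12 d13 d23.
  have t0 : turn a1 a2 a3 != 0 by apply: turn_circle_eq0 => //; rewrite eq_sym.
  have [t1|t1] := ltP 0 (turn a1 a2 a3); first exact: H.
  have t2 : 0 < turn a1 a3 a2 by rewrite turn_swap oppr_gt0 lt_neqAle t0.
  have [|e e0 he] := H a3 a2 t2 n1 n3 n2 d13 d12; first by rewrite eq_sym.
  exists e => // T T' b1 b2 b3 b1' b2' b3' cT cT' TD TD' [? ? ?] [? ? ?] [? ? ?] [? ? ?]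
    [? ? ?] [? ? ?].
  exact: (he T T' b1 b3 b2 b1' b3' b2').
(* By [turn_close], perturbations below [D / 32] change the turn by at most [D / 2], so it remains
   positive. *)
move=> n1 n2 n3 _ _ _; exists (turn a1 a2 a3 / 32); first by rewrite divr_gt0.
set D := turn a1 a2 a3 in D0 *.
move=> T T' b1 b2 b3 b1' b2' b3' cT cT' TD TD' [Tb1 Tb2 Tb3] [Tb1' Tb2' Tb3'].
move=> [m1 m2 m3] [m1' m2' m3'] [e1 e2 e3] [e1' e2' e3'].
have e0 : 0 < D / 32 by rewrite divr_gt0.
have pos x y z : normsq x = 1 -> normsq y = 1 -> normsq z = 1 ->
    mdist a1 x < D / 32 -> mdist a2 y < D / 32 -> mdist a3 z < D / 32 -> 0 < turn x y z.
  move=> nx ny nz d1 d2 d3.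
  have := turn_close e0 _ _ _ _ _ _ d1 d2 d3; rewrite n1 n2 n3 nx ny nz.
  move=> /(_ (lexx _) (lexx _) (lexx _) (lexx _) (lexx _) (lexx _)).
  by rewrite -/D ler_norml; lra.
have [h1|h1] := ltP (turn b1 b2 b1') 0.
  apply: (@chord_crossing T T' b1 b2 b1' b3') => //.
  by rewrite nmulr_rlt0//; exact: pos.
have [h2|h2] := ltP 0 (turn b1 b3 b1').
  apply: (@chord_crossing T T' b1 b3 b1' b2') => //.
  by rewrite pmulr_rlt0// turn_swap oppr_lt0; exact: pos.
have E : b1' = b1 by apply: (@circle_triangle b1 b2 b3 b1') => //; exact: pos.
by exists b1; split => //; rewrite -E.
Qed.

End Circle.

(** * Local connectedness of stable continua *)

Section Charts.
Context {R : realType} {S : metricType R}.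
Implicit Types (x y z : S) (A B C D E K F O U V W T Y : set S) (phi : R * R -> S).

(** An open embedding of the whole plane, as [surface] provides; discs and rims are the images of
    the unit disc and circle. *)
Definition chart phi := [/\ continuous phi, injective phi &
  forall O' : set (R * R), open O' -> open (phi @` O')].

Definition disc phi : set S := phi @` unit_disc.
Definition rim phi : set S := phi @` [set p | normsq p = 1].

Lemma normsq_continuous : continuous (@normsq R).
Proof.
move=> p; apply: cvgD.
  by rewrite expr2; apply: cvgM; exact: cvg_fst.
by rewrite expr2; apply: cvgM; exact: cvg_snd.
Qed.

Lemma normsq_le_bound (p : R * R) : normsq p <= 1 -> (`|p.1| <= 1) /\ (`|p.2| <= 1).
Proof.
rewrite /normsq => h; rewrite -[1](@sqrtr1 R) -!sqrtr_sqr.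
by split; apply: ler_wsqrtr; apply: le_trans h; rewrite (lerDl, lerDr) sqr_ge0.
Qed.

Lemma compact_unit_disc : compact (@unit_disc R).
Proof.
have cb : compact (`[-1, 1]%classic `*` `[-1, 1]%classic : set (R * R)).
  by apply: compact_setX; exact: segment_compact.
apply: (subclosed_compact _ cb).
  rewrite (_ : unit_disc = @normsq R @^-1` [set t | t <= 1])//.
  by apply: preimage_closed => [p _|]; [exact: normsq_continuous|exact: closed_le].
move=> [u v] /normsq_le_bound[h1 h2]; split; rewrite /= in_itv /=.
  by rewrite -ler_norml.
by rewrite -ler_norml.
Qed.

Lemma compact_rim : compact [set p : R * R | normsq p = 1].
Proof.
apply: (subclosed_compact _ compact_unit_disc).
  rewrite (_ : [set p | _] = @normsq R @^-1` [set 1])//.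
  by apply: preimage_closed => [p _|]; [exact: normsq_continuous|exact: closed_eq].
by move=> p /= h; rewrite /unit_disc /= h.
Qed.

Lemma disc_closed phi : chart phi -> closed (disc phi).
Proof.
move=> [cp _ _]; apply: compact_closedS.
by apply: continuous_compact compact_unit_disc; exact: continuous_subspaceT.
Qed.

Lemma rim_closed phi : chart phi -> closed (rim phi).
Proof.
move=> [cp _ _]; apply: compact_closedS.
by apply: continuous_compact compact_rim; exact: continuous_subspaceT.
Qed.

Lemma rim_disc phi : rim phi `<=` disc phi.
Proof. by apply: image_subset => p /= h; rewrite /unit_disc /= h. Qed.

Lemma disc_interior phi p : chart phi -> normsq p < 1 -> interior (disc phi) (phi p).
Proof.
move=> [_ _ op] hp.
have oD : open [set p : R * R | normsq p < 1].
  rewrite (_ : [set p | _] = @normsq R @^-1` [set t | t < 1])//.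
  by apply: open_comp => [q _|]; [exact: normsq_continuous|exact: open_lt].
have nb : nbhs (phi p) (phi @` [set p | normsq p < 1]).
  by apply: open_nbhs_nbhs; split; [exact: op|exists p].
apply: (filterS _ nb).
by apply: image_subset => q /= /ltW.
Qed.

Lemma disc_not_interior phi y : chart phi -> disc phi y -> ~ interior (disc phi) y ->
  rim phi y.
Proof.
move=> cp [p Dp <-] ni; exists p => //=; apply/eqP; rewrite eq_le Dp /= leNgt.
by apply/negP => h; apply: ni; exact: disc_interior.
Qed.

Lemma chart_center phi : chart phi -> nbhs (phi (0 : R * R)) (disc phi).
Proof.
by move=> cp; apply: (@disc_interior phi 0 cp); rewrite /normsq /= !expr0n /= addr0.
Qed.

Lemma chart_center_rim phi : chart phi -> ~ rim phi (phi (0 : R * R)).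
Proof.
move=> [_ inj _] [p /= p1 /inj E]; move: p1; rewrite E /normsq /= !expr0n /= addr0.
by move/eqP; rewrite eq_sym oner_eq0.
Qed.

Lemma chart_preimage_continuum phi T : chart phi -> continuum T -> T `<=` disc phi ->
  continuum (phi @^-1` T) /\ phi @^-1` T `<=` unit_disc.
Proof.
move=> [cp inj op] [kT cT] TD.
have sub : phi @^-1` T `<=` unit_disc by move=> p /TD[q Dq /inj <-].
split => //; split.
  apply: (subclosed_compact _ compact_unit_disc) => //.
  by apply: preimage_closed => [p _|]; [exact: cp|exact: compact_closedS].
move=> B [b Bb] [ O oO B1] [F cF B2].
suff E : phi @` B = T.
  apply/seteqP; split => p; first by rewrite B1 => -[].
  by rewrite /preimage /= -E => -[q Bq /inj <-].
apply: cT; first by exists (phi b), b.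
  exists (phi @` O); first exact: op.
  apply/seteqP; split => [_ [p Bp <-]|y [Ty [p Op py]]].
    by move: Bp; rewrite B1 => -[? ?]; split => //; exists p.
  by exists p => //; rewrite B1; split => //; rewrite /preimage /= py.
exists (~` (phi @` (~` F))).
  by apply: open_closedC; apply: op; exact: closed_openC.
apply/seteqP; split => [_ [p Bp <-]|y [Ty ny]].
  move: Bp; rewrite B2 => -[Tp Fp]; split => // -[q nFq /inj qp].
  by apply: nFq; rewrite qp.
have [p Dp py] := TD y Ty; exists p => //; rewrite B2; split.
  by rewrite /preimage /= py.
by apply: contrapT => nFp; apply: ny; exists p.
Qed.

Lemma chart_cvg phi (I : Type) (G : set_system I) (UG : UltraFilter G)
    (u : I -> R * R) p : chart phi ->
  (fun i => phi (u i)) @ G --> phi p -> u @ G --> p.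
Proof.
move=> [cp inj op] h V; rewrite nbhsE => -[ O [oO Op] OV].
have : nbhs (phi p) (phi @` O).
  by apply: open_nbhs_nbhs; split; [exact: op|exists p].
move=> hO; have hG : \forall i \near G, (phi @` O) (phi (u i)) := h _ hO.
change (\forall i \near G, V (u i)).
by apply: (nearS1 hG) => i [q Oq /inj <-]; exact: OV.
Qed.

Lemma chart_affine phi (q : R * R) (r : R) : chart phi -> 0 < r ->
  chart (fun p => phi (q.1 + r * p.1, q.2 + r * p.2)).
Proof.
move=> [cp inj op] r0.
have ca : continuous (fun p : R * R => (q.1 + r * p.1, q.2 + r * p.2)).
  apply: pair_continuous => p; apply: cvgD; try exact: cvg_cst;
  by apply: cvgM; [exact: cvg_cst|]; [exact: cvg_fst || exact: cvg_snd].
split.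
- by move=> p; apply: continuous_comp; [exact: ca|exact: cp].
- move=> [a b] [a' b'] /inj[] /= /addrI /(mulfI (lt0r_neq0 r0)) ->.
  by move=> /addrI /(mulfI (lt0r_neq0 r0)) ->.
- move=> O oO; rewrite -(image_comp (fun p : R * R => (q.1 + r * p.1, q.2 + r * p.2)) phi).
  apply: op.
  rewrite (_ : _ @` O = (fun p : R * R => (r^-1 * p.1 + (- (r^-1 * q.1)),
      r^-1 * p.2 + (- (r^-1 * q.2)))) @^-1` O).
    apply: open_comp => // p _; apply: pair_continuous => p'; apply: cvgD; try exact: cvg_cst;
    by apply: cvgM; [exact: cvg_cst|]; [exact: cvg_fst || exact: cvg_snd].
  have rn := lt0r_neq0 r0.
  apply/seteqP; split => [_ [[a b] Op <-]|[a b] /= Op].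
    by rewrite /preimage /= !mulrDr !mulKf// addrC addKr [X in (_, X)]addrC addKr.
  eexists; first exact: Op.
  by congr pair; rewrite /= mulrDr mulrN !mulVKf// addrC subrK.
Qed.

Lemma surface_chart x : surface R S -> exists2 phi, chart phi & phi (0 : R * R) = x.
Proof.
move=> [_ _ /(_ x)[U [oU Ux] [h]]].
pose psi (p : R * R) : S := set_val (homeo_inv h p).
have cpsi : chart psi.
  split.
  - move=> p; apply: continuous_comp; first exact: homeo_inv_continuous.
    exact: set_val_continuous.
  - move=> p q; rewrite /psi => /val_inj E.
    by rewrite -[p](homeo_invK h) -[q](homeo_invK h) E.
  - move=> O oO.
    have oh : open (h @^-1` O) by apply: open_comp => // y _; exact: homeo_fun_continuous.
    have [V oV VE] := set_type_open oh.
    rewrite (_ : psi @` O = U `&` V); first exact: openI.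
    apply/seteqP; split => [_ [p Op <-]|y [Uy Vy]].
      split; first exact: set_typeP.
      have : (h @^-1` O) (homeo_inv h p) by rewrite /preimage /= homeo_invK.
      by rewrite VE.
    have : (h @^-1` O) (mkset_type Uy) by rewrite VE.
    by move=> Oh; exists (h (mkset_type Uy)) => //; rewrite /psi homeo_funK.
pose q := h (mkset_type Ux).
exists (fun p => psi (q.1 + 1 * p.1, q.2 + 1 * p.2)); first exact: chart_affine.
by rewrite /= !mulr0 !addr0 -surjective_pairing /psi /q homeo_funK.
Qed.

Lemma plane_dist0 (p : R * R) (e : R) :
  (mdist (0 : R * R) p < e) = (`|p.1| < e) && (`|p.2| < e).
Proof. by rewrite plane_dist_lt -[(0 : R * R).1]/(0 : R) -[(0 : R * R).2]/(0 : R) !sub0r !normrN. Qed.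

Lemma small_chart x V : surface R S -> nbhs x V -> exists phi,
  [/\ chart phi, phi (0 : R * R) = x & disc phi `<=` V].
Proof.
move=> sS xV; have [phi cphi p0] := surface_chart x sS.
have [cp _ _] := cphi.
have : nbhs (0 : R * R) (phi @^-1` V) by apply: cp; rewrite p0.
move=> /(@nbhs_mdist_ex R (R * R)%type)[e e0 he].
exists (fun p => phi (0 + e / 2 * p.1, 0 + e / 2 * p.2)); split.
- by apply: (@chart_affine phi (0 : R * R)); rewrite ?divr_gt0.
- rewrite -p0; apply: (congr1 phi); apply: (@eq_trans _ _ ((0 : R), (0 : R))) => //.
  by congr pair; rewrite add0r; exact: mulr0.
- move=> _ [p /normsq_le_bound[h1 h2] <-]; apply: he.
  rewrite plane_dist0 !(_ : forall u v : R, (u, v).1 = u) // !(_ : forall u v : R, (u, v).2 = v) //.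
  have E1 (t : R) : (0 : R * R).1 + t = t by exact: add0r.
  have E2 (t : R) : (0 : R * R).2 + t = t by exact: add0r.
  have e2 : 0 < e / 2 by rewrite divr_gt0.
  rewrite E1 E2 !(normrM (e / 2)) (gtr0_norm e2).
  have a1 := normr_ge0 p.1; have a2 := normr_ge0 p.2.
  by apply/andP; split; nra.
Qed.

Lemma plane_ball_connected (e : R) : connected [set p : R * R | mdist (0 : R * R) p < e].
Proof.
have [e0|e0] := ltP 0 e; last first.
  rewrite (_ : [set p | _] = set0); first exact: connected0.
  rewrite -subset0 => p /= h; move: (le_lt_trans (mdist_ge0 _ _) h).
  by rewrite ltNge e0.
rewrite (_ : [set p | _] = \bigcup_(q in [set p : R * R | mdist (0 : R * R) p < e])
    ((fun t => (t * q.1, t * q.2)) @` `[0, 1])).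
  apply: bigcup_connected.
    exists (0 : R * R) => q _; exists 0; first by rewrite /= in_itv /= lexx ler01.
    by rewrite !mul0r.
  move=> q _; apply: connected_continuous_connected; first exact: segment_connected.
  apply: continuous_subspaceT; apply: pair_continuous => t;
    by apply: cvgM; [exact: cvg_id|exact: cvg_cst].
apply/seteqP; split => [q hq|p' [q hq [t]]].
  exists q => //; exists 1; first by rewrite /= in_itv /= ler01 lexx.
  by rewrite !mul1r -surjective_pairing.
rewrite /= in_itv /= => /andP[t0 t1] <-; move: hq; rewrite /= !plane_dist0.
move=> /andP[h1 h2]; rewrite !normrM (ger0_norm t0).
by apply/andP; split; [apply: le_lt_trans h1|apply: le_lt_trans h2]; rewrite ler_piMl.
Qed.

Lemma surface_lc : surface R S -> locally_connected S.
Proof.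
move=> sS x V xV; have [phi [cphi p0 DV]] := small_chart sS xV.
have [cp _ op] := cphi.
exists (phi @` [set p : R * R | mdist (0 : R * R) p < 1 / 2]); split.
- by apply: op; exact: (@open_mdist_lt R (R * R)%type).
- by exists 0 => //=; rewrite mdistxx divr_gt0.
- apply: subset_trans DV; apply: image_subset => p /=.
  rewrite plane_dist0 /unit_disc /normsq /= => /andP[h1 h2].
  rewrite -[p.1 ^+ 2]real_normK ?num_real// -[p.2 ^+ 2]real_normK ?num_real//.
  have a1 := normr_ge0 p.1; have a2 := normr_ge0 p.2; nra.
- apply: connected_continuous_connected; first exact: plane_ball_connected.
  exact: continuous_subspaceT.
Qed.

Lemma surface_perfect : surface R S -> forall x, ~ open [set x].
Proof.
move=> sS x ox; have [phi [cp inj _] p0] := surface_chart x sS.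
have : nbhs (0 : R * R) (phi @^-1` [set x]).
  by apply: cp; rewrite p0; exact: open_nbhs_nbhs.
move=> /(@nbhs_mdist_ex R (R * R)%type)[e e0 he].
have : (phi @^-1` [set x]) (e / 2, 0).
  apply: he; rewrite plane_dist0 /= normr0 gtr0_norm ?divr_gt0// e0 andbT.
  by rewrite ltr_pdivrMr// ltr_pMr// ltr1n.
rewrite /preimage /= -p0 => /inj[] h; move: e0; have : e = 0 by lra.
by move=> ->; rewrite ltxx.
Qed.

End Charts.

Lemma ultra_cluster (X : topologicalType) (x : X) (P : X -> Prop) :
  (forall V, nbhs x V -> exists2 y, V y & P y) ->
  exists G : set_system X, [/\ UltraFilter G, G --> x & \forall y \near G, P y].
Proof.
move=> H; pose F := filter_from (nbhs x) (fun V => V `&` [set y | P y]).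
have PF : ProperFilter F.
  apply: filter_from_proper; last by move=> V /H[y Vy Py]; exists y.
  apply: filter_from_filter; first by exists setT; exact: filterT.
  move=> V V' xV xV'; exists (V `&` V'); first exact: filterI.
  by move=> y [[]].
have [G [UG FG]] := ultraFilterLemma PF.
exists G; split => //; first by move=> V xV; apply: FG; exists V => // y [].
by apply: FG; exists setT; [exact: filterT|move=> y []].
Qed.

Section LocalConnectedness.
Context {R : realType} {S : metricType R}.
Implicit Types (x y z : S) (A B C D E F O U V W T Y : set S) (phi : R * R -> S).
Hypothesis S_compact : compact [set: S].
Hypothesis S_surface : surface R S.

Let S_lc : locally_connected S := surface_lc S_surface.
Let S_perfect : forall x : S, ~ open [set x] := surface_perfect S_surface.

Lemma chart_inverse phi : chart phi -> exists psi : S -> R * R,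
  [/\ forall z, disc phi z -> phi (psi z) = z,
      forall z, rim phi z -> normsq (psi z) = 1 &
      forall (I : Type) (G : set_system I) (v : I -> S) z, UltraFilter G ->
        (\forall i \near G, disc phi (v i)) -> v @ G --> z -> disc phi z ->
        (fun i => psi (v i)) @ G --> psi z].
Proof.
move=> cphi; have [cp inj op] := cphi.
have H z : exists p, disc phi z -> phi p = z.
  by have [[p _ pz]|n] := pselect (disc phi z); [exists p|exists (0 : R * R)].
have [psi hpsi] := choice H; exists psi; split => //.
  move=> z rz; have [p p1 pz] := rz.
  by rewrite (_ : psi z = p)//; apply: inj; rewrite hpsi//; exact: rim_disc.
move=> I G v z UG Gv vz Dz; apply: (chart_cvg UG cphi); rewrite (hpsi z Dz).
apply: cvg_mdist => e e0; have := near_dist_lt vz e0.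
by move=> h; apply: (nearS2 Gv h) => i Di; rewrite hpsi.
Qed.

Section Nice.
Variables (f : homeo S S) (c : R).
Local Notation Q := (continua_dec (stab f)).

(** The last clause, that every plaque reaches the rim, supplies the legs of the tripods to which
    [tripod_meet] is applied. *)
Definition nice phi := chart phi /\ forall z, disc phi z ->
  [/\ stab f (Q (disc phi) z), forall n, fsmall (iter n f) c (Q (disc phi) z) &
      exists2 y, Q (disc phi) z y & rim phi y].

Hypothesis Hc : cwF_const f c.

Lemma component_rim phi C z : chart phi -> continuum C -> C z -> disc phi z ->
  ~ (C `<=` disc phi) -> exists2 y, connected_component (C `&` disc phi) z y & rim phi y.
Proof.
move=> cphi cC Cz Dz nCD; have cD := disc_closed cphi.
have [y Ey iy] := boundary_bumping S_compact cC cD Cz Dz nCD.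
exists y => //; apply: disc_not_interior => //.
by have [] := connected_component_sub Ey.
Qed.

(** A disc smaller than the size in [uniform_stable] cannot contain the stable continuum given
    there, so bumping carries a piece of it to the rim. *)
Lemma small_nice : exists2 r : R, 0 < r & forall phi, chart phi ->
  small r (disc phi) -> nice phi.
Proof.
have [r1 r10 h1] := small_stab_ex S_compact Hc.
have [e e0 he] := uniform_stable S_compact S_lc S_perfect Hc.
exists (Num.min r1 (e / 2)); first by rewrite lt_min r10 divr_gt0.
move=> phi cphi sD; split => // z Dz; have cD := disc_closed cphi.
have sD1 : small r1 (disc phi) by apply: small_le sD; rewrite ge_min lexx.
have [sQ bQ] := h1 _ cD sD1 z Dz; split => //.
have [C [sC _ Cz [w Cw ew]]] := he z.
have nCD : ~ (C `<=` disc phi).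
  move=> CD; have := sD _ _ Dz (CD w Cw).
  rewrite le_min => /andP[_ h]; have h' := le_trans ew h.
  by move: e0; rewrite ltNge; case/negP; lra.
have [y Ey ry] := component_rim cphi sC.1 Cz Dz nCD.
exists y => //; apply: (dec_max (C := connected_component (C `&` disc phi) z)) => //.
- apply: (stab_sub _ _ sC); last by move=> q /connected_component_sub[].
  by apply: component_continuum => //; apply: closedI => //; apply: compact_closedS => //; case: sC => -[].
- by move=> q /connected_component_sub[].
- by apply: connected_component_refl.
Qed.

Lemma dec_ulim Y (I : Type) (G : set_system I) (u : I -> S) : UltraFilter G ->
  closed Y -> (forall z, Y z -> continuum (Q Y z) /\ forall n, fsmall (iter n f) c (Q Y z)) ->
  (\forall i \near G, Y (u i)) -> stab f (ulim G (fun i => Q Y (u i))).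
Proof.
move=> UG cY np GD; set L := ulim _ _.
have kQ : \forall i \near G, compact (Q Y (u i)).
  by apply: (nearS1 GD) => i Di; case: (np _ Di) => -[].
have cL : continuum L.
  by apply: (ulim_continuum S_compact UG); apply: (nearS1 GD) => i Di; case: (np _ Di).
apply: (bounded_stab S_compact Hc) => // n z z' Lz Lz'.
have [s Gs sz] := ulim_sel UG Lz kQ.
have [s' Gs' sz'] := ulim_sel UG Lz' kQ.
have cn : continuous (iter n f) by apply: iter_continuous; exact: homeo_fun_continuous.
apply: (ulim_dist_le UG (cvg_homeo cn sz) (cvg_homeo cn sz')).
apply: (nearS3 GD Gs Gs') => i Di h h'.
by have [_ hb] := np _ Di; exact: hb.
Qed.

(** The limit of the plaques is a stable continuum in the disc that contains both limit points. *)
Lemma dec_limit phi (I : Type) (G : set_system I) (u v : I -> S) y p : UltraFilter G ->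
  nice phi -> u @ G --> y -> v @ G --> p ->
  (\forall i \near G, Q (disc phi) (u i) (v i)) -> Q (disc phi) y p.
Proof.
move=> UG [cphi np] uy vp Guv; have cD := disc_closed cphi.
have GD : \forall i \near G, disc phi (u i).
  by apply: (nearS1 Guv) => i h; apply: (dec_sub (dec_sym h)).
apply: (dec_max (C := ulim G (fun i => Q (disc phi) (u i)))).
- by apply: dec_ulim => // z /np[[]].
- by apply: ulim_sub => //; apply: nearW => i; exact: dec_sub.
- by apply: (ulim_mem UG uy); apply: (nearS1 GD) => i Di; exact: dec_refl.
- exact: (ulim_mem UG vp).
Qed.

End Nice.

Lemma lc_subset_image (h k : S -> S) C : cancel h k -> cancel k h -> continuous h ->
  continuous k -> lc_subset (h @` C) -> lc_subset C.
Proof.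
move=> hk kh ch ck lC x V Cx xV.
have kV : nbhs (h x) (k @^-1` V) by apply: ck; rewrite hk.
have [W [ O [WC cW Wx oO [Ox CO]]]] := lC (h x) _ (imageP h Cx) kV.
exists (k @` W), (h @^-1` O); split.
- move=> _ [w /WC[[z Cz <-] Vz] <-]; rewrite hk; split => //.
  by move: Vz; rewrite /preimage /= hk.
- by apply: connected_continuous_connected => //; exact: continuous_subspaceT.
- by exists (h x).
- by apply: open_comp => // *; exact: ch.
- split => // z [Cz Oz]; exists (h z) => //; apply: CO; split => //; exact: imageP.
Qed.

(* If [C] is not locally connected at [y0], then infinitely many components of
   [C] in a disc accumulate on a nondegenerate continuum. Each component joins a
   point of the rim to two unstable plaques that reach the rim elsewhere, and by
   [tripod_meet] two such tripods meet. Hence some unstable plaque meets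
   infinitely many of the components, which contradicts cwF-expansivity. *)
Lemma bounded_lc (f : homeo S S) (c : R) C : cwF_const f c -> continuum C ->
  (forall n, fsmall (iter n f) c C) -> lc_subset C.
Proof.
move=> Hc cC bC y0 V Cy0 y0V.
(* The chart is adapted to the inverse, so [Qu] below stands for unstable plaques. *)
have Hg := cwF_const_inv Hc.
have [r1 r10 hr1] := small_nice Hg.
have nbr : nbhs y0 (V `&` [set y | mdist y0 y < r1 / 2]).
  by apply: filterI => //; apply: nbhs_mdist_lt; rewrite divr_gt0.
have [phi [cphi p0 DV]] := small_chart S_surface nbr.
have nphi : nice (hinv f) c phi.
  apply: hr1 => //; apply: (fsmall_center (h := id) (x := y0)) => y /DV[_ /ltW].
  by [].
have [_ np] := nphi.
set D := disc phi in DV np; have cD : closed D := disc_closed cphi.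
have Dy0 : D y0 by rewrite -p0; exact: nbhs_singleton (chart_center cphi).
have [CD|nCD] := pselect (C `<=` D).
  exists C, setT; split => //; first by move=> z Cz; split => //; case: (DV z (CD z Cz)).
    by case: cC.
  exact: openT.
pose E x := connected_component (C `&` D) x.
have clC : closed C by apply: compact_closedS => //; case: cC.
have cE x : continuum (E x) by apply: component_continuum => //; exact: closedI.
have ECD x : E x `<=` C `&` D by exact: connected_component_sub.
suff [ O [oO Oy0 OE]] : exists O, [/\ open O, O y0 & C `&` O `<=` E y0].
  exists (E y0), O; split => //.
  - by move=> z /ECD[Cz /DV[]].
  - by case: (cE y0).
  - by apply: connected_component_refl.
apply: contrapT => nO.
have [G [UG Gy0 GP]] : exists G : set_system S, [/\ UltraFilter G, G --> y0 &
    \forall x \near G, [/\ C x, D x & ~ E y0 x]].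
  apply: ultra_cluster => W yW; apply: contrapT => h; apply: (nO).
  exists (interior (W `&` D)); split; first exact: open_interior.
    by apply: filterI => //; rewrite -p0; exact: chart_center.
  move=> x [Cx /interior_subset[Wx Dx]]; apply: contrapT => nE; apply: h.
  by exists x.
have GC : \forall x \near G, C x by apply: (nearS1 GP) => x [].
have GD : \forall x \near G, D x by apply: (nearS1 GP) => x [].
have GE : \forall x \near G, ~ E y0 x by apply: (nearS1 GP) => x [].
(* Such a [w] would have a closed component [E w] containing almost all [x], hence also [y0]. *)
have far w : ~ (\forall x \near G, E x w).
  move=> h; have Ew : \forall x \near G, E w x.
    by apply: (nearS1 h) => x /connected_component_sym.
  have clE : closed (E w) by apply: compact_closedS => //; case: (cE w).
  have Ewy0 : E w y0 := ulim_closed_mem UG clE Gy0 Ew.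
  have [x [h1 h2]] := near_ex2 UG Ew GE; apply: (h2).
  exact: connected_component_trans (connected_component_sym Ewy0) h1.
pose Qu z := continua_dec (stab (hinv f)) D z.
have finQ z : D z -> finite_set (C `&` Qu z).
  by move=> Dz; have [[cQ _] bQ _] := np z Dz; apply: Hc.2 => //.
(* An unstable plaque has only finitely many points on [C], so if it met almost all [E x], a single
   point would lie in almost all of them. *)
have farQ z : D z -> ~ (\forall x \near G, exists2 w, E x w & Qu z w).
  move=> Dz h; have /(ultra_finite UG (finQ z Dz))[w _] : \forall x \near G,
      exists2 w, (C `&` Qu z) w & E x w.
    by apply: (nearS1 h) => x [w Ew Qw]; exists w => //; split => //; case: (ECD x w Ew).
  exact: far.
have exE x : exists e, C x -> D x -> E x e /\ rim phi e.
  have [[Cx Dx]|n] := pselect (C x /\ D x); last by exists x => ? ?; case: n.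
  by have [e h1 h2] := component_rim cphi cC Cx Dx nCD; exists e.
have [e he] := choice exE.
have exP z : exists p, D z -> Qu z p /\ rim phi p.
  have [Dz|n] := pselect (D z); last by exists z.
  by have [_ _ [p h1 h2]] := np z Dz; exists p.
have [p hp] := choice exP.
have [e0 ee0] := ulim_ex S_compact UG e.
have GEe : \forall x \near G, E x (e x) /\ rim phi (e x).
  by apply: (nearS2 GC GD) => x Cx Dx; exact: he.
pose K := ulim G E.
have cK : continuum K by apply: (ulim_continuum S_compact UG); exact: nearW.
have KCD : K `<=` C `&` D.
  by apply: ulim_sub; [exact: closedI|exact: nearW].
have Ky0 : K y0.
  apply: (ulim_mem UG (u := id) Gy0); apply: (nearS2 GC GD) => x Cx Dx.
  exact: connected_component_refl.
have Ke0 : K e0 by apply: (ulim_mem UG ee0); apply: (nearS1 GEe) => x [].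
have re0 : rim phi e0.
  by apply: (ulim_closed_mem UG (rim_closed cphi) ee0); apply: (nearS1 GEe) => x [].
(* The limit continuum joins the centre to the rim, so it is infinite and not covered by two
   unstable plaques. This leaves room for [y] and [y'] such that the plaques of [e0], [y] and [y']
   are distinct, whence three distinct limit points on the rim. *)
have infK : ~ finite_set K.
  move=> fK; have E0 : y0 = e0 := finite_connected fK cK.2 Ky0 Ke0.
  by apply: (chart_center_rim cphi); rewrite p0 E0.
have [_ De0] := KCD _ Ke0.
have [y Ky nQy] : exists2 y, K y & ~ Qu e0 y.
  apply: contrapT => h; apply: infK; apply: sub_finite_set (finQ e0 De0) => z Kz.
  by split; [case: (KCD z Kz)|apply: contrapT => nQ; apply: h; exists z].
have [_ Dy] := KCD _ Ky.
have [y' Ky' [nQy' nQyy']] : exists2 y', K y' & ~ Qu e0 y' /\ ~ Qu y y'.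
  apply: contrapT => h; apply: infK.
  apply: sub_finite_set (_ : finite_set ((C `&` Qu e0) `|` (C `&` Qu y))).
    move=> z Kz; have [Cz _] := KCD z Kz.
    have [?|n1] := pselect (Qu e0 z); first by left.
    have [?|n2] := pselect (Qu y z); first by right.
    by case: h; exists z.
  by rewrite finite_setU; split; exact: finQ.
have [_ Dy'] := KCD _ Ky'.
have GK : \forall x \near G, compact (E x) by apply: nearW => x; case: (cE x).
have [u Gu uy] := ulim_sel UG Ky GK.
have [u' Gu' uy'] := ulim_sel UG Ky' GK.
have sel v z : (\forall x \near G, E x (v x)) -> v @ G --> z -> exists q,
    [/\ (fun x => p (v x)) @ G --> q, Qu z q & rim phi q].
  move=> Gv vz; have [q hq] := ulim_ex S_compact UG (fun x => p (v x)).
  have GQ : \forall x \near G, Qu (v x) (p (v x)) /\ rim phi (p (v x)).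
    by apply: (nearS1 Gv) => x /ECD[_ Dv]; exact: hp.
  exists q; split => //.
    by apply: (dec_limit Hg UG nphi vz hq); apply: (nearS1 GQ) => x [].
  by apply: (ulim_closed_mem UG (rim_closed cphi) hq); apply: (nearS1 GQ) => x [].
have [q [uq Qq rq]] := sel u y Gu uy.
have [q' [uq' Qq' rq']] := sel u' y' Gu' uy'.
have [psi [psiK psi1 psic]] := chart_inverse cphi.
have [cp inj op] := cphi.
have psi_neq a b : rim phi a -> rim phi b -> a <> b -> psi a != psi b.
  move=> ra rb ab; apply/eqP => E0; apply: ab.
  by rewrite -(psiK a (rim_disc ra)) -(psiK b (rim_disc rb)) E0.
have ne1 : e0 <> q.
  by move=> E0; apply: nQy; rewrite E0; exact: dec_sym.
have ne2 : e0 <> q'.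
  by move=> E0; apply: nQy'; rewrite E0; exact: dec_sym.
have ne3 : q <> q'.
  move=> E0; apply: nQyy'; apply: (dec_trans Qq); rewrite E0; exact: dec_sym.
have [d d0 hd] := tripod_meet (psi1 _ re0) (psi1 _ rq) (psi1 _ rq')
  (psi_neq _ _ re0 rq ne1) (psi_neq _ _ re0 rq' ne2) (psi_neq _ _ rq rq' ne3).
pose T x := E x `|` Qu (u x) `|` Qu (u' x).
pose good x := [/\ [/\ C x, D x, E x (u x) & E x (u' x)],
  mdist (psi e0) (psi (e x)) < d, mdist (psi q) (psi (p (u x))) < d &
  mdist (psi q') (psi (p (u' x))) < d].
have near_psi (v : S -> S) z : (\forall x \near G, rim phi (v x)) -> v @ G --> z ->
    rim phi z -> \forall x \near G, mdist (psi z) (psi (v x)) < d.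
  move=> Gv vz rz; apply: (@near_dist_lt R (R * R)%type) => //; apply: psic => //.
    by apply: (nearS1 Gv) => x; exact: rim_disc.
  exact: rim_disc.
have Ggood : \forall x \near G, good x.
  have h1 : \forall x \near G, mdist (psi e0) (psi (e x)) < d.
    by apply: near_psi => //; apply: (nearS1 GEe) => x [].
  have h2 : \forall x \near G, mdist (psi q) (psi (p (u x))) < d.
    by apply: near_psi => //; apply: (nearS1 Gu) => x /ECD[_ Du]; case: (hp _ Du).
  have h3 : \forall x \near G, mdist (psi q') (psi (p (u' x))) < d.
    by apply: near_psi => //; apply: (nearS1 Gu') => x /ECD[_ Du]; case: (hp _ Du).
  have h4 : \forall x \near G, E x (u x) /\ E x (u' x) by exact: (nearS2 Gu Gu').
  have h5 : \forall x \near G, C x /\ D x by exact: (nearS2 GC GD).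
  have h6 : \forall x \near G, [/\ C x, D x, E x (u x) & E x (u' x)].
    by apply: (nearS2 h4 h5) => x [? ?] [].
  apply: (nearS2 h6 (nearS3 h1 h2 h3 (fun x a b c => And3 a b c))) => x h [a b d'].
  by split.
have good_cont x : good x -> [/\ continuum (T x) & T x `<=` D].
  move=> [[Cx Dx Eu Eu'] _ _ _].
  have [_ Du] := ECD _ _ Eu; have [_ Du'] := ECD _ _ Eu'.
  have [[cQ _] _ _] := np _ Du; have [[cQ' _] _ _] := np _ Du'.
  split.
    apply: continuumU; [|apply: continuumU => //|exact: cQ'].
      by exists (u' x); split; [left|exact: dec_refl].
    by exists (u x); split => //; exact: dec_refl.
  by move=> z [[/ECD[]//|]|]; exact: dec_sub.
have meet x x' : good x -> good x' -> T x `&` T x' !=set0.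
  move=> gx gx'; have [kT TD] := good_cont x gx; have [kT' TD'] := good_cont x' gx'.
  have [P1 P2] := chart_preimage_continuum cphi kT TD.
  have [P1' P2'] := chart_preimage_continuum cphi kT' TD'.
  have mem z : good z -> [/\ (phi @^-1` T z) (psi (e z)), (phi @^-1` T z) (psi (p (u z))) &
      (phi @^-1` T z) (psi (p (u' z)))] /\ [/\ normsq (psi (e z)) = 1,
      normsq (psi (p (u z))) = 1 & normsq (psi (p (u' z))) = 1].
    move=> [[Cz Dz Eu Eu'] _ _ _].
    have [_ Du] := ECD _ _ Eu; have [_ Du'] := ECD _ _ Eu'.
    have [Ee re] := he z Cz Dz; have [Qp rp] := hp _ Du; have [Qp' rp'] := hp _ Du'.
    split; last by split; exact: psi1.
    rewrite /preimage /=; split; rewrite psiK; try exact: rim_disc.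
    - by left; left.
    - by left; right.
    - by right.
  have [m1 n1] := mem x gx; have [m2 n2] := mem x' gx'.
  have [_ a1 a2 a3] := gx; have [_ b1 b2 b3] := gx'.
  have [z [z1 z2]] := hd _ _ _ _ _ _ _ _ P1 P1' P2 P2' m1 m2 n1 n2 (And3 a1 a2 a3) (And3 b1 b2 b3).
  by exists (phi z).
(* Of the nine ways in which the parts of two tripods can meet, seven would, for almost all [x'],
   give a fixed component or a fixed plaque meeting almost all components. *)
have case1 x : good x -> \forall x' \near G,
    (exists2 w, E x w & Qu (u x') w) \/ (exists2 w, E x w & Qu (u' x') w).
  move=> gx; have [[Cx Dx Eu Eu'] _ _ _] := gx.
  have [_ Du] := ECD _ _ Eu; have [_ Du'] := ECD _ _ Eu'.
  have notin z v : D z -> (\forall x' \near G, E x' (v x')) ->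
      ~ (\forall x' \near G, exists2 w, Qu z w & Qu (v x') w).
    move=> Dz Gv h; apply: (farQ z Dz); apply: (nearS2 Gv h) => x' Ev [w Qw Qv].
    by exists (v x') => //; apply: (dec_trans Qw); exact: dec_sym.
  have n1 := ultra_not UG (far x).
  have n2 := ultra_not UG (farQ _ Du).
  have n3 := ultra_not UG (farQ _ Du').
  have n4 := ultra_not UG (notin _ _ Du Gu).
  have n5 := ultra_not UG (notin _ _ Du Gu').
  have n6 := ultra_not UG (notin _ _ Du' Gu).
  have n7 := ultra_not UG (notin _ _ Du' Gu').
  apply: (nearS3 Ggood (nearS3 n1 n2 n3 (fun x a b c => And3 a b c))
    (nearS3 n4 n5 (nearS2 n6 n7 (fun x a b => conj a b)) (fun x a b c => And3 a b c)))
    => x' gx' [m1 m2 m3] [m4 m5 [m6 m7]].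
  have [w [Tw Tw']] := meet x x' gx gx'.
  case: Tw => [[Ew|Qw]|Qw]; case: Tw' => [[Ew'|Qw']|Qw'].
  - case: m1; exact: connected_component_trans Ew' (connected_component_sym Ew).
  - by left; exists w.
  - by right; exists w.
  - by case: m2; exists w.
  - by case: m4; exists w.
  - by case: m5; exists w.
  - by case: m3; exists w.
  - by case: m6; exists w.
  - by case: m7; exists w.
(* If the plaques of [v x'] meet the closed set [E x] for almost all [x'], so does the plaque of
   their limit [z]; for almost all [x] this is excluded by [farQ]. *)
have final v z : D z -> v @ G --> z ->
    ~ (\forall x \near G, \forall x' \near G, exists2 w, E x w & Qu (v x') w).
  move=> Dz vz h; apply: (farQ z Dz); apply: (nearS1 h) => x h'.
  have [w hw] : exists w : S -> S, \forall x' \near G, E x (w x') /\ Qu (v x') (w x').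
    have /choice[w hw] : forall x', exists w, (exists2 w, E x w & Qu (v x') w) ->
        E x w /\ Qu (v x') w.
      move=> x'; have [[w h1 h2]|n] := pselect (exists2 w, E x w & Qu (v x') w).
        by exists w.
      by exists x'.
    by exists w; apply: (nearS1 h') => x'; exact: hw.
  have [w0 ww0] := ulim_ex S_compact UG w.
  exists w0.
    apply: (ulim_closed_mem UG _ ww0); last by apply: (nearS1 hw) => x' [].
    by apply: compact_closedS => //; case: (cE x).
  by apply: (dec_limit Hg UG nphi vz ww0); apply: (nearS1 hw) => x' [].
have : \forall x \near G, (\forall x' \near G, exists2 w, E x w & Qu (u x') w) \/
    (\forall x' \near G, exists2 w, E x w & Qu (u' x') w).
  by apply: (nearS1 Ggood) => x /case1/(ultra_or UG).
by move=> /(ultra_or UG)[]; [exact: final uy|exact: final uy'].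
Qed.

Section Peano.
Variables (f : homeo S S) (c : R).
Hypothesis Hc : cwF_const f c.

Lemma stab_lc C : stab f C -> lc_subset C.
Proof.
move=> sC; have [N hN] := stab_bounded_image Hc sC.
apply: (@lc_subset_image (hiter f N) (hiter f (- N%:Z))).
- exact: hiterK.
- exact: hiterVK.
- exact: hiter_continuous.
- exact: hiter_continuous.
- apply: (bounded_lc Hc) => //; apply: hiter_image_continuum; exact: sC.1.
Qed.

Lemma stab_peano_atlas : peano_atlas (continua_atlas (stab f)).
Proof.
split; first exact: (stab_is_atlas S_compact Hc).
move=> P [U [x [AU Ux ->]]]; apply: lc_set_type; apply: lc_subset_component.
  by apply: stab_lc; apply: adom_stab => //; exact: subset_closure.
by case: (AU).
Qed.

End Peano.
End LocalConnectedness.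

(** * Branching plaques *)

(** One representative is kept for each code that occurs, which turns an uncountable property with
    countably many codes into a sequence; [None] fills the remaining indices. *)
Lemma code_repr (T : countType) (X : Type) (P : X -> Prop) (cd : X -> T) :
  exists w : nat -> option X, (forall n x, w n = Some x -> P x) /\
    forall x, P x -> exists n x', [/\ w n = Some x', P x' & cd x' = cd x].
Proof.
have H t : exists o : option X, (forall x, o = Some x -> P x) /\
    forall x, P x -> cd x = t -> exists2 x', o = Some x' & cd x' = t.
  have [[x [Px xt]]|n] := pselect (exists x, P x /\ cd x = t).
    exists (Some x); split => [_ [<-] //|x' _ _]; by exists x.
  by exists None; split => // x Px xt; case: n; exists x.
have [w ho] := choice H.
exists (fun n => if choice.unpickle n is Some t then w t else None); split.
  by move=> n x; case: (choice.unpickle _) => // t; case: (ho t) => h _; exact: h.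
move=> x Px; have [h1 h2] := ho (cd x); have [x' ox' xx'] := h2 x Px erefl.
exists (choice.pickle (cd x)), x'; rewrite choice.pickleK; split => //; exact: h1.
Qed.

Lemma floor_close (R : realType) (x y : R) : Num.floor x = Num.floor y -> `|x - y| < 1.
Proof.
move=> E; have hx1 := floor_le x; have hx2 := floorD1_gt x.
have hy1 := floor_le y; have hy2 := floorD1_gt y.
by move: hx1 hx2; rewrite E !intrD in hy2 * => hx1 hx2; rewrite ltr_norml; apply/andP; split; lra.
Qed.

Section GoodLeaves.
Context {R : realType} {S : metricType R}.
Implicit Types (x y z : S) (A B C D E F O U V W T Y : set S) (phi : R * R -> S).
Hypothesis S_compact : compact [set: S].
Hypothesis S_surface : surface R S.

Let S_lc : locally_connected S := surface_lc S_surface.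
Let S_perfect : forall x : S, ~ open [set x] := surface_perfect S_surface.

Definition odisc phi : set S := phi @` [set p | normsq p < 1].

Lemma odisc_open phi : chart phi -> open (odisc phi).
Proof.
move=> [_ _]; apply; rewrite (_ : [set p | _] = @normsq R @^-1` [set t | t < 1])//.
by apply: open_comp => [q _|]; [exact: normsq_continuous|exact: open_lt].
Qed.

Lemma odisc_disc phi : odisc phi `<=` disc phi.
Proof. by apply: image_subset => p /ltW. Qed.

(** For each pair of basic open sets, one small chart is kept, if there is any, whose open disc
    contains the first and whose closed disc lies in the second. The injective code [cd] expresses
    countability. *)
Lemma disc_basis (r : R) : 0 < r -> exists (Phi : set (R * R -> S)) (cd : (R * R -> S) -> nat),
  [/\ {in Phi &, injective cd},
  forall phi, Phi phi -> chart phi /\ small r (disc phi) &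
  forall x V, nbhs x V -> exists phi, [/\ Phi phi, odisc phi x & disc phi `<=` V]].
Proof.
move=> r0; have [_ [B cB [Bo Bb]] _] := S_surface.
have /countable_injP[cf cfi] := cB.
pose P (X : (R * R -> S) * (set S * set S)) := [/\ chart X.1, small r (disc X.1),
  B X.2.1 /\ B X.2.2, X.2.1 `<=` odisc X.1 & disc X.1 `<=` X.2.2].
have [w [wP wE]] := code_repr P (fun X => (cf X.2.1, cf X.2.2)).
have /choice[cd hcd] : forall phi, exists n, (exists n X, w n = Some X /\ X.1 = phi) ->
    exists X, w n = Some X /\ X.1 = phi.
  move=> phi; have [[n [X h]]|n] := pselect (exists n X, w n = Some X /\ X.1 = phi).
    by exists n => _; exists X.
  by exists 0%N.
exists [set phi | exists n X, w n = Some X /\ X.1 = phi], cd; split.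
- move=> phi phi'; rewrite !inE => h h' E; have [X [h1 <-]] := hcd _ h.
  by have [X' [h1' <-]] := hcd _ h'; move: h1; rewrite E h1' => -[->].
- by move=> _ [n [X [wn <-]]]; have [] := wP _ _ wn.
- move=> x V xV.
  have /Bb[V' [BV V'x] V'V] := xV.
  have : nbhs x (V' `&` [set y | mdist x y < r / 2]).
    apply: filterI; last by apply: nbhs_mdist_lt; rewrite divr_gt0.
    by apply: open_nbhs_nbhs; split => //; exact: Bo.
  move=> /(small_chart S_surface)[phi [cphi p0 DV]].
  have xo : nbhs x (odisc phi).
    apply: open_nbhs_nbhs; split; first exact: odisc_open.
    by rewrite -p0; exists (0 : R * R) => //=; rewrite /normsq /= !expr0n /= addr0.
  have /Bb[U' [BU U'x] U'o] := xo.
  have PX : P (phi, (U', V')).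
    split => //=; last by move=> y /DV[].
    by apply: (fsmall_center (h := id) (x := x)) => y /DV[_ /ltW].
  have [n [[phi' [U'' V'']] [wn [/= cphi' sphi' [BU2 BV2] Uo DV2] [EU EV]]]] := wE _ PX.
  have EU' : U'' = U' by apply: cfi; rewrite ?inE.
  have EV' : V'' = V' by apply: cfi; rewrite ?inE.
  exists phi'; split; first by exists n, (phi', (U'', V'')).
    by apply: Uo; rewrite EU'.
  by move=> y /DV2; rewrite EV' => /V'V.
Qed.

Lemma Gdelta_dense_compl (J : countType) (C : J -> set S) :
  (forall i, closed (C i) /\ interior (C i) = set0) ->
  Gdelta_dense [set x | forall i, ~ C i x].
Proof.
move=> hC; pose F n : set S := if @choice.unpickle J n is Datatypes.Some i then ~` C i else setT.
exists F.
  move=> n; rewrite /F; case: (choice.unpickle _) => [i|]; last first.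
    by split; [exact: openT|move=> O [x Ox] _; exists x].
  have [cC iC] := hC i; split; first exact: closed_openC.
  move=> O [x Ox] oO; apply: contrapT => h.
  have : set0 x.
    rewrite -iC; apply: (filterS _ (open_nbhs_nbhs (conj oO Ox))) => y Oy.
    by apply: contrapT => nC; apply: h; exists y.
  by [].
apply/seteqP; split => [x nC n _|x hF i].
  by rewrite /F; case: (choice.unpickle _) => [i|//]; exact: nC.
by have := hF (choice.pickle i) I; rewrite /F choice.pickleK.
Qed.

(** The conclusion of [tripod_meet] at scale [e], isolated so that the scale can enter a code. *)
Definition tripod_scale (e : R) (a1 a2 a3 : R * R) :=
  forall (T T' : set (R * R)) (b1 b2 b3 b1' b2' b3' : R * R), continuum T -> continuum T' ->
  T `<=` unit_disc -> T' `<=` unit_disc ->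
  [/\ T b1, T b2 & T b3] -> [/\ T' b1', T' b2' & T' b3'] ->
  [/\ normsq b1 = 1, normsq b2 = 1 & normsq b3 = 1] ->
  [/\ normsq b1' = 1, normsq b2' = 1 & normsq b3' = 1] ->
  [/\ mdist a1 b1 < e, mdist a2 b2 < e & mdist a3 b3 < e] ->
  [/\ mdist a1 b1' < e, mdist a2 b2' < e & mdist a3 b3' < e] ->
  T `&` T' !=set0.

Section Branching.
Variables (f : homeo S S) (c : R).
Hypothesis Hc : cwF_const f c.
Local Notation Q := (continua_dec (stab f)).

Definition branching phi z := exists a b d,
  [/\ Q (disc phi) z a, Q (disc phi) z b & Q (disc phi) z d] /\
  [/\ rim phi a, rim phi b, rim phi d & [/\ a <> b, a <> d & b <> d]].

(* By [tripod_meet], plaques reaching the rim near the same three points meet, so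
   up to intersection there are only countably many branching plaques. *)
Lemma branch_code phi : nice f c phi ->
  exists cd : S -> nat * ((int * int) * (int * int) * (int * int)), forall z z',
    disc phi z /\ branching phi z -> disc phi z' /\ branching phi z' -> cd z = cd z' ->
    Q (disc phi) z `&` Q (disc phi) z' !=set0.
Proof.
move=> [cphi np].
pose P z (N : nat) (a1 a2 a3 : R * R) :=
  [/\ [/\ Q (disc phi) z (phi a1), Q (disc phi) z (phi a2) & Q (disc phi) z (phi a3)],
    [/\ normsq a1 = 1, normsq a2 = 1 & normsq a3 = 1] & tripod_scale N.+1%:R^-1 a1 a2 a3].
have /choice[X hX] : forall z, exists X : nat * ((R * R) * (R * R) * (R * R)),
    branching phi z -> P z X.1 X.2.1.1 X.2.1.2 X.2.2.
  move=> z; have [[a [b [d [Qabd [[pa a1 Ea] [pb b1 Eb] [pd d1 Ed] []]]]]]|n] :=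
    pselect (branching phi z); last by exists (0%N, (0, 0, 0)).
  move: Qabd; rewrite -Ea -Eb -Ed => Qabd ab ad bd.
  have n1 : pa != pb by apply/eqP => E0; apply: ab; rewrite E0.
  have n2 : pa != pd by apply/eqP => E0; apply: ad; rewrite E0.
  have n3 : pb != pd by apply/eqP => E0; apply: bd; rewrite E0.
  have [e e0 he] := tripod_meet a1 b1 d1 n1 n2 n3.
  have [N hN] := ex_invS_lt e0.
  exists (N, (pa, pb, pd)) => _; split => //.
  move=> T T' x1 x2 x3 y1 y2 y3 h1 h2 h3 h4 h5 h6 h7 h8 [h9 h10 h11] [h12 h13 h14].
  by apply: (he T T' x1 x2 x3 y1 y2 y3) => //; split; apply: lt_trans hN.
(* Rim points are rounded to a grid of mesh [1 / (N + 1)]; [N] is itself part of the code, so equal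
   codes have a common scale. *)
pose q (N : nat) (p : R * R) := (Num.floor (N.+1%:R * p.1), Num.floor (N.+1%:R * p.2)).
have qP N p p' : q N p = q N p' -> mdist p p' < N.+1%:R^-1.
  move=> [/floor_close h1 /floor_close h2]; rewrite plane_dist_lt.
  move: h1 h2; rewrite -!mulrBr !normrM gtr0_norm ?ltr0n// => h1 h2.
  by rewrite -[_^-1]mulr1 !ltr_pdivlMl ?ltr0n// h1.
exists (fun z => ((X z).1, (q (X z).1 (X z).2.1.1, q (X z).1 (X z).2.1.2, q (X z).1 (X z).2.2))).
move=> z z' [Dz bz] [Dz' bz'] E.
have [[m1 m2 m3] [n1 n2 n3] h] := hX z bz; have [[m1' m2' m3'] [n1' n2' n3'] _] := hX z' bz'.
have EN : (X z).1 = (X z').1 by case: E.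
have E1 := congr1 (fun t => t.2.1.1) E; have E2 := congr1 (fun t => t.2.1.2) E.
have E3 := congr1 (fun t => t.2.2) E; move: E1 E2 E3; rewrite /= -EN => E1 E2 E3.
have [[kQ _] _ _] := np z Dz; have [[kQ' _] _ _] := np z' Dz'.
have [P1 P2] := chart_preimage_continuum cphi kQ (@dec_sub _ _ _ _ _).
have [P1' P2'] := chart_preimage_continuum cphi kQ' (@dec_sub _ _ _ _ _).
have [||w [w1 w2]] := h _ _ _ _ _ (X z').2.1.1 (X z').2.1.2 (X z').2.2 P1 P1' P2 P2'
  (And3 m1 m2 m3) (And3 m1' m2' m3') (And3 n1 n2 n3) (And3 n1' n2' n3').
- by rewrite !mdistxx invr_gt0 ltr0n.
- by split; apply: qP.
by exists (phi w).
Qed.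

(** A property of the whole leaf of [x], stated with stable continua through [x] as in [leafE]. *)
Definition good (Phi : set (R * R -> S)) x := forall phi, Phi phi -> forall C z,
  stab f C -> C x -> C z -> disc phi z -> ~ branching phi z.

Lemma good_leaf Phi x y C : good Phi x -> stab f C -> C x -> C y -> good Phi y.
Proof.
move=> gx sC Cx Cy phi Pphi C' z sC' C'y C'z; apply: (gx phi Pphi (C `|` C')).
- by apply: stabU => //; exists y.
- by left.
- by right.
Qed.

(** Branching plaques with equal codes meet and so lie on one leaf; each leaf is exhausted by
    countably many stable continua. An index pairs a code with a place in that exhaustion. *)
Lemma bad_cover (Phi : set (R * R -> S)) (cd : (R * R -> S) -> nat) :
  {in Phi &, injective cd} -> (forall phi, Phi phi -> nice f c phi) ->
  exists C : nat * nat -> set S, (forall i, C i = set0 \/ stab f (C i)) /\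
    forall x, good Phi x <-> forall i, ~ C i x.
Proof.
move=> cdi nP.
have /choice[bc hbc] : forall phi, exists cd' : S -> nat * ((int * int) * (int * int) * (int * int)),
    Phi phi -> forall z z', disc phi z /\ branching phi z -> disc phi z' /\ branching phi z' ->
    cd' z = cd' z' -> Q (disc phi) z `&` Q (disc phi) z' !=set0.
  move=> phi; have [Pp|n] := pselect (Phi phi); last first.
    by exists (fun=> (0%N, ((0, 0), (0, 0), (0, 0)))).
  by have [cd' h] := branch_code (nP _ Pp); exists cd'.
pose P (X : (R * R -> S) * S) := [/\ Phi X.1, disc X.1 X.2 & branching X.1 X.2].
have [w [wP wE]] := code_repr P (fun X => (cd X.1, bc X.1 X.2)).
have /choice[K hK] : forall X : nat * S, exists C,
    [/\ stab f C, C X.2 & leaf_plaque S_compact Hc X.1 X.2 `<=` C].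
  move=> [m z] /=; have [C [sC PC Cx _]] := open_plaque_stab (leaf_plaque_open S_compact Hc m z)
    (leaf_plaque_refl S_compact Hc m z) (leaf_plaque_refl S_compact Hc m z).
  by exists C.
exists (fun i => if w i.1 is Datatypes.Some X then K (i.2, X.2) else set0); split.
  move=> [n m] /=; case: (w n) => [[phi z]|]; last by left.
  by right; have [sC _ _] := hK (m, z).
move=> x; split => [gx [n m] /=|nC phi Pphi C z sC Cx Cz Dz bz].
  case E: (w n) => [[phi z]|] //; have [sC Cz _] := hK (m, z) => Cx.
  have [Pphi Dz bz] := wP _ _ E.
  exact: (gx phi Pphi _ z sC Cx Cz Dz bz).
have [n [[phi' z'] [wn [/= P' Dz' bz'] []]]] := wE (phi, z) (And3 Pphi Dz bz).
move=> /cdi; rewrite !inE => /(_ P' Pphi) E; subst phi' => E2.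
have [y [Qy Qy']] := hbc phi Pphi z' z (conj Dz' bz') (conj Dz bz) E2.
have [_ np] := nP _ Pphi; have [sQ _ _] := np z Dz; have [sQ' _ _] := np z' Dz'.
pose T := C `|` Q (disc phi) z `|` Q (disc phi) z'.
have sT : stab f T.
  apply: stabU => //; first by exists y; split => //; right.
  by apply: stabU => //; exists z; split => //; exact: dec_refl.
have Tz' : T z' by right; exact: dec_refl.
have Tx : T x by left; left.
have [m hm] := stab_sub_leaf_plaque S_compact Hc sT Tz'.
have [_ _ hk] := hK (m, z').
by apply: (nC (n, m)); rewrite /= wn; apply: hk; exact: hm.
Qed.

End Branching.
End GoodLeaves.

(** * Irreducible continua and arcs *)

Section Irreducible.
Context {R : realType} {S : metricType R}.
Implicit Types (x y z u v w : S) (A B C D E F K L O U V W T Y : set S).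
Hypothesis S_compact : compact [set: S].
Hypothesis S_countable : @second_countable S.

Lemma continuum_closed A : continuum A -> closed A.
Proof. by move=> [cA _]; exact: compact_closedS. Qed.

Lemma closed_continuum A : closed A -> connected A -> continuum A.
Proof. by move=> cA kA; split => //; exact: closed_compactS. Qed.

Lemma set1_continuum z : continuum [set z].
Proof. by split; [exact: compact_set1|exact: connected1]. Qed.

(** A clopen part of the remainder that contains [z] becomes clopen in [A] once the removed piece is
    added; one that misses [z] is already clopen in [A]. *)
Lemma connected_avoid A z O1 O2 : connected A -> A z -> open O1 -> open O2 ->
  ~ O1 z -> ~ O2 z -> (forall y, A y -> y <> z -> O1 y \/ O2 y) ->
  A `&` O1 `&` O2 = set0 -> connected (A `\` O2).
Proof.
move=> cA Az oO1 oO2 n1 n2 cov dis B [b Bb] [U oU BU] [F cF BF].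
have disj y : A y -> O1 y -> ~ O2 y.
  by move=> Ay Oy Oy'; have : set0 y by rewrite -dis.
have BA y : B y -> A y /\ ~ O2 y by rewrite BU => -[[]].
have [Bz|nBz] := pselect (B z).
- have E : B `|` (A `&` O2) = A.
    apply: cA; first by exists b; left.
      exists (U `|` O2); first exact: openU.
      apply/seteqP; split => [y [By|[Ay Oy]]|y [Ay [Uy|Oy]]].
      + by split; [case: (BA y By)|left; move: By; rewrite BU => -[]].
      + by split => //; right.
      + have [?|n] := pselect (O2 y); first by right.
        by left; rewrite BU; split.
      + by right.
    exists (F `|` ~` O1).
      by apply: closedU => //; exact: open_closedC.
    apply/seteqP; split => [y [By|[Ay Oy]]|y [Ay [Fy|nOy]]].
    + by split; [case: (BA y By)|left; move: By; rewrite BF => -[]].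
    + by split => //; right => Oy'; exact: disj Oy' Oy.
    + have [?|n] := pselect (O2 y); first by right.
      by left; rewrite BF; split.
    + have [->|yz] := pselect (y = z); first by left.
      by have [//|?] := cov y Ay yz; right.
  apply/seteqP; split => [y /BA//|y [Ay nOy]].
  by have : A y by []; rewrite -{1}E => -[//|[_]].
- have E : B = A.
    apply: cA; first by exists b.
      exists (U `&` O1); first exact: openI.
      apply/seteqP; split => [y By|y [Ay [Uy Oy]]]; last first.
        by rewrite BU; split => //; split => //; exact: disj.
      have [Ay nOy] := BA y By; split => //; split; first by move: By; rewrite BU => -[].
      have yz : y <> z by move=> E; apply: nBz; rewrite -E.
      by have [] := cov y Ay yz.
    exists (F `&` ~` O2); first by apply: closedI => //; exact: open_closedC.
    by rewrite BF; apply/seteqP; split => y; [case=> -[]|case=> ? []].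
  by case: nBz; rewrite E.
Qed.

Definition irred K u v := [/\ continuum K, K u, K v & forall A, continuum A ->
  A `<=` K -> A u -> A v -> K `<=` A].

(** Brouwer reduction: stage [n] passes, if possible, to a subcontinuum through [u] and [v] that
    misses the basic open set of code [n]. A proper subcontinuum of the limit through [u] and [v]
    would miss a basic set that meets the limit. *)
Lemma irred_ex C u v : continuum C -> C u -> C v -> exists2 K, K `<=` C & irred K u v.
Proof.
move=> cC Cu Cv; have [B cB [Bo Bb]] := S_countable.
have /countable_injP[cf cfi] := cB.
have /choice[nx hnx] : forall X : nat * set S, exists A, A `<=` X.2 /\
    (continuum X.2 -> X.2 u -> X.2 v -> [/\ continuum A, A u, A v &
      forall A' V, B V -> cf V = X.1 -> continuum A' -> A' `<=` X.2 -> A' u -> A' v ->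
        A' `&` V = set0 -> A `&` V = set0]).
  move=> [n X] /=.
  have [[A [V [BV Vn cA AX [Au Av AV]]]]|h] := pselect (exists A V,
    [/\ B V, cf V = n, continuum A, A `<=` X & [/\ A u, A v & A `&` V = set0]]).
    exists A; split => // _ _ _; split => // A' V' BV' Vn' _ _ _ _ _.
    by rewrite (cfi V' V) ?inE// Vn' Vn.
  exists X; split => // cX Xu Xv; split => // A' V BV Vn cA AX Au Av AV.
  by case: h; exists A', V.
pose K := fix K n := if n is m.+1 then nx (m, K m) else C.
have hK n : [/\ continuum (K n), K n u & K n v].
  elim: n => [//|n [h1 h2 h3]]; have [_ h] := hnx (n, K n).
  by have [] := h h1 h2 h3.
have KS n : K n.+1 `<=` K n by have [] := hnx (n, K n).
have Kle m n : (m <= n)%N -> K n `<=` K m.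
  by move=> /subnKC <-; elim: (n - m)%N => [|k IH]; rewrite ?addn0// addnS => y /KS/IH.
have [G [UG _ GN]] : exists G : set_system nat, [/\ UltraFilter G,
    \forall n \near G, True & forall N, \forall n \near G, (N <= n)%N].
  by apply: ultra_frequently => N; exists N.
pose K' := ulim G K.
have K'K m : K' `<=` K m.
  apply: ulim_sub; first by apply: continuum_closed; case: (hK m).
  by apply: (nearS1 (GN m)) => n; exact: Kle.
exists K'; first exact: (K'K 0%N).
split.
- by apply: (ulim_continuum S_compact UG); apply: nearW => n; case: (hK n).
- by apply: ulim_const; apply: nearW => n; case: (hK n).
- by apply: ulim_const; apply: nearW => n; case: (hK n).
- move=> A cA AK Au Av y Ky; apply: contrapT => nAy.
  have [V [BV Vy] VA] : filter_from [set U | B U /\ U y] id (~` A).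
    by apply: Bb; apply: open_nbhs_nbhs; split => //; apply: closed_openC; exact: continuum_closed.
  have [h1 h2 h3] := hK (cf V); have [_ h] := hnx (cf V, K (cf V)).
  have [_ _ _ h'] := h h1 h2 h3.
  have : (K (cf V).+1 `&` V) y by split => //; exact: K'K.
  rewrite (h' A V)//.
  - by move=> z /AK; exact: K'K.
  - by rewrite -subset0 => z [Az /VA].
Qed.

Section Arc.
Variables (K : set S) (u v : S).
Hypotheses (iK : irred K u v) (lK : lc_subset K) (uv : u <> v).

Let cK : continuum K. Proof. by case: iK. Qed.
Let Ku : K u. Proof. by case: iK. Qed.
Let Kv : K v. Proof. by case: iK. Qed.
Let minK A : continuum A -> A `<=` K -> A u -> A v -> K `<=` A.
Proof. by case: iK => _ _ _; apply. Qed.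

(** If the component of [u] in [K] without [z] contained [v], local connectedness would give a
    continuum from [u] to [v] inside it, against irreducibility. *)
Lemma irred_cut z : K z -> z <> u -> z <> v -> exists O1 O2,
  [/\ open O1 /\ open O2, ~ O1 z /\ ~ O2 z, O1 u /\ O2 v,
      (forall y, K y -> y <> z -> O1 y \/ O2 y) /\ K `&` O1 `&` O2 = set0 &
      forall w, K w -> O1 w -> exists A, [/\ continuum A, A `<=` K, A u, A w & ~ A z]].
Proof.
move=> Kz zu zv; have o1 : open (~` [set z]) by apply: closed_openC; exact: closed_set1.
set L := connected_component (K `&` ~` [set z]) u.
have [ O oO LE] := lc_component_open u lK o1; rewrite -/L in LE.
have Lu : L u by apply: connected_component_refl; split => // /esym.
have LK : L `<=` K `&` ~` [set z] by exact: connected_component_sub.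
have chain w : L w -> exists A, [/\ continuum A, A `<=` L, A u & A w].
  move=> Lw; apply: (lc_continuum_chainable S_compact (continuum_closed cK) lK oO LE) => //.
  exact: component_connected.
have clL y : K y -> y <> z -> closure L y -> L y.
  move=> Ky yz cLy; have [ O' oO' LE'] := lc_component_open y lK o1.
  have Ly : connected_component (K `&` ~` [set z]) y y by exact: connected_component_refl.
  have O'y : O' y by move: Ly; rewrite LE' => -[].
  have [w [Lw O'w]] := cLy O' (open_nbhs_nbhs (conj oO' O'y)).
  have : connected_component (K `&` ~` [set z]) y w by rewrite LE'; split => //; case: (LK w Lw).
  by move=> /connected_component_sym; exact: connected_component_trans Lw.
exists (O `&` ~` [set z]), (~` closure L `&` ~` [set z]); split.
- by split; apply: openI => //; apply: closed_openC; exact: closed_closure.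
- by split => -[_]; apply.
- split; split; try by apply/eqP; rewrite eq_sym; apply/eqP.
    by move: Lu; rewrite LE => -[].
  move=> cLv; have Lv : L v by apply: clL => //; exact/nesym.
  have [A [cA AL Au Av]] := chain v Lv.
  have AK : A `<=` K by move=> y /AL/LK[].
  have Az := minK cA AK Au Av Kz; have [_] := LK _ (AL _ Az); exact.
- split.
    move=> y Ky yz; have [cLy|n] := pselect (closure L y); last by right.
    by left; split => //; have := clL y Ky yz cLy; rewrite LE => -[].
  rewrite -subset0 => y [[Ky [Oy _]] [ncL _]]; apply: ncL; apply: subset_closure.
  by rewrite LE.
- move=> w Kw [Ow _]; have [|A [cA AL Au Aw]] := chain w; first by rewrite LE.
  exists A; split => //; first by move=> y /AL/LK[].
  by move=> /AL/LK[_]; apply.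
Qed.

(** The initial segment from [u] to [z] of the arc to be found; inclusion of segments will be its
    order. *)
Definition seg z : set S :=
  [set y | forall A, continuum A -> A `<=` K -> A u -> A z -> A y].

Lemma seg_min z A : continuum A -> A `<=` K -> A u -> A z -> seg z `<=` A.
Proof. by move=> cA AK Au Az y; apply. Qed.

Lemma seg_end : seg v = K.
Proof.
apply/seteqP; split; first exact: seg_min.
by move=> y Ky A cA AK Au Av; exact: minK.
Qed.

Lemma seg_start : seg u = [set u].
Proof.
apply/seteqP; split; first by apply: seg_min => //; [exact: set1_continuum|move=> _ ->].
by move=> _ -> A.
Qed.

Lemma seg_cut z O1 O2 : K z -> open O1 -> open O2 -> ~ O1 z -> ~ O2 z -> O1 u -> O2 v ->
  (forall y, K y -> y <> z -> O1 y \/ O2 y) -> K `&` O1 `&` O2 = set0 ->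
  seg z = K `\` O2 /\ continuum (seg z).
Proof.
move=> Kz oO1 oO2 n1 n2 O1u O2v cov dis.
have disj y : K y -> O1 y -> ~ O2 y.
  by move=> Ay Oy Oy'; have : set0 y by rewrite -dis.
have rem A : continuum A -> A `<=` K -> A z -> continuum (A `\` O2).
  move=> cA AK Az; apply: closed_continuum.
    by apply: closedI; [exact: continuum_closed|exact: open_closedC].
  apply: (connected_avoid cA.2 Az oO1 oO2 n1 n2); first by move=> y /AK; exact: cov.
  by rewrite -subset0 -dis => y [[/AK]].
have cB : continuum (K `\` O1).
  apply: closed_continuum.
    by apply: closedI; [exact: continuum_closed|exact: open_closedC].
  apply: (connected_avoid cK.2 Kz oO2 oO1 n2 n1); first by move=> y Ky yz; have [] := cov y Ky yz; [right|left].
  by rewrite -subset0 -dis => y [[Ky h1] h2].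
have E : seg z = K `\` O2; last by rewrite E; split => //; exact: rem.
apply/seteqP; split.
  by apply: seg_min; [exact: rem|move=> y []|split => //; exact: disj|].
move=> y [Ky nOy] A cA AK Au Az.
have [->//|yz] := pselect (y = z).
have Oy : O1 y by have [] := cov y Ky yz.
have cU : continuum ((A `\` O2) `|` (K `\` O1)).
  by apply: continuumU => //; [exists z|exact: rem].
have [] : ((A `\` O2) `|` (K `\` O1)) y; last 2 first.
- by move=> [].
- by move=> [].
apply: (minK cU) => //.
- by move=> w [[/AK]|[]].
- by left; split => //; exact: disj.
- by right; split => // Ov; exact: disj Ov O2v.
Qed.

Lemma seg_continuum z : K z -> [/\ continuum (seg z), seg z u, seg z z & seg z `<=` K].
Proof.
move=> Kz; split; [|by move=> A|by move=> A|exact: seg_min].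
have [->|zu] := pselect (z = u); first by rewrite seg_start; exact: set1_continuum.
have [->|zv] := pselect (z = v); first by rewrite seg_end.
have [ O1 [ O2 [[? ?] [? ?] [? ?] [? ?] _]]] := irred_cut Kz zu zv.
by have [] := @seg_cut z O1 O2.
Qed.

Let seg_lt1 z w : K z -> K w -> z <> w -> z <> v ->
  (seg z `<=` seg w /\ ~ seg z w) \/ (seg w `<=` seg z /\ ~ seg w z).
Proof.
move=> Kz Kw zw zv.
have [zu|zu] := pselect (z = u).
  by left; rewrite zu seg_start; split => [_ -> A //|/= wu]; apply: zw; rewrite zu wu.
have [ O1 [ O2 [[oO1 oO2] [n1 n2] [ O1u O2v] [cov dis] H]]] := irred_cut Kz zu zv.
have [E cE] := seg_cut Kz oO1 oO2 n1 n2 O1u O2v cov dis.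
have [ O1w|O2w] := cov w Kw (nesym zw).
  right; have [A [cA AK Au Aw nAz]] := H w Kw O1w; split.
    apply: seg_min => //; first by rewrite E => y [].
    rewrite E; split => // O2w; have : set0 w by rewrite -dis.
    by [].
  by move=> sz; apply: nAz; exact: (seg_min cA AK Au Aw sz).
left; split; last by rewrite E => -[].
have [cw wu ww wK] := seg_continuum Kw.
apply: seg_min => //; apply: contrapT => nz.
have nO : ~ O1 w by move=> O1w; have : set0 w by rewrite -dis.
apply: (nO); apply: (connected_open_split cw.2 oO1 oO2) => //.
- by move=> y sy; apply: cov; [exact: wK|move=> yz; apply: nz; rewrite -yz].
- by rewrite -subset0 -dis => y [[/wK]].
- by exists u.
Qed.

Lemma seg_lt z w : K z -> K w -> z <> w ->
  (seg z `<=` seg w /\ ~ seg z w) \/ (seg w `<=` seg z /\ ~ seg w z).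
Proof.
move=> Kz Kw zw; have [zv|zv] := pselect (z = v); last exact: seg_lt1.
have [] := seg_lt1 Kw Kz (nesym zw); first by rewrite -zv; exact/nesym.
  by right.
by left.
Qed.

(** Points close to [z] lie in one small connected subset of [K], so the segment of either is
    contained in that of the other together with the closure of this subset. *)
Lemma seg_near z (e : R) : K z -> 0 < e -> exists2 d : R, 0 < d & forall w w', K w ->
  K w' -> mdist z w < d -> mdist z w' < d ->
  forall y, seg w y -> exists2 y', seg w' y' & mdist y y' <= e.
Proof.
move=> Kz e0; have e20 : 0 < e / 2 by rewrite divr_gt0.
have [W [ O [WK cW Wz oO [Oz KO]]]] := lK Kz (nbhs_mdist_lt z e20).
have [d d0 hd] := nbhs_mdist_ex (open_nbhs_nbhs (conj oO Oz)).
exists d => // w w' Kw Kw' zw zw' y sy.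
have Ww : W w by apply: KO; split => //; exact: hd.
have Ww' : W w' by apply: KO; split => //; exact: hd.
have [cw wu ww wK] := seg_continuum Kw'.
have cU : continuum (seg w' `|` closure W).
  apply: continuumU => //; first by exists w'; split => //; exact: subset_closure.
  exact: closure_continuum.
have clWK : closure W `<=` K.
  rewrite [X in _ `<=` X](closure_id K).1; last exact: continuum_closed.
  by apply: closureS => y' /WK[].
have := seg_min cU _ _ _ sy; case.
- by move=> y' [/wK|/clWK].
- by left.
- by right; apply: subset_closure.
- by exists y => //; rewrite mdistxx ltW.
move=> cWy; exists w' => //.
have sub : closure W `<=` [set y | mdist z y <= e / 2].
  rewrite [X in _ `<=` X](closure_id _).1; last exact: mdist_closed_le.
  by apply: closureS => y' /WK[_ /= h]; exact: ltW.
have h1 := sub _ cWy; have h2 := sub _ (subset_closure Ww').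
by have := metric_triangle y z w'; rewrite (mdist_sym y z); rewrite /= in h1 h2; lra.
Qed.
End Arc.
End Irreducible.

(** * Parametrisation of irreducible continua *)

Section Arcs.
Context {R : realType} {S : metricType R}.
Implicit Types (x y z u v w : S) (A B C D E F K L O U V W T Y : set S).
Hypothesis S_compact : compact [set: S].
Hypothesis S_countable : @second_countable S.

Lemma dense_seq x0 : exists q : nat -> S, forall y V, nbhs y V -> exists n, V (q n).
Proof.
have [B cB [Bo Bb]] := S_countable; have /countable_injP[cf cfi] := cB.
have /choice[q hq] : forall n, exists y, forall V, B V -> cf V = n -> V !=set0 -> V y.
  move=> n; have [[V [BV Vn [y Vy]]]|h] := pselect (exists V, [/\ B V, cf V = n & V !=set0]).
    by exists y => V' BV' Vn' _; rewrite (cfi V' V) ?inE// Vn' Vn.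
  by exists x0 => V BV Vn V0; case: h; exists V.
exists q => y V /Bb[V' [BV' V'y] V'V]; exists (cf V'); apply: V'V.
by apply: (hq _ V' BV' erefl); exists y.
Qed.

(** Mutually inverse bijections between [K] and the unit interval, with continuity in epsilon-delta
    form because the values elsewhere are arbitrary. *)
Definition arc_map (K : set S) u v (g : S -> R) (h : R -> S) :=
  [/\ [/\ g u = 0, g v = 1 & h 0 = u /\ h 1 = v],
      forall z, K z -> [/\ 0 <= g z <= 1 & h (g z) = z],
      forall t, 0 <= t <= 1 -> K (h t) /\ g (h t) = t,
      forall z (e : R), K z -> 0 < e -> exists2 d : R, 0 < d & forall w, K w ->
        mdist z w < d -> `|g z - g w| < e &
      forall t (e : R), 0 <= t <= 1 -> 0 < e -> exists2 d : R, 0 < d & forall s,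
        0 <= s <= 1 -> `|t - s| < d -> mdist (h t) (h s) < e].

Section Param.
Variables (K : set S) (u v : S).
Hypotheses (iK : irred K u v) (lK : lc_subset K) (uv : u <> v).

Let cK : continuum K. Proof. by case: iK. Qed.
Let Ku : K u. Proof. by case: iK. Qed.
Let Kv : K v. Proof. by case: iK. Qed.

(* [g z] sums, with weights [2 ^- k], the distances from the points of a dense
   sequence to [seg K u z], which increases with [z]. *)
Lemma irred_height : exists g : S -> R,
  (forall z w, K z -> K w -> g z = g w -> z = w) /\
  (forall z (e : R), K z -> 0 < e -> exists2 d : R, 0 < d & forall w, K w ->
     mdist z w < d -> `|g z - g w| < e) /\
  (forall z, K z -> g v <= g z <= g u).
Proof.
have [q hq] := dense_seq u; have [M hM] := mdist_bounded S_compact.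
have M0 : 0 <= M by apply: le_trans (hM u u I I); exact: mdist_ge0.
have /choice[m hm] : forall X : S * nat, exists r, K X.1 ->
    (exists2 y, seg K u X.1 y & r = mdist (q X.2) y) /\
    forall y, seg K u X.1 y -> r <= mdist (q X.2) y.
  move=> [z n] /=; have [Kz|] := pselect (K z); last by exists 0.
  have [[kz _] zu _ _] := seg_continuum S_compact iK lK Kz.
  have [|y sy hy] := nearest (q n) kz; first by exists u.
  by exists (mdist (q n) y) => _; split => //; exists y.
pose md k z := m (z, k).
have md_ge0 k z : K z -> 0 <= md k z.
  by move=> Kz; have [[y _ E] _] := hm (z, k) Kz; rewrite /md E mdist_ge0.
have md_leM k z : K z -> md k z <= M.
  by move=> Kz; have [[y _ E] _] := hm (z, k) Kz; rewrite /md E; exact: hM.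
have md_mono k z w : K z -> K w -> seg K u z `<=` seg K u w -> md k w <= md k z.
  move=> Kz Kw zw; have [[y sy E] _] := hm (z, k) Kz; have [_ h] := hm (w, k) Kw.
  by rewrite {2}/md E; apply: h; exact: zw.
have md_strict z w : K z -> K w -> seg K u z `<=` seg K u w -> ~ seg K u z w ->
    exists k, md k w < md k z.
  move=> Kz Kw zw nw; have [cz zu zz zK] := seg_continuum S_compact iK lK Kz.
  have o1 : open (~` seg K u z) by apply: closed_openC; exact: continuum_closed cz.
  have [e e0 he] := nbhs_mdist_ex (open_nbhs_nbhs (conj o1 nw)).
  (* A point of the dense sequence within [e / 2] of [w] is closer to [w] than to the segment of
     [z], whose points are at distance at least [e] from [w]. *)
  have [k /= hk] := hq w _ (nbhs_mdist_lt w (divr_gt0 e0 (ltr0Sn R 1))).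
  exists k; have [_ h2] := hm (w, k) Kw; have [[y sy E] _] := hm (z, k) Kz.
  have [_ _ ww _] := seg_continuum S_compact iK lK Kw.
  have h3 : e <= mdist w y by rewrite leNgt; apply/negP => /he; apply.
  have h4 := metric_triangle w (q k) y; have h5 := h2 w ww.
  by rewrite {2}/md E; rewrite /= (mdist_sym (q k) w) in h5; rewrite /md; lra.
pose gn n z := \sum_(k < n) (2^-1 ^+ k) * md k z.
have w0 k : 0 <= (2^-1 : R) ^+ k by rewrite exprn_ge0// invr_ge0.
have sumw n : \sum_(k < n) (2^-1 : R) ^+ k <= 2.
  have : \sum_(k < n) (2^-1 : R) ^+ k = 2 - 2 * 2^-1 ^+ n.
    elim: n => [|n IH]; first by rewrite big_ord0 expr0; lra.
    by rewrite big_ord_recr /= IH exprS; lra.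
  by move=> ->; have := w0 n; lra.
have gn_ub n z : K z -> gn n z <= 2 * M.
  move=> Kz; apply: le_trans (_ : (\sum_(k < n) (2^-1 : R) ^+ k) * M <= _).
    rewrite mulr_suml; apply: ler_sum => k _; apply: ler_wpM2l => //; exact: md_leM.
  by apply: ler_wpM2r.
have gn_S n z : K z -> gn n z <= gn n.+1 z.
  by move=> Kz; rewrite /gn big_ord_recr /= lerDl mulr_ge0// md_ge0.
have gn_le n n' z : K z -> (n <= n')%N -> gn n z <= gn n' z.
  move=> Kz /subnKC <-; elim: (n' - n)%N => [|j IH]; first by rewrite addn0.
  by rewrite addnS; apply: le_trans IH _; exact: gn_S.
pose g z := sup (range (gn ^~ z)).
have g_sup z : K z -> has_sup (range (gn ^~ z)).
  move=> Kz; split; first by exists (gn 0%N z), 0%N.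
  by exists (2 * M) => _ [n _ <-]; exact: gn_ub.
have g_ge n z : K z -> gn n z <= g z.
  by move=> Kz; apply: sup_upper_bound; [exact: g_sup|exists n].
have g_le z r : K z -> (forall n, gn n z <= r) -> g z <= r.
  by move=> Kz h; apply: ge_sup; [exists (gn 0%N z), 0%N|move=> _ [n _ <-]].
have g_close z w (e : R) : K z -> K w -> 0 <= e ->
    (forall k, md k z <= md k w + e) -> g z <= g w + 2 * e.
  move=> Kz Kw e0 h; apply: g_le => // n; apply: le_trans (_ : gn n w + 2 * e <= _); last first.
    by rewrite lerD2r g_ge.
  apply: le_trans (_ : gn n w + (\sum_(k < n) (2^-1 : R) ^+ k) * e <= _); last first.
    by rewrite lerD2l; apply: ler_wpM2r.
  rewrite mulr_suml -big_split; apply: ler_sum => k _ /=.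
  by rewrite -mulrDr; apply: ler_wpM2l.
have g_strict z w : K z -> K w -> seg K u z `<=` seg K u w -> ~ seg K u z w -> g w < g z.
  move=> Kz Kw zw nw; have [k hk] := md_strict z w Kz Kw zw nw.
  pose d := 2^-1 ^+ k * (md k z - md k w).
  have d0 : 0 < d by rewrite mulr_gt0 ?subr_gt0// exprn_gt0// invr_gt0.
  suff : g w <= g z - d by lra.
  apply: g_le => // n; apply: le_trans (_ : gn (maxn n k.+1) w <= _).
    by apply: gn_le => //; exact: leq_maxl.
  apply: le_trans (_ : gn (maxn n k.+1) z - d <= _); last by rewrite lerD2r g_ge.
  rewrite lerBrDr; set N := maxn n k.+1.
  have kN : (k < N)%N by rewrite leq_maxr.
  rewrite /gn (bigD1 (Ordinal kN))//= [leRHS](bigD1 (Ordinal kN))//= /d.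
  set s1 := \sum_(_ < _ | _) _; set s2 := \sum_(_ < _ | _) _.
  have : s1 <= s2.
    by apply: ler_sum => i _; apply: ler_wpM2l => //; exact: md_mono.
  by rewrite mulrBr; lra.
exists g; split; [|split].
- move=> z w Kz Kw E; apply: contrapT => zw.
  have [[s n]|[s n]] := seg_lt S_compact iK lK Kz Kw zw.
    by have := g_strict _ _ Kz Kw s n; rewrite E ltxx.
  by have := g_strict _ _ Kw Kz s n; rewrite E ltxx.
- move=> z e Kz e0; have e40 : 0 < e / 4 by rewrite divr_gt0.
  have [d d0 hd] := seg_near S_compact iK lK Kz e40.
  have half w w' : K w -> K w' -> mdist z w < d -> mdist z w' < d -> g w <= g w' + 2 * (e / 4).
    move=> Kw Kw' zw zw'; apply: g_close => //; first exact: ltW.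
    move=> k; have [[y sy E] _] := hm (w', k) Kw'; have [_ h] := hm (w, k) Kw.
    have [y' sy' yy'] := hd w' w Kw' Kw zw' zw y sy.
    have h1 := h y' sy'; have := metric_triangle (q k) y y'.
    by rewrite [in X in _ <= X -> _]/= in E *; rewrite {2}/md E /md; rewrite /= in h1; lra.
  exists d => // w Kw zw; have z0 : mdist z z < d by rewrite mdistxx.
  have h1 := half z w Kz Kw z0 zw; have h2 := half w z Kw Kz zw z0.
  by rewrite ltr_norml; apply/andP; split; lra.
- move=> z Kz; apply/andP; split.
    have [->//|zv] := pselect (z = v).
    have [[s n]|[s n]] := seg_lt S_compact iK lK Kz Kv zv.
      exact: ltW (g_strict _ _ Kz Kv s n).
    by case: n; rewrite (seg_end iK).
  have [->//|zu] := pselect (z = u).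
  apply: ltW; apply: g_strict => //; first by rewrite (seg_start iK) => _ -> A.
  by rewrite (seg_start iK).
Qed.

Lemma irred_arc : exists g h, arc_map K u v g h.
Proof.
have [g [gi [gc gb]]] := irred_height.
have guv : g v < g u.
  have /andP[] := gb v Kv; rewrite le_eqVlt => _; rewrite le_eqVlt => /orP[/eqP E|//].
  by case: uv; apply: gi.
pose L := g u - g v; have L0 : 0 < L by rewrite subr_gt0.
(* Distances to larger segments are smaller, so [g] decreases from [u] to [v]; it is reversed and
   rescaled to run from 0 to 1. *)
pose G z := (g u - g z) / L.
have Gi z w : K z -> K w -> G z = G w -> z = w.
  move=> Kz Kw /(mulIf (invr_neq0 (lt0r_neq0 L0))) E; apply: gi => //.
  by move: E; clear; move=> E; apply: oppr_inj; apply: (addrI (g u)).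
have Gc z (e : R) : K z -> 0 < e -> exists2 d : R, 0 < d & forall w, K w ->
    mdist z w < d -> `|G z - G w| < e.
  move=> Kz e0; have [d d0 hd] := gc z (e * L) Kz (mulr_gt0 e0 L0).
  exists d => // w Kw zw; rewrite /G -mulrBl normrM (gtr0_norm (_ : 0 < L^-1)) ?invr_gt0//.
  rewrite ltr_pdivrMr//; have := hd w Kw zw.
  by rewrite distrC (_ : g u - g z - (g u - g w) = g w - g z)//; ring.
have G01 z : K z -> 0 <= G z <= 1.
  move=> /gb/andP[h1 h2]; rewrite /G ler_pdivrMr// mul1r lerD2l lerN2 h1 andbT.
  by apply: divr_ge0; [rewrite subr_ge0|exact: ltW].
have Gu : G u = 0 by rewrite /G subrr mul0r.
have Gv : G v = 1 by rewrite /G divff// lt0r_neq0.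
have wG : {within K, continuous G}.
  apply/subspace_continuousP => z Kz; apply/cvgrPdist_lt => e e0.
  have [d d0 hd] := Gc z e Kz e0.
  by apply/near_within_mdist; exists d => // w zw Kw; exact: hd.
have onto t : 0 <= t <= 1 -> exists2 z, K z & G z = t.
  move=> t01; have /connected_intervalP := connected_continuous_connected cK.2 wG.
  move=> /(_ 0 1 _ _ t)[]//; last by move=> z Kz <-; exists z.
  - by exists u.
  - by exists v.
have /choice[h hh] : forall t, exists z, 0 <= t <= 1 -> K z /\ G z = t.
  move=> t; have [/onto[z Kz Gz]|n] := pselect (0 <= t <= 1); first by exists z.
  by exists u.
have i0 : 0 <= (0 : R) <= 1 by rewrite lexx ler01.
have i1 : 0 <= (1 : R) <= 1 by rewrite lexx ler01.
have hG z : K z -> h (G z) = z.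
  by move=> Kz; have [Kh Gh] := hh _ (G01 z Kz); exact: Gi.
exists G, h; split => //.
- by split => //; rewrite -Gu -Gv !hG.
- by move=> z Kz; split; [exact: G01|exact: hG].
(* At a discontinuity, points [h s] with [s] tending to [t] have a limit [z] in [K] other than
   [h t], whereas continuity of [G] gives [G z = t]. *)
- move=> t e t01 e0; apply: contrapT => nd.
  have [W [UW Wt WP]] : exists W : set_system R, [/\ UltraFilter W, W --> t &
      \forall s \near W, 0 <= s <= 1 /\ e <= mdist (h t) (h s)].
    apply: ultra_cluster => V /nbhs_ballP[d /= d0 hd]; apply: contrapT => n; apply: nd.
    exists d => // s s01 ts; rewrite ltNge; apply/negP => es; apply: n; exists s => //.
    exact: hd.
  have [z hz] := ulim_ex S_compact UW h.
  have WK : \forall s \near W, K (h s) /\ G (h s) = s.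
    by apply: (nearS1 WP) => s [s01 _]; exact: hh.
  have Kz : K z.
    apply: (ulim_closed_mem UW _ hz); first exact: continuum_closed cK.
    by apply: (nearS1 WK) => s [].
  have Wz : (id : R -> R) @ W --> G z.
    apply/cvgrPdist_lt => r r0; have [d d0 hd] := Gc z r Kz r0.
    apply: (nearS2 WK (near_dist_lt hz d0)) => s [Ks Gs] zs.
    by rewrite /= -Gs; apply: hd.
  have E : t = G z by exact: (cvg_unique (@norm_hausdorff _ _) Wt Wz).
  have zE : z = h t by rewrite E hG.
  have [s [h1 [_ h2]]] := near_ex2 UW (near_dist_lt hz e0) WP.
  by move: h1; rewrite zE ltNge h2.
Qed.
End Param.
End Arcs.

(** * Continua without branching *)

Section Thin.
Context {R : realType} {S : metricType R}.
Implicit Types (x y z u v w : S) (A B C D E F J K L M O U V W T Y : set S).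
Hypothesis S_compact : compact [set: S].
Hypothesis S_countable : @second_countable S.

Definition hereditarily_lc C := forall K, continuum K -> K `<=` C -> lc_subset K.

(** The component of [z] leaves [O] through at most two points. This is the form in which the
    absence of branching plaques is used. *)
Definition thin_at C O z := [/\ open O, O z & forall a b d,
  (forall y, y = a \/ y = b \/ y = d ->
     connected_component (C `&` closure O) z y /\ ~ O y) ->
  [\/ a = b, a = d | b = d]].

Definition thin C := forall z V, C z -> nbhs z V ->
  exists2 O, thin_at C O z & closure O `<=` V.

Lemma component_sub (A B : set S) z : A `<=` B ->
  connected_component A z `<=` connected_component B z.
Proof.
move=> AB y Ay; have Az : A z by exact: connected_component_sub (connected_component_sym Ay).
apply: (connected_component_max _ _ (@component_connected _ A z)) => //.
  exact: connected_component_refl.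
by apply: subset_trans AB; exact: connected_component_sub.
Qed.

Lemma no_clopen_piece K W X : connected K -> W !=set0 -> W `<=` K -> X `<=` K `\` W ->
  closed X -> closed ((K `\` W) `\` X) -> closure W `&` X = set0 -> X = set0.
Proof.
move=> cK [w Ww] WK XK cX cX' WX; apply: contrapT => /eqP/set0P[b Xb].
have E : X = K.
  apply: cK; first by exists b.
    exists (~` (((K `\` W) `\` X) `|` closure W)).
      by apply: closed_openC; apply: closedU => //; exact: closed_closure.
    apply/seteqP; split => [y Xy|y [Ky n]].
      have [Ky _] := XK y Xy; split => // -[[_]|cWy]; first exact.
      have : set0 y by rewrite -WX.
      by [].
    apply: contrapT => nX; apply: n.
    have [Wy|nW] := pselect (W y); first by right; exact: subset_closure.
    by left.
  by exists X => //; apply/seteqP; split => [y Xy|y []//]; split => //; case: (XK y Xy).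
have Xw : X w by rewrite E; exact: WK.
by have [_] := XK _ Xw; apply.
Qed.

Section Frontier.
Variables (K O : set S) (z : S).
Hypotheses (cK : continuum K) (lK : lc_subset K) (oO : open O) (Kz : K z) (Oz : O z).
Let W := connected_component (K `&` O) z.

Lemma frontier_open : exists O', [/\ open O', O' z & W = K `&` O'].
Proof.
have [ O' oO' WE] := lc_component_open z lK oO; exists O'; split => //.
have : W z by apply: connected_component_refl.
by rewrite /W WE => -[].
Qed.

Lemma frontier_component : closure W `<=` connected_component (K `&` closure O) z.
Proof.
apply: connected_component_max.
- by apply: subset_closure; exact: connected_component_refl.
- have clK : closed (K `&` closure O).
    by apply: closedI; [exact: continuum_closed|exact: closed_closure].
  rewrite [X in _ `<=` X](closure_id _).1//; apply: closureS => y.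
  by move=> /connected_component_sub[Ky Oy]; split => //; exact: subset_closure.
- by apply: connected_closure; exact: component_connected.
Qed.

Lemma frontier_out y : closure W y -> O y -> W y.
Proof.
move=> cWy Oy.
have Ky : K y by have [] := connected_component_sub (frontier_component cWy).
have [ O' oO' WE] := lc_component_open y lK oO.
have Wy : connected_component (K `&` O) y y by exact: connected_component_refl.
have O'y : O' y by move: Wy; rewrite WE => -[].
have [w [Ww O'w]] := cWy O' (open_nbhs_nbhs (conj oO' O'y)).
have : connected_component (K `&` O) y w.
  by rewrite WE; split => //; case: (connected_component_sub Ww).
by move=> /connected_component_sym; exact: connected_component_trans Ww.
Qed.

End Frontier.

(** With only one exit, [K] without the component [W] of [z] would still be connected, a smaller
    continuum through [u] and [v]. *)
Lemma irred_frontier K O u v z : irred K u v -> lc_subset K -> open O -> K z -> O z ->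
  ~ closure O u -> ~ closure O v -> exists a b, [/\ a <> b,
    connected_component (K `&` closure O) z a /\ ~ O a &
    connected_component (K `&` closure O) z b /\ ~ O b].
Proof.
move=> [cK Ku Kv minK] lK oO Kz Oz nu nv.
set W := connected_component (K `&` O) z.
have Wz : W z by exact: connected_component_refl.
have WK : W `<=` K `&` O by exact: connected_component_sub.
have fc : closure W `<=` connected_component (K `&` closure O) z by exact: frontier_component.
have fo y : closure W y -> O y -> W y by exact: frontier_out.
have [ O' [oO' O'z WE]] := frontier_open lK oO Kz Oz.
apply: contrapT => nab.
have one a b : closure W a -> ~ O a -> closure W b -> ~ O b -> a = b.
  move=> Wa nOa Wb nOb; apply: contrapT => ab; apply: nab; exists a, b.
  by split => //; split => //; exact: fc.
have clKW : closed (K `\` W).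
  rewrite (_ : K `\` W = K `&` ~` O').
    by apply: closedI; [exact: continuum_closed|exact: open_closedC].
  apply/seteqP; split => y [Ky n]; split => //; first by move=> Oy; apply: n; rewrite /W WE.
  by rewrite /W WE => -[].
have nW y : ~ closure O y -> ~ W y by move=> n /WK[_ Oy]; apply: n; exact: subset_closure.
suff cKW : connected (K `\` W).
  have : (K `\` W) z.
    apply: (minK _ (closed_continuum S_compact clKW cKW)) => //.
    - by split => //; exact: nW.
    - by split => //; exact: nW.
  by case.
move=> B B0 [U oU BU] [F cF BF].
have BK : B `<=` K `\` W by rewrite BU => y [].
have clB : closed B by rewrite BF; exact: closedI.
have E' : (K `\` W) `\` B = (K `\` W) `&` ~` U.
  apply/seteqP; split => y [KWy n]; split => //; first by move=> Uy; apply: n; rewrite BU.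
  by rewrite BU => -[].
have clB' : closed ((K `\` W) `\` B).
  by rewrite E'; apply: closedI => //; exact: open_closedC.
have W0 : W !=set0 by exists z.
have WK' : W `<=` K by move=> y /WK[].
have [h|h] := pselect (closure W `&` B = set0).
  have E0 := no_clopen_piece cK.2 W0 WK' BK clB clB' h.
  by move: B0; rewrite E0 => -[].
have [a [Wa Ba]] : closure W `&` B !=set0 by apply/set0P/eqP.
have nOa : ~ O a by move=> /(fo a Wa) Wa'; have [_] := BK a Ba; apply.
suff E0 : (K `\` W) `\` B = set0.
  apply/seteqP; split => // y KWy; apply: contrapT => nB.
  by have : set0 y by rewrite -E0.
apply: (no_clopen_piece cK.2 W0 WK') => //.
  rewrite (_ : (K `\` W) `\` _ = B)//; apply/seteqP; split => y.
    by move=> [KWy n]; apply: contrapT => nB; apply: n.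
  by move=> By; split; [exact: BK|move=> [_]; apply].
rewrite -subset0 => b [Wb [[Kb nWb] nBb]].
have nOb : ~ O b by move=> /(fo b Wb).
by apply: nBb; rewrite -(one a b).
Qed.

Section InThin.
Variable C : set S.
Hypotheses (cC : continuum C) (hC : hereditarily_lc C) (tC : thin C).

Let lC : lc_subset C. Proof. exact: hC. Qed.
Let clC : closed C. Proof. exact: continuum_closed. Qed.

Lemma complement_component K y : closed K -> C y -> ~ K y ->
  exists O, [/\ open O, O y & connected_component (C `&` ~` K) y = C `&` O].
Proof.
move=> clK Cy nK; have oK : open (~` K) by exact: closed_openC.
by have [ O' [h1 h2 h3]] := @frontier_open C (~` K) y lC oK Cy nK; exists O'.
Qed.

(** The exit found here, which is outside [K], competes with the exits of [K], and thinness admits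
    only two in all. *)
Lemma complement_reach K O y z : closed K -> open O -> C y -> ~ K y ->
  connected_component (C `&` closure O) z y ->
  ~ (connected_component (C `&` ~` K) y `<=` closure O) ->
  exists d, [/\ connected_component (C `&` ~` K) y d,
    connected_component (C `&` closure O) z d & ~ O d].
Proof.
move=> clK oO Cy nKy Ey nsub; set J := connected_component (C `&` ~` K) y.
have [y' Jy' nOy'] : exists2 y', J y' & ~ closure O y'.
  by apply: contrapT => h; apply: nsub => y' Jy'; apply: contrapT => n; apply: h; exists y'.
have [ O1 [oO1 O1y JE]] := complement_component clK Cy nKy.
have Jy : J y by exact: connected_component_refl.
have [A [cA AJ Ay Ay']] := lc_continuum_chainable S_compact clC lC oO1 JE
  (@component_connected _ _ _) Jy Jy'.
have cOy : closure O y by have [] := connected_component_sub Ey.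
have [d Ad nd] := boundary_bumping S_compact cA (@closed_closure _ O) Ay cOy
  (fun h => nOy' (h y' Ay')).
have AC : A `<=` C by move=> q /AJ/connected_component_sub[].
exists d; split.
- by apply: AJ; case: (connected_component_sub Ad).
- apply: connected_component_trans Ey _; move: Ad; apply: component_sub; exact: setSI.
- move=> Od; apply: nd; apply: (filterS _ (open_nbhs_nbhs (conj oO Od))).
  exact: subset_closure.
Qed.

Lemma complement_closure K y : closed K -> C y -> ~ K y -> (exists2 z, C z & K z) ->
  exists2 z, closure (connected_component (C `&` ~` K) y) z & K z.
Proof.
move=> clK Cy nKy [z0 Cz0 Kz0]; set J := connected_component (C `&` ~` K) y.
have Jy : J y by exact: connected_component_refl.
have [ O1 [oO1 O1y JE]] := complement_component clK Cy nKy; rewrite -/J in JE.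
apply: contrapT => H.
have clJ : closure J `<=` J.
  move=> q cJq.
  have Cq : C q.
    rewrite (closure_id C).1//; move: cJq; apply: closureS => p.
    by move=> /connected_component_sub[].
  have nKq : ~ K q by move=> Kq; apply: H; exists q.
  by apply: (frontier_out cC lC) => //; exact: closed_openC.
have E : J = C.
  apply: cC.2; first by exists y.
    by exists O1.
  exists (closure J); first exact: closed_closure.
  apply/seteqP; split => [q Jq|q [_ /clJ]//]; split; last exact: subset_closure.
  by case: (connected_component_sub Jq).
by have := Cz0; rewrite -E => /connected_component_sub[_]; apply.
Qed.

Lemma interior_closure_complement K O z y : open O -> O z -> C `&` O `<=` K ->
  ~ closure (connected_component (C `&` ~` K) y) z.
Proof.
move=> oO Oz CO cz; have [q [/connected_component_sub[Cq nKq] Oq]] :=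
  cz O (open_nbhs_nbhs (conj oO Oz)).
by apply: nKq; apply: CO.
Qed.

Section Irred.
Variables (K : set S) (u v : S).
Hypotheses (iK : irred K u v) (KC : K `<=` C).

Let cK : continuum K. Proof. by case: iK. Qed.
Let clK : closed K. Proof. exact: continuum_closed cK. Qed.
Let lK : lc_subset K. Proof. exact: hC. Qed.

(** By [irred_frontier] the continuum [K] already uses both exits of [O], so a component of the rest
    of [C] near [z] has no way out. *)
Lemma thin_complement O z y : K z -> thin_at C O z -> ~ closure O u -> ~ closure O v ->
  connected_component (C `&` closure O) z y -> ~ K y ->
  connected_component (C `&` ~` K) y `<=` closure O.
Proof.
move=> Kz [oO Oz h] nu nv Ey nKy; apply: contrapT => nsub.
have [Cy _] := connected_component_sub Ey.
have [d [Jd Ed nOd]] := complement_reach clK oO Cy nKy Ey nsub.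
have [a [b [ab [Ea nOa] [Eb nOb]]]] := irred_frontier iK lK oO Kz Oz nu nv.
have KE : connected_component (K `&` closure O) z `<=` connected_component (C `&` closure O) z.
  by apply: component_sub; exact: setSI.
have [_ nKd] := connected_component_sub Jd.
have inK q : connected_component (K `&` closure O) z q -> K q.
  by move=> /connected_component_sub[].
case: (h a b d).
- by move=> q [->|[->|->]]; split => //; exact: KE.
- exact: ab.
- by move=> E; apply: nKd; rewrite -E; exact: inK.
- by move=> E; apply: nKd; rewrite -E; exact: inK.
Qed.

(** A component of the rest of [C] near [z] is trapped near [z] by [thin_complement], and its
    closure meets [K] at some [z'] other than [u] and [v]. The same lemma at [z'], with a
    neighbourhood whose closure avoids the point [y] of the component, traps the component away from
    [y]. *)
Lemma irred_interior z : K z -> z <> u -> z <> v ->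
  exists O, [/\ open O, O z & C `&` O `<=` K].
Proof.
move=> Kz zu zv.
have avoid x (A : set S) : closed A -> ~ A x -> nbhs x (~` A).
  by move=> cA nA; apply: open_nbhs_nbhs; split => //; exact: closed_openC.
have cl2 : closed [set u; v] by apply: closedU; exact: closed_set1.
have [|O tO OV] := tC (KC Kz) (avoid z [set u; v] cl2 _); first by case.
have [oO Oz _] := tO.
have nu : ~ closure O u by move=> /OV; apply; left.
have nv : ~ closure O v by move=> /OV; apply; right.
have [ O1 [oO1 O1z WE]] := frontier_open lC oO (KC Kz) Oz.
exists O1; split => // y [Cy O1y]; apply: contrapT => nKy.
have Wy : connected_component (C `&` O) z y by rewrite WE.
have Ey : connected_component (C `&` closure O) z y.
  by move: Wy; apply: component_sub; apply: setIS; exact: subset_closure.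
have JO := thin_complement Kz tO nu nv Ey nKy.
set J := connected_component (C `&` ~` K) y in JO.
have Jy : J y by exact: connected_component_refl.
have [z' cJz' Kz'] := complement_closure clK Cy nKy (ex_intro2 _ _ z (KC Kz) Kz).
have cOz' : closure O z'.
  by rewrite (closure_id (closure O)).1; [exact: closureS cJz'|exact: closed_closure].
have cl3 : closed ([set u; v] `|` [set y]) by apply: closedU => //; exact: closed_set1.
have nz' : ~ ([set u; v] `|` [set y]) z'.
  by case; [move=> h; exact: OV cOz' h|move=> /= E; apply: nKy; rewrite -E].
have [ O' tO' OV'] := tC (KC Kz') (avoid z' _ cl3 nz').
have [oO' Oz' _] := tO'.
have nu' : ~ closure O' u by move=> /OV'; apply; left; left.
have nv' : ~ closure O' v by move=> /OV'; apply; left; right.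
have ny' : ~ closure O' y by move=> /OV'; apply; right.
have [ O2 [oO2 O2z WE']] := frontier_open lC oO' (KC Kz') Oz'.
have [y' [Jy' O2y']] := cJz' O2 (open_nbhs_nbhs (conj oO2 O2z)).
have [Cy' nKy'] := connected_component_sub Jy'.
have Wy' : connected_component (C `&` O') z' y' by rewrite WE'.
have Ey' : connected_component (C `&` closure O') z' y'.
  by move: Wy'; apply: component_sub; apply: setIS; exact: subset_closure.
apply: ny'; apply: (thin_complement Kz' tO' nu' nv' Ey' nKy').
exact: connected_component_sym.
Qed.

Lemma complement_closure_ends y z : C y -> ~ K y ->
  closure (connected_component (C `&` ~` K) y) z -> K z -> z = u \/ z = v.
Proof.
move=> Cy nKy cz Kz; apply: contrapT => n.
have [ O [oO Oz CO]] : exists O, [/\ open O, O z & C `&` O `<=` K].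
  by apply: irred_interior => // E; apply: n; [left|right].
exact: interior_closure_complement oO Oz CO cz.
Qed.

End Irred.

Lemma connected_near A v w O : connected A -> A v -> A w -> v <> w -> open O -> O v ->
  exists y, [/\ A y, O y & y <> v].
Proof.
move=> cA Av Aw vw oO Ov; apply: contrapT => n.
have E : [set v] = A.
  apply: cA; first by exists v.
    exists O => //; apply/seteqP; split => [_ ->//|y [Ay Oy] /=].
    by apply: contrapT => yv; apply: n; exists y.
  exists [set v]; first exact: closed_set1.
  by apply/seteqP; split => [_ ->//|y [_]].
by move: Aw; rewrite -E => /= E'; apply: vw.
Qed.

(** Otherwise two different components of the rest of [C] come close to [x], as no single one
    accumulates there; both must leave [O], and with the exit of [K] this makes three. *)
Lemma boundary_component K x v : irred K x v -> K `<=` C -> x <> v ->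
  (forall O, open O -> O x -> ~ (C `&` O `<=` K)) ->
  exists y, [/\ C y, ~ K y & closure (connected_component (C `&` ~` K) y) x].
Proof.
move=> iK KC xv H; apply: contrapT => N.
have cK : continuum K by case: iK. have clK := continuum_closed cK.
have Kx : K x by case: iK.
have Kv : K v by case: iK.
have nbx : nbhs x (~` [set v]).
  by apply: open_nbhs_nbhs; split => //; apply: closed_openC; exact: closed_set1.
have [ O [oO Ox h] OV] := tC (KC _ Kx) nbx.
have nv : ~ closure O v by move=> /OV; apply.
have [ O1 [oO1 O1x WE]] := frontier_open lC oO (KC _ Kx) Ox.
have inE y : C y -> O1 y -> connected_component (C `&` closure O) x y.
  move=> Cy O1y; have Wy : connected_component (C `&` O) x y by rewrite WE.
  by move: Wy; apply: component_sub; apply: setIS; exact: subset_closure.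
have pick O' : open O' -> O' x -> exists y, [/\ C y, O' y & ~ K y].
  move=> oO' O'x; apply: contrapT => n; apply: (H O' oO' O'x) => y [Cy O'y].
  by apply: contrapT => nK; apply: n; exists y.
have reach y : C y -> O1 y -> ~ K y -> exists d,
    [/\ connected_component (C `&` ~` K) y d, connected_component (C `&` closure O) x d & ~ O d].
  move=> Cy O1y nKy; apply: complement_reach => //; first exact: inE.
  move=> JO; have [z cJz Kz] := complement_closure clK Cy nKy (ex_intro2 _ _ x (KC _ Kx) Kx).
  have [E|E] := complement_closure_ends iK KC Cy nKy cJz Kz.
    by apply: N; exists y; rewrite -E.
  apply: nv; rewrite (closure_id (closure O)).1; last exact: closed_closure.
  by rewrite -E; exact: closureS cJz.
have [y1 [Cy1 O1y1 nK1]] := pick O1 oO1 O1x.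
set J1 := connected_component (C `&` ~` K) y1.
have nJx : ~ closure J1 x by move=> cx; apply: N; exists y1.
have [|y2 [Cy2 [ O1y2 nJ1y2] nK2]] := pick (O1 `&` ~` closure J1) _ (conj O1x nJx).
  by apply: openI => //; apply: closed_openC; exact: closed_closure.
have [d1 [Jd1 Ed1 nO1]] := reach y1 Cy1 O1y1 nK1.
have [d2 [Jd2 Ed2 nO2]] := reach y2 Cy2 O1y2 nK2.
have [a Ea na] := boundary_bumping S_compact cK (@closed_closure _ O) Kx
  (subset_closure Ox) (fun h => nv (h v Kv)).
have nOa : ~ O a.
  move=> Oa; apply: na; apply: (filterS _ (open_nbhs_nbhs (conj oO Oa))).
  exact: subset_closure.
have Ka : K a by have [] := connected_component_sub Ea.
have nKd1 : ~ K d1 by have [] := connected_component_sub Jd1.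
have nKd2 : ~ K d2 by have [] := connected_component_sub Jd2.
case: (h a d1 d2).
- move=> q [->|[->|->]]; split => //.
  by move: Ea; apply: component_sub; exact: setSI.
- by move=> E; apply: nKd1; rewrite -E.
- by move=> E; apply: nKd2; rewrite -E.
- move=> E; apply: nJ1y2; apply: subset_closure.
  by apply: connected_component_trans Jd1 _; rewrite E; exact: connected_component_sym.
Qed.

(** The common point cuts the union, so a subcontinuum from [v] to [w] contains it and meets [K] and
    [L] in continua, to which irreducibility applies. *)
Lemma irred_join K L x v w : irred K x v -> irred L x w -> K `&` L = [set x] ->
  irred (K `|` L) v w.
Proof.
move=> [cK Kx Kv minK] [cL Lx Lw minL] KL.
have clK := continuum_closed cK; have clL := continuum_closed cL.
have oK : open (~` K) by exact: closed_openC. have oL : open (~` L) by exact: closed_openC.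
have KLx y : K y -> L y -> y = x.
  by move=> Ky Ly; have : (K `&` L) y by []; rewrite KL.
split; [|by left|by right|].
  by apply: continuumU => //; exists x.
move=> A cA AM Av Aw.
have Ax : A x.
  apply: contrapT => nAx.
  have cov : A `<=` ~` L `|` ~` K.
    move=> y Ay; have [Ky|nKy] := pselect (K y); last by right.
    by left => Ly; apply: nAx; rewrite -(KLx y).
  have dis : A `&` ~` L `&` ~` K = set0.
    by rewrite -subset0 => y [[/AM[]]].
  have : A `<=` ~` L.
    apply: (connected_open_split cA.2 oL oK cov dis); exists v; split => // Lv.
    by apply: nAx; rewrite -(KLx v).
  by move=> /(_ w Aw); apply.
have E (B : set S) : A `&` B = A `\` ~` B by rewrite setDE setCK.
have conK : continuum (A `&` K).
  apply: closed_continuum => //; first by apply: closedI => //; exact: continuum_closed.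
  rewrite E; apply: (connected_avoid cA.2 Ax oL oK) => //.
    move=> y Ay yx; have [Ky|nKy] := pselect (K y); last by right.
    by left => Ly; apply: yx; exact: KLx.
  by rewrite -subset0 => y [[/AM[]]].
have conL : continuum (A `&` L).
  apply: closed_continuum => //; first by apply: closedI => //; exact: continuum_closed.
  rewrite E; apply: (connected_avoid cA.2 Ax oK oL) => //.
    move=> y Ay yx; have [Ky|nKy] := pselect (K y); last by left.
    by right => Ly; apply: yx; exact: KLx.
  by rewrite -subset0 => y [[/AM[]]].
have hK := minK _ conK (@subIsetr _ _ _) (conj Ax Kx) (conj Av Kv).
have hL := minL _ conL (@subIsetr _ _ _) (conj Ax Lx) (conj Aw Lw).
by move=> y [/hK[]|/hL[]].
Qed.

(** If an irreducible continuum [K] from [x] is not a neighbourhood of [x] in [C], it is prolonged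
    beyond [x] through a component of the rest that accumulates at [x], and [x] becomes an interior
    point. In the other case [p = x] is an end point, the source of boundary points of leaves. *)
Lemma thin_local x v : C x -> C v -> v <> x -> exists K p q O,
  [/\ irred K p q, K `<=` C, K x /\ p <> q, x <> q & [/\ open O, O x & C `&` O `<=` K]].
Proof.
move=> Cx Cv vx; have [K KC iK] := irred_ex S_compact S_countable cC Cx Cv.
have [[ O [oO Ox CO]]|H] := pselect (exists O, [/\ open O, O x & C `&` O `<=` K]).
  exists K, x, v, O; split => //; last exact/nesym.
  by split; [case: iK|exact/nesym].
have [|y [Cy nKy cJx]] := boundary_component iK KC (nesym vx).
  by move=> O oO Ox CO; apply: H; exists O.
set J := connected_component (C `&` ~` K) y in cJx.
have [cK Kx Kv _] := iK. have clK := continuum_closed cK.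
have Jy : J y by exact: connected_component_refl.
have JC : closure J `<=` C.
  rewrite [X in _ `<=` X](closure_id C).1//; apply: closureS => p.
  by move=> /connected_component_sub[].
have cJ : continuum (closure J) by apply: closure_continuum => //; exact: component_connected.
have [L LJ iL] := irred_ex S_compact S_countable cJ cJx (subset_closure Jy).
have LC : L `<=` C by move=> p /LJ/JC.
have ends p : K p -> closure J p -> p = x \/ p = v.
  by move=> Kp cJp; apply: (complement_closure_ends iK KC Cy nKy cJp Kp).
have yv : y <> v by move=> E; apply: nKy; rewrite E.
have yx : y <> x by move=> E; apply: nKy; rewrite E.
(* Otherwise [v] would be interior to the arc [L], and points of [K] close to [v] would lie in [L],
   which meets [K] only at ends. *)
have nLv : ~ L v.
  move=> Lv; have [ O [oO Ov CO]] := irred_interior iL LC Lv vx (nesym yv).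
  have [|p [Kp [Op px] pv]] := connected_near cK.2 Kv Kx vx (O := O `&` ~` [set x]) _ (conj Ov vx).
    by apply: openI => //; apply: closed_openC; exact: closed_set1.
  by have [] := ends p Kp (LJ p (CO p (conj (KC p Kp) Op))).
have KL : K `&` L = [set x].
  apply/seteqP; split => [p [Kp Lp]|_ ->]; last by split => //; case: iL.
  by have [//|E] := ends p Kp (LJ p Lp); case: nLv; rewrite -E.
have iM := irred_join iK iL KL.
have MC : K `|` L `<=` C by rewrite subUset.
have Mx : (K `|` L) x by left.
have [ O [oO Ox CO]] := irred_interior iM MC Mx (nesym vx) (nesym yx).
exists (K `|` L), v, y, O; split => //; last exact/nesym.
by split => //; exact/nesym.
Qed.

End InThin.
End Thin.

(** * Leaves as one-dimensional manifolds *)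

Lemma continuous_to_set_type (X Y : topologicalType) (B : set Y) (F : X -> set_type B) :
  continuous (fun x => set_val (F x) : Y) -> continuous F.
Proof.
move=> cF x V /set_type_nbhs[ O [oO Ox OV]].
have : nbhs x ((fun x => set_val (F x)) @^-1` O) by apply: cF; exact: open_nbhs_nbhs.
by apply: filterS => y Oy; exact: OV.
Qed.

Section LeafManifold.
Context {R : realType} {S : metricType R}.
Implicit Types (x y z u v w : S) (B C D E F J K L M O P U V W T Y : set S).
Implicit Types (phi : R * R -> S).
Hypothesis S_compact : compact [set: S].
Hypothesis S_surface : surface R S.

Let S_lc : locally_connected S := surface_lc S_surface.
Let S_perfect : forall x : S, ~ open [set x] := surface_perfect S_surface.
Let S_countable : @second_countable S. Proof. by case: S_surface. Qed.

Variables (f : homeo S S) (c : R).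
Hypothesis Hc : cwF_const f c.
Local Notation Q := (continua_dec (stab f)).
Local Notation A := (continua_atlas (stab f)).

Lemma stab_hereditarily_lc C : stab f C -> hereditarily_lc C.
Proof.
move=> sC K cK KC; apply: (stab_lc S_compact S_surface Hc); exact: stab_sub KC sC.
Qed.

Section Topology.

Lemma plaque_sub_open U x O y : adom A U -> plaque f U x y -> open O -> O y ->
  exists P, [/\ open_plaque A P, P y & P `<=` plaque f U x `&` O].
Proof.
move=> AU Py oO Oy; have [Qy Uy] := connected_component_sub Py.
have oU : open U by case: (AU).
have AUO : adom A (U `&` O).
  by apply: (adom_sub S_compact AU); [exact: openI|exact: subIsetl].
exists (plaque f (U `&` O) y); split.
- by exists (U `&` O), y.
- exact: plaque_refl.
- have Qsub : Q (closure (U `&` O)) y `<=` Q (closure U) x.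
    move=> w [_ [C [sC CU Cy Cw]]].
    apply: (dec_trans Qy); split.
      by apply: closureS (CU w Cw); exact: subIsetl.
    by exists C; split => //; apply: subset_trans CU _; apply: closureS; exact: subIsetl.
  move=> w Pw; have [Qw [Uw Ow]] := connected_component_sub Pw; split => //.
  apply: connected_component_trans Py _; move: Pw; apply: component_sub => q.
  by move=> [Qq [Uq _]]; split => //; exact: Qsub.
Qed.

(** Here local connectedness of stable continua gives relatively open components. As a consequence
    the plaque topology agrees with that of [S] on a stable continuum. *)
Lemma stab_sub_plaque C y P : stab f C -> C y -> open_plaque A P -> P y ->
  exists O, [/\ open O, O y & C `&` O `<=` P].
Proof.
move=> sC Cy [U [x [AU Ux ->]]] Py; have [Qy Uy] := connected_component_sub Py.
have oU : open U by case: (AU).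
have lC := stab_lc S_compact S_surface Hc sC.
have cC := continuum_closed sC.1.
have [ O [oO Oy WE]] := frontier_open lC oU Cy Uy.
exists O; split => // w; rewrite -WE => Ww.
set W := connected_component (C `&` U) y in WE Ww.
have WC : W `<=` C `&` U by exact: connected_component_sub.
have Wy : W y by exact: connected_component_refl.
have cW : closure W `<=` C.
  by rewrite [X in _ `<=` X](closure_id C).1//; apply: closureS => p /WC[].
have QW : closure W `<=` Q (closure U) x.
  rewrite (dec_eq Qy); apply: (dec_max (C := closure W)) => //.
  - by apply: stab_sub cW sC; apply: closure_continuum => //; exact: component_connected.
  - by apply: closureS => p /WC[].
  - exact: subset_closure.
apply: connected_component_trans Py _.
apply: (connected_component_max _ _ (@component_connected _ (C `&` U) y)) => //.
by move=> p Wp; split; [apply: QW; exact: subset_closure|case: (WC p Wp)].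
Qed.

Lemma plaque_nbhs (y : plaque_space A) (V : set (plaque_space A)) :
  nbhs y V <-> exists P : set S, [/\ open_plaque A P, P y & P `<=` V].
Proof.
have [Bo Bb] := open_plaque_basis (stab_is_atlas S_compact Hc) (adom_basis S_compact Hc).
split=> [/Bb[P [AP Py] PV]|[P [AP Py PV]]]; first by exists P.
by apply: (filterS PV); apply: open_nbhs_nbhs; split => //; exact: Bo.
Qed.

Variable x0 : S.
Local Notation X := (leaf_space A x0).

Definition leaf_val (a : X) : S := set_val a.

Lemma leaf_nbhs (a : X) (V : set X) :
  nbhs a V <-> exists P : set S, [/\ open_plaque A P, P (leaf_val a) &
    forall b, P (leaf_val b) -> V b].
Proof.
split=> [/set_type_nbhs[ O [oO Oa OV]]|[P [AP Pa PV]]].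
  have /plaque_nbhs[P [AP Pa PO]] : nbhs (set_val a) O by exact: open_nbhs_nbhs.
  by exists P; split => // b Pb; apply: OV; exact: PO.
have nP : nbhs (set_val a : plaque_space A) (P : set (plaque_space A)).
  by apply: (plaque_nbhs (set_val a) P).2; exists P; split => //; exact: Pa.
have : nbhs a (set_val @^-1` (P : set (plaque_space A))) := @set_val_continuous _ _ a _ nP.
by apply: filterS => b; exact: PV.
Qed.

Lemma leaf_val_leaf (a : X) : leaf A x0 (leaf_val a).
Proof. exact: set_typeP. Qed.

Definition mk_leaf y (h : leaf A x0 y) : X :=
  @mkset_type (plaque_space A) (leaf A x0 : set (plaque_space A)) y h.

Lemma leaf_val_inj : injective leaf_val.
Proof. by move=> a b /val_inj. Qed.

Lemma leaf_plaque_in (a : X) O : open O -> O (leaf_val a) ->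
  exists P, [/\ open_plaque A P, P (leaf_val a) & P `<=` O].
Proof.
move=> oO Oa; have [U AU Ua] := adom_cover S_compact Hc (leaf_val a).
have [P [AP Pa PO]] := plaque_sub_open AU (plaque_refl f Ua) oO Oa.
by exists P; split => // w /PO[].
Qed.

Lemma leaf_val_continuous : continuous leaf_val.
Proof.
move=> a V; rewrite nbhsE => -[ O [oO Oa] OV].
have [P [AP Pa PO]] := leaf_plaque_in oO Oa.
by apply/leaf_nbhs; exists P; split => // b /PO/OV.
Qed.

Lemma leaf_hausdorff : hausdorff_space X.
Proof.
move=> a b ab; apply: leaf_val_inj; have [hS _ _] := S_surface; apply: hS.
move=> V W /leaf_val_continuous aV /leaf_val_continuous bW.
by have [d [Vd Wd]] := ab _ _ aV bW; exists (leaf_val d).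
Qed.

Lemma leaf_stab y : leaf A x0 y -> exists C, [/\ stab f C, C x0 & C y].
Proof. by rewrite (leafE S_compact Hc). Qed.

Lemma stab_leaf C y : stab f C -> C x0 -> C y -> leaf A x0 y.
Proof. by move=> sC C0 Cy; rewrite (leafE S_compact Hc); exists C. Qed.

(** The basic sets are the traces of countably many open sets on the plaques [leaf_plaque m x0]; by
    [stab_sub_plaque] they are small enough for the plaque topology. *)
Lemma leaf_second_countable : @second_countable X.
Proof.
have [B cB [Bo Bb]] := S_countable.
pose G (p : nat * set S) : set X :=
  [set b | leaf_plaque S_compact Hc p.1 x0 (leaf_val b) /\ p.2 (leaf_val b)].
have lpo m := leaf_plaque_open S_compact Hc m x0.
exists (G @` ([set: nat] `*` B)).
  apply: sub_countable (card_image_le _ _) _; apply: countableX => //.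
have nG p a : open p.2 -> G p a -> nbhs a (G p).
  move=> op [Pa pa]; have [U [z [AU Uz E]]] := lpo p.1.
  have Pa' : plaque f U z (leaf_val a) by move: Pa; rewrite E.
  have [P [AP Pa'' PP]] := plaque_sub_open AU Pa' op pa.
  by apply/leaf_nbhs; exists P; split => // b /PP[h1 h2]; split => //; rewrite E.
split.
  move=> _ [[m O] [_ BO] <-]; rewrite openE => a Ga; apply: nG => //; exact: Bo.
move=> a V /leaf_nbhs[P [AP Pa PV]].
have : leaf A x0 (leaf_val a) by exact: leaf_val_leaf.
rewrite {1}(leaf_bigcup S_compact Hc) => -[m _ ma].
have [C [sC PC C0 Ca]] := open_plaque_stab (lpo m) (leaf_plaque_refl S_compact Hc m x0) ma.
have [ O [oO Oa CO]] := stab_sub_plaque sC Ca AP Pa.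
have [ O' [BO' O'a] O'O] : filter_from [set U | B U /\ U (leaf_val a)] id O.
  by apply: Bb; exact: open_nbhs_nbhs.
exists (G (m, O')).
  by split; [exists (m, O')|split].
by move=> b [mb O'b]; apply: PV; apply: CO; split; [exact: PC|exact: O'O].
Qed.

(* Finitely many plaques through [x0] lie in one stable continuum, which cannot
   contain the whole leaf. *)
Lemma leaf_not_compact : ~ compact [set: X].
Proof.
move=> kX; have cover n : exists C, [/\ stab f C, C x0 &
    forall m, (m <= n)%N -> leaf_plaque S_compact Hc m x0 `<=` C].
  have one m : exists C, [/\ stab f C, C x0 & leaf_plaque S_compact Hc m x0 `<=` C].
    have [C [sC PC C0 _]] := open_plaque_stab (leaf_plaque_open S_compact Hc m x0)
      (leaf_plaque_refl S_compact Hc m x0) (leaf_plaque_refl S_compact Hc m x0).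
    by exists C.
  elim: n => [|n [C [sC C0 hC]]].
    by have [C [sC C0 PC]] := one 0%N; exists C; split => // m; rewrite leqn0 => /eqP ->.
  have [C' [sC' C'0 PC']] := one n.+1; exists (C `|` C'); split.
  - by apply: stabU => //; exists x0.
  - by left.
  - move=> m; rewrite leq_eqVlt => /orP[/eqP -> p /PC'|mn p]; first by right.
    by move=> /(hC m mn p); left.
have /choice[b hb] : forall n, exists b : X, forall m, (m <= n)%N ->
    ~ leaf_plaque S_compact Hc m x0 (leaf_val b).
  move=> n; apply: contrapT => /forallNP h; have [C [sC C0 hC]] := cover n.
  apply: (stab_leaf_not_stab S_compact S_lc S_perfect Hc (x := x0)); exists C => // y ly.
  have := h (mk_leaf ly) => /existsNP[m /not_implyP[mn /contrapT]].
  exact: hC.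
have [G [UG _ GN]] : exists G : set_system nat, [/\ UltraFilter G,
    \forall n \near G, True & forall N, \forall n \near G, (N <= n)%N].
  by apply: ultra_frequently => N; exists N.
move: kX; rewrite compact_ultra => /(_ _ (ultra_fmap b UG)).
move=> [|a [_ ba]]; first exact: filterT.
have : leaf A x0 (leaf_val a) by exact: leaf_val_leaf.
rewrite {1}(leaf_bigcup S_compact Hc) => -[m _ ma].
have na : nbhs a [set a' | leaf_plaque S_compact Hc m x0 (leaf_val a')].
  by apply/leaf_nbhs; exists (leaf_plaque S_compact Hc m x0); split => //; exact: leaf_plaque_open.
have h1 : \forall n \near G, leaf_plaque S_compact Hc m x0 (leaf_val (b n)) := ba _ na.
have [n [h h2]] := near_ex2 UG h1 (GN m).
exact: hb h2 h.
Qed.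

End Topology.

Section Charts.
Variable Phi : set (R * R -> S).
Hypothesis niceP : forall phi, Phi phi -> nice f c phi.
Hypothesis basisP : forall x V, nbhs x V ->
  exists phi, [/\ Phi phi, odisc phi x & disc phi `<=` V].

(** Points where a component leaves the open disc are on the rim and in the plaque of [z]; three of
    them would make that plaque branching. *)
Lemma good_thin x C : good f Phi x -> stab f C -> C x -> thin C.
Proof.
move=> gx sC Cx z V Cz /basisP[phi [Pphi oz DV]].
have [cphi np] := niceP Pphi; have cD := disc_closed cphi.
have clO : closure (odisc phi) `<=` disc phi.
  by rewrite [X in _ `<=` X](closure_id _).1//; apply: closureS; exact: odisc_disc.
exists (odisc phi); last exact: subset_trans DV.
split => //; first exact: odisc_open.
move=> a b d H; have Dz := odisc_disc oz.
have inQ y : y = a \/ y = b \/ y = d -> Q (disc phi) z y /\ rim phi y.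
  move=> /H[Ey nOy]; have [Cy cOy] := connected_component_sub Ey; split.
    apply: (dec_max (C := connected_component (C `&` disc phi) z)) => //.
    - apply: (stab_sub _ _ sC); last by move=> q /connected_component_sub[].
      by apply: component_continuum => //; apply: closedI => //; exact: continuum_closed sC.1.
    - by move=> q /connected_component_sub[].
    - by apply: connected_component_refl.
    - by move: Ey; apply: component_sub; exact: setIS.
  have [p Dp py] := clO y cOy; exists p => //=; apply/eqP; rewrite eq_le Dp /= leNgt.
  by apply/negP => p1; apply: nOy; exists p.
have [Qa ra] := inQ a (or_introl erefl).
have [Qb rb] := inQ b (or_intror (or_introl erefl)).
have [Qd rd] := inQ d (or_intror (or_intror erefl)).
apply: contrapT => n; apply: (gx phi Pphi C z sC Cx Cz Dz).
exists a, b, d; split => //; split => //; split => E; apply: n.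
- by constructor 1.
- by constructor 2.
- by constructor 3.
Qed.

(** By [thin_local] the point has an arc as neighbourhood in a stable continuum [C], and the
    parameter of the arc is the chart. Its inverse is continuous for the plaque topology by
    [stab_sub_plaque]. *)
Lemma leaf_chart x0 (a : leaf_space A x0) : good f Phi x0 ->
  exists2 U : set (leaf_space A x0), open_nbhs a U &
    exists2 W : set R, open W &
      homeomorphic (set_type U) (set_type (W `&` [set t : R | 0 <= t])).
Proof.
move=> g0; pose x := leaf_val a.
have [C0 [sC0 C00 C0x]] := leaf_stab (leaf_val_leaf a).
have gx : good f Phi x := good_leaf g0 sC0 C00 C0x.
have [U AU Ux] := adom_cover S_compact Hc x.
have oU : open U by case: (AU).
have cUx : closure U x by exact: subset_closure.
pose C := Q (closure U) x; have sC : stab f C by exact: adom_stab.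
have Cx : C x by exact: dec_refl.
have [B [sB _ Bx BU [v Bv vx]]] := uniform_stable_in S_compact S_lc S_perfect Hc
  (@closed_closure _ U) (filterS (@subset_closure _ U) (open_nbhs_nbhs (conj oU Ux))).
have Cv : C v by exact: (dec_max sB).
have [K [p [q [ O [iK KC [Kx pq] xq [oO Ox CO]]]]]] := thin_local S_compact S_countable
  sC.1 (stab_hereditarily_lc sC) (good_thin gx sC Cx) Cx Cv (elimN eqP vx).
have lK : lc_subset K by apply: (stab_hereditarily_lc sC) => //; case: iK.
have [g [h [[gp gq [h0 h1]] gK hK gc hc]]] := irred_arc S_compact S_countable iK lK pq.
have [ OP [oOP OPx PE]] := frontier_open (stab_lc S_compact S_surface Hc sC) oU Cx Ux.
pose P := plaque f U x.
have {}PE : P = C `&` OP by exact: PE.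
(* [OP] keeps points in the plaque and [O] in the arc. Removing the far end [q], which is not [x],
   leaves the half-open range of parameters that fits the half-line. *)
pose OO := OP `&` O `&` ~` [set q].
have oOO : open OO.
  by apply: openI; [exact: openI|apply: closed_openC; exact: closed_set1].
pose N : set (leaf_space A x0) := [set b | C (leaf_val b) /\ OO (leaf_val b)].
have NK b : N b -> K (leaf_val b) by move=> [Cb [[_ Ob] _]]; exact: CO.
have oN : open N.
  rewrite openE => b [Cb OOb].
  have Pb : plaque f U x (leaf_val b).
    by rewrite -/P PE; split => //; case: OOb => -[].
  have [P' [AP' P'b PP]] := plaque_sub_open AU Pb oOO OOb.
  apply/leaf_nbhs; exists P'; split => // b' /PP[Pb' OOb']; split => //.
  by move: Pb'; rewrite -/P PE => -[].
exists N.
  by split => //; split => //; split => //; split.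
(* [W] has to be open in the whole line, so it may contain negative [t]; only parameters in the unit
   interval are tested. *)
pose W := [set t : R | t < 1 /\ exists2 e : R, 0 < e &
  forall s, 0 <= s <= 1 -> `|t - s| < e -> OO (h s)].
have oW : open W.
  rewrite openE => t [t1 [e e0 he]]; apply/nbhs_ballP.
  exists (Num.min (1 - t) (e / 2)); first by rewrite /= lt_min subr_gt0 t1 divr_gt0.
  move=> t' /=; rewrite /ball /= lt_min => /andP[]; rewrite !ltr_norml => /andP[b1 b2] /andP[b3 b4].
  split; first by lra.
  exists (e / 2); first by rewrite divr_gt0.
  move=> s s01; rewrite ltr_norml => /andP[b5 b6]; apply: he => //.
  by rewrite ltr_norml; apply/andP; split; lra.
exists W => //.
have WP t : (W `&` [set t : R | 0 <= t]) t -> 0 <= t <= 1 /\ OO (h t).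
  move=> [[t1 [e e0 he]] /= t0]; have t01 : 0 <= t <= 1 by rewrite t0 ltW.
  by split => //; apply: he => //; rewrite subrr normr0.
have gW b : N b -> (W `&` [set t : R | 0 <= t]) (g (leaf_val b)).
  move=> Nb; have [Cb OOb] := Nb; have Kb := NK b Nb.
  have [g01 hg] := gK _ Kb; have /andP[g0' g1'] := g01.
  have OOh : OO (h (g (leaf_val b))) by rewrite hg.
  split => //; split.
    rewrite lt_neqAle g1' andbT; apply/eqP => E; move: OOh; rewrite E h1 => -[_].
    by apply.
  have [e e0 he] := nbhs_mdist_ex (open_nbhs_nbhs (conj oOO OOh)).
  have [d d0 hd] := hc _ e g01 e0.
  by exists d => // s s01 /(hd s s01); exact: he.
have hleaf t : (W `&` [set t : R | 0 <= t]) t -> leaf A x0 (h t).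
  move=> /WP[t01 _]; have [Kh _] := hK t t01.
  apply: (@stab_leaf x0 (C0 `|` C)).
  - by apply: stabU => //; exists x.
  - by left.
  - by right; exact: KC.
have hN t (Wt : (W `&` [set t : R | 0 <= t]) t) : N (mk_leaf (hleaf t Wt)).
  by have [t01 OOt] := WP t Wt; have [Kh _] := hK t t01; split => //; exact: KC.
pose F (b : set_type N) : set_type (W `&` [set t : R | 0 <= t]) :=
  mkset_type (gW _ (set_typeP b)).
pose H (t : set_type (W `&` [set t : R | 0 <= t])) : set_type N :=
  mkset_type (hN _ (set_typeP t)).
have FK : cancel F H.
  move=> b; apply: val_inj; apply: leaf_val_inj.
  by have [_ E] := gK _ (NK _ (set_typeP b)).
have HK : cancel H F.
  move=> t; apply: val_inj; have [t01 _] := WP _ (set_typeP t).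
  by have [_ E] := hK _ t01.
have cF' : continuous (fun b : set_type N => g (leaf_val (set_val b))).
  move=> b V /nbhs_ballP[e /= e0 eV]; have [d d0 hd] := gc _ e (NK _ (set_typeP b)) e0.
  have nb : nbhs (set_val b) (@leaf_val x0 @^-1` [set w | mdist (leaf_val (set_val b)) w < d]).
    by apply: leaf_val_continuous; exact: nbhs_mdist_lt.
  have nb' := @set_val_continuous _ _ b _ nb.
  apply: (@filterS _ _ (nbhs_filter b) _ _ _ nb') => b' db'.
  by apply: eV; apply: hd => //; apply: NK; exact: set_typeP.
have cF : continuous F by apply: continuous_to_set_type; exact: cF'.
have cH : continuous H.
  apply: continuous_to_set_type => t V /leaf_nbhs[P' [AP' P't PV]].
  have [t01 _] := WP _ (set_typeP t); have [Kh _] := hK _ t01.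
  have [ O' [oO' O't CO']] := stab_sub_plaque sC (KC _ Kh) AP' P't.
  have [e e0 he] := nbhs_mdist_ex (open_nbhs_nbhs (conj oO' O't)).
  have [d d0 hd] := hc _ e t01 e0.
  have nt : nbhs (set_val t : R) [set s : R | `|set_val t - s| < d].
    by apply/nbhs_ballP; exists d.
  have nt' := @set_val_continuous _ _ t _ nt.
  apply: (@filterS _ _ (nbhs_filter t) _ _ _ nt') => s ds.
  have [s01 _] := WP _ (set_typeP s); have [Kh' _] := hK _ s01.
  by apply: PV; apply: CO'; split; [exact: KC|apply: he; exact: hd].
by constructor; exact: Homeo FK HK cF cH.
Qed.

Lemma leaf_manifold x0 : good f Phi x0 ->
  one_manifold_with_boundary R (leaf_space A x0).
Proof.
move=> g0; split; [exact: leaf_hausdorff|exact: leaf_second_countable|].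
by move=> a; exact: leaf_chart.
Qed.

End Charts.
End LeafManifold.

(** * Transversality *)

Section Sides.
Context {R : realType}.
Implicit Types (p q w x y z : (R * R)%type) (A B : set (R * R)%type).

Definition square : set (R * R) := [set p | 0 <= p.1 <= 1 /\ 0 <= p.2 <= 1].

Definition crosses (g : R -> R * R) := [/\ continuous g,
  forall s t : R, 0 <= s <= 1 -> 0 <= t <= 1 -> g s = g t -> s = t,
  (g 0).1 = 0 /\ (g 1).1 = 1,
  forall t : R, 0 < t < 1 -> 0 < (g t).1 < 1 &
  forall t : R, 0 <= t <= 1 -> 0 < (g t).2 < 1].

Definition path_set (g : R -> R * R) : set (R * R) := g @` `[0, 1].

Lemma path_setP g w : path_set g w <-> exists2 t : R, 0 <= t <= 1 & g t = w.
Proof. by split=> -[t]; rewrite ?set_itvE /= => h <-; exists t; rewrite //= ?in_itv. Qed.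

Lemma crosses_square g t : crosses g -> 0 <= t <= 1 -> square (g t).
Proof.
move=> [_ _ [g0 g1] hx hy] t01; split; last first.
  by have /andP[/ltW -> /ltW ->] := hy t t01.
have [->|t0] := eqVneq t 0; first by rewrite g0 lexx ler01.
have [->|t1] := eqVneq t 1; first by rewrite g1 lexx ler01.
have /hx/andP[/ltW -> /ltW ->//] : 0 < t < 1.
by rewrite !lt_neqAle eq_sym t0 t1.
Qed.

Lemma square_convex p q (s : R) : square p -> square q -> 0 <= s <= 1 ->
  square (p.1 + s * (q.1 - p.1), p.2 + s * (q.2 - p.2)).
Proof.
move=> [/andP[p1 p1'] /andP[p2 p2']] [/andP[q1 q1'] /andP[q2 q2']] /andP[s0 s1].
by split => /=; apply/andP; split; nra.
Qed.

Definition segment p q : set (R * R) :=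
  (fun s : R => (p.1 + s * (q.1 - p.1), p.2 + s * (q.2 - p.2))) @` `[0, 1].

Lemma segment_continuum p q : continuum (segment p q).
Proof.
apply: continuous_continuum2.
  by apply: pair_continuous => s; apply: cvgD; try exact: cvg_cst;
    apply: cvgM; [exact: cvg_id|exact: cvg_cst|exact: cvg_id|exact: cvg_cst].
by split; [exact: segment_compact|exact: segment_connected].
Qed.

Lemma segment_ends p q : segment p q p /\ segment p q q.
Proof.
split; [exists 0|exists 1]; rewrite /= ?in_itv /= ?lexx ?ler01//.
  by rewrite !mul0r !addr0 -surjective_pairing.
by rewrite [RHS]surjective_pairing; congr pair; ring.
Qed.

Lemma segment_dist p q w : segment p q w -> mdist p w <= mdist p q /\ mdist q w <= mdist p q.
Proof.
move=> [s]; rewrite /= in_itv /= => /andP[s0 s1] <-.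
have h1 := plane_dist1 p q; have h2 := plane_dist2 p q.
rewrite !(plane_distE _ (_, _)) /= !ge_max.
have nn (r x : R) : 0 <= r -> r * `|x| = `|r * x| by move=> r0; rewrite normrM ger0_norm.
have k1 : `|p.1 - (p.1 + s * (q.1 - p.1))| = s * `|p.1 - q.1|.
  by rewrite nn//; congr `|_|; ring.
have k2 : `|p.2 - (p.2 + s * (q.2 - p.2))| = s * `|p.2 - q.2|.
  by rewrite nn//; congr `|_|; ring.
have s1' : 0 <= 1 - s by rewrite subr_ge0.
have k3 : `|q.1 - (p.1 + s * (q.1 - p.1))| = (1 - s) * `|p.1 - q.1|.
  by rewrite nn// -[LHS]normrN; congr `|_|; ring.
have k4 : `|q.2 - (p.2 + s * (q.2 - p.2))| = (1 - s) * `|p.2 - q.2|.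
  by rewrite nn// -[LHS]normrN; congr `|_|; ring.
rewrite k1 k2 k3 k4; have a1 := normr_ge0 (p.1 - q.1); have a2 := normr_ge0 (p.2 - q.2).
by split; apply/andP; split; nra.
Qed.

(** In the last clause, of the fact that a segment leaving [W] meets the path, only the distances to
    its ends are retained; this lets the path itself be counted in [W] or not. *)
Definition two_sided_hyp g (W : set (R * R)) := [/\ forall t : R, 0 <= t <= 1 -> W (t, 1),
  forall t : R, 0 <= t <= 1 -> ~ W (t, 0) &
  forall p q, square p -> square q -> W p -> ~ W q ->
    exists2 w, path_set g w & mdist p w <= mdist p q /\ mdist q w <= mdist p q].

(* Otherwise the path can be cut at [g t]: labelling the points by the half of the
   path they are close to, and by [W] away from both halves, contradicts
   [square_labelling]. *)
Lemma two_sided g W (t : R) (e : R) : crosses g -> two_sided_hyp g W -> 0 < t < 1 -> 0 < e ->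
  (exists p, [/\ square p, W p & mdist (g t) p < e]) /\
  (exists p, [/\ square p, ~ W p & mdist (g t) p < e]).
Proof.
move=> cg [Wtop Wbot WH] /andP[t0 t1] e0; have [cg' gi [g0 g1] gx gy] := cg.
suff main (b : bool) : ~ (forall p, square p -> mdist (g t) p < e -> W p <-> b).
  split; apply: contrapT => n.
    by apply: (main false) => p sp pe; split => // Wp; case: n; exists p.
  apply: (main true) => p sp pe; split => // _; apply: contrapT => nW; apply: n.
  by exists p.
move=> side.
have e20 : 0 < e / 2 by rewrite divr_gt0.
have nb : nbhs t (g @^-1` [set p | mdist (g t) p < e / 2]).
  by apply: cg'; exact: (@nbhs_mdist_lt R (R * R)%type).
have /nbhs_ballP[d' /= d'0 hd'] := nb.
(* During the times within [d] of [t] the path stays in the [e / 2]-ball of [g t]; the remaining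
   halves [b1] and [b2] are disjoint. *)
pose d := Num.min (d' / 2) (Num.min (t / 2) ((1 - t) / 2)).
have d0 : 0 < d by rewrite !lt_min !divr_gt0// subr_gt0.
have [dd' dt dt'] : [/\ d <= d' / 2, d <= t / 2 & d <= (1 - t) / 2].
  by rewrite /d; split; rewrite !ge_min lexx ?orbT.
have mid s : `|t - s| <= d -> mdist (g t) (g s) < e / 2.
  by move=> h; apply: hd'; rewrite /ball /=; apply: le_lt_trans h _; lra.
have cim (a1 a2 : R) : continuum (g @` `[a1, a2]).
  by apply: continuous_continuum2 => //; split; [exact: segment_compact|exact: segment_connected].
pose b1 := g @` `[0, t - d]; pose b2 := g @` `[t + d, 1].
have b1P s : 0 <= s <= t - d -> b1 (g s) by move=> h; exists s; rewrite //= in_itv.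
have b2P s : t + d <= s <= 1 -> b2 (g s) by move=> h; exists s; rewrite //= in_itv.
have [d1 d10 hd1] : exists2 e : R, 0 < e & forall x y, b1 x -> b2 y -> e <= mdist x y.
  apply: (@compact_dist R (R * R)%type); [by case: (cim 0 (t - d))|by case: (cim (t + d) 1)|].
  rewrite -subset0 => _ [[s + <-] [s' + E]]; rewrite /= !in_itv /= => /andP[u1 u2] /andP[u3 u4].
  have : s' = s by apply: gi E; lra.
  by move=> E'; move: u3; rewrite E'; lra.
have [d2 d20 hd2] : exists2 e : R, 0 < e & forall x y, b1 x ->
    [set q : R * R | 0 <= q.2 <= 1 /\ q.1 = 1] y -> e <= mdist x y.
  apply: (@compact_dist R (R * R)%type); first by case: (cim 0 (t - d)).
    by case: (vsegment_continuum (0 : R) 1 1).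
  rewrite -subset0 => _ [[s + <-] [_ E]]; rewrite /= in_itv /= => /andP[u1 u2].
  have [s0|s0] := eqVneq s 0; first by move: E; rewrite s0 g0 => /eqP; rewrite eq_sym oner_eq0.
  have sp : (0 : R) < s by move: u1; rewrite le_eqVlt eq_sym (negbTE s0).
  have /gx/andP[_] : 0 < s < 1 by rewrite sp; lra.
  by rewrite E ltxx.
have [d3 d30 hd3] : exists2 e : R, 0 < e & forall x y, b2 x ->
    [set q : R * R | 0 <= q.2 <= 1 /\ q.1 = 0] y -> e <= mdist x y.
  apply: (@compact_dist R (R * R)%type); first by case: (cim (t + d) 1).
    by case: (vsegment_continuum (0 : R) 1 0).
  rewrite -subset0 => _ [[s + <-] [_ E]]; rewrite /= in_itv /= => /andP[u1 u2].
  have [s1|s1] := eqVneq s 1; first by move: E; rewrite s1 g1 => /eqP; rewrite oner_eq0.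
  have sp : s < (1 : R) by move: u2; rewrite le_eqVlt (negbTE s1).
  have /gx/andP[+ _] : 0 < s < 1 by rewrite sp andbT; lra.
  by rewrite E ltxx.
(* Two margins [eta] and a step below [eta] cannot bridge the distance [d1] between the halves; the
   other bounds keep [b1] off the right edge and [b2] off the left edge. *)
pose eta := Num.min (d1 / 3) (Num.min d2 d3).
have eta0 : 0 < eta by rewrite !lt_min divr_gt0// d20 d30.
have [e1 e2 e3] : [/\ eta <= d1 / 3, eta <= d2 & eta <= d3].
  by rewrite /eta; split; rewrite !ge_min lexx ?orbT.
pose near (B : set (R * R)) p := exists2 w, B w & mdist p w < eta.
pose lab p : bool * bool := if `[< near b1 p >] then (true, false)
  else if `[< near b2 p >] then (true, true) else (false, `[< W p >]).
pose e' := Num.min eta (e / 2).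
have e'0 : 0 < e' by rewrite lt_min eta0.
have [e'1 e'2] : e' <= eta /\ e' <= e / 2 by rewrite /e'; split; rewrite ge_min lexx ?orbT.
have far p q : near b1 p -> near b2 q -> mdist p q < e' -> False.
  move=> [w w1 pw] [w' w2 qw'] pq; have h := hd1 w w' w1 w2.
  have := metric_triangle w p w'; have := metric_triangle p q w'.
  by rewrite (mdist_sym w p); lra.
have same p q : square p -> square q -> mdist p q < e' -> ~ near b1 p -> ~ near b2 p ->
    W p -> W q.
  move=> sp sq pq n1 n2 Wp; apply: contrapT => nWq.
  have [w /path_setP[s /andP[s0 s1] <-] [h1 h2]] := WH p q sp sq Wp nWq.
  have [c1|c1] := leP s (t - d).
    by apply: n1; exists (g s); [apply: b1P; rewrite s0|lra].
  have [c2|c2] := leP (t + d) s.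
    by apply: n2; exists (g s); [apply: b2P; rewrite c2|lra].
  have m : mdist (g t) (g s) < e / 2 by apply: mid; rewrite ler_norml; apply/andP; split; lra.
  have hp : mdist (g t) p < e.
    by have := metric_triangle (g t) (g s) p; rewrite (mdist_sym (g s) p); lra.
  have hq : mdist (g t) q < e.
    by have := metric_triangle (g t) (g s) q; rewrite (mdist_sym (g s) q); lra.
  by apply: nWq; apply/(side q sq hq); apply/(side p sp hp).
apply: (@square_labelling R lab e' e'0).
- move=> p q p1 p2 q1 q2 pq; rewrite /lab.
  have qp : mdist q p < e' by rewrite mdist_sym.
  case: (asboolP (near b1 p)) => n1; case: (asboolP (near b1 q)) => m1 //=.
  + by case: (asboolP (near b2 q)) => m2 //=; case: (far p q n1 m2 pq).
  + by case: (asboolP (near b2 p)) => n2 //=; case: (far q p m1 n2 qp).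
  + case: (asboolP (near b2 p)) => n2; case: (asboolP (near b2 q)) => m2 //=.
    apply/eqP; apply/asboolP/asboolP => h.
      exact: (same p q).
    exact: (same q p).
- move=> s s01; rewrite /lab; case: asboolP => // n1; case: asboolP => // -[w w2 hw].
  have := hd3 w (0, s) w2 (conj s01 erefl); rewrite mdist_sym; lra.
- move=> s s01; rewrite /lab; case: asboolP => [[w w1 hw]|n1]; last by case: asboolP.
  have := hd2 w (1, s) w1 (conj s01 erefl); rewrite mdist_sym; lra.
- move=> s s01; rewrite /lab; case: asboolP => // _; case: asboolP => // _.
  by case: asboolP => // /(Wbot s s01).
- move=> s s01; rewrite /lab; case: asboolP => // _; case: asboolP => // _.
  by case: asboolP => // -[]; exact: Wtop.
Qed.

Section Above.
Variable g : R -> R * R.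
Hypothesis cg : crosses g.
Let b := path_set g.

(** The base point is the top left corner; joining by continua allows [crossing] to separate this
    side from the bottom edge. *)
Definition above : set (R * R) := [set p | exists A,
  [/\ continuum A, A `<=` square, A `&` b = set0, A (0, 1) & A p]].

Lemma above_sub p : above p -> square p /\ ~ b p.
Proof.
move=> [A [_ As Ab _ Ap]]; split; first exact: As.
by move=> bp; have : set0 p by rewrite -Ab.
Qed.

Lemma above_segment p q : above p -> square q -> segment p q `&` b = set0 -> above q.
Proof.
move=> ap sq sb; have [sp _] := above_sub ap; have [A [cA As Ab A0 Ap]] := ap.
have [sp' sq'] := segment_ends p q.
exists (A `|` segment p q); split.
- by apply: (@continuumU R (R * R)%type) => //; [exists p|exact: segment_continuum].
- move=> w [/As//|[s]]; rewrite /= in_itv /= => s01 <-.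
  exact: square_convex.
- by rewrite setIUl Ab sb setU0.
- by left.
- by right.
Qed.

Lemma above_hyp : two_sided_hyp g above.
Proof.
have [_ _ [g0 g1] gx gy] := cg.
have top : above (0, 1).
  exists [set (0, 1)]; split => //.
  - by split; [exact: compact_set1|exact: connected1].
  - by move=> _ ->; split => /=; rewrite ?lexx ?ler01.
  - rewrite -subset0 => _ [-> /path_setP[t t01 E]]; have := gy t t01.
    by rewrite E /= ltxx andbF.
split.
- move=> t t01; apply: (above_segment top); first by split => //=; rewrite lexx ler01.
  rewrite -subset0 => _ [[s _ <-] /path_setP[r r01 E]]; have := gy r r01.
  by rewrite E /= subrr mulr0 addr0 ltxx andbF.
- move=> t t01 [A [cA As Ab A0 At]].
  have cb : continuum b.
    by apply: continuous_continuum2; [case: cg|split; [exact: segment_compact|exact: segment_connected]].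
  have i0 : 0 <= (0 : R) <= 1 by rewrite lexx ler01.
  have i1 : 0 <= (1 : R) <= 1 by rewrite lexx ler01.
  have [p [bp Ap]] : b `&` A !=set0.
    apply: (@crossing R b A (g 0) (g 1) (t, 0) (0, 1)) => //.
    - by apply/path_setP; exists 0.
    - by apply/path_setP; exists 1.
    - by move=> p /As[p1 _]; rewrite g0 g1.
    - by move=> _ /path_setP[s s01 <-]; have /andP[/ltW h /ltW h'] := gy s s01; rewrite /= h h'.
  by have : set0 p by rewrite -Ab.
- move=> p q sp sq ap nq; have [w [sw bw]] : segment p q `&` b !=set0.
    by apply/set0P/eqP => E; apply: nq; exact: above_segment E.
  by exists w => //; exact: segment_dist.
Qed.

(** With the path counted in the upper side, [two_sided] yields points close to it that are neither
    above nor on the path. *)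
Lemma above_path_hyp : two_sided_hyp g (above `|` b).
Proof.
have [h1 h2 h3] := above_hyp; have [_ _ _ _ gy] := cg; split.
- by move=> t t01; left; exact: h1.
- move=> t t01 [/(h2 t t01)//|/path_setP[s s01 E]].
  by have := gy s s01; rewrite E /= ltxx.
- move=> p q sp sq [ap|bp] nq; first by apply: h3 => // aq; apply: nq; left.
  by exists p => //; rewrite mdistxx mdist_ge0 mdist_sym lexx.
Qed.

Lemma above_near p q (e : R) : square p -> square q ->
  (forall w, b w -> e <= mdist p w) -> mdist p q < e -> above p <-> above q.
Proof.
move=> sp sq far pq; have [_ _ h] := above_hyp.
split=> [ap|aq]; apply: contrapT => n.
  by have [w bw [h1 h2]] := h p q sp sq ap n; have := far w bw; lra.
have [w bw [h1 h2]] := h q p sq sp aq n; have := far w bw.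
by rewrite mdist_sym in h2; move: h2; rewrite mdist_sym in pq; move: h1; rewrite mdist_sym; lra.
Qed.

End Above.
End Sides.

(** * Parametrised arcs, end points and crossing times *)

Section ArcTools.
Context {R : realType} {S : metricType R}.
Implicit Types (x y z u v w : S) (A B C D E F J K L M N O P U V W Y : set S).
Hypothesis S_compact : compact [set: S].

(** Retraction of the line to the unit interval, which makes parametrisations continuous on all of
    [R]. *)
Definition clamp (t : R) : R := if t <= 0 then 0 else if 1 <= t then 1 else t.

Lemma clamp_in t : 0 <= clamp t <= 1.
Proof.
rewrite /clamp; have [t0|t0] := leP t 0; first by rewrite lexx ler01.
by have [t1|t1] := leP 1 t; rewrite ?lexx ?ler01 ?(ltW t0) ?(ltW t1).
Qed.

Lemma clamp_id t : 0 <= t <= 1 -> clamp t = t.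
Proof.
move=> /andP[t0 t1]; rewrite /clamp; have [t0'|_] := leP t 0.
  by apply/eqP; rewrite eq_le t0 t0'.
by have [t1'|//] := leP 1 t; apply/eqP; rewrite eq_le t1 t1'.
Qed.

Lemma clamp_dist s t : `|clamp s - clamp t| <= `|s - t|.
Proof.
have h1 := ler_norm (s - t); have h2 := ler_norm (t - s); rewrite distrC in h2.
rewrite /clamp; case: (lerP s 0) => s0; case: (lerP t 0) => t0; try case: (lerP 1 s) => s1;
  try case: (lerP 1 t) => t1; rewrite ?subrr ?normr0 ?normr_ge0//;
  by rewrite ler_norml; apply/andP; split; lra.
Qed.

Definition arc_param K u v (g : S -> R) (h : R -> S) := [/\ continuous h,
  h 0 = u /\ h 1 = v, forall t, 0 <= t <= 1 -> K (h t) /\ g (h t) = t,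
  forall z, K z -> 0 <= g z <= 1 /\ h (g z) = z &
  forall z (e : R), K z -> 0 < e -> exists2 d : R, 0 < d & forall w, K w ->
    mdist z w < d -> `|g z - g w| < e].

Lemma irred_arc_param K u v : @second_countable S -> irred K u v -> lc_subset K -> u <> v ->
  exists g h, arc_param K u v g h.
Proof.
move=> sc iK lK uv; have [g [h [[gu gv [h0 h1]] gK hK gc hc]]] := irred_arc S_compact sc iK lK uv.
have i0 : 0 <= (0 : R) <= 1 by rewrite lexx ler01.
have i1 : 0 <= (1 : R) <= 1 by rewrite lexx ler01.
exists g, (h \o clamp); split => //=.
- move=> t V /nbhs_mdist_ex[e e0 eV].
  have [d d0 hd] := hc _ e (clamp_in t) e0; apply/nbhs_ballP; exists d => //= s ts.
  apply: eV; apply: hd; first exact: clamp_in.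
  by apply: le_lt_trans (clamp_dist _ _) _.
- by rewrite !clamp_id.
- by move=> t t01; rewrite clamp_id//; exact: hK.
- by move=> z Kz; have [g01 hg] := gK z Kz; rewrite clamp_id.
Qed.

Lemma param_arc K u v g h (a b : R) : arc_param K u v g h -> 0 <= a -> a < b -> b <= 1 ->
  Defs.arc R (h @` `[a, b]).
Proof.
move=> [ch [h0 h1] hK gK gc] a0 ab b1; set A := h @` _.
have ba : 0 < b - a by rewrite subr_gt0.
have AK z : A z -> K z /\ a <= g z <= b.
  move=> [t]; rewrite /= in_itv /= => /andP[ta tb] <-.
  by have [Kh ->] := hK t (introT andP (conj (le_trans a0 ta) (le_trans tb b1))); rewrite ta.
pose k z : R := (g z - a) / (b - a).
have kP z : A z -> [set t : R | 0 <= t <= 1] (k z).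
  move=> /AK[_ /andP[h2 h3]]; rewrite /k /= ler_pdivrMr// mul1r lerD2r h3 andbT.
  by apply: divr_ge0; [rewrite subr_ge0|exact: ltW].
pose l (t : R) : S := h (a + t * (b - a)).
have lin (t : R) : 0 <= t <= 1 -> a <= a + t * (b - a) <= b.
  by move=> /andP[t0 t1]; apply/andP; split; nra.
have lP (t : R) : [set t : R | 0 <= t <= 1] t -> A (l t).
  by move=> /lin t01; exists (a + t * (b - a)); rewrite //= in_itv.
pose F (z : set_type A) : set_type [set t : R | 0 <= t <= 1] := mkset_type (kP _ (set_typeP z)).
pose G (t : set_type [set t : R | 0 <= t <= 1]) : set_type A := mkset_type (lP _ (set_typeP t)).
have FG : cancel F G.
  move=> z; apply: val_inj; rewrite /= /l /k divfK ?lt0r_neq0// addrC subrK.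
  by have [Kz _] := AK _ (set_typeP z); have [] := gK _ Kz.
have GF : cancel G F.
  move=> t; apply: val_inj; rewrite /= /k /l.
  have /andP[t1 t2] := lin _ (set_typeP t).
  have [_ ->] := hK _ (introT andP (conj (le_trans a0 t1) (le_trans t2 b1))).
  by rewrite addrC addKr mulfK// lt0r_neq0.
have cF' : continuous (fun z : set_type A => k (set_val z)).
  move=> z V /nbhs_ballP[e /= e0 eV].
  have [Kz _] := AK _ (set_typeP z).
  have [d d0 hd] := gc _ (e * (b - a)) Kz (mulr_gt0 e0 ba).
  have nz := @set_val_continuous _ _ z _ (nbhs_mdist_lt (set_val z) d0).
  apply: (@filterS _ _ (nbhs_filter z) _ _ _ nz) => w zw; apply: eV.
  have [Kw _] := AK _ (set_typeP w).
  rewrite /ball /= /k -mulrBl normrM (gtr0_norm (_ : 0 < (b - a)^-1)) ?invr_gt0//.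
  rewrite ltr_pdivrMr// (_ : g (set_val z) - a - (g (set_val w) - a) = g (set_val z) - g (set_val w)).
    exact: hd.
  by ring.
have cl : continuous l.
  move=> t; apply: (continuous_comp (f := fun t : R => a + t * (b - a))); last exact: ch.
  by apply: cvgD; [exact: cvg_cst|apply: cvgM; [exact: cvg_id|exact: cvg_cst]].
have cG' : continuous (fun t : set_type [set t : R | 0 <= t <= 1] => l (set_val t)).
  by move=> t; apply: continuous_comp; [exact: set_val_continuous|exact: cl].
constructor; apply: (Homeo FG GF); exact: continuous_to_set_type.
Qed.

Lemma param_connected (h : R -> S) (I : set R) : continuous h -> is_interval I ->
  connected (h @` I).
Proof.
move=> ch iI; apply: connected_continuous_connected; last exact: continuous_subspaceT.
exact/connected_intervalP.
Qed.

(** Used by contraposition: removing a crossing point separates the arc, so it is not an end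
    point. *)
Lemma endpoint_connected A x : arc_endpoint R A x -> connected (A `\ x).
Proof.
move=> [H [a ax He]].
pose I01 := [set t : R | 0 <= t <= 1].
pose J : set R := I01 `\ set_val (H a).
have JI : J `<=` I01 by move=> t [].
have cJ : connected J.
  apply/connected_intervalP; case: He => E p q [/andP[p0 p1] pn] [/andP[q0 q1] qn] r /andP[pr rq].
    split; first by rewrite /I01 /=; apply/andP; split; lra.
    move=> /= rE; apply: pn; rewrite /= E in rE *; apply/eqP; rewrite eq_le p0.
    by rewrite -rE pr.
  split; first by rewrite /I01 /=; apply/andP; split; lra.
  move=> /= rE; apply: qn; rewrite /= E in rE *; apply/eqP; rewrite eq_le q1.
  by rewrite -rE rq.
have cJ' := connected_set_type JI cJ.
have cim : connected (homeo_inv H @` (set_val @^-1` J)).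
  apply: connected_continuous_connected => //; apply: continuous_subspaceT.
  exact: homeo_inv_continuous.
have := connected_set_val cim; congr connected; apply/seteqP; split.
  move=> _ [_ [t [_ nt] <-] <-]; split; first exact: set_typeP.
  move=> /= E; apply: nt; congr set_val; rewrite -[t](homeo_invK H); congr (H _).
  by apply: val_inj; rewrite [LHS]E -ax.
move=> y [Ay yx]; exists (mkset_type Ay) => //.
exists (H (mkset_type Ay)); last by rewrite homeo_funK.
split; first exact: set_typeP.
move=> /= E; apply: yx => /=; rewrite -ax.
have : H (mkset_type Ay) = H a by exact: val_inj.
by move=> /(congr1 (homeo_inv H)); rewrite !homeo_funK => <-.
Qed.

Lemma chart_closed_disc (phi : R * R -> S) : chart phi -> closed_disc R (disc phi).
Proof.
move=> cphi; have [cp inj op] := cphi; have [psi [psiK _ psic]] := chart_inverse cphi.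
have psiD z : disc phi z -> [set p : R * R | p.1 ^+ 2 + p.2 ^+ 2 <= 1] (psi z).
  by move=> Dz; have [p Dp pz] := Dz; rewrite (_ : psi z = p)//; apply: inj; rewrite psiK.
have phiD p : [set p : R * R | p.1 ^+ 2 + p.2 ^+ 2 <= 1] p -> disc phi (phi p).
  by move=> Dp; exists p.
pose F (z : set_type (disc phi)) : set_type [set p : R * R | p.1 ^+ 2 + p.2 ^+ 2 <= 1] :=
  mkset_type (psiD _ (set_typeP z)).
pose G (p : set_type [set p : R * R | p.1 ^+ 2 + p.2 ^+ 2 <= 1]) : set_type (disc phi) :=
  mkset_type (phiD _ (set_typeP p)).
have FG : cancel F G by move=> z; apply: val_inj; rewrite /= psiK//; exact: set_typeP.
have GF : cancel G F.
  move=> p; apply: val_inj; rewrite /=; apply: inj; rewrite psiK//.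
  exact: (phiD _ (set_typeP p)).
have cF : continuous (fun z : set_type (disc phi) => psi (set_val z)).
  move=> z V psiV.
  have [p Dp pz] := set_typeP z.
  have oV : nbhs (set_val z) (phi @` (interior V)).
    rewrite -(psiK _ (set_typeP z)); apply: open_nbhs_nbhs; split.
      by apply: op; exact: open_interior.
    by exists (psi (set_val z)).
  have nz := @set_val_continuous _ _ z _ oV.
  apply: (@filterS _ _ (nbhs_filter z) _ _ _ nz) => w [q Vq qw].
  rewrite /= (_ : psi (set_val w) = q); first exact: interior_subset.
  by apply: inj; rewrite psiK; [rewrite qw|exact: set_typeP].
have cG : continuous (fun p : set_type [set p : R * R | p.1 ^+ 2 + p.2 ^+ 2 <= 1] => phi (set_val p)).
  by move=> p; apply: continuous_comp; [exact: set_val_continuous|exact: cp].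
constructor; apply: (Homeo FG GF); exact: continuous_to_set_type.
Qed.

(** The time [s] is the supremum of the times spent in [O1] off [B], so the path lies in [B] at [s].
    Finitely many hits isolate [s], and by connectedness the path keeps to one side just before
    it. *)
Lemma crossing_time (h : R -> S) B O1 O2 : continuous h -> closed B -> open O1 -> open O2 ->
  (forall t, 0 <= t <= 1 -> ~ B (h t) -> O1 (h t) \/ O2 (h t)) ->
  (forall t, 0 <= t <= 1 -> ~ B (h t) -> O1 (h t) -> ~ O2 (h t)) ->
  finite_set [set t : R | 0 <= t <= 1 /\ B (h t)] ->
  O1 (h 0) -> ~ B (h 0) -> O2 (h 1) -> ~ B (h 1) ->
  exists (s e : R), [/\ 0 < e, 0 <= s - e /\ s + e <= 1, B (h s),
    forall t, s - e <= t < s -> O1 (h t) /\ ~ B (h t) &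
    forall t, s < t <= s + e -> O2 (h t) /\ ~ B (h t)].
Proof.
move=> ch cB oO1 oO2 cov dis fin O10 nB0 O21 nB1.
pose T := [set t : R | [/\ 0 <= t <= 1, O1 (h t) & ~ B (h t)]].
have i0 : 0 <= (0 : R) <= 1 by rewrite lexx ler01.
have i1 : 0 <= (1 : R) <= 1 by rewrite lexx ler01.
have supT : has_sup T.
  by split; [exists 0|exists 1 => t [/andP[]]].
pose s := sup T.
have s0 : 0 <= s by apply: (sup_upper_bound supT).
have s1 : s <= 1 by apply: ge_sup; [exists 0|move=> t [/andP[]]].
have nbh U : open U -> U (h s) -> exists2 e : R, 0 < e & forall t, `|s - t| < e -> U (h t).
  move=> oU Us; have /ch/nbhs_ballP[e /= e0 he] := open_nbhs_nbhs (conj oU Us).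
  by exists e.
have oB : open (~` B) by exact: closed_openC.
have Bs : B (h s).
  apply: contrapT => nBs; have [e1 e10 h1] := nbh _ oB nBs.
  have s01 : 0 <= s <= 1 by rewrite s0.
  have [Os|Os] := cov s s01 nBs.
    have [e2 e20 h2] := nbh _ oO1 Os.
    have ls1 : s < 1.
      rewrite lt_neqAle s1 andbT; apply/eqP => E; apply: (dis 1 i1 nB1) => //.
      by rewrite -E.
    pose r := Num.min (e1 / 2) (Num.min (e2 / 2) (1 - s)).
    have r0 : 0 < r by rewrite !lt_min !divr_gt0// subr_gt0.
    have [r1 r2 r3] : [/\ r <= e1 / 2, r <= e2 / 2 & r <= 1 - s].
      by rewrite /r; split; rewrite !ge_min lexx ?orbT.
    have : s + r <= s.
      apply: (sup_upper_bound supT); split; first by apply/andP; split; lra.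
        by apply: h2; rewrite ltr_norml; apply/andP; split; lra.
      by apply: h1; rewrite ltr_norml; apply/andP; split; lra.
    by lra.
  have [e2 e20 h2] := nbh _ oO2 Os.
  have [t [t01 Ot nBt] st] := sup_adherent e20 supT.
  have ts : t <= s by apply: (sup_upper_bound supT).
  apply: (dis t t01 nBt Ot); apply: h2; rewrite ltr_norml; apply/andP; split; rewrite -/s in st; lra.
have ss0 : 0 < s by rewrite lt_neqAle s0 andbT; apply/eqP => E; apply: nB0; rewrite E.
have ss1 : s < 1 by rewrite lt_neqAle s1 andbT; apply/eqP => E; apply: nB1; rewrite -E.
have [e1 e10 iso] : exists2 e : R, 0 < e & forall t, 0 <= t <= 1 -> `|s - t| < e -> t <> s -> ~ B (h t).
  have fin' : finite_set ([set t : R | 0 <= t <= 1 /\ B (h t)] `\ s) by exact: finite_setD.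
  have cl : closed ([set t : R | 0 <= t <= 1 /\ B (h t)] `\ s).
    by apply: compact_closed; [exact: norm_hausdorff|exact: finite_compact].
  have op := closed_openC cl.
  have /nbhs_ballP[e /= e0 he] : nbhs s (~` ([set t : R | 0 <= t <= 1 /\ B (h t)] `\ s)).
    by apply: open_nbhs_nbhs; split => // -[_]; apply.
  by exists e => // t t01 st ts Bt; apply: (he t st).
pose e := Num.min (e1 / 2) (Num.min s (1 - s)).
have e0 : 0 < e by rewrite !lt_min divr_gt0// ss0 subr_gt0.
have [r1 r2 r3] : [/\ e <= e1 / 2, e <= s & e <= 1 - s].
  by rewrite /e; split; rewrite !ge_min lexx ?orbT.
exists s, e; split => //; first by split; lra.
- have nB t : s - e <= t < s -> 0 <= t <= 1 /\ ~ B (h t).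
    move=> /andP[t1 t2]; have t01 : 0 <= t <= 1 by apply/andP; split; lra.
    split => //; apply: iso => //; last by move=> E; move: t2; rewrite E ltxx.
    by rewrite ltr_norml; apply/andP; split; lra.
  have cI : connected (h @` `[(s - e), s[).
    by apply: param_connected => //; exact: interval_is_interval.
  have [t [t01 Ot nBt] st] := sup_adherent e0 supT.
  have ts : t <= s by apply: (sup_upper_bound supT).
  have sub : h @` `[(s - e), s[ `<=` O1.
    apply: (connected_open_split cI oO1 oO2).
    + move=> _ [r + <-]; rewrite /= in_itv /= => /nB[r01 nBr]; exact: cov.
    + rewrite -subset0 => _ [[[r + <-] h1] h2]; rewrite /= in_itv /= => /nB[r01 nBr].
      exact: (dis r).
    + exists (h t); split => //; exists t => //; rewrite /= in_itv /=; apply/andP; split.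
        by apply: ltW; rewrite -/s in st.
      rewrite lt_neqAle ts andbT; apply/eqP => E; apply: nBt.
      by rewrite E.
  move=> r rs; have [_ nBr] := nB r rs; split => //; apply: sub.
  by exists r; rewrite //= in_itv.
- move=> t /andP[t1 t2]; have t01 : 0 <= t <= 1 by apply/andP; split; lra.
  have nBt : ~ B (h t).
    apply: iso => //; last by move=> E; move: t1; rewrite E ltxx.
    by rewrite ltr_norml; apply/andP; split; lra.
  split => //; have [Ot|//] := cov t t01 nBt.
  by have : t <= s by [apply: (sup_upper_bound supT)]; rewrite leNgt t1.
Qed.
End ArcTools.

Section Transverse.
Context {R : realType} {S : metricType R}.
Implicit Types (x y z u v w : S) (A B C D E F J K L M N O P V W Y : set S).
Hypothesis S_compact : compact [set: S].
Hypothesis S_surface : surface R S.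

Lemma component_eq A C y : C `<=` A -> connected C -> C y ->
  (forall E, connected E -> E `<=` A -> E y -> E `<=` C) -> connected_component A y = C.
Proof.
move=> CA cC Cy maxC; apply/seteqP; split.
  apply: maxC; [exact: component_connected|exact: connected_component_sub|].
  by apply: connected_component_refl; exact: CA.
exact: connected_component_max.
Qed.

(** The disc is a chart disc inside [N], and [a] a short piece of the path in it. Off [B] the disc
    is divided between [O1] and [O2], so connected sets there stay on one side, which determines the
    components. The arc [B] need not lie in the disc. *)
Lemma transverse_core K u v (g : S -> R) (h : R -> S) B Fs Fu N O1 O2 (s e : R) :
  arc_param K u v g h -> K `<=` Fs -> Defs.arc R B -> B `<=` Fu ->
  nbhs (h s) N -> 0 < e -> 0 <= s - e -> s + e <= 1 -> B (h s) -> open O1 -> open O2 ->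
  (forall y, N y -> ~ B y -> O1 y \/ O2 y) ->
  (forall y, N y -> ~ B y -> O1 y -> ~ O2 y) ->
  (forall t : R, s - e <= t < s -> O1 (h t) /\ ~ B (h t)) ->
  (forall t : R, s < t <= s + e -> O2 (h t) /\ ~ B (h t)) ->
  top_transverse R Fs Fu (h s).
Proof.
move=> aK KF aB BF nN e0 se0 se1 Bs oO1 oO2 cov dis hb ha.
have [ch [h0 h1] hK gK gc] := aK.
have [phi [cphi p0 DN]] := small_chart S_surface nN.
have nD : nbhs (h s) (disc phi) by rewrite -p0; exact: chart_center.
have /ch/nbhs_ballP[r /= r0 hr] := nD.
pose e1 := Num.min e (r / 2).
have e10 : 0 < e1 by rewrite lt_min e0 divr_gt0.
have [e1e e1r] : e1 <= e /\ e1 <= r / 2 by rewrite /e1; split; rewrite ge_min lexx ?orbT.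
pose a := h @` `[(s - e1), (s + e1)].
pose a1 := h @` `[(s - e1), s[; pose a2 := h @` `]s, (s + e1)].
have aE y : a y -> y = h s \/ a1 y \/ a2 y.
  move=> [t]; rewrite /= in_itv /= => /andP[t1 t2] <-.
  have [ts|ts|->] := ltgtP t s; last by left.
    by right; left; exists t; rewrite //= in_itv /= t1.
  by right; right; exists t; rewrite //= in_itv /= t2 andbT.
have a1a : a1 `<=` a.
  move=> _ [t + <-]; rewrite /= in_itv /= => /andP[t1 t2]; exists t => //=.
  by rewrite in_itv /= t1 /=; lra.
have a2a : a2 `<=` a.
  move=> _ [t + <-]; rewrite /= in_itv /= => /andP[t1 t2]; exists t => //=.
  by rewrite in_itv /= t2 andbT; lra.
have a1P y : a1 y -> O1 y /\ ~ B y.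
  by move=> [t + <-]; rewrite /= in_itv /= => /andP[t1 t2]; apply: hb; rewrite t2 andbT; lra.
have a2P y : a2 y -> O2 y /\ ~ B y.
  by move=> [t + <-]; rewrite /= in_itv /= => /andP[t1 t2]; apply: ha; rewrite t1 /=; lra.
have aD : a `<=` disc phi.
  move=> _ [t + <-]; rewrite /= in_itv /= => /andP[t1 t2]; apply: hr.
  by rewrite /ball /= ltr_norml; apply/andP; split; lra.
have aK' : a `<=` K.
  move=> _ [t + <-]; rewrite /= in_itv /= => /andP[t1 t2].
  by have [] := hK t _ => //; apply/andP; split; lra.
have aB' : a `\` B = a1 `|` a2.
  apply/seteqP; split => [y [/aE[->//|//]]|y [a1y|a2y]].
    by split; [exact: a1a|case: (a1P y a1y)].
  by split; [exact: a2a|case: (a2P y a2y)].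
pose p1 := h (s - e1); pose p2 := h (s + e1).
have a1p : a1 p1 by exists (s - e1); rewrite //= in_itv /= lexx /=; lra.
have a2p : a2 p2 by exists (s + e1); rewrite //= in_itv /= lexx andbT; lra.
have ca1 : connected a1 by apply: param_connected => //; exact: interval_is_interval.
have ca2 : connected a2 by apply: param_connected => //; exact: interval_is_interval.
have split1 E y : connected E -> E `<=` disc phi `\` B -> E y -> O1 y -> E `<=` O1.
  move=> cE ED Ey Oy; apply: (connected_open_split cE oO1 oO2).
  - by move=> w /ED[/DN Nw nBw]; exact: cov.
  - by rewrite -subset0 => w [[/ED[/DN Nw nBw] Ow1] Ow2]; exact: (dis w).
  - by exists y.
have split2 E y : connected E -> E `<=` disc phi `\` B -> E y -> O2 y -> E `<=` O2.
  move=> cE ED Ey Oy; apply: (connected_open_split cE oO2 oO1).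
  - by move=> w /ED[/DN Nw nBw]; rewrite setUC; exact: cov.
  - by rewrite -subset0 => w [[/ED[/DN Nw nBw] Ow1] Ow2]; exact: (dis w).
  - by exists y.
have sub1 : a1 `<=` disc phi `\` B.
  by move=> y a1y; split; [exact/aD/a1a|case: (a1P y a1y)].
have sub2 : a2 `<=` disc phi `\` B.
  by move=> y a2y; split; [exact/aD/a2a|case: (a2P y a2y)].
have not12 y : disc phi y -> ~ B y -> O1 y -> ~ O2 y by move=> /DN; exact: dis.
have nboth E : connected E -> E `<=` disc phi `\` B -> E p1 -> E p2 -> False.
  move=> cE ED E1 E2; have [ O2p _] := a2P _ a2p; have [ O1p _] := a1P _ a1p.
  have [D2 nB2] := ED p2 E2.
  by apply: (not12 p2) => //; exact: (split1 E p1).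
have comp1 y : a1 y -> connected_component (a `\` B) y = a1.
  move=> a1y; apply: component_eq => //; first by rewrite aB'; left.
  move=> E cE EA Ey w Ew; have ED : E `<=` disc phi `\` B.
    by move=> q /EA; rewrite aB' => -[/sub1|/sub2].
  have [ O1y _] := a1P y a1y; have O1w := split1 E y cE ED Ey O1y w Ew.
  have := EA w Ew; rewrite aB' => -[//|a2w]; have [Dw nBw] := ED w Ew.
  by have [ O2w _] := a2P w a2w; case: (not12 w Dw nBw O1w O2w).
have comp2 y : a2 y -> connected_component (a `\` B) y = a2.
  move=> a2y; apply: component_eq => //; first by rewrite aB'; right.
  move=> E cE EA Ey w Ew; have ED : E `<=` disc phi `\` B.
    by move=> q /EA; rewrite aB' => -[/sub1|/sub2].
  have [ O2y _] := a2P y a2y; have O2w := split2 E y cE ED Ey O2y w Ew.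
  have := EA w Ew; rewrite aB' => -[a1w|//]; have [Dw nBw] := ED w Ew.
  by have [ O1w _] := a1P w a1w; case: (not12 w Dw nBw O1w O2w).
exists a, B, (disc phi); split.
- split => //; first by apply: (param_arc aK); lra.
  by apply: subset_trans KF.
- apply/seteqP; split => [y [/aE[->//|[/a1P[_ nB]|/a2P[_ nB]]] By]|_ ->]; [by []..|].
  by split => //; exists s => //; rewrite /= in_itv /=; apply/andP; split; lra.
- move=> /endpoint_connected cax; apply: (nboth _ cax).
  + move=> y [/aE[->|[/sub1//|/sub2//]]] ns; by case: ns.
  + split; first exact: a1a.
    by move=> E; have [_] := a1P _ a1p; rewrite E.
  + split; first exact: a2a.
    by move=> E; have [_] := a2P _ a2p; rewrite E.
- split => //; first exact: chart_closed_disc.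
  by move=> cD; apply: (nboth _ cD) => //; [exact: sub1|exact: sub2].
- exists a1, a2, (connected_component (disc phi `\` B) p1), (connected_component (disc phi `\` B) p2).
  split.
  + apply/seteqP; split => [C [y]|C [->|->]].
    * by rewrite {1}aB' => -[/comp1 ->|/comp2 ->] ->; [left|right].
    * by exists p1; [rewrite aB'; left|rewrite comp1].
    * by exists p2; [rewrite aB'; right|rewrite comp2].
  + move=> E; apply: (nboth a1) => //; by rewrite E.
  + by split; [exists p1 => //; exact: sub1|exists p2 => //; exact: sub2].
  + move=> E; apply: (nboth (connected_component (disc phi `\` B) p1)).
    * exact: component_connected.
    * exact: connected_component_sub.
    * by apply: connected_component_refl; exact: sub1.
    * by rewrite E; apply: connected_component_refl; exact: sub2.
  + by split; apply: connected_component_max.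
Qed.

Lemma first_hit (k : R -> R) (s : R) : continuous k -> k 0 < s -> s <= k 1 ->
  exists t, [/\ 0 < t, t <= 1, k t = s & forall r : R, 0 <= r < t -> k r < s].
Proof.
move=> ck k0 k1; pose T := [set r : R | 0 <= r <= 1 /\ forall q : R, 0 <= q <= r -> k q < s].
have supT : has_sup T.
  split; last by exists 1 => r [/andP[]].
  exists 0; split; first by rewrite lexx ler01.
  by move=> q /andP[q0 q0']; rewrite (_ : q = 0)//; apply/eqP; rewrite eq_le q0 q0'.
pose t := sup T.
have t0 : 0 <= t.
  apply: (sup_upper_bound supT); split; first by rewrite lexx ler01.
  by move=> q /andP[q0 q0']; rewrite (_ : q = 0)//; apply/eqP; rewrite eq_le q0 q0'.
have t1 : t <= 1 by apply: ge_sup; [case: supT|move=> r [/andP[]]].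
have lt (r : R) : 0 <= r < t -> k r < s.
  move=> /andP[r0 rt]; have tr : 0 < t - r by rewrite subr_gt0.
  have [q [q01 hq] rq] := sup_adherent tr supT.
  by apply: hq; rewrite r0 /=; move: rq; rewrite -/t; lra.
have near (r : R) : k r != s -> exists2 d : R, 0 < d & forall q, `|r - q| < d ->
    (k q < s) = (k r < s).
  move=> rs; have e0 : 0 < `|k r - s| by rewrite normr_gt0 subr_eq0.
  have /nbhs_ballP[d /= d0 hd] := ck r _ (nbhsx_ballx (k r) _ e0).
  have hd' q : `|r - q| < d -> `|k r - k q| < `|k r - s| by exact: hd.
  exists d => // q /hd'; have [krs|krs|E] := ltgtP (k r) s.
  - have -> : `|k r - s| = s - k r by rewrite ltr0_norm ?subr_lt0// opprB.
    by rewrite ltr_norml => /andP[a1 a2]; lra.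
  - have -> : `|k r - s| = k r - s by rewrite gtr0_norm// subr_gt0.
    rewrite ltr_norml => /andP[a1 a2].
    by apply/negbTE; rewrite -leNgt; lra.
  - by move: rs; rewrite E eqxx.
have kt : k t = s.
  apply/eqP; apply: contrapT => /negP nE; have [d d0 hd] := near t nE.
  have [kts|kts|E] := ltgtP (k t) s; last by move: nE; rewrite E eqxx.
    have lt1 : t < 1.
      by rewrite lt_neqAle t1 andbT; apply/eqP => E; move: kts; rewrite E ltNge k1.
    pose r := Num.min (d / 2) (1 - t).
    have r0 : 0 < r by rewrite lt_min divr_gt0// subr_gt0.
    have [r1 r2] : r <= d / 2 /\ r <= 1 - t by rewrite /r; split; rewrite ge_min lexx ?orbT.
    have : t + r <= t.
      apply: (sup_upper_bound supT); split; first by apply/andP; split; lra.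
      move=> q /andP[q0 q1]; have [qt|qt] := ltP q t; first by apply: lt; rewrite q0.
      by rewrite hd// ltr_norml; apply/andP; split; lra.
    by lra.
  have tpos : 0 < t.
    by rewrite lt_neqAle t0 andbT; apply/eqP => E; move: kts; rewrite -E ltNge ltW.
  pose r := Num.min (d / 2) t.
  have r0 : 0 < r by rewrite lt_min divr_gt0.
  have [r1 r2] : r <= d / 2 /\ r <= t by rewrite /r; split; rewrite ge_min lexx ?orbT.
  have : k (t - r) < s by apply: lt; apply/andP; split; lra.
  by rewrite hd; [rewrite ltNge ltW|rewrite ltr_norml; apply/andP; split; lra].
exists t; split => //; rewrite lt_neqAle t0 andbT; apply/eqP => E.
by move: k0; rewrite {1}E kt ltxx.
Qed.

Lemma chart_comp (phi : R * R -> S) (L M : R * R -> R * R) : continuous L -> continuous M ->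
  cancel L M -> cancel M L -> chart phi -> chart (phi \o L).
Proof.
move=> cL cM LM ML [cp inj op]; split.
- by move=> p; apply: continuous_comp; [exact: cL|exact: cp].
- by move=> p q /inj/(can_inj LM).
- move=> O oO; rewrite -image_comp; apply: op.
  rewrite (_ : L @` O = M @^-1` O); first by apply: open_comp => // p _; exact: cM.
  apply/seteqP; split => [_ [p Op <-]|p Op]; first by rewrite /preimage /= LM.
  by exists (M p) => //; rewrite ML.
Qed.

Definition box (r : R) : set (R * R) := [set p | `|p.1| <= r /\ `|p.2| <= r].

(** Between the last visit to the initial abscissa and the first visit to the final one, the path
    stays strictly between the two. The strip of height 1 above this range is rescaled to the unit
    square; as the path lies in the box of radius [1 / 4], it avoids top and bottom. *)
Lemma rectangle_core (phi : R * R -> S) (P : R -> R * R) : chart phi -> continuous P ->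
  (forall s t : R, 0 <= s <= 1 -> 0 <= t <= 1 -> P s = P t -> s = t) ->
  (forall t : R, 0 <= t <= 1 -> box (1 / 4) (P t)) -> (P 0).1 < (P 1).1 ->
  exists psi gm (a b : R), [/\ chart psi, crosses gm, [/\ 0 <= a, a < b & b <= 1],
    psi @` @square R `<=` phi @` box (1 / 2) &
    forall t : R, psi (gm t) = phi (P (a + t * (b - a)))].
Proof.
move=> cphi cP Pi Pb P01; set s0 := (P 0).1 in P01; set s1 := (P 1).1 in P01.
have cu : continuous (fun t => (P t).1).
  by move=> t; apply: continuous_comp; [exact: cP|exact: cvg_fst].
have cv : continuous (fun t => (P t).2).
  by move=> t; apply: continuous_comp; [exact: cP|exact: cvg_snd].
have [b [b0 b1 ub hb]] := first_hit cu P01 (lexx _).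
have clin (x y : R) : continuous (fun t : R => x + t * y).
  by move=> t; apply: cvgD; [exact: cvg_cst|apply: cvgM; [exact: cvg_id|exact: cvg_cst]].
(* Time is reversed from [b] and values are negated, so that [first_hit] finds the last visit to
   [s0] before [b]. *)
have cu' : continuous (fun t : R => - (P (b + t * - b)).1).
  have c3 : continuous (fun t : R => (P (b + t * - b)).1).
    move=> t; apply: (continuous_comp (f := fun t : R => b + t * - b) (g := fun t : R => (P t).1)).
      exact: clin.
    exact: cu.
  by move=> t; exact: (cvgN (c3 t)).
have h0 : - (P (b + 0 * - b)).1 < - s0 by rewrite mul0r addr0 ub ltrN2.
have h1 : - s0 <= - (P (b + 1 * - b)).1 by rewrite mul1r subrr.
have [r [r0 r1 ur hr]] := first_hit cu' h0 h1.
pose a := b + r * - b.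
have ua : (P a).1 = s0 by apply: oppr_inj; rewrite ur.
have a0 : 0 <= a by rewrite /a; nra.
have ab : a < b by rewrite /a mulrN ltrBlDr ltrDl mulr_gt0.
have ha (t : R) : a < t <= b -> s0 < (P t).1.
  move=> /andP[at' tb]; pose q := (b - t) / b.
  have qE : b + q * - b = t by rewrite /q mulrN divfK ?lt0r_neq0//; ring.
  have : - (P (b + q * - b)).1 < - s0.
    apply: hr; apply/andP; split; first by apply: divr_ge0; [rewrite subr_ge0|exact: ltW].
    by rewrite ltr_pdivrMr//; move: at'; rewrite /a; lra.
  by rewrite qE ltrN2.
have s10 : 0 < s1 - s0 by rewrite subr_gt0.
have ba : 0 < b - a by rewrite subr_gt0.
pose L (q : R * R) := (s0 + q.1 * (s1 - s0), - (1 / 2) + q.2 * 1).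
pose M (q : R * R) := (- (s0 / (s1 - s0)) + q.1 * (s1 - s0)^-1, 1 / 2 + q.2 * 1).
have c1 (x y : R) : continuous (fun q : R * R => x + q.1 * y).
  move=> q; apply: (continuous_comp (f := fun q : R * R => q.1) (g := fun t : R => x + t * y));
    [exact: cvg_fst|exact: clin].
have c2 (x y : R) : continuous (fun q : R * R => x + q.2 * y).
  move=> q; apply: (continuous_comp (f := fun q : R * R => q.2) (g := fun t : R => x + t * y));
    [exact: cvg_snd|exact: clin].
have cL : continuous L by apply: pair_continuous; [exact: c1|exact: c2].
have cM : continuous M by apply: pair_continuous; [exact: c1|exact: c2].
have n10 := lt0r_neq0 s10.
have LM : cancel L M.
  by move=> [x y]; rewrite /L /M /=; congr pair; [field|field].
have ML : cancel M L.
  by move=> [x y]; rewrite /L /M /=; congr pair; [field|field].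
pose gm t := M (P (a + t * (b - a))).
have lin (t : R) : 0 <= t <= 1 -> a <= a + t * (b - a) <= b.
  by move=> /andP[t0 t1]; apply/andP; split; nra.
have in01 (t : R) : a <= t <= b -> 0 <= t <= 1 by move=> /andP[? ?]; apply/andP; split; lra.
have P4 (t : R) : 0 <= t <= 1 -> box (1 / 4) (P t) by exact: Pb.
have i0 : 0 <= (0 : R) <= 1 by rewrite lexx ler01.
have i1 : 0 <= (1 : R) <= 1 by rewrite lexx ler01.
exists (phi \o L), gm, a, b; split => //.
- exact: chart_comp LM ML cphi.
- split.
  + move=> t; apply: (continuous_comp (f := fun t : R => P (a + t * (b - a)))); last exact: cM.
    by apply: (continuous_comp (f := fun t : R => a + t * (b - a))); [exact: clin|exact: cP].
  + move=> s t s01 t01 /(can_inj ML) E.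
    have := Pi _ _ (in01 _ (lin s s01)) (in01 _ (lin t t01)) E.
    by move=> /addrI /(mulIf (lt0r_neq0 ba)).
  + rewrite /gm mul0r addr0 mul1r addrC subrK /M /= ua ub; split; field => //.
  + move=> t /andP[t0 t1]; rewrite /gm /M /=.
    have h2 : s0 < (P (a + t * (b - a))).1.
      by apply: ha; apply/andP; split; nra.
    have h3 : (P (a + t * (b - a))).1 < s1.
      by apply: hb; apply/andP; split; nra.
    rewrite addrC -mulNr -mulrDl; apply/andP; split; first by rewrite divr_gt0// subr_gt0.
    by rewrite ltr_pdivrMr// mul1r ltrD2r.
  + move=> t t01; have [_] := P4 _ (in01 _ (lin t t01)); rewrite /gm /M /= ler_norml => /andP[h2 h3].
    by apply/andP; split; lra.
- move=> _ [q [/andP[q1 q2] /andP[q3 q4]] <-]; exists (L q) => //.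
  have [+ _] := P4 0 i0; have [+ _] := P4 1 i1; rewrite -/s0 -/s1 !ler_norml.
  move=> /andP[h2 h3] /andP[h4 h5]; rewrite /L; split; rewrite /= ler_norml; apply/andP; split; nra.
- by move=> t; rewrite /gm /= ML.
Qed.

End Transverse.

(** * Rectangles cut by an unstable arc *)

Section Rectangle.
Context {R : realType} {S : metricType R}.
Implicit Types (x y z u v w : S) (B C D E F J K L N O V W Y : set S).
Hypothesis S_compact : compact [set: S].
Hypothesis S_surface : surface R S.

Let S_lc : locally_connected S := surface_lc S_surface.
Let S_perfect : forall x : S, ~ open [set x] := surface_perfect S_surface.
Let S_countable : @second_countable S. Proof. by case: S_surface. Qed.

Lemma clamp_continuous : continuous (@clamp R).
Proof.
move=> t V /nbhs_ballP[e /= e0 eV]; apply/nbhs_ballP; exists e => //= s ts.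
by apply: eV; apply: le_lt_trans (clamp_dist _ _) _.
Qed.

(** The path may run to the left or end at its initial abscissa; a symmetry of the boxes prepares it
    for [rectangle_core]. *)
Lemma rotate_axes (p q : R * R) : p <> q -> exists L M : R * R -> R * R,
  [/\ continuous L, continuous M, cancel L M /\ cancel M L,
    forall r a, (box r a -> box r (L a)) /\ (box r a -> box r (M a)) &
    (M p).1 < (M q).1].
Proof.
move=> pq.
have c1 : continuous (fun a : R * R => a.1) by move=> a; exact: cvg_fst.
have c2 : continuous (fun a : R * R => a.2) by move=> a; exact: cvg_snd.
have n1 : continuous (fun a : R * R => - a.1) by move=> a; exact: (cvgN (c1 a)).
have n2 : continuous (fun a : R * R => - a.2) by move=> a; exact: (cvgN (c2 a)).
have [h1|h1|E1] := ltgtP p.1 q.1.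
- by exists id, id; split => //; move=> a; exact: cvg_id.
- exists (fun a => (- a.1, a.2)), (fun a => (- a.1, a.2)); split => //=.
  + exact: pair_continuous.
  + exact: pair_continuous.
  + by split => -[a b] /=; rewrite opprK.
  + by move=> r a; rewrite /box /= normrN.
  + by rewrite ltrN2.
- have [h2|h2|E2] := ltgtP p.2 q.2.
  + exists (fun a => (a.2, a.1)), (fun a => (a.2, a.1)); split => //=.
    * exact: pair_continuous.
    * exact: pair_continuous.
    * by split => -[a b].
    * by move=> r a; rewrite /box /=; split => -[].
  + exists (fun a => (a.2, - a.1)), (fun a => (- a.2, a.1)); split => //=.
    * exact: pair_continuous.
    * exact: pair_continuous.
    * by split => -[a b] /=; rewrite opprK.
    * by move=> r a; rewrite /box /= !normrN; split => -[].
    * by rewrite ltrN2.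
  + by case: pq; rewrite [p]surjective_pairing [q]surjective_pairing E1 E2.
Qed.

Lemma box_disc (phi : R * R -> S) : phi @` box (1 / 2) `<=` disc phi.
Proof.
apply: image_subset => p [h1 h2]; rewrite /unit_disc /normsq /=.
rewrite -[p.1 ^+ 2]real_normK ?num_real// -[p.2 ^+ 2]real_normK ?num_real//.
by have a1 := normr_ge0 p.1; have a2 := normr_ge0 p.2; nra.
Qed.

Lemma box_compact (r : R) : compact (@box R r).
Proof.
rewrite (_ : box r = `[- r, r]%classic `*` `[- r, r]%classic).
  by apply: compact_setX; exact: segment_compact.
by apply/seteqP; split => -[a b] [/=]; rewrite /= !in_itv /= -!ler_norml.
Qed.

Lemma box_nbhs (phi : R * R -> S) : chart phi -> interior (phi @` box (1 / 4)) (phi (0 : R * R)).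
Proof.
move=> [_ _ op]; have e0 : 0 < (1 / 4 : R) by rewrite divr_gt0.
have oU := op _ (@open_mdist_lt R (R * R)%type 0 (1 / 4)).
apply: (filterS _ (open_nbhs_nbhs (conj oU _))); last by exists 0 => //=; rewrite mdistxx.
by apply: image_subset => p; rewrite /= plane_dist0 => /andP[/ltW ? /ltW ?].
Qed.

(** The point [y0] need not lie on the crossing arc, only in [B]; this is enough to place the arc in
    the leaf of [y0]. *)
Lemma rectangle_ex (k : homeo S S) (c : R) y0 V : cwF_const k c -> nbhs y0 V ->
  exists psi gm B, [/\ chart psi, crosses gm, psi @` @square R `<=` V,
    [/\ stab k B, B y0, forall n, fsmall (iter n k) c B & psi @` path_set gm `<=` B] &
    Defs.arc R (psi @` path_set gm)].
Proof.
move=> Hk nV; have [phi [cphi p0 DV]] := small_chart S_surface nV.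
have [cp inj op] := cphi.
have q12 : (1 / 4 : R) <= 1 / 2 by lra.
have box12 : @box R (1 / 4) `<=` box (1 / 2).
  by move=> p [h1 h2]; split; [exact: le_trans h1 q12|exact: le_trans h2 q12].
have cF : closed (phi @` box (1 / 4)).
  apply: compact_closedS; apply: continuous_compact; last exact: box_compact.
  exact: continuous_subspaceT.
have iF : interior (phi @` box (1 / 4)) y0 by rewrite -p0; exact: box_nbhs.
have [B [sB bB By0 BF [y By yy0]]] := uniform_stable_in S_compact S_lc S_perfect Hk cF iF.
have [K KB iK] := irred_ex S_compact S_countable sB.1 By0 By.
have lK : lc_subset K by apply: (stab_hereditarily_lc S_compact S_surface Hk sB) => //; case: iK.
have [g [h aK]] := irred_arc_param S_compact S_countable iK lK (nesym (elimN eqP yy0)).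
have [ch [h0 h1] hK gK gc] := aK.
have [psi0 [psiK _ _]] := chart_inverse cphi.
pose P t := psi0 (h (clamp t)).
have FD : phi @` box (1 / 4) `<=` disc phi.
  by apply: subset_trans (@box_disc phi); exact: image_subset.
have hF t : (phi @` box (1 / 4)) (h (clamp t)).
  by apply: BF; apply: KB; have [] := hK _ (clamp_in t).
have PE t : phi (P t) = h (clamp t) by apply: psiK; exact: FD.
have Pb t : box (1 / 4) (P t) by have [p bp E] := hF t; rewrite (_ : P t = p)//; apply: inj; rewrite PE.
have cP : continuous P.
  move=> t W WP; have nW : nbhs (h (clamp t)) (phi @` interior W).
    rewrite -PE; apply: open_nbhs_nbhs; split; first by apply: op; exact: open_interior.
    by exists (P t).
  have nt := @clamp_continuous t _ (ch _ _ nW).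
  apply: (@filterS _ _ (nbhs_filter t) _ _ _ nt) => s [q Wq qs].
  by rewrite /= (_ : P s = q); [exact: interior_subset|apply: inj; rewrite PE].
have Pi (s t : R) : 0 <= s <= 1 -> 0 <= t <= 1 -> P s = P t -> s = t.
  move=> s01 t01 /(congr1 phi); rewrite !PE !clamp_id// => /(congr1 g).
  by have [_ ->] := hK s s01; have [_ ->] := hK t t01.
have i0 : 0 <= (0 : R) <= 1 by rewrite lexx ler01.
have i1 : 0 <= (1 : R) <= 1 by rewrite lexx ler01.
have P01 : P 0 <> P 1 by move=> /(Pi _ _ i0 i1)/eqP; rewrite eq_sym oner_eq0.
have [L [M [cL cM [LM ML] LMb M01]]] := rotate_axes P01.
have cMP : continuous (M \o P) by move=> t; apply: continuous_comp; [exact: cP|exact: cM].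
have [psi [gm [a [b [cpsi cgm [a0 ab b1] sub E]]]]] :=
  rectangle_core (chart_comp cL cM LM ML cphi) cMP
  (fun s t s01 t01 e => Pi s t s01 t01 (can_inj ML e)) (fun t _ => (LMb _ _).2 (Pb t)) M01.
have E' (t : R) : psi (gm t) = h (clamp (a + t * (b - a))) by rewrite E /= ML PE.
have lin (t : R) : 0 <= t <= 1 -> a <= a + t * (b - a) <= b.
  by move=> /andP[t0 t1]; apply/andP; split; nra.
have in01 (t : R) : a <= t <= b -> 0 <= t <= 1 by move=> /andP[? ?]; apply/andP; split; lra.
have pE : psi @` path_set gm = h @` `[a, b].
  apply/seteqP; split => [_ [_ /path_setP[t t01 <-] <-]|_ [t + <-]].
    by rewrite E' clamp_id ?in01 ?lin//; exists (a + t * (b - a)); rewrite //= in_itv /= lin.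
  rewrite /= in_itv /= => tab; have ba : 0 < b - a by rewrite subr_gt0.
  exists (gm ((t - a) / (b - a))).
    apply/path_setP; exists ((t - a) / (b - a)) => //; have /andP[t1 t2] := tab.
    rewrite ler_pdivrMr// mul1r lerD2r t2 andbT.
    by apply: divr_ge0; [rewrite subr_ge0|exact: ltW].
  by rewrite E' divfK ?lt0r_neq0// addrC subrK clamp_id// in01.
exists psi, gm, B; split => //.
- move=> _ /sub[q bq <-]; apply: DV; apply: box_disc; exists (L q) => //.
  by apply: (LMb _ _).1.
- split => //; rewrite pE => _ [t + <-]; rewrite /= in_itv /= => tab.
  by apply: KB; have [] := hK t (in01 t tab).
- by rewrite pE; exact: param_arc aK a0 ab b1.
Qed.

(** Bumping gives a nondegenerate subcontinuum of [B] inside [C], so small that its orbit is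
    [c]-bounded in both directions; expansivity makes it finite. *)
Lemma stab_unstab_degenerate (f : homeo S S) (c : R) B C O : cwF_const f c ->
  stab (hinv f) B -> (exists p q, [/\ B p, B q & p <> q]) -> stab f C ->
  open O -> B `&` O !=set0 -> ~ (B `&` O `<=` C).
Proof.
move=> Hc sB [p [q [Bp Bq pq]]] sC oO [w [Bw Ow]] BO.
have Hg := cwF_const_inv Hc; have c0 : 0 < c by case: Hc.
have [d1 d10 hd1] := stab_small_forward S_compact Hc c0.
have [d2 d20 hd2] := stab_small_forward S_compact Hg c0.
have [r r0 hr] := nbhs_mdist_ex (open_nbhs_nbhs (conj oO Ow)).
have [w' Bw' ww'] : exists2 w', B w' & w <> w'.
  by have [E|n] := pselect (w = p); [exists q => //; rewrite E|exists p].
have ww0 : 0 < mdist w w' by rewrite lt_neqAle mdist_ge0 andbT eq_sym; apply/eqP => /mdist_positivity.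
pose e := Num.min (mdist w w' / 2) (Num.min (r / 2) (Num.min (d1 / 2) (d2 / 2))).
have e0 : 0 < e by rewrite !lt_min !divr_gt0.
have [e1 e2 e3 e4] : [/\ e <= mdist w w' / 2, e <= r / 2, e <= d1 / 2 & e <= d2 / 2].
  by rewrite /e; split; rewrite !ge_min lexx ?orbT.
pose F := [set y | mdist w y <= e].
have nF : ~ (B `<=` F) by move=> /(_ w' Bw'); rewrite /F /=; lra.
have Fw : F w by rewrite /F /= mdistxx ltW.
have cF : closed F by exact: mdist_closed_le.
have [y Ey ny] := boundary_bumping S_compact sB.1 cF Bw Fw nF.
set E := connected_component (B `&` F) w in Ey.
have EBF : E `<=` B `&` F by exact: connected_component_sub.
have cE : continuum E.
  by apply: component_continuum => //; apply: closedI => //; exact: continuum_closed sB.1.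
have Ew : E w by exact: connected_component_refl.
have smallE (d : R) : e <= d / 2 -> small d E.
  by move=> ed; apply: (fsmall_center (h := id) (x := w)) => z /EBF[_ /= h]; apply: le_trans h ed.
have sE : stab f E.
  apply: stab_sub cE _ sC => z /EBF[Bz Fz]; apply: BO; split => //; apply: hr.
  by rewrite /F /= in Fz; lra.
have uE : stab (hinv f) E by apply: stab_sub cE _ sB => z /EBF[].
have finE : finite_set (E `&` E).
  by apply: Hc.2 => //; [exact: (hd1 E sE (smallE _ e3))|exact: (hd2 E uE (smallE _ e4))].
have E0 : w = y by apply: (finite_connected _ cE.2) => //; rewrite -[E]setIid.
apply: ny; rewrite -E0; apply: (filterS _ (nbhs_mdist_lt w e0)) => z /= h.
exact: ltW.
Qed.

Lemma countable_seq (J : countType) (C : J -> set S) : exists D : nat -> set S,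
  (forall n, D n = set0 \/ exists i, D n = C i) /\ forall i, exists n, D n = C i.
Proof.
exists (fun n => if @choice.unpickle J n is Datatypes.Some i then C i else set0); split.
  by move=> n; case: (choice.unpickle n) => [i|]; [right; exists i|left].
by move=> i; exists (choice.pickle i); rewrite choice.pickleK.
Qed.

Lemma cover_dense (J : countType) (C : J -> set S) V :
  (forall i, closed (C i) /\ interior (C i) = set0) -> open V -> V !=set0 ->
  exists2 x, V x & forall i, ~ C i x.
Proof.
move=> hC oV [x0 Vx0]; apply: contrapT => n.
have [D [D1 D2]] := countable_seq C.
have [r r0 hr] := nbhs_mdist_ex (open_nbhs_nbhs (conj oV Vx0)).
have r20 : 0 < r / 2 by rewrite divr_gt0.
pose Z := closure [set y | mdist x0 y < r / 2].
have ZV : Z `<=` V.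
  move=> y Zy; apply: hr; have : [set y | mdist x0 y <= r / 2] y.
    rewrite [X in X y](closure_id _).1; last exact: mdist_closed_le.
    by apply: closureS Zy => z /=; exact: ltW.
  by rewrite /=; lra.
have hD m : closed (D m) /\ interior (D m) = set0.
  by have [->|[i ->]] := D1 m; [split; [exact: closed0|exact: interior0]|exact: hC].
have [||m [ O [oO [q [Zq Oq]] ZO]]] := @baire_cover _ _ S_compact Z D (@closed_closure _ _) _ (fun m => (hD m).1).
- by exists x0; apply: subset_closure; rewrite /= mdistxx.
- move=> y Zy; apply: contrapT => nD; apply: n; exists y; first exact: ZV.
  by move=> i Ci; apply: nD; have [m E] := D2 i; exists m => //; rewrite E.
have [w [ww Ow]] := Zq O (open_nbhs_nbhs (conj oO Oq)).
have : interior (D m) w.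
  have oW : open ([set y | mdist x0 y < r / 2] `&` O) by apply: openI => //; exact: open_mdist_lt.
  apply: (filterS _ (open_nbhs_nbhs (conj oW (conj ww Ow)))) => y [y1 y2].
  by apply: ZO; split => //; exact: subset_closure.
by rewrite (hD m).2.
Qed.

End Rectangle.

(** * A stable plaque that crosses the arc *)

Section Crossing.
Context {R : realType} {S : metricType R}.
Implicit Types (x y z u v w : S) (B C D E F J K L N O V W Y : set S).
Hypothesis S_compact : compact [set: S].
Hypothesis S_surface : surface R S.

Let S_lc : locally_connected S := surface_lc S_surface.
Let S_perfect : forall x : S, ~ open [set x] := surface_perfect S_surface.
Let S_countable : @second_countable S. Proof. by case: S_surface. Qed.

Variables (f : homeo S S) (c : R).
Hypothesis Hc : cwF_const f c.
Local Notation Q := (continua_dec (stab f)).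

Lemma stab_closed_thin (C : set S) : C = set0 \/ stab f C -> closed C /\ interior C = set0.
Proof.
move=> [->|sC]; first by split; [exact: closed0|exact: interior0].
split; first exact: continuum_closed sC.1.
exact: (stab_interior S_compact S_lc S_perfect Hc).
Qed.

(** Either the stable continuum of uniform size lies in [Y], or its piece in [Y] reaches the
    boundary of [Y], at distance at least [r / 2] from points close to [x]. *)
Lemma plaque_size Y x : closed Y -> interior Y x -> exists2 e : R, 0 < e &
  \forall z \near x, Y z /\ exists2 y, Q Y z y & e <= mdist z y.
Proof.
move=> cY iY; have [e e0 he] := uniform_stable S_compact S_lc S_perfect Hc.
have [r r0 hr] := nbhs_mdist_ex (iY : nbhs x Y).
exists (Num.min e (r / 2)); first by rewrite lt_min e0 divr_gt0.
apply: (filterS _ (nbhs_mdist_lt x (divr_gt0 r0 (ltr0Sn R 1)))) => z /= xz.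
have Yz : Y z by apply: hr; lra.
split => //; have [C [sC _ Cz [w Cw ew]]] := he z.
have [CY|nCY] := pselect (C `<=` Y).
  by exists w; [exact: (dec_max sC)|rewrite ge_min ew].
have [y Ey ny] := boundary_bumping S_compact sC.1 cY Cz Yz nCY.
exists y.
  apply: (dec_max (C := connected_component (C `&` Y) z)) => //.
  - apply: (stab_sub _ _ sC); last by move=> q /connected_component_sub[].
    by apply: component_continuum => //; apply: closedI => //; exact: continuum_closed sC.1.
  - by move=> q /connected_component_sub[].
  - by apply: connected_component_refl.
rewrite ge_min; apply/orP; right; rewrite leNgt; apply/negP => zy; apply: ny.
have xy : mdist x y < r by have := metric_triangle x z y; lra.
have d0 : 0 < r - mdist x y by rewrite subr_gt0.
apply: (filterS _ (nbhs_mdist_lt y d0)) => q /= yq; apply: hr.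
by have := metric_triangle x y q; lra.
Qed.

Section InRectangle.
Variables (psi : R * R -> S) (gm : R -> R * R) (J : countType) (Cs : J -> set S).
Hypotheses (cpsi : chart psi) (cgm : crosses gm).
Let Y := psi @` @square R.
Let b := psi @` path_set gm.
Hypothesis stabY : forall z, Y z -> stab f (Q Y z) /\ forall n, fsmall (iter n f) c (Q Y z).
Hypothesis stabCs : forall i, Cs i = set0 \/ stab f (Cs i).
Hypothesis ub : stab (hinv f) b.
Hypothesis bb : forall n, fsmall (iter n (hinv f)) c b.

Let good_pt z := forall i, ~ Cs i z.
Let inj : injective psi. Proof. by case: cpsi. Qed.
Let cp : continuous psi. Proof. by case: cpsi. Qed.
Let op (W : set (R * R)) : open W -> open (psi @` W). Proof. by case: cpsi => _ _; apply. Qed.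

Let X1 y := exists2 p, above gm p & psi p = y.
Let X2 y := exists2 p, [/\ square p, ~ above gm p & ~ path_set gm p] & psi p = y.

(** The sides [X1] and [X2] contain parts of the edge of the rectangle and are not open in [S]. Each
    of their points is thickened by a ball that misses the path; on [Y] nothing is added. *)
Let side (P : R * R -> Prop) : set S := psi @` [set p | exists q (e : R),
  [/\ square q, P q, 0 < e, forall w : R * R, path_set gm w -> e <= mdist q w & mdist q p < e]].
Let O1 := side (above gm).
Let O2 := side (fun p => ~ above gm p).

Lemma path_far p : ~ path_set gm p ->
  exists2 e : R, 0 < e & forall w : R * R, path_set gm w -> e <= mdist p w.
Proof.
move=> np; have kb : compact (path_set gm).
  apply: continuous_compact; last exact: segment_compact.
  by apply: continuous_subspaceT; case: cgm.
have [|e e0 he] := @compact_dist R (R * R)%type [set p] (path_set gm) (@compact_set1 _ p) kb.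
  by rewrite -subset0 => _ [-> /np].
by exists e => // w; exact: he.
Qed.

Let side_open P : open (side P).
Proof.
apply: op; apply/(open_setP (S := (R * R)%type)) => p [q [e [sq Pq e0 he qp]]].
exists (e - mdist q p); first by rewrite subr_gt0.
move=> p' pp'; exists q, e; split => //.
by have := metric_triangle q p p'; lra.
Qed.

Let cases y : Y y -> [\/ b y, X1 y | X2 y].
Proof.
move=> [p sp <-]; have [bp|nb] := pselect (path_set gm p); first by constructor 1; exists p.
have [ap|na] := pselect (above gm p); first by constructor 2; exists p.
by constructor 3; exists p.
Qed.

Let X1O y : X1 y -> O1 y.
Proof.
move=> [p ap <-]; exists p => //; have [sp nb] := above_sub ap.
by have [e e0 he] := path_far nb; exists p, e; rewrite mdistxx.
Qed.

Let X2O y : X2 y -> O2 y.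
Proof.
move=> [p [sp na nb] <-]; exists p => //.
by have [e e0 he] := path_far nb; exists p, e; rewrite mdistxx.
Qed.

Let OX1 y : Y y -> O1 y -> X1 y.
Proof.
move=> [p sp <-] [p' [q [e [sq aq e0 he qp]]] /inj E]; subst p'; exists p => //.
by apply/(above_near cgm sq sp he qp).
Qed.

Let OX2 y : Y y -> O2 y -> X2 y.
Proof.
move=> [p sp <-] [p' [q [e [sq aq e0 he qp]]] /inj E]; subst p'; exists p => //.
split => //; first by move=> /(above_near cgm sq sp he qp).
by move=> bp; have := he p bp; rewrite leNgt qp.
Qed.

Let X1b y : X1 y -> ~ b y.
Proof. by move=> [p ap <-] [q bq /inj E]; have [_] := above_sub ap; rewrite -E. Qed.

Let X2b y : X2 y -> ~ b y.
Proof. by move=> [p [_ _ nb] <-] [q bq /inj E]; apply: nb; rewrite -E. Qed.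

Let X12 y : X1 y -> ~ X2 y.
Proof. by move=> [p ap <-] [q [_ na _] /inj E]; apply: na; rewrite E. Qed.

Let bY : b `<=` Y.
Proof. by apply: image_subset => _ /path_setP[t t01 <-]; exact: crosses_square. Qed.

Let cY : closed Y.
Proof.
apply: compact_closedS; apply: continuous_compact; first exact: continuous_subspaceT.
rewrite (_ : square = `[0, 1]%classic `*` `[0, 1]%classic).
  by apply: compact_setX; exact: segment_compact.
by apply/seteqP; split => -[p q] [/=]; rewrite /= !in_itv.
Qed.

Let inner (t : R) : 0 < t < 1 -> interior Y (psi (gm t)).
Proof.
move=> t01; have [_ _ _ hx hy] := cgm.
have t01' : 0 <= t <= 1 by have /andP[h1 h2] := t01; rewrite !ltW.
have o1 : open [set p : R * R | 0 < p.1 < 1 /\ 0 < p.2 < 1].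
  rewrite (_ : mkset _ = (fst @^-1` `]0, 1[) `&` (snd @^-1` `]0, 1[)).
    apply: openI; apply: open_comp; try exact: itv_open.
      by move=> *; exact: cvg_fst.
    by move=> *; exact: cvg_snd.
  by apply/seteqP; split => -[p q] /=; rewrite !in_itv.
have nb : nbhs (psi (gm t)) (psi @` [set p : R * R | 0 < p.1 < 1 /\ 0 < p.2 < 1]).
  apply: open_nbhs_nbhs; split; first exact: op.
  by exists (gm t) => //; split; [exact: hx|exact: hy].
apply: (filterS _ nb); apply: image_subset => p [/andP[a1 a2] /andP[a3 a4]].
by split; rewrite !ltW.
Qed.

Let good_dense V : open V -> V !=set0 -> exists2 z, V z & good_pt z.
Proof. by apply: (cover_dense S_compact) => i; exact: stab_closed_thin. Qed.

Let near_side (t : R) V : 0 < t < 1 -> nbhs (psi (gm t)) V ->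
  (exists z, [/\ V z, Y z, X1 z & good_pt z]) /\ (exists z, [/\ V z, Y z, X2 z & good_pt z]).
Proof.
move=> t01 nV; have nW : nbhs (gm t) (psi @^-1` interior (V `&` Y)).
  by apply: cp; apply: nbhs_interior; apply: filterI => //; exact: inner.
have [e e0 he] := @nbhs_mdist_ex R (R * R)%type _ _ nW.
have [[p1 [sp1 ap1 d1]] _] := two_sided cgm (above_hyp cgm) t01 e0.
have [_ [p2 [sp2 np2 d2]]] := two_sided cgm (above_path_hyp cgm) t01 e0.
have main O : open O -> (exists2 p, mdist (gm t) p < e & O (psi p)) ->
    exists z, [/\ V z, Y z, O z & good_pt z].
  move=> oO [p dp Op]; have [|z [/interior_subset[Vz Yz] Oz] gz] :=
    good_dense (openI (@open_interior _ (V `&` Y)) oO).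
    by exists (psi p); split => //; exact: he.
  by exists z.
split.
- have [|z [Vz Yz Oz gz]] := main O1 (side_open _).
    by exists p1 => //; apply: X1O; exists p1.
  by exists z; split => //; exact: OX1.
- have [|z [Vz Yz Oz gz]] := main O2 (side_open _).
    exists p2 => //; apply: X2O; exists p2 => //; split => // h; apply: np2.
      by left.
    by right.
  by exists z; split => //; exact: OX2.
Qed.

Let e0 := psi (gm 0).
Let e1 := psi (gm 1).

(** Baire category on the arc: by [stab_unstab_degenerate] no stable continuum contains a relatively
    open part of it. *)
Let generic_point : exists t : R, [/\ 0 < t < 1, good_pt (psi (gm t)),
  ~ Q Y e0 (psi (gm t)) & ~ Q Y e1 (psi (gm t))].
Proof.
have i0 : 0 <= (0 : R) <= 1 by rewrite lexx ler01.
have i1 : 0 <= (1 : R) <= 1 by rewrite lexx ler01.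
have b0 : b e0 by exists (gm 0) => //; apply/path_setP; exists 0.
have b1 : b e1 by exists (gm 1) => //; apply/path_setP; exists 1.
(* The plaques of the two ends of the path join the family; avoiding them also excludes the ends
   themselves. *)
pose D (j : option (option J)) : set S := match j with
  | Datatypes.Some (Datatypes.Some i) => Cs i | Datatypes.Some None => Q Y e0 | None => Q Y e1 end.
have sD j : D j = set0 \/ stab f (D j).
  case: j => [[i|]|] /=; first exact: stabCs.
    by right; case: (stabY (bY b0)).
  by right; case: (stabY (bY b1)).
have [F [F1 F2]] := countable_seq D.
have sF m : F m = set0 \/ stab f (F m).
  by have [->|[j ->]] := F1 m; [left|exact: sD].
apply: contrapT => n.
have [||||m [ O [oO bO bF]]] := @baire_cover _ _ S_compact b F.
- exact: continuum_closed ub.1.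
- by exists e0.
- by move=> m; case: (stab_closed_thin (sF m)).
- move=> _ [_ /path_setP[t t01 <-] <-]; apply: contrapT => nF; apply: n.
  have nD j : ~ D j (psi (gm t)).
    by move=> Dj; apply: nF; have [m E] := F2 j; exists m => //; rewrite E.
  exists t; split.
  + have /andP[t0 t1] := t01; rewrite !lt_neqAle t0 t1 !andbT; apply/andP; split; apply/eqP => E.
      apply: (nD (Datatypes.Some None)); rewrite -E; apply: dec_refl; exact: bY.
    by apply: (nD None); rewrite E; apply: dec_refl; exact: bY.
  + by move=> i; exact: (nD (Datatypes.Some (Datatypes.Some i))).
  + exact: (nD (Datatypes.Some None)).
  + exact: (nD None).
have [F0|sFm] := sF m.
  by have [w /bF] := bO; rewrite F0.
apply: (stab_unstab_degenerate S_compact Hc ub _ sFm oO bO bF).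
exists e0, e1; split => // /inj E; have [_ gi _ _ _] := cgm.
by have /eqP := gi 0 1 i0 i1 E; rewrite eq_sym oner_eq0.
Qed.

(** Plaques of good points on the side [X] near [x] have a uniform size and miss [O]; so does their
    limit, a continuum in the plaque of [x]. It is nondegenerate and meets the arc in a finite set,
    so it leaves the arc. *)
Let limit_side (t : R) (X : S -> Prop) O : 0 < t < 1 -> ~ Q Y e0 (psi (gm t)) ->
  ~ Q Y e1 (psi (gm t)) -> open O -> (forall y, Y y -> O y -> ~ X y) ->
  (forall V, nbhs (psi (gm t)) V -> exists z, [/\ V z, Y z, X z & good_pt z]) ->
  (forall z, Y z -> good_pt z -> X z -> ~ Q Y z e0 -> ~ Q Y z e1 ->
     Q Y z `&` O = set0) ->
  exists2 y, Q Y (psi (gm t)) y & ~ b y /\ ~ O y.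
Proof.
move=> t01 n0 n1 oO XO nX hO; set x := psi (gm t) in n0 n1 nX *.
have iY : interior Y x by exact: inner.
have Yx : Y x by exact: interior_subset.
have [e e0' he] := plaque_size cY iY.
have far0 w : ~ Q Y w x -> Y w -> \forall z \near x, ~ Q Y z w.
  move=> nw Yw; have clQ : closed (Q Y w) by apply: continuum_closed; case: (stabY Yw) => -[].
  apply: (filterS _ (open_nbhs_nbhs (conj (closed_openC clQ) nw))) => z nz Qz.
  by apply: nz; exact: dec_sym.
have Ye0 : Y e0.
  by exists (gm 0) => //; apply: (crosses_square cgm); rewrite lexx ler01.
have Ye1 : Y e1.
  by exists (gm 1) => //; apply: (crosses_square cgm); rewrite lexx ler01.
have [G [UG Gx GP]] : exists G : set_system S, [/\ UltraFilter G, G --> x &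
    \forall z \near G, [/\ Y z, Q Y z `&` O = set0 & exists2 y, Q Y z y & e <= mdist z y]].
  apply: ultra_cluster => V nV.
  have nV' : nbhs x (V `&` [set z | [/\ ~ Q Y z e0, ~ Q Y z e1 &
      Y z /\ exists2 y, Q Y z y & e <= mdist z y]]).
    apply: filterI => //; apply: (nearS3 (far0 _ n0 Ye0) (far0 _ n1 Ye1) he) => z h1 h2 h3.
    by split.
  have [z [[Vz [m0 m1 [_ hz]]] Yz Xz gz]] := nX _ nV'.
  by exists z => //; split => //; exact: hO.
have GY : \forall z \near G, Y z by apply: (nearS1 GP) => z [].
have np z : Y z -> continuum (Q Y z) /\ forall n, fsmall (iter n f) c (Q Y z).
  by move=> /stabY[[cQ _] bQ].
pose L := ulim G (Q Y).
have sL : stab f L := dec_ulim S_compact Hc (u := id) UG cY np GY.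
have LY : L `<=` Y by apply: ulim_sub => //; apply: nearW => z; exact: dec_sub.
have Lx : L x.
  by apply: (ulim_mem UG (u := id) Gx); apply: (nearS1 GY) => z Yz; exact: dec_refl.
have LQ : L `<=` Q Y x by exact: (dec_max sL).
have LO y : L y -> ~ O y.
  have : L `<=` ~` O.
    apply: ulim_sub; first exact: open_closedC.
    apply: (nearS1 GP) => z [_ zO _] w Qw Ow; have : set0 w by rewrite -zO.
    by [].
  by apply.
have /choice[s hs] : forall z, exists y, (exists2 y, Q Y z y & e <= mdist z y) ->
    Q Y z y /\ e <= mdist z y.
  move=> z; have [[y h1 h2]|n] := pselect (exists2 y, Q Y z y & e <= mdist z y).
    by exists y.
  by exists z.
have [y sy] := ulim_ex S_compact UG s.
have Ly : L y by apply: (ulim_mem UG sy); apply: (nearS1 GP) => z [_ _ /hs[]].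
have xy : x <> y.
  move=> E; have : e <= mdist x y.
    by apply: (ulim_dist_ge UG (u := id) Gx sy); apply: (nearS1 GP) => z [_ _ /hs[]].
  by rewrite E mdistxx leNgt e0'.
apply: contrapT => n.
have Lb : L `<=` L `&` b.
  by move=> w Lw; split => //; apply: contrapT => nb; apply: n; exists w; [exact: LQ|split => //; exact: LO].
have fin : finite_set (L `&` b).
  apply: Hc.2 => //; [exact: sL.1|exact: ub.1|].
  by move=> m u v /LQ Qu /LQ Qv; have [_ h] := stabY Yx; exact: h.
apply: xy; apply: (finite_connected _ sL.1.2 Lx Ly).
exact: sub_finite_set fin.
Qed.

(* Plaques of generic points on either side of the arc accumulate on the plaque of
   a generic point of the arc; if they all remain on their side, then that plaque
   reaches both sides. *)
Let crossing_plaque : exists z, [/\ Y z, good_pt z, ~ Q Y z e0 /\ ~ Q Y z e1,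
  exists2 y, Q Y z y & X1 y & exists2 y, Q Y z y & X2 y].
Proof.
apply: contrapT => N.
have [t [t01 gt n0 n1]] := generic_point.
have tY : Y (psi (gm t)) by exact: interior_subset (inner t01).
have [y1 Q1 [nb1 nO1]] : exists2 y, Q Y (psi (gm t)) y & ~ b y /\ ~ O2 y.
  apply: (limit_side t01 n0 n1 (X := X1)); first exact: side_open.
  - by move=> y Yy /(OX2 Yy) h /X12.
  - by move=> V /(near_side t01)[].
  - move=> z Yz gz Xz m0 m1; rewrite -subset0 => y [Qy Oy]; apply: N.
    have Yy : Y y := dec_sub Qy.
    by exists z; split => //; [exists z => //; exact: dec_refl|exists y => //; exact: OX2].
have [y2 Q2 [nb2 nO2]] : exists2 y, Q Y (psi (gm t)) y & ~ b y /\ ~ O1 y.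
  apply: (limit_side t01 n0 n1 (X := X2)); first exact: side_open.
  - by move=> y Yy /(OX1 Yy) h /(X12 h).
  - by move=> V /(near_side t01)[].
  - move=> z Yz gz Xz m0 m1; rewrite -subset0 => y [Qy Oy]; apply: N.
    have Yy : Y y := dec_sub Qy.
    by exists z; split => //; [exists y => //; exact: OX1|exists z => //; exact: dec_refl].
apply: N; exists (psi (gm t)); split => //.
- by split => h; [apply: n0|apply: n1]; exact: dec_sym.
- exists y1 => //; case: (cases (dec_sub Q1)) => // /X2O.
  by [].
- exists y2 => //; case: (cases (dec_sub Q2)) => // /X1O.
  by [].
Qed.

(** An arc in the crossing plaque joins the two sides and meets [b] in a finite set; [crossing_time]
    then finds a place where it changes sides. *)
Lemma rectangle_transverse : Defs.arc R b -> exists x, [/\ Y x, b x,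
  exists z, [/\ good_pt z, stab f (Q Y z), Q Y z z & Q Y z x] &
  forall Fs Fu, (forall z, Q Y z x -> Q Y z `<=` Fs) -> b `<=` Fu -> top_transverse R Fs Fu x].
Proof.
move=> ab; have [z [Yz gz [m0 m1] [y1 Q1 X1y] [y2 Q2 X2y]]] := crossing_plaque.
have [sQ bQ] := stabY Yz.
have [K KQ iK] := irred_ex S_compact S_countable sQ.1 Q1 Q2.
have lK : lc_subset K by apply: (stab_hereditarily_lc S_compact S_surface Hc sQ) => //; case: iK.
have y12 : y1 <> y2 by move=> E; apply: (X12 X1y); rewrite E.
have [g [h aK]] := irred_arc_param S_compact S_countable iK lK y12.
have [ch [h0 h1] hK gK gc] := aK.
have hY (t : R) : 0 <= t <= 1 -> Y (h t) by move=> /hK[/KQ/dec_sub].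
have cb : closed b := continuum_closed ub.1.
have covY y : Y y -> ~ b y -> O1 y \/ O2 y.
  by move=> /cases[//|/X1O|/X2O]; [left|right].
have disY y : Y y -> ~ b y -> O1 y -> ~ O2 y.
  by move=> Yy _ /(OX1 Yy) X1y' /(OX2 Yy); exact: X12.
have fin : finite_set [set t : R | 0 <= t <= 1 /\ b (h t)].
  have fKb : finite_set (K `&` b).
    apply: Hc.2 => //; [by case: iK|exact: ub.1|].
    by move=> n u v /KQ Qu /KQ Qv; exact: bQ.
  apply: sub_finite_set (finite_image g fKb) => t [t01 bt].
  by have [Kt gt] := hK t t01; exists (h t).
have [s [e [e0' [se0 se1] bs hb ha]]] := @crossing_time R S h b O1 O2 ch cb (side_open _)
  (side_open _) (fun t t01 => covY _ (hY t t01)) (fun t t01 => disY _ (hY t t01)) fin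
  (eq_ind_r O1 (X1O X1y) h0) (eq_ind_r (fun y => ~ b y) (X1b X1y) h0)
  (eq_ind_r O2 (X2O X2y) h1) (eq_ind_r (fun y => ~ b y) (X2b X2y) h1).
have s01 : 0 <= s <= 1 by apply/andP; split; lra.
have Ks : K (h s) by case: (hK s s01).
exists (h s); split => //; first exact: hY.
  by exists z; split => //; [exact: dec_refl|exact: KQ].
move=> Fs Fu FsP FuP.
(* The plaque contains neither end of the path, so the crossing point is interior to the
   rectangle. *)
have iYs : nbhs (h s) Y.
  have [_ /path_setP[t t01 <-] E] := bs; rewrite -E; apply: inner.
  have /andP[t0 t1] := t01; rewrite !lt_neqAle t0 t1 !andbT; apply/andP; split; apply/eqP => E'.
    by apply: m0; rewrite /e0 E' E; exact: KQ.
  by apply: m1; rewrite /e1 -E' E; exact: KQ.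
apply: (transverse_core S_surface aK _ ab FuP iYs e0' se0 se1 bs (side_open _)
  (side_open _) covY disY hb ha).
by move=> y Ky; apply: (FsP z); exact: KQ.
Qed.

End InRectangle.
End Crossing.

Theorem theorem6p7p1 (R : realType) (S : metricType R)
    (S_surface : surface R S) (S_compact : compact [set: S])
    (f : homeo S S) (f_cwF : cwF_expansive f) :
  [/\ invariant_dendritation f (stable_atlas f) /\
      invariant_dendritation f (unstable_atlas f),
      forall x : S, ~ peano_continuum (leaf (stable_atlas f) x) /\
                    ~ peano_continuum (leaf (unstable_atlas f) x) &
      exists2 G : set S, Gdelta_dense G &
        (forall x, G x ->
          [/\ one_manifold_with_boundary R (leaf_space (stable_atlas f) x),
              ~ compact [set: leaf_space (stable_atlas f) x],
              one_manifold_with_boundary R (leaf_space (unstable_atlas f) x) &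
              ~ compact [set: leaf_space (unstable_atlas f) x]]) /\
        exists2 H : set S, H `<=` G /\ dense H &
          forall x, H x ->
            top_transverse R (leaf (stable_atlas f) x)
              (leaf (unstable_atlas f) x) x].
Proof.
have [c Hc] := cwF_constP S_compact f_cwF; have Hg := cwF_const_inv Hc.
have S_lc := surface_lc S_surface; have S_perfect := surface_perfect S_surface.
rewrite /stable_atlas /unstable_atlas (stable_continuumE S_compact) (unstable_continuumE S_compact).
split.
- split; split.
  + exact: (adom_basis S_compact Hc).
  + exact: (stab_peano_atlas S_compact S_surface Hc).
  + exact: (stab_cw_atlas S_compact S_lc S_perfect Hc).
  + exact: stab_invariant.
  + exact: (adom_basis S_compact Hg).
  + exact: (stab_peano_atlas S_compact S_surface Hg).
  + exact: (stab_cw_atlas S_compact S_lc S_perfect Hg).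
  (* Invariance is known for iterates of [hinv f]; exponents only change sign. *)
  + move=> n U AU; have E : hiter f n = hiter (hinv f) (- n).
      by apply/funext => x; rewrite hiter_inv opprK.
    by rewrite E; exact: stab_invariant.
- move=> x; split; first exact: (leaf_not_peano S_compact S_lc S_perfect Hc).
  exact: (leaf_not_peano S_compact S_lc S_perfect Hg).
have [r1 r10 hr1] := small_nice S_compact S_surface Hc.
have [r2 r20 hr2] := small_nice S_compact S_surface Hg.
have [|Phi [cd [cdi cPhi bPhi]]] := @disc_basis _ _ S_surface (Num.min r1 r2).
  by rewrite lt_min r10.
have niceS phi : Phi phi -> nice f c phi.
  move=> /cPhi[cphi sphi]; apply: hr1 => //; apply: small_le sphi.
  by rewrite ge_min lexx.
have niceU phi : Phi phi -> nice (hinv f) c phi.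
  move=> /cPhi[cphi sphi]; apply: hr2 => //; apply: small_le sphi.
  by rewrite ge_min lexx orbT.
have [Cs [sCs goodS]] := bad_cover S_compact Hc cdi niceS.
have [Cu [sCu goodU]] := bad_cover S_compact Hg cdi niceU.
pose D (i : (nat * nat) + (nat * nat)) := match i with inl j => Cs j | inr j => Cu j end.
have thinS j := stab_closed_thin S_compact S_surface Hc (sCs j).
have thinU j := stab_closed_thin S_compact S_surface Hg (sCu j).
have GE x : (forall i, ~ D i x) <-> good f Phi x /\ good (hinv f) Phi x.
  split=> [h|[/goodS hs /goodU hu] [j|j]]; [|exact: hs|exact: hu].
  by split; [apply/goodS => j; exact: (h (inl j))|apply/goodU => j; exact: (h (inr j))].
exists [set x | forall i, ~ D i x].
  by apply: Gdelta_dense_compl => -[j|j]; [exact: thinS|exact: thinU].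
split.
  move=> x /GE[gs gu]; split.
  - exact: (leaf_manifold S_compact S_surface Hc niceS bPhi gs).
  - exact: (leaf_not_compact S_compact S_surface Hc).
  - exact: (leaf_manifold S_compact S_surface Hg niceU bPhi gu).
  - exact: (leaf_not_compact S_compact S_surface Hg).
(* The set [H] is taken as large as possible, so that only its density remains to be shown. *)
exists [set x | (forall i, ~ D i x) /\
    top_transverse R (leaf (continua_atlas (stab f)) x) (leaf (continua_atlas (stab (hinv f))) x) x].
  split; first by move=> x [].
  (* Only [y0] is chosen generic for the unstable atlas: the arc lies in an unstable continuum
     through [y0], so all its points are on that good leaf. *)
  move=> O O0 oO; have [y0 Oy0 /goodU gy0] := cover_dense S_compact thinU oO O0.
  have [r3 r30 hr3] := small_stab_ex S_compact Hc.
  pose V := O `&` [set y | mdist y0 y < r3 / 2].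
  have nV : nbhs y0 V.
    apply: filterI; first exact: open_nbhs_nbhs.
    by apply: nbhs_mdist_lt; rewrite divr_gt0.
  have [psi [gm [B [cpsi cgm YV [sB By0 bB bsub] ab]]]] := rectangle_ex S_compact S_surface Hg nV.
  pose Y := psi @` @square R; pose b := psi @` path_set gm.
  have [cp _ _] := cpsi; have [cg _ _ _ _] := cgm.
  have cY : closed Y.
    apply: compact_closedS; apply: continuous_compact; first exact: continuous_subspaceT.
    rewrite (_ : square = `[0, 1]%classic `*` `[0, 1]%classic).
      by apply: compact_setX; exact: segment_compact.
    by apply/seteqP; split => -[p q] [/=]; rewrite /= !in_itv.
  have sY : small r3 Y.
    by apply: (fsmall_center (h := id) (x := y0)) => y /YV[_ /= /ltW].
  have stabY := hr3 Y cY sY.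
  have cb : continuum b.
    apply: continuous_continuum2 => //; apply: continuous_continuum2 => //.
    by split; [exact: segment_compact|exact: segment_connected].
  have ub : stab (hinv f) b := stab_sub cb bsub sB.
  have bb n : fsmall (iter n (hinv f)) c b := fsmall_sub bsub (bB n).
  have [x [Yx bx [z [gz sQz Qzz Qzx]] tt]] :=
    rectangle_transverse S_compact S_surface Hc cpsi cgm stabY sCs ub bb ab.
  exists x; split; first by case: (YV x Yx).
  split.
    (* The crossing point is not itself chosen outside the sets [Cs]; it is good because its stable
       plaque contains a point [z] outside them. *)
    apply/GE; split; last exact: (good_leaf gy0 sB By0 (bsub x bx)).
    by apply: (good_leaf _ sQz Qzz Qzx); apply/goodS.
  apply: tt => [w Qwx y Qwy|y By].
    have Yw : Y w := dec_sub (dec_sym Qwx).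
    by apply: (stab_leaf S_compact Hc (stabY w Yw).1).
  by apply: (stab_leaf S_compact Hg sB); exact: bsub.
by move=> x [].
Qed.
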